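(* Let $n \geq 3$ and let $G$ be a connected Lie group with finite center, locally isomorphic to $O(1,n)$ or to $O(2,n)$. Suppose $G$ acts isometrically on a connected Lorentz manifold $M$ and has a degenerate orbit $O = Gx$ with noncompact stabilizer $G(x)$. Then: (1) $G$ is locally isomorphic to $O(1,n)$; (2) the Lie algebra $\mathfrak{g}(x)$ of $G(x)$ is isomorphic to $\mathfrak{o}(n-1) \ltimes \mathbf{R}^{n-1}$; (3) the orbit $O$ is locally homothetic to the light cone in Minkowski space $\mathbf{R}^{1,n}$.
   Context: Two Lie groups are locally isomorphic if their Lie algebras are isomorphic. A submanifold $N$ of a Lorentz manifold is degenerate if $T_xN^{\perp} \cap T_xN \neq \mathbf{0}$. $G(x)$ denotes the stabilizer of $x$ and $\mathfrak{g}(x)$ its Lie algebra. In $\mathfrak{o}(n-1) \ltimes \mathbf{R}^{n-1}$, $\mathfrak{o}(n-1)$ acts on $\mathbf{R}^{n-1}$ by the standard representation. The light cone in $\mathbf{R}^{1,n}$ is the set of isotropic vectors; away from the origin it is a submanifold carrying the (degenerate) metric induced from $\mathbf{R}^{1,n}$. Homothetic means diffeomorphic by a map that carries one (possibly degenerate) metric to a positive constant multiple of the other; locally homothetic means that points have neighborhoods homothetic to open subsets of the model (here, of the light cone minus the origin, with $O$ carrying the metric induced from $M$). *)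

(* Defs.v *)
From HB Require Import structures.
From mathcomp Require Import all_boot all_order all_algebra.
From mathcomp Require Import all_classical all_reals all_analysis.

Set Implicit Arguments.
Unset Strict Implicit.
Unset Printing Implicit Defensive.

Import Order.TTheory GRing.Theory Num.Theory numFieldNormedType.Exports.

Local Open Scope classical_set_scope.
Local Open Scope ring_scope.

(** * C^oo maps between normed spaces *)

Section Smooth.
Context {R : realType} {V W : normedModType R}.

Fixpoint iter_derive (f : V -> W) (vs : seq V) : V -> W :=
  if vs is v :: vs' then fun z => 'D_v (iter_derive f vs') z else f.

(* Meant for [S] open: all iterated directional derivatives exist and are
   continuous on [S], i.e. [f] is C^oo on [S] when [V] is finite
   dimensional. *)
Definition smooth_on (S : set V) (f : V -> W) : Prop :=
  forall (vs : seq V) (z : V), S z ->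
    {for z, continuous (iter_derive f vs)} /\
    (forall v : V, derivable (iter_derive f vs) z v).

End Smooth.

(** * Smooth manifolds *)

Record chart (R : realType) (n : nat) (M : Type) := Chart {
  cdom : set M;
  cfun : M -> 'rV[R]_n;
  cinv : 'rV[R]_n -> M }.

Definition homeo_chart (R : realType) (n : nat) (M : topologicalType)
    (c : chart R n M) : Prop :=
  [/\ open (cdom c), open (cfun c @` cdom c),
      (forall p, cdom c p -> cinv c (cfun c p) = p),
      {within cdom c, continuous (cfun c)} &
      {within cfun c @` cdom c, continuous (cinv c)}].

(* The atlas need not be maximal. *)
HB.mixin Record Topological_isManifold (R : realType) (n : nat) M
    of Topological M := {
  atlas : set (chart R n M);
  manifold_hausdorff : hausdorff_space M;
  manifold_second_countable : @second_countable M;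
  atlas_homeo : forall c, atlas c -> homeo_chart c;
  atlas_cover : forall p : M, exists2 c, atlas c & cdom c p;
  atlas_compat : forall c1 c2, atlas c1 -> atlas c2 ->
    smooth_on (cfun c1 @` (cdom c1 `&` cdom c2)) (cfun c2 \o cinv c1) }.

#[short(type="manifoldType")]
HB.structure Definition Manifold (R : realType) (n : nat) :=
  {M of Topological M & Topological_isManifold R n M}.

Arguments atlas {R n} M : rename.

Section SmoothMaps.
Context {R : realType}.

Definition smooth_map_on (m n : nat) (M : manifoldType R m)
    (N : manifoldType R n) (U : set M) (f : M -> N) : Prop :=
  (forall p, U p -> {for p, continuous f}) /\
  forall c c', atlas M c -> atlas N c' ->
    smooth_on (cfun c @` (U `&` cdom c `&` f @^-1` cdom c'))
              (cfun c' \o f \o cinv c).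

Definition smooth_map (m n : nat) (M : manifoldType R m)
    (N : manifoldType R n) (f : M -> N) : Prop := smooth_map_on setT f.

(* Smoothness on the product manifold [L * M], with its product charts. *)
Definition smooth_map2 (l m n : nat) (L : manifoldType R l)
    (M : manifoldType R m) (N : manifoldType R n) (f : L -> M -> N) : Prop :=
  continuous (fun pq : L * M => f pq.1 pq.2) /\
  forall c1 c2 c3, atlas L c1 -> atlas M c2 -> atlas N c3 ->
    smooth_on
      [set z : 'rV[R]_(l + m) | exists p q,
         [/\ cdom c1 p, cdom c2 q, cdom c3 (f p q) &
             z = row_mx (cfun c1 p) (cfun c2 q)]]
      (fun z => cfun c3 (f (cinv c1 (lsubmx z)) (cinv c2 (rsubmx z)))).

Definition smooth_fun (m : nat) (M : manifoldType R m) (f : M -> R^o) : Prop :=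
  forall c, atlas M c -> smooth_on (cfun c @` cdom c) (f \o cinv c).

(* Tangent vectors at [p] are read in a chart around [p] as row vectors; the
   differential of [f] at [p] is then [v |-> v *m local_jacobian f c c' p]. *)
Definition local_jacobian (m n : nat) (M : manifoldType R m)
    (N : manifoldType R n) (f : M -> N) (c : chart R m M) (c' : chart R n N)
    (p : M) : 'M[R]_(m, n) :=
  jacobian (cfun c' \o f \o cinv c) (cfun c p).

Definition immersion (m n : nat) (M : manifoldType R m)
    (N : manifoldType R n) (f : M -> N) : Prop :=
  smooth_map f /\
  forall c c' p, atlas M c -> atlas N c' -> cdom c p -> cdom c' (f p) ->
    row_free (local_jacobian f c c' p).

Definition submersion (m n : nat) (M : manifoldType R m)
    (N : manifoldType R n) (f : M -> N) : Prop :=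
  smooth_map f /\
  forall c c' p, atlas M c -> atlas N c' -> cdom c p -> cdom c' (f p) ->
    row_full (local_jacobian f c c' p).

End SmoothMaps.

(** * R^n as a manifold *)

Section RowManifold.
Context {R : realType} {n : nat}.

Definition id_chart : chart R n 'rV[R]_n := Chart setT id id.

Lemma row_second_countable : @second_countable 'rV[R]_n.
Proof.
exists [set ball (map_mx ratr u : 'rV[R]_n) (k.+1%:R^-1)
       | u in [set: 'rV[rat]_n] & k in [set: nat]].
  have -> : [set ball (map_mx ratr u : 'rV[R]_n) (k.+1%:R^-1)
       | u in [set: 'rV[rat]_n] & k in [set: nat]] =
     (fun uk : 'rV[rat]_n * nat =>
        ball (map_mx ratr uk.1 : 'rV[R]_n) (uk.2.+1%:R^-1)) @` setT.
    apply/seteqP; split => A /=.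
      by case=> u _ [k _ <-]; exists (u, k).
    by case=> -[u k] _ <-; exists u => //; exists k.
  exact: card_le_trans (card_image_le _ _) (countableP _).
split.
  move=> _ [u _ [k _ <-]]; exact: ball_open.
move=> x A /nbhs_ballP[e /= e0 eA].
have [k ke] : exists k, k.+1%:R^-1 < e / 2.
  have e20 : 0 < e / 2 by rewrite divr_gt0.
  exists (Num.truncn (e / 2)^-1).
  rewrite -[ltRHS]invrK ltf_pV2 ?posrE ?invr_gt0 ?ltr0n//.
  exact: truncnS_gt.
have k0 : 0 < (k.+1%:R^-1 : R) by rewrite invr_gt0 ltr0n.
have Hq (j : 'I_n) : exists q : rat, `|ratr q - x 0 j| < k.+1%:R^-1.
  have : x 0 j - k.+1%:R^-1 < x 0 j + k.+1%:R^-1.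
    by rewrite ltrD2l gt0_cp.
  move=> /rat_in_itvoo[q]; rewrite in_itv/= => /andP[h1 h2].
  by exists q; rewrite ltr_distl h1 h2.
have [q Hq'] := choice Hq.
pose u : 'rV[rat]_n := \row_j q j.
have xu : ball (map_mx ratr u : 'rV[R]_n) (k.+1%:R^-1) x.
  by split => // i j; rewrite (ord1 i) !mxE; exact: Hq'.
exists (ball (map_mx ratr u : 'rV[R]_n) (k.+1%:R^-1)).
  by split => //; exists u => //; exists k.
move=> y uy; apply: eA.
have /ball_sym xu2 := le_ball (ltW ke) xu.
by rewrite (splitr e); exact: (ball_triangle xu2 (le_ball (ltW ke) uy)).
Qed.

Lemma row_atlas_homeo (c : chart R n 'rV[R]_n) :
  [set id_chart] c -> homeo_chart c.
Proof.
move=> ->; split => //=.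
- exact: openT.
- by rewrite image_id; exact: openT.
- by apply: continuous_subspaceT => z; exact: cvg_id.
- by apply: continuous_subspaceT => z; exact: cvg_id.
Qed.

Lemma row_atlas_cover (p : 'rV[R]_n) :
  exists2 c, [set id_chart] c & cdom c p.
Proof. by exists id_chart. Qed.

Lemma row_atlas_compat (c1 c2 : chart R n 'rV[R]_n) :
  [set id_chart] c1 -> [set id_chart] c2 ->
  smooth_on (cfun c1 @` (cdom c1 `&` cdom c2)) (cfun c2 \o cinv c1).
Proof.
move=> -> -> vs z _.
have H : iter_derive (id : 'rV[R]_n -> 'rV[R]_n) vs = id \/
  exists a, iter_derive (id : 'rV[R]_n -> 'rV[R]_n) vs = cst a.
  elim: vs => [|v vs [IH|[a IH]]]; [by left| |]; right.
    by exists v; apply/funext => y /=; rewrite IH derive_id.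
  by exists 0; apply/funext => y /=; rewrite IH derive_cst.
rewrite -[X in iter_derive X]/(id : 'rV[R]_n -> 'rV[R]_n).
by case: H => [->|[a ->]]; split => //; exact: cst_continuous.
Qed.

HB.instance Definition _ := Topological_isManifold.Build R n 'rV[R]_n
  (@norm_hausdorff _ _) row_second_countable row_atlas_homeo row_atlas_cover
  row_atlas_compat.

End RowManifold.

(** * Lie groups and their Lie algebras *)

HB.mixin Record Manifold_Group_isLieGroup (R : realType) (n : nat) G
    of Manifold R n G & Group G := {
  smooth_mul : smooth_map2 (fun a b : G => (a * b)%g);
  smooth_inv : smooth_map (fun a : G => a^-1%g) }.

#[short(type="lieGroupType")]
HB.structure Definition LieGroup (R : realType) (n : nat) :=
  {G of Manifold R n G & Group G & Manifold_Group_isLieGroup R n G}.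

(* Lie algebras are presented as subspaces [A] of an ambient vector space [V]
   on which a bracket is defined. *)
Definition lie_isomorphic (R : realType) (V W : lmodType R)
    (A : set V) (bV : V -> V -> V) (B : set W) (bW : W -> W -> W) : Prop :=
  exists f : V -> W,
    [/\ set_bij A B f,
        (forall (a : R) u v, A u -> A v -> f (a *: u + v) = a *: f u + f v) &
        (forall u v, A u -> A v -> f (bV u v) = bW (f u) (f v))].

Section LieAlgebra.
Context {R : realType} {n : nat} (G : lieGroupType R n).

(* An operator on functions; vector fields are the derivations of the algebra
   of smooth functions, extended by 0 to nonsmooth functions so that each
   derivation is represented by exactly one operator. *)
Definition operator := (G -> R^o) -> (G -> R^o).

Definition vector_field (X : operator) : Prop :=
  [/\ (forall f, smooth_fun f -> smooth_fun (X f)),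
      (forall (a : R) f h, smooth_fun f -> smooth_fun h ->
         X (a *: f + h) = a *: X f + X h),
      (forall f h : G -> R^o, smooth_fun f -> smooth_fun h ->
         X (fun p => f p * h p) = fun p => f p * X h p + X f p * h p) &
      (forall f, ~ smooth_fun f -> X f = 0)].

Definition left_invariant (X : operator) : Prop :=
  forall (a : G) (f : G -> R^o), smooth_fun f ->
    X (fun p => f (a * p)%g) = fun p => X f (a * p)%g.

Definition lie_algebra : set operator :=
  [set X | vector_field X /\ left_invariant X].

Definition lie_bracket (X Y : operator) : operator :=
  fun f => X (Y f) - Y (X f).

(* [gamma t = exp (t X)]: the one-parameter subgroup that is an integral curve
   of [X]. *)
Definition one_parameter_subgroup (X : operator) (gamma : R -> G) : Prop :=
  (forall s t : R, gamma (s + t) = (gamma s * gamma t)%g) /\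
  forall f : G -> R^o, smooth_fun f -> forall t : R,
    is_derive t (1 : R) (fun s => f (gamma s) : R) (X f (gamma t)).

(* The Lie algebra of a closed subgroup [H]. *)
Definition subgroup_lie_algebra (H : set G) : set operator :=
  [set X | lie_algebra X /\
     exists2 gamma, one_parameter_subgroup X gamma & forall t, H (gamma t)].

Definition lie_center : set G := [set a | forall b : G, (a * b = b * a)%g].

End LieAlgebra.

Arguments lie_algebra {R n} G.
Arguments lie_bracket {R n} G.
Arguments lie_center {R n} G.

(** * Matrix Lie algebras *)

Definition eta (R : realType) (p q : nat) : 'M[R]_(p + q) :=
  block_mx (- 1%:M) 0 0 1%:M.

Definition mx_bracket (R : realType) (n : nat) (A B : 'M[R]_n) : 'M[R]_n :=
  A *m B - B *m A.

(* o(p, q), the Lie algebra of O(p, q) = {A | A^T *m eta *m A = eta}. *)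
Definition o_pq (R : realType) (p q : nat) : set 'M[R]_(p + q) :=
  [set A | A^T *m eta R p q + eta R p q *m A = 0].

(* o(k) |x R^k inside 'M_k * 'cV_k. *)
Definition o_semidirect (R : realType) (k : nat) :
    set ('M[R]_k * 'cV[R]_k)%type := [set X | X.1^T = - X.1].

Definition o_semidirect_bracket (R : realType) (k : nat)
    (X Y : ('M[R]_k * 'cV[R]_k)%type) : ('M[R]_k * 'cV[R]_k)%type :=
  (X.1 *m Y.1 - Y.1 *m X.1, X.1 *m Y.2 - Y.1 *m X.2).

Arguments o_pq R p q : clear implicits.
Arguments mx_bracket R n : clear implicits.
Arguments o_semidirect R k : clear implicits.
Arguments o_semidirect_bracket R k : clear implicits.

Definition locally_isomorphic_to_O (R : realType) (d : nat)
    (G : lieGroupType R d) (p q : nat) : Prop :=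
  lie_isomorphic (lie_algebra G) (lie_bracket G)
                 (o_pq R p q) (mx_bracket R (p + q)).

(** * Lorentz metrics *)

Section Metrics.
Context {R : realType}.

(* A field of bilinear forms, given by its Gram matrix in each chart. *)
Definition form_field (n : nat) (M : manifoldType R n) :=
  chart R n M -> M -> 'M[R]_n.

(* Gram matrix in the chart [c] of the pullback of [g] by [f], computed through
   the chart [c'] of the target. *)
Definition pullback (m n : nat) (M : manifoldType R m) (N : manifoldType R n)
    (f : M -> N) (g : form_field N) (c : chart R m M) (c' : chart R n N)
    (p : M) : 'M[R]_m :=
  let J := local_jacobian f c c' p in J *m g c' (f p) *m J^T.

Definition preserves_form (n : nat) (M : manifoldType R n) (g : form_field M)
    (f : M -> M) : Prop :=
  forall c c' p, atlas M c -> atlas M c' -> cdom c p -> cdom c' (f p) ->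
    pullback f g c c' p = g c p.

(* For [f := id], [preserves_form] is the change of chart rule. *)
Definition smooth_form_field (n : nat) (M : manifoldType R n)
    (g : form_field M) : Prop :=
  (forall c, atlas M c -> smooth_on (cfun c @` cdom c) (g c \o cinv c)) /\
  preserves_form g id.

Definition lorentz_metric (m : nat) (M : manifoldType R (1 + m))
    (g : form_field M) : Prop :=
  smooth_form_field g /\
  forall c p, atlas M c -> cdom c p ->
    exists2 P : 'M[R]_(1 + m), P \in unitmx & P *m g c p *m P^T = eta R 1 m.

(* T_pN meets its [g]-orthogonal nontrivially at every point [p] of the
   submanifold [i : N -> M]; the row space of the Jacobian of [i] is T_pN in
   the chart [c'] of [M]. *)
Definition degenerate_submanifold (k m : nat) (N : manifoldType R k)
    (M : manifoldType R m) (i : N -> M) (g : form_field M) : Prop :=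
  forall c c' p, atlas N c -> atlas M c' -> cdom c p -> cdom c' (i p) ->
    exists u : 'rV[R]_m,
      [/\ u != 0, (u <= local_jacobian i c c' p)%MS &
          forall w : 'rV[R]_m, (w <= local_jacobian i c c' p)%MS ->
            u *m g c' (i p) *m w^T = 0].

End Metrics.

(** * Isometric actions and orbits *)

Section Actions.
Context {R : realType} {d m : nat}.
Context (G : lieGroupType R d) (M : manifoldType R m).

Definition isometric_action (g : form_field M) (act : G -> M -> M) : Prop :=
  [/\ (forall p, act 1%g p = p),
      (forall a b p, act (a * b)%g p = act a (act b p)),
      smooth_map2 act &
      (forall a, preserves_form g (act a))].

Definition stabilizer (act : G -> M -> M) (x : M) : set G :=
  [set a | act a x = x].

(* The orbit [G x] with its canonical structure of (immersed) submanifold of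
   [M]: the manifold structure of [G / G(x)], for which the orbit map is a
   submersion from [G]. *)
Definition orbit_submanifold (act : G -> M -> M) (x : M) (k : nat)
    (O : manifoldType R k) (i : O -> M) : Prop :=
  [/\ immersion i, injective i, range i = range (act ^~ x) &
      exists2 pi : G -> O, submersion pi & forall a, i (pi a) = act a x].

End Actions.

Arguments stabilizer {R d m G M}.

(** * Homotheties with the light cone *)

Section LightCone.
Context {R : realType}.

(* The only chart of ['rV[R]_(1 + n)] is the identity. *)
Definition minkowski_metric (n : nat) : form_field 'rV[R]_(1 + n) :=
  fun _ _ => eta R 1 n.

(* Without its vertex. *)
Definition light_cone (n : nat) : set 'rV[R]_(1 + n) :=
  [set v | v != 0 /\ v *m eta R 1 n *m v^T = 0].

Arguments minkowski_metric n : clear implicits.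
Arguments light_cone n : clear implicits.

(* [i : N -> M] is a submanifold of [(M, g)], [S] is an embedded submanifold of
   [(L, h)], both with the (possibly degenerate) induced metrics.  A
   diffeomorphism [f] from [U] open in [N] onto the open subset [S `&` W] of [S]
   is a smooth map into [L] whose inverse is the restriction of a smooth map
   defined on the open set [W]. *)
Definition homothety (k m l : nat) (N : manifoldType R k)
    (M : manifoldType R m) (L : manifoldType R l) (i : N -> M)
    (g : form_field M) (h : form_field L) (S : set L)
    (U : set N) (W : set L) (f : N -> L) : Prop :=
  [/\ smooth_map_on U f,
      f @` U = S `&` W,
      exists2 f' : L -> N, smooth_map_on W f' &
        (forall q, U q -> f' (f q) = q) &
      exists2 lambda : R, 0 < lambda &
        forall c cM cL q, atlas N c -> atlas M cM -> atlas L cL ->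
          U q -> cdom c q -> cdom cM (i q) -> cdom cL (f q) ->
          pullback f h c cL q = lambda *: pullback i g c cM q].

Definition locally_homothetic_to_light_cone (k m n : nat)
    (N : manifoldType R k) (M : manifoldType R m) (i : N -> M)
    (g : form_field M) : Prop :=
  forall p : N, exists U W f,
    [/\ open U, U p, open W &
        homothety i g (minkowski_metric n) (light_cone n) U W f].

End LightCone.

(* Main.v *)
Require Import Defs.
From HB Require Import structures.
From mathcomp Require Import all_boot all_order all_algebra.
From mathcomp Require Import all_classical all_reals all_analysis.
From mathcomp Require Import ring lra.

(** The orbit map pulls the Lorentz form back to a semidefinite form [b] on the
    Lie algebra, identified with o(p, q); the isotropy algebra [h] has
    codimension one in the radical of [b], and [b] is invariant under Ad (G(x)).

    As the centre is finite, a noncompact closed stabilizer has unbounded image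
    in O(p, q).  Rescaled elements of this image converge to some Q <> 0 with
    isotropic image, and invariance of [b] puts [Q x /\ w] in the radical when
    [w] is orthogonal to the image of Q.  Hence [h] contains a nilpotent
    [v /\ w], with [v] null and [w] orthogonal to [v] but not null; being both
    nilpotent and skew for [b], it maps o(p, q) into the radical.  Bracketing,
    the radical contains [v /\ v^perp] and the boosts [v /\ v'].  This excludes
    p = 2, and for p = 1 it forces [h] to be the stabilizer of [v], that is
    o(n-1) |x R^(n-1), and [b] to be [kappa] times the Euclidean form on the
    abelian algebra spanned by Y_i = [v' /\ e_i], with A = [v /\ v'] in the
    radical.

    Since [A, Y_i] = - Y_i, the metric of the orbit in the coordinates
    (s, y) |-> a exp (sum_i y_i Y_i) exp (s A) x is kappa e^(2 s) |dy|^2, and the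
    light cone has the metric e^(2 s) |dy|^2 in the coordinates
    (s, y) |-> e^s ((1 + |y|^2) / 2, (1 - |y|^2) / 2, y). *)

Set Implicit Arguments.
Unset Strict Implicit.
Unset Printing Implicit Defensive.

Import Order.TTheory GRing.Theory Num.Theory numFieldNormedType.Exports.

Local Open Scope classical_set_scope.
Local Open Scope ring_scope.

(** * Calculus in R^n *)

(** No convergent sequence of isotropy elements is extracted: Q minimizes the size of Q^T J Q over a
    compact set of unit matrices defined by the rescaled invariance. Since p <= 2 and the image of Q
    is totally isotropic, a dimension count gives two independent bivectors of the radical with a
    common factor, and codimension one puts a combination of them, again decomposable, in h. The
    radical cannot be everything, since h would then be a subalgebra of codimension one in o(p, q),
    and there is none; the exclusions end in this contradiction. For p = 2, a second timelike vector
    e gives e /\ f in the radical, with eigenvectors v' /\ (e + f) and v' /\ (e - f) of opposite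
    eigenvalues; no multiple of the boost cancels both.

    On the analytic side the obstacle is that elements of the Lie algebra are derivations of smooth
    functions. Hadamard's lemma makes them tangent vectors, Picard iteration and the inverse
    function theorem give one-parameter subgroups and coordinates, and Ad is compared with matrix
    conjugation near 1, connectedness doing the rest. *)

Section Lines.
Context {R : realType} {V W : normedModType R}.

Lemma line_is_derive (f : V -> W) (z v : V) (t : R) :
  derivable f (t *: v + z) v ->
  is_derive t (1 : R) (fun s : R => f (s *: v + z)) ('D_v f (t *: v + z)).
Proof.
have E : (fun h : R => h^-1 *: (((fun s : R => f (s *: v + z)) \o shift t) (h *: 1)
      - f (t *: v + z))) =
  (fun h : R => h^-1 *: ((f \o shift (t *: v + z)) (h *: v) - f (t *: v + z))).
  by apply/funext => h /=; rewrite [_%:A]mulr1 scalerDl addrA.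
by move=> df; split; [rewrite /derivable E | rewrite /derive E].
Qed.

End Lines.

Section Mvt.
Context {R : realType} {V : normedModType R}.

Lemma mvt_line (f : V -> R^o) (z v : V) (h : R) :
  (forall t : R, `|t| <= `|h| -> derivable f (t *: v + z) v) ->
  exists2 t : R, `|t| <= `|h| & f (h *: v + z) - f z = h * 'D_v f (t *: v + z).
Proof.
move=> df.
pose g (s : R) : R := f (s *: v + z).
have dg t : `|t| <= `|h| -> is_derive t (1 : R) g ('D_v f (t *: v + z)).
  by move=> /df /line_is_derive.
have cg (a b : R) : `|a| <= `|h| -> `|b| <= `|h| -> {within `[a, b], continuous g}.
  move=> ha hb; apply: derivable_within_continuous => x.
  rewrite in_itv /= => /andP[ax xb].
  apply: (@ex_derive _ _ _ _ _ _ _ (dg x _)).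
  rewrite ler_norml; apply/andP; split.
    by apply: le_trans ax; rewrite lerNl; apply: le_trans ha; rewrite -normrN ler_norm.
  by apply: (le_trans xb); apply: le_trans hb; rewrite ler_norm.
have [h0|h0] := leP 0 h.
  have [||c + E] := @MVT_segment _ g (fun t => 'D_v f (t *: v + z)) 0 h h0.
  - move=> x; rewrite in_itv /= => /andP[x0 xh].
    by apply: dg; rewrite !ger0_norm// ltW.
  - by apply: cg; rewrite ?normr0.
  rewrite in_itv /= => /andP[c0 ch]; exists c; first by rewrite !ger0_norm.
  by move: E; rewrite /g scale0r add0r subr0 mulrC.
have h0' := ltW h0.
have [||c + E] := @MVT_segment _ g (fun t => 'D_v f (t *: v + z)) h 0 h0'.
- move=> x; rewrite in_itv /= => /andP[hx x0].
  by apply: dg; rewrite !ler0_norm ?lerN2// ltW.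
- by apply: cg; rewrite ?normr0.
rewrite in_itv /= => /andP[hc c0]; exists c; first by rewrite !ler0_norm ?lerN2.
move: E; rewrite /g scale0r add0r sub0r => /(congr1 -%R).
by rewrite opprB mulrN opprK mulrC.
Qed.

End Mvt.

(** * Finite orders of differentiability *)

Section Ck.
Context {R : realType} {V W : normedModType R}.

(** Differentiates before recursing, whereas [iter_derive] adds derivatives on the outside: closure
    properties become inductions on the order, in which the derivative of a sum, product or
    composite is again built from functions of lower order. Continuity is asked at each level
    because derivability along every direction does not give it. *)
Fixpoint Ck (k : nat) (S : set V) (f : V -> W) : Prop :=
  (forall z, S z -> {for z, continuous f}) /\
  if k is k'.+1 then
    forall v, (forall z, S z -> derivable f z v) /\ Ck k' S ('D_v f)
  else True.

Implicit Types (f g : V -> W) (S T : set V).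

Lemma Ck_cont k S f : Ck k S f -> forall z, S z -> {for z, continuous f}.
Proof. by case: k => [|k] []. Qed.

Lemma Ck_derivable k S f : Ck k.+1 S f -> forall v z, S z -> derivable f z v.
Proof. by move=> [_ H] v z; have [h _] := H v; exact: h. Qed.

Lemma Ck_derive k S f v : Ck k.+1 S f -> Ck k S ('D_v f).
Proof. by move=> [_ H]; have [_] := H v. Qed.

Lemma CkW k S f : Ck k.+1 S f -> Ck k S f.
Proof.
elim: k f => [|k IH] f [cf H]; first by split.
by split=> // v; have [dv hv] := H v; split => //; exact: IH.
Qed.

Lemma Ck_le j k S f : (j <= k)%N -> Ck k S f -> Ck j S f.
Proof.
move=> jk; rewrite -(subnK jk); elim: (k - j)%N => // i IH H.
by apply: IH; apply: CkW; rewrite -addSn.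
Qed.

Lemma iter_derive_rcons (f : V -> W) vs v :
  iter_derive f (rcons vs v) = iter_derive ('D_v f) vs.
Proof. by elim: vs => //= w vs ->. Qed.

Lemma smooth_on_derive S f v : smooth_on S f -> smooth_on S ('D_v f).
Proof. by move=> H vs z Sz; rewrite -iter_derive_rcons; exact: H. Qed.

Lemma smooth_onP S f : smooth_on S f <-> forall k, Ck k S f.
Proof.
split.
  move=> + k; elim: k f => [|k IH] f H.
    by split => // z Sz; have [] := H [::] z Sz.
  split=> [z Sz|v]; first by have [] := H [::] z Sz.
  split=> [z Sz|]; first by have [_] := H [::] z Sz; apply.
  by apply: IH; exact: smooth_on_derive.
move=> H vs; elim/last_ind: vs f H => [|vs v IH] f H z Sz /=.
  by split=> [|v]; [exact: (Ck_cont (H 0)) | exact: (Ck_derivable (H 1))].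
rewrite iter_derive_rcons; apply: IH => // k; exact: Ck_derive (H k.+1).
Qed.

Lemma smooth_on_sub S T f : T `<=` S -> smooth_on S f -> smooth_on T f.
Proof. by move=> TS H vs z /TS; exact: H. Qed.

Lemma smooth_on_cont S f z : smooth_on S f -> S z -> {for z, continuous f}.
Proof. by move=> /smooth_onP/(_ 0)/Ck_cont; apply. Qed.

Lemma smooth_on_derivable S f z v : smooth_on S f -> S z -> derivable f z v.
Proof. by move=> /smooth_onP/(_ 1)/Ck_derivable H /H. Qed.

Lemma Ck_eq k (S : set V) (f g : V -> W) : open S -> (forall z, S z -> f z = g z) ->
  Ck k S f -> Ck k S g.
Proof.
move=> oS; elim: k f g => [|k IH] f g fg [cf H].
  split => // z Sz.
  have E : \forall y \near z, f y = g y.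
    by apply: filterS (open_nbhs_nbhs (conj oS Sz)) => y /fg.
  have := cf z Sz; rewrite /prop_for /continuous_at fg// => h; apply: cvg_trans h.
  exact: near_eq_cvg.
have N z : S z -> \forall y \near z, f y = g y.
  by move=> Sz; apply: filterS (open_nbhs_nbhs (conj oS Sz)) => y /fg.
split=> [z Sz|v].
  have := cf z Sz; rewrite /prop_for /continuous_at fg// => h; apply: cvg_trans h.
  by apply: near_eq_cvg; exact: N.
have [dv hv] := H v; split=> [z Sz|].
  by apply: near_eq_derivable (dv z Sz); exact: N.
by apply: IH hv => z Sz; apply: near_eq_derive; exact: N.
Qed.

Lemma smooth_on_eq (S : set V) (f g : V -> W) : open S ->
  (forall z, S z -> f z = g z) -> smooth_on S f -> smooth_on S g.
Proof.
by move=> oS fg /smooth_onP H; apply/smooth_onP => k; exact: Ck_eq (H k).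
Qed.

Lemma smooth_on_loc (S : set V) (f : V -> W) :
  (forall z, S z -> exists T, [/\ open T, T z & smooth_on T f]) -> smooth_on S f.
Proof. by move=> H vs z Sz; have [T [_ Tz h]] := H z Sz; exact: h. Qed.

Lemma Ck_cst k S (a : W) : Ck k S (cst a).
Proof.
elim: k a => [|k IH] a; split=> //; try by move=> z _; exact: cst_continuous.
move=> v; split=> [z _|]; first exact: derivable_cst.
have -> : 'D_v (cst a) = cst (0 : W) by apply/funext => z; rewrite derive_cst.
exact: IH.
Qed.

Lemma Ck_lin k S (f : {linear V -> W}) : continuous f -> Ck k S f.
Proof.
move=> cf; case: k => [|k]; split=> //; try by move=> z _; exact: cf.
move=> v; have D z : is_derive z v f (f v).
  have df : differentiable f z by exact: linear_differentiable.
  by split; [exact: diff_derivable|rewrite deriveE// diff_lin].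
split=> [z _|]; first exact: ex_derive.
have -> : 'D_v f = cst (f v) by apply/funext => z; rewrite derive_val.
exact: Ck_cst.
Qed.

Lemma CkD k (S : set V) (f g : V -> W) : open S ->
  Ck k S f -> Ck k S g -> Ck k S (f + g).
Proof.
move=> oS; elim: k f g => [|k IH] f g [cf Hf] [cg Hg].
  by split=> // z Sz; apply: continuousD; [exact: cf|exact: cg].
split=> [z Sz|v]; first by apply: continuousD; [exact: cf|exact: cg].
have [df hf] := Hf v; have [dg hg] := Hg v.
split=> [z Sz|]; first by apply: derivableD; [exact: df|exact: dg].
apply: (@Ck_eq _ _ ('D_v f + 'D_v g)) => //; last exact: IH.
by move=> z Sz; rewrite deriveD//; [exact: df|exact: dg].
Qed.

End Ck.

Section CkReal.
Context {R : realType} {V : normedModType R}.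
Implicit Types (f g : V -> R^o) (S : set V).

Lemma CkM k S f g : open S -> Ck k S f -> Ck k S g -> Ck k S (fun z => f z * g z).
Proof.
move=> oS; elim: k f g => [|k IH] f g [cf Hf] [cg Hg].
  by split=> // z Sz; apply: (@continuousM R V f g z); [exact: cf|exact: cg].
split=> [z Sz|v]; first by apply: (@continuousM R V f g z); [exact: cf|exact: cg].
have [df hf] := Hf v; have [dg hg] := Hg v.
split=> [z Sz|]; first by apply: (@derivableM R V f g z v); [exact: df|exact: dg].
apply: (@Ck_eq _ _ _ _ _ ((fun z => f z * 'D_v g z) + (fun z => g z * 'D_v f z))) => //.
  move=> z Sz; rewrite (@deriveM R V f g z v)//; [exact: df|exact: dg].
apply: CkD => //; apply: IH => //; apply: CkW; split => //.
Qed.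

Lemma CkV k S f : open S -> (forall z, S z -> f z != 0) -> Ck k S f ->
  Ck k S (fun z => (f z)^-1).
Proof.
move=> oS f0; elim: k => [|k IH] [cf Hf].
  by split=> // z Sz; apply: (@continuousV R V f z); [exact: f0|exact: cf].
split=> [z Sz|v]; first by apply: (@continuousV R V f z); [exact: f0|exact: cf].
have [df hf] := Hf v.
split=> [z Sz|]; first by apply: (@derivableV R V f z v); [exact: f0|exact: df].
have fk : Ck k S f by apply: CkW; split.
apply: (@Ck_eq _ _ _ _ _ (fun z => - 1 * ((f z)^-1 * (f z)^-1 * 'D_v f z))) => //.
  move=> z Sz; rewrite (@deriveV R V f z v)//; [|exact: f0|exact: df].
  by rewrite mulN1r -[_ *: _]/(_ * _) mulNr -expr2 exprVn.
apply: CkM => //; first exact: (@Ck_cst _ _ R^o).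
by apply: CkM => //; apply: CkM => //; exact: IH.
Qed.

Lemma smooth_on_cst S (a : R) : smooth_on S (fun _ : V => a : R^o).
Proof. by apply/smooth_onP => k; exact: Ck_cst. Qed.

Lemma smooth_onD S f g : open S -> smooth_on S f -> smooth_on S g ->
  smooth_on S (fun z => f z + g z : R^o).
Proof.
move=> oS /smooth_onP hf /smooth_onP hg; apply/smooth_onP => k.
by have := CkD oS (hf k) (hg k).
Qed.

Lemma smooth_onM S f g : open S -> smooth_on S f -> smooth_on S g ->
  smooth_on S (fun z => f z * g z : R^o).
Proof.
by move=> oS /smooth_onP hf /smooth_onP hg; apply/smooth_onP => k; exact: CkM.
Qed.

Lemma smooth_onN S f : open S -> smooth_on S f -> smooth_on S (fun z => - f z : R^o).
Proof.
move=> oS hf; have := smooth_onM oS (@smooth_on_cst S (-1)) hf.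
by apply: smooth_on_eq => // z _; rewrite mulN1r.
Qed.

Lemma smooth_onB S f g : open S -> smooth_on S f -> smooth_on S g ->
  smooth_on S (fun z => f z - g z : R^o).
Proof. by move=> oS hf hg; exact: (smooth_onD oS hf (smooth_onN oS hg)). Qed.

Lemma smooth_onV S f : open S -> (forall z, S z -> f z != 0) -> smooth_on S f ->
  smooth_on S (fun z => (f z)^-1 : R^o).
Proof.
by move=> oS f0 /smooth_onP hf; apply/smooth_onP => k; exact: CkV.
Qed.

Lemma smooth_on_sum (I : Type) (r : seq I) (P : pred I) S (f : I -> V -> R^o) :
  open S -> (forall i, P i -> smooth_on S (f i)) ->
  smooth_on S (fun z => \sum_(i <- r | P i) f i z : R^o).
Proof.
move=> oS H; elim: r => [|a r IH].
  apply: smooth_on_eq (@smooth_on_cst S 0) => // z _; by rewrite big_nil.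
case Pa : (P a).
  apply: smooth_on_eq (smooth_onD oS (H a Pa) IH) => // z _.
  by rewrite big_cons Pa.
by apply: smooth_on_eq IH => // z _; rewrite big_cons Pa.
Qed.

Lemma smooth_on_prod (I : Type) (r : seq I) (P : pred I) S (f : I -> V -> R^o) :
  open S -> (forall i, P i -> smooth_on S (f i)) ->
  smooth_on S (fun z => \prod_(i <- r | P i) f i z : R^o).
Proof.
move=> oS H; elim: r => [|a r IH].
  apply: smooth_on_eq (@smooth_on_cst S 1) => // z _; by rewrite big_nil.
case Pa : (P a).
  apply: smooth_on_eq (smooth_onM oS (H a Pa) IH) => // z _.
  by rewrite big_cons Pa.
by apply: smooth_on_eq IH => // z _; rewrite big_cons Pa.
Qed.

Lemma Ck_sum k (I : Type) (r : seq I) S (f : I -> V -> R^o) :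
  open S -> (forall i, Ck k S (f i)) ->
  Ck k S (fun z => \sum_(i <- r) f i z : R^o).
Proof.
move=> oS H; elim: r => [|a r IH].
  by apply: Ck_eq (Ck_cst k S (0 : R^o)) => // z _; rewrite big_nil.
by apply: Ck_eq (CkD oS (H a) IH) => // z _; rewrite big_cons.
Qed.

End CkReal.

Lemma differentiable_littleo {R : realType} {V W : normedModType R} (f : V -> W)
    (df : {linear V -> W}) x :
  continuous df -> f \o shift x = cst (f x) + df +o_ 0 id -> differentiable f x.
Proof.
move=> dfc dxf; have E := diff_unique dfc dxf.
by apply/diff_locallyP; rewrite E.
Qed.

Section Row.
Context {R : realType} {n : nat}.
Implicit Types (z h : 'rV[R]_n) (S : set 'rV[R]_n).

Lemma row_normE (m : nat) (u : 'rV[R]_m) (C : R) : 0 <= C ->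
  (`|u| <= C) <-> (forall j, `|u 0 j| <= C).
Proof.
move=> C0; rewrite [`|u|]mx_normrE; split.
  move=> H j; apply: le_trans H.
  by apply: le_trans (le_bigmax _ _ (0, j)); rewrite lexx.
by move=> H; apply: bigmax_le => // -[i j] _ /=; rewrite (ord1 i).
Qed.

Lemma row_coord_le (m : nat) (u : 'rV[R]_m) j : `|u 0 j| <= `|u|.
Proof. by apply: (row_normE u (normr_ge0 u)).1. Qed.

Definition trunc (k : nat) h : 'rV[R]_n := \row_j (if (j < k)%N then h 0 j else 0).

Lemma trunc0 h : trunc 0 h = 0.
Proof. by apply/rowP => j; rewrite !mxE. Qed.

Lemma truncn h : trunc n h = h.
Proof. by apply/rowP => j; rewrite !mxE ltn_ord. Qed.

Lemma truncS (k : 'I_n) h : trunc k.+1 h = h 0 k *: 'e_k + trunc k h.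
Proof.
apply/rowP => j; rewrite !mxE ltnS leq_eqVlt eqxx /= -val_eqE /=.
case: eqVneq => [/val_inj jk|_]; last by rewrite mulr0 add0r.
by rewrite jk ltnn addr0 mulr1.
Qed.

Lemma norm_trunc k h (t : R) (j : 'I_n) : `|t| <= `|h 0 j| ->
  (k <= j)%N -> `|t *: 'e_j + trunc k h| <= `|h|.
Proof.
move=> tj kj; apply/row_normE => // i; rewrite !mxE eqxx /=.
case: eqVneq => [->|ij]; last first.
  by rewrite mulr0 add0r; case: ifP => _; rewrite ?normr0// row_coord_le.
rewrite ltnNge kj /= mulr1 addr0; exact: le_trans tj (row_coord_le _ _).
Qed.

(* Telescoping over the coordinates reduces the increment to partial
   derivatives at nearby points. *)
Lemma mvt_partials (f : 'rV[R]_n -> R^o) z h :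
  (forall y (j : 'I_n), `|y| <= `|h| -> derivable f (y + z) 'e_j) ->
  exists2 y : 'I_n -> 'rV[R]_n, (forall j, `|y j| <= `|h|) &
    f (h + z) - f z = \sum_j h 0 j * 'D_('e_j) f (y j + z).
Proof.
move=> df.
have H (j : 'I_n) : exists y : 'rV[R]_n, `|y| <= `|h| /\
    f (trunc j.+1 h + z) - f (trunc j h + z) = h 0 j * 'D_('e_j) f (y + z).
  have [|t th E] := @mvt_line _ _ f (trunc j h + z) 'e_j (h 0 j).
    by move=> t th; rewrite addrA; apply: df; exact: norm_trunc.
  exists (t *: 'e_j + trunc j h); split; first exact: norm_trunc.
  by rewrite truncS -!addrA.
have [y Hy] := choice H; exists y => [j|]; first by have [] := Hy j.
under eq_bigr do rewrite -(Hy _).2.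
rewrite -[in LHS](truncn h) -[in X in _ - X](add0r z) -(trunc0 h).
rewrite -(big_mkord xpredT (fun j => f (trunc j.+1 h + z) - f (trunc j h + z))).
by rewrite telescope_sumr.
Qed.

(** The candidate differential [L] is built from the partial derivatives; [mvt_partials] writes the
    error as a sum of differences of partials at nearby points, which continuity makes small. *)
Lemma Ck1_differentiable S (f : 'rV[R]_n -> R^o) z : open S -> S z ->
  Ck 1 S f -> differentiable f z.
Proof.
move=> oS Sz C1.
pose L (h : 'rV[R]_n) : R^o := \sum_j h 0 j * 'D_('e_j) f z.
have Llin : linear L.
  move=> a u v; rewrite /L scaler_sumr -big_split; apply: eq_bigr => j _ /=.
  by rewrite !mxE mulrDl -mulrA.
pose L' := GRing.isLinear.Build _ _ _ _ L Llin.
pose Lf : {linear 'rV[R]_n -> R^o} := HB.pack L L'.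
have LE (h : 'rV[R]_n) : `|L h| <= (\sum_j `|'D_('e_j) f z|) * `|h|.
  rewrite /L mulr_suml; apply: le_trans (ler_norm_sum _ _ _) _.
  by apply: ler_sum => j _; rewrite normrM mulrC ler_wpM2l// row_coord_le.
have Lcont : continuous Lf.
  apply/linear_bounded_continuous/ex_bound => /=; exists (\sum_j `|'D_('e_j) f z|).
  apply/nbhs_ballP; exists 1 => //= h; rewrite -ball_normE /= sub0r normrN => h1.
  apply: (le_trans (LE h)); rewrite -[leRHS]mulr1; apply: ler_wpM2l (ltW h1).
  exact: sumr_ge0.
apply: (@differentiable_littleo _ 'rV[R]_n R^o f Lf z Lcont).
apply/eqaddoP => e e0.
(* Dimension 0 is set apart: the tolerance [e / n%:R] below would be 0. *)
have [n0|n0] := eqVneq n 0%N.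
  near=> h; have -> : h = 0.
    by apply/rowP => j; exfalso; have := ltn_ord j; rewrite [X in (_ < X)%N]n0.
  rewrite !fctE /= add0r.
  have -> : L 0 = 0 by rewrite -[L]/(Lf : _ -> _) linear0.
  by rewrite /cst addr0 subrr normr0 mulr_ge0// ltW.
pose e' := e / n%:R.
have e'0 : 0 < e' by rewrite divr_gt0// ltr0n lt0n.
have h2 : \forall y \near z, forall j : 'I_n, `|'D_('e_j) f z - 'D_('e_j) f y| <= e'.
  apply: (@filter_forall _ _ (fun (j : 'I_n) y => `|'D_('e_j) f z - 'D_('e_j) f y| <= e') (nbhs z)) => j.
  have := Ck_cont (Ck_derive 'e_j C1) Sz.
  by move=> /cvgrPdist_le/(_ _ e'0).
have /nbhs_ballP[r /= r0 rP] : \forall y \near z, S y /\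
    forall j : 'I_n, `|'D_('e_j) f z - 'D_('e_j) f y| <= e'.
  by apply: filterI h2; exact: open_nbhs_nbhs.
apply/nbhs_ballP; exists r => //= h; rewrite -ball_normE /= sub0r normrN => hr.
have inr (y : 'rV[R]_n) : `|y| <= `|h| -> ball z r (y + z).
  by move=> yh; rewrite -ball_normE /= opprD addrCA subrr addr0 normrN (le_lt_trans yh).
have [|y yh E] := @mvt_partials f z h.
  move=> y j /inr /rP[Sy _]; exact: (Ck_derivable C1).
rewrite !fctE /= opprD addrA E /L -sumrB.
apply: le_trans (ler_norm_sum _ _ _) _.
have -> : e * `|h| = \sum_(j < n) (e' * `|h|).
  by rewrite sumr_const card_ord -mulr_natl mulrA /e' mulrC [_%:R * _]mulrC divfK ?pnatr_eq0// mulrC.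
apply: ler_sum => j _; rewrite -mulrBr normrM mulrC ler_pM ?row_coord_le//.
by have [_ /(_ j)] := rP _ (inr _ (yh j)); rewrite distrC.
Unshelve. all: by end_near. Qed.

End Row.

Lemma differentiable_mxP {R : realType} {V : normedModType R} (m n : nat)
  (F : V -> 'M[R]_(m, n)) (z : V) :
  (forall i j, differentiable (fun x => F x i j : R^o) z) -> differentiable F z.
Proof.
move=> H.
have -> : F = \sum_(p : 'I_m * 'I_n) (fun x => (F x p.1 p.2 : R^o) *: delta_mx p.1 p.2).
  apply/funext => x; rewrite fct_sumE [LHS]matrix_sum_delta.
  by rewrite pair_bigA.
elim/big_ind: _ => [|f g df dg|[i j] _].
- exact: differentiable_cst.
- exact: differentiableD.
- by apply: differentiableZl; exact: H.
Qed.

Section CkMatrix.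
Context {R : realType} {V : normedModType R} {m n : nat}.
Implicit Types (F : V -> 'M[R]_(m, n)) (S : set V).

Lemma continuous_mxP F (z : V) :
  {for z, continuous F} <-> forall i j, {for z, continuous (fun x => F x i j : R^o)}.
Proof.
split=> [cF i j|H].
  apply: (@continuous_comp _ _ _ F (fun M : 'M[R]_(m, n) => M i j : R^o) z cF).
  exact: coord_continuous.
apply/cvgrPdist_le => e e0.
have : \forall y \near z, forall ij : 'I_m * 'I_n, `|F z ij.1 ij.2 - F y ij.1 ij.2| <= e.
  apply: filter_forall => -[a b].
  by have /cvgrPdist_le/(_ _ e0) := H a b.
apply: filterS => y Hy.
rewrite [leLHS]mx_normrE; apply: bigmax_le; first exact: ltW.
by move=> [i j] _ /=; rewrite !mxE; exact: (Hy (i, j)).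
Qed.

Lemma Ck_mx k S F : open S ->
  (forall i j, Ck k S (fun x => F x i j : R^o)) -> Ck k S F.
Proof.
move=> oS; elim: k F => [|k IH] F H.
  by split=> // z Sz; apply/continuous_mxP => i j; exact: Ck_cont (H i j) _ Sz.
split=> [z Sz|v].
  by apply/continuous_mxP => i j; exact: Ck_cont (H i j) _ Sz.
have D z : S z -> derivable F z v.
  by move=> Sz; apply/derivable_mxP => i j; exact: (Ck_derivable (H i j)).
split => //; apply: IH => i j.
apply: (@Ck_eq _ _ _ _ _ ('D_v (fun x => F x i j : R^o))) => //.
  by move=> z Sz; rewrite derive_mx ?mxE//; exact: D.
exact: Ck_derive.
Qed.

Lemma Ck_mx_comp k S F i j : open S -> Ck k S F -> Ck k S (fun x => F x i j : R^o).
Proof.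
move=> oS; elim: k F => [|k IH] F H.
  split=> // z Sz; apply: (continuous_mxP F z).1; exact: Ck_cont H _ Sz.
split=> [z Sz|v].
  apply: (continuous_mxP F z).1; exact: Ck_cont H _ Sz.
split=> [z Sz|].
  by apply/(derivable_mxP F z v).1; exact: (Ck_derivable H).
apply: (@Ck_eq _ _ _ _ _ (fun x => 'D_v F x i j : R^o)) => //; last first.
  by apply: IH; exact: Ck_derive.
by move=> z Sz; rewrite derive_mx ?mxE//; exact: (Ck_derivable H).
Qed.

Lemma smooth_on_mxP S F : open S ->
  smooth_on S F <-> forall i j, smooth_on S (fun x => F x i j : R^o).
Proof.
move=> oS; split=> [/smooth_onP H i j|H]; apply/smooth_onP => k.
  exact: Ck_mx_comp.
by apply: Ck_mx => // i j; exact: ((smooth_onP _ _).1 (H i j)).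
Qed.

End CkMatrix.

Section Chain.
Context {R : realType} {V : normedModType R} {n : nat}.

(** The inner function is only derivable along [v]. Restricted to the line through [z] it depends on
    a real variable, where derivable means differentiable, so the chain rule for differentials
    applies. *)
Lemma derive_comp_row (f : V -> 'rV[R]_n) (g : 'rV[R]_n -> R^o) (z v : V) :
  derivable f z v -> differentiable g (f z) ->
  is_derive z v (g \o f) (\sum_j ('D_v f z) 0 j * 'D_('e_j) g (f z)).
Proof.
move=> df dg.
have df0 : is_derive (0 : R) 1 (fun s : R => f (s *: v + z)) ('D_v f z).
  by have := @line_is_derive _ _ _ f z v 0; rewrite scale0r add0r; apply.
have [df1 df2] := df0.
have df3 := (derivable1_diffP _ _).1 df1.
have dg0 : differentiable g (f (0 *: v + z)) by rewrite scale0r add0r.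
have dgf : differentiable (g \o (fun s : R => f (s *: v + z))) (0 : R).
  exact: differentiable_comp.
have E : 'D_1 (g \o (fun s : R => f (s *: v + z))) (0 : R) =
   \sum_j ('D_v f z) 0 j * 'D_('e_j) g (f z).
  rewrite deriveE// diff_comp// /= -[X in 'd g _ X](@deriveE _ _ _ (fun s : R => f (s *: v + z)))//.
  rewrite df2 scale0r add0r [X in 'd g _ X]row_sum_delta linear_sum.
  by apply: eq_bigr => j _; rewrite linearZ /= -(@deriveE _ _ _ g).
have D : derivable (g \o f) z v by apply/derivable1P; exact: diff_derivable.
split => //; rewrite -E.
have := @line_is_derive _ _ _ (g \o f) z v 0; rewrite scale0r add0r => /(_ D) H.
by rewrite -[LHS](@derive_val _ _ _ _ _ _ _ H).
Qed.

Lemma Ck_comp k (S : set V) (T : set 'rV[R]_n) (f : V -> 'rV[R]_n) (g : 'rV[R]_n -> R^o) :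
  open S -> open T -> (forall z, S z -> T (f z)) ->
  Ck k S f -> Ck k T g -> Ck k S (g \o f).
Proof.
move=> oS oT fST; elim: k g => [|k IH] g Cf Cg.
  split => // z Sz; apply: continuous_comp; first exact: Ck_cont Cf _ Sz.
  exact: (Ck_cont Cg (fST _ Sz)).
have dg z : S z -> differentiable g (f z).
  move=> Sz; apply: (Ck1_differentiable oT (fST _ Sz)).
  exact: Ck_le Cg.
have D z v : S z -> is_derive z v (g \o f) (\sum_j ('D_v f z) 0 j * 'D_('e_j) g (f z)).
  move=> Sz; apply: derive_comp_row; last exact: dg.
  exact: (Ck_derivable Cf).
split=> [z Sz|v].
  apply: continuous_comp; first exact: Ck_cont Cf _ Sz.
  exact: (Ck_cont Cg (fST _ Sz)).
split=> [z Sz|]; first by have [] := D z v Sz.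
apply: (@Ck_eq _ _ _ _ _ (fun z => \sum_j (('D_v f z) 0 j : R^o) * 'D_('e_j) g (f z) : R^o)) => //.
  by move=> z Sz; have [_ ->] := D z v Sz.
apply: Ck_sum => // j; apply: CkM => //; last first.
  by apply: (IH ('D_('e_j) g)); [exact: CkW|exact: Ck_derive].
exact: (Ck_mx_comp 0 j oS (Ck_derive v Cf)).
Qed.

Lemma smooth_on_comp (S : set V) (T : set 'rV[R]_n) (f : V -> 'rV[R]_n)
    (g : 'rV[R]_n -> R^o) :
  open S -> open T -> (forall z, S z -> T (f z)) ->
  smooth_on S f -> smooth_on T g -> smooth_on S (g \o f : V -> R^o).
Proof.
move=> oS oT fST /smooth_onP hf /smooth_onP hg; apply/smooth_onP => k.
exact: (Ck_comp oS oT).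
Qed.

End Chain.

Section SmoothRow.
Context {R : realType} {V : normedModType R}.

(** A smooth function of one real variable is given as the tower of its successive derivatives, so
    that smoothness of the composite is a single induction. This serves for exp, ln and the flat
    exponential, and also for flows, where the tower comes from iterating a vector field or a
    matrix. *)
Lemma smooth_on_tower (S : set V) (I : set R) (u : V -> R^o) (h : nat -> R -> R) :
  open S -> (forall z, S z -> I (u z)) -> smooth_on S u ->
  (forall k t, I t -> is_derive t (1 : R) (h k) (h k.+1 t)) ->
  smooth_on S (fun z => h 0 (u z) : R^o).
Proof.
move=> oS SI su dh; apply/smooth_onP => k; have {su} := (smooth_onP _ _).1 su k.
have cont j z : S z -> {for z, continuous u} -> {for z, continuous (fun z => h j (u z) : R^o)}.
  move=> Sz cu; apply: (@continuous_comp _ _ _ u (h j : R -> R^o)) => //.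
  apply: differentiable_continuous; apply/derivable1_diffP.
  by have [] := dh j (u z) (SI _ Sz).
have D j z v : S z -> derivable u z v ->
    is_derive z v (fun z => h j (u z) : R^o) (h j.+1 (u z) * 'D_v u z).
  move=> Sz du.
  have du0 : is_derive (0 : R) 1 (fun s : R => u (s *: v + z)) ('D_v u z).
    by have := @line_is_derive _ _ _ u z v 0; rewrite scale0r add0r; apply.
  pose w : R -> R := fun s => u (s *: v + z).
  have w0 : w 0 = u z by rewrite /w scale0r add0r.
  have [e1 e2] : is_derive (0 : R) (1 : R) w ('D_v u z) := du0.
  have [d1 d2] : is_derive (w 0) (1 : R) (h j) (h j.+1 (w 0)).
    by rewrite w0; apply: dh; exact: SI.
  have c1 : derivable (h j \o w) 0 1.
    apply/derivable1_diffP; apply: differentiable_comp; exact/derivable1_diffP.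
  have E := derive1_comp e1 d1.
  have c2 : derivable (fun z => h j (u z) : R^o) z v by apply/derivable1P.
  split => //.
  have H := @line_is_derive _ _ _ (fun z => h j (u z) : R^o) z v 0.
  rewrite scale0r add0r in H; rewrite -(@derive_val _ _ _ _ _ _ _ (H c2)).
  by rewrite -w0 -d2 -e2 -!derive1E -E.
suff : forall j, Ck k S u -> Ck k S (fun z => h j (u z) : R^o) by apply.
elim: k => [|k IH] j Cu.
  by split => // z Sz; apply: cont => //; exact: Ck_cont Cu _ Sz.
split=> [z Sz|v]; first by apply: cont => //; exact: Ck_cont Cu _ Sz.
split=> [z Sz|].
  by have [] := D j z v Sz (Ck_derivable Cu Sz).
apply: (@Ck_eq _ _ _ _ _ (fun z => h j.+1 (u z) * 'D_v u z : R^o)) => //.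
  by move=> z Sz; have [_ ->] := D j z v Sz (Ck_derivable Cu Sz).
by apply: CkM => //; [apply: IH; exact: CkW|exact: Ck_derive].
Qed.

Lemma smooth_on_linear (S : set V) (f : {linear V -> R^o}) :
  continuous f -> smooth_on S f.
Proof. by move=> cf; apply/smooth_onP => k; exact: Ck_lin. Qed.

Lemma smooth_on_exp (S : set V) (u : V -> R^o) : open S -> smooth_on S u ->
  smooth_on S (fun z => expR (u z) : R^o).
Proof.
move=> oS su; apply: (@smooth_on_tower S setT u (fun _ => expR)) => //.

Qed.

End SmoothRow.

Section SmoothRow2.
Context {R : realType} {n : nat}.
Implicit Types (S : set 'rV[R]_n).

Lemma smooth_on_coord S (j : 'I_n) : smooth_on S (fun z : 'rV[R]_n => z 0 j : R^o).
Proof.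
have lin : linear (fun z : 'rV[R]_n => z 0 j : R^o) by move=> a u v; rewrite !mxE.
pose f : {linear 'rV[R]_n -> R^o} := HB.pack (fun z : 'rV[R]_n => z 0 j : R^o)
  (GRing.isLinear.Build _ _ _ _ _ lin).
by apply: (@smooth_on_linear _ _ S f); exact: coord_continuous.
Qed.

End SmoothRow2.

Section SmoothRow3.
Context {R : realType}.

Lemma smooth_on_lsub m1 m2 (S : set 'rV[R]_(m1 + m2)) :
  open S -> smooth_on S (@lsubmx R 1 m1 m2).
Proof.
move=> oS; apply/smooth_on_mxP => // i j.
apply: smooth_on_eq (@smooth_on_coord R _ S (lshift m2 j)) => // z _.
by rewrite mxE (ord1 i).
Qed.

Lemma smooth_on_rsub m1 m2 (S : set 'rV[R]_(m1 + m2)) :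
  open S -> smooth_on S (@rsubmx R 1 m1 m2).
Proof.
move=> oS; apply/smooth_on_mxP => // i j.
apply: smooth_on_eq (@smooth_on_coord R _ S (rshift m1 j)) => // z _.
by rewrite mxE (ord1 i).
Qed.

Lemma smooth_on_row_mx (V : normedModType R) m1 m2 (S : set V)
    (f : V -> 'rV[R]_m1) (g : V -> 'rV[R]_m2) : open S ->
  smooth_on S f -> smooth_on S g -> smooth_on S (fun z => row_mx (f z) (g z)).
Proof.
move=> oS /(smooth_on_mxP _ oS) hf /(smooth_on_mxP _ oS) hg.
apply/smooth_on_mxP => // i j; rewrite (ord1 i); case: (split_ordP j) => l ->.
  by apply: smooth_on_eq (hf 0 l) => // z _; rewrite row_mxEl.
by apply: smooth_on_eq (hg 0 l) => // z _; rewrite row_mxEr.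
Qed.

Lemma smooth_on_mulmx (V : normedModType R) m1 m2 m3 (S : set V)
    (f : V -> 'M[R]_(m1, m2)) (g : V -> 'M[R]_(m2, m3)) : open S ->
  smooth_on S f -> smooth_on S g -> smooth_on S (fun z => f z *m g z).
Proof.
move=> oS /(smooth_on_mxP _ oS) hf /(smooth_on_mxP _ oS) hg.
apply/smooth_on_mxP => // i j.
have H : smooth_on S (fun z => \sum_k f z i k * g z k j : R^o).
  by apply: smooth_on_sum => // k _; exact: smooth_onM.
by apply: smooth_on_eq H => // z _; rewrite mxE.
Qed.

Lemma smooth_on_cstmx (V : normedModType R) m1 m2 (S : set V) (A : 'M[R]_(m1, m2)) :
  smooth_on S (fun _ : V => A).
Proof. by apply/smooth_onP => k; exact: Ck_cst. Qed.

Lemma smooth_on_comp_mx (V : normedModType R) n m1 m2 (S : set V) (T : set 'rV[R]_n)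
    (f : V -> 'rV[R]_n) (g : 'rV[R]_n -> 'M[R]_(m1, m2)) :
  open S -> open T -> (forall z, S z -> T (f z)) ->
  smooth_on S f -> smooth_on T g -> smooth_on S (g \o f).
Proof.
move=> oS oT ST hf /(smooth_on_mxP _ oT) hg; apply/smooth_on_mxP => // i j.
exact: (smooth_on_comp oS oT ST hf (hg i j)).
Qed.

Lemma smooth_on_differentiable n m1 m2 (S : set 'rV[R]_n) (f : 'rV[R]_n -> 'M[R]_(m1, m2)) z :
  open S -> S z -> smooth_on S f -> differentiable f z.
Proof.
move=> oS Sz /(smooth_on_mxP _ oS) hf; apply: differentiable_mxP => i j.
by apply: (Ck1_differentiable oS Sz); exact: ((smooth_onP _ _).1 (hf i j)).
Qed.

Lemma smooth_on_differentiableR n (S : set 'rV[R]_n) (f : 'rV[R]_n -> R^o) z :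
  open S -> S z -> smooth_on S f -> differentiable f z.
Proof.
by move=> oS Sz /smooth_onP hf; apply: (Ck1_differentiable oS Sz).
Qed.

Lemma derive_partials n (f : 'rV[R]_n -> R^o) z v : differentiable f z ->
  'D_v f z = \sum_j v 0 j * 'D_('e_j) f z.
Proof.
move=> df; rewrite deriveE// [X in 'd f z X]row_sum_delta linear_sum.
by apply: eq_bigr => j _; rewrite linearZ /= -deriveE.
Qed.

Lemma derive_linearv n (W : normedModType R) (f : 'rV[R]_n -> W) z (a : R) u v :
  differentiable f z ->
  'D_(a *: u + v) f z = a *: 'D_u f z + 'D_v f z.
Proof. by move=> df; rewrite !deriveE// linearP. Qed.

Let subB_ACA (A B C D : R) : A - B - (C - D) = A - C - (B - D).
Proof. by rewrite !opprB addrACA [RHS]addrACA; congr (_ + _); exact: addrC. Qed.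

(** The second difference of [f] along [s *: u] and [s *: v] is symmetric in [u] and [v]; two mean
    value steps turn it into s^2 times a mixed derivative at a nearby point, in either order.
    Continuity of both mixed derivatives concludes. *)
Lemma derive_comm n (S : set 'rV[R]_n) (f : 'rV[R]_n -> R^o) (z u v : 'rV[R]_n) :
  open S -> S z -> smooth_on S f -> 'D_u ('D_v f) z = 'D_v ('D_u f) z.
Proof.
move=> oS Sz sf.
have suv := smooth_on_derive u (smooth_on_derive v sf).
have svu := smooth_on_derive v (smooth_on_derive u sf).
have su := smooth_on_derive u sf.
have sv := smooth_on_derive v sf.
apply/eqP; rewrite eq_sym -subr_eq0 -normr_le0; apply/ler_addgt0Pr => e e0; rewrite add0r.
have e20 : 0 < e / 2 by rewrite divr_gt0.
have h3 : \forall y \near z, `|'D_u ('D_v f) z - 'D_u ('D_v f) y| <= e / 2 /\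
   `|'D_v ('D_u f) z - 'D_v ('D_u f) y| <= e / 2.
  have /cvgrPdist_le/(_ _ e20) h1 := smooth_on_cont suv Sz.
  have /cvgrPdist_le/(_ _ e20) h2 := smooth_on_cont svu Sz.
  by apply: filterI; [exact: h1|exact: h2].
have /nbhs_ballP[r /= r0 rP] : \forall y \near z, S y /\
   (`|'D_u ('D_v f) z - 'D_u ('D_v f) y| <= e / 2 /\
   `|'D_v ('D_u f) z - 'D_v ('D_u f) y| <= e / 2).
  by apply: filterI h3; exact: open_nbhs_nbhs.
pose N := `|u| + `|v| + 1.
have N0 : 0 < N by rewrite ltr_wpDl// addr_ge0.
(* Keeps all points [a *: u + (b *: v + z)] with |a|, |b| <= s in the ball of radius [r]. *)
pose s := r / (2 * N).
have s0 : 0 < s by rewrite divr_gt0// mulr_gt0.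
have inb (a b : R) : `|a| <= `|s| -> `|b| <= `|s| -> ball z r (a *: u + (b *: v + z)).
  move=> ha hb; rewrite -ball_normE /= addrA opprD addrCA subrr addr0 normrN.
  apply: le_lt_trans (ler_normD _ _) _; rewrite !normrZ.
  have : `|a| * `|u| + `|b| * `|v| <= s * N.
    rewrite /N !mulrDr mulr1; apply: ler_wpDr; first exact: ltW.
    apply: lerD.
      by rewrite ler_wpM2r// -[s]gtr0_norm.
    by rewrite ler_wpM2r// -[s]gtr0_norm.
  move=> /le_lt_trans; apply; rewrite /s invfM mulrA -mulrA mulVf ?gt_eqF// mulr1.
  by rewrite ltr_pdivrMr// ltr_pMr// ltr1n.
have key (a b : 'rV[R]_n) : (a = u /\ b = v) \/ (a = v /\ b = u) ->
    exists2 y, ball z r y & f (s *: a + (s *: b + z)) - f (s *: b + z)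
      - (f (s *: a + z) - f z) = s * (s * 'D_b ('D_a f) y).
  move=> Hab.
  have inab (p q : R) : `|p| <= `|s| -> `|q| <= `|s| -> ball z r (p *: b + (q *: a + z)).
    case: Hab => -[-> ->] hp hq; last exact: inb.
    by rewrite addrCA; exact: inb.
  have S' y : ball z r y -> S y by move=> /rP[].
  pose g (y : 'rV[R]_n) : R^o := f (s *: b + y) - f y.
  have df y c : ball z r y -> derivable f y c.
    by move=> /S'; exact: smooth_on_derivable sf.
  have dfs y c : ball z r (s *: b + y) -> is_derive y c (fun y => f (s *: b + y)) ('D_c f (s *: b + y)).
    move=> By; have d := df _ c By.
    by split; [move: d; rewrite /derivable /= | rewrite /derive /=];
      under eq_fun do rewrite addrCA.
  have [|t ts E1] := @mvt_line _ _ g z a s.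
    move=> t ts; apply: derivableB.
      by have [] := dfs (t *: a + z) a (inab s t (lexx _) ts).
    apply: df; have := inab 0 t; rewrite scale0r add0r; apply => //.
    by rewrite normr0.
  have Bt := inab s t (lexx _) ts.
  have Bt0 : ball z r (t *: a + z).
    by have := inab 0 t; rewrite scale0r add0r; apply => //; rewrite normr0.
  have [|t' ts' E2] := @mvt_line _ _ ('D_a f) (t *: a + z) b s.
    move=> t' ts'; apply: smooth_on_derivable (smooth_on_derive a sf) _.
    by apply: S'; exact: inab.
  exists (t' *: b + (t *: a + z)); first exact: inab.
  rewrite -E2; have [d1 d2] := dfs (t *: a + z) a Bt.
  have : 'D_a g (t *: a + z) = 'D_a f (s *: b + (t *: a + z)) - 'D_a f (t *: a + z).
    by rewrite deriveB ?d2//; exact: df.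
  move=> <-; rewrite -E1 /g [s *: b + (s *: a + z)]addrCA; exact: subB_ACA.
have [y1 /rP[_ [b1 _]] e1] := key v u (or_intror (conj erefl erefl)).
have [y2 /rP[_ [_ b2]] e2] := key u v (or_introl (conj erefl erefl)).
have E : 'D_u ('D_v f) y1 = 'D_v ('D_u f) y2.
  apply: (mulfI (lt0r_neq0 s0)); apply: (mulfI (lt0r_neq0 s0)).
  have e3 : s *: v + (s *: u + z) = s *: u + (s *: v + z) by rewrite addrCA.
  rewrite e3 in e1; apply: (etrans (esym e1)); apply: etrans e2.
  exact: subB_ACA.
rewrite (_ : _ - _ = ('D_v ('D_u f) z - 'D_v ('D_u f) y2) +
   ('D_u ('D_v f) y1 - 'D_u ('D_v f) z)); last by rewrite E addrA subrK.
rewrite distrC in b1.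
by apply: (le_trans (ler_normD _ _)); rewrite [leRHS]splitr; exact: lerD b2 b1.
Qed.

End SmoothRow3.

Section DeriveAlong.
Context {R : realType} {U V W : normedModType R}.

(** A directional derivative depends only on the values along a line; partial derivatives on
    products and derivatives of group-valued expressions are moved from one space to another this
    way. *)
Lemma derive_along (f : U -> W) (g : V -> W) x v y w :
  (forall h : R, f (h *: v + x) = g (h *: w + y)) -> 'D_v f x = 'D_w g y.
Proof.
move=> E; rewrite /derive.
suff -> : (fun h : R => h^-1 *: ((f \o shift x) (h *: v) - f x)) =
  (fun h => h^-1 *: ((g \o shift y) (h *: w) - g y)) by [].
apply/funext => h /=.
by rewrite E; congr (_ *: (_ - _)); have := E 0; rewrite !scale0r !add0r.
Qed.

Lemma is_derive_along (f : U -> W) (g : V -> W) x v y w dg :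
  (forall h : R, f (h *: v + x) = g (h *: w + y)) -> is_derive y w g dg -> is_derive x v f dg.
Proof.
move=> E [d1 d2]; split; last by rewrite (derive_along E).
move: d1; rewrite /derivable.
suff -> : (fun h : R => h^-1 *: ((f \o shift x) (h *: v) - f x)) =
  (fun h => h^-1 *: ((g \o shift y) (h *: w) - g y)) by [].
apply/funext => h /=.
by rewrite E; congr (_ *: (_ - _)); have := E 0; rewrite !scale0r !add0r.
Qed.

End DeriveAlong.

Local Opaque derive smooth_on.

Lemma line_continuous {R : realType} {V : normedModType R} (w y : V) :
  continuous (fun h : R => h *: w + y).
Proof.
move=> h; apply: cvgD; last exact: cvg_cst.
by apply: cvgZr_tmp; exact: cvg_id.
Qed.

Lemma near0_ltR {R : realType} (e : R) : 0 < e -> \forall h \near (0 : R), `|h| < e.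
Proof.
move=> e0; apply/nbhs_ballP; exists e => // h.
by rewrite /ball /= sub0r normrN.
Qed.

Lemma continuous_lip_at {R : realType} {V W : normedModType R} (f : V -> W) x (C : R) :
  0 <= C -> (\forall t \near x, `|f x - f t| <= C * `|x - t|) -> {for x, continuous f}.
Proof.
move=> C0 H; apply/cvgrPdist_lt => e e0.
have C1 : 0 < C + 1 by rewrite ltr_wpDl.
have h : \forall t \near x, `|x - t| < e / (C + 1).
  apply/nbhs_ballP; exists (e / (C + 1)); first exact: divr_gt0.
  by move=> t; rewrite -ball_normE.
apply: filterS2 H h => t h1; rewrite ltr_pdivlMr// mulrC => h2.
by apply: (le_lt_trans h1); apply: le_lt_trans h2; rewrite ler_wpM2r// lerDl.
Qed.

Lemma differentiable_expand {R : realType} {V W : normedModType R} (f : V -> W) x (e : R) :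
  differentiable f x -> 0 < e ->
  \forall h \near 0, `|f (h + x) - (f x + 'd f x h)| <= e * `|h|.
Proof. by move=> /diff_locally/eqaddoP H /H. Qed.

Section DeriveMx.
Context {R : realType} {V : normedModType R}.

Lemma is_derive_mxP m n (M : V -> 'M[R]_(m, n)) x v (dM : 'M[R]_(m, n)) :
  is_derive x v M dM <->
  forall i j, is_derive x v (fun y => M y i j : R^o) (dM i j).
Proof.
split=> [[d1 <-] i j|H].
  split; first exact: ((derivable_mxP M x v).1 d1).
  by rewrite derive_mx// mxE.
have d : derivable M x v by apply/derivable_mxP => i j; have [] := H i j.
split=> //; rewrite derive_mx//; apply/matrixP => i j; rewrite mxE.
by have [_ ->] := H i j.
Qed.

Lemma is_derive_bigsum (I : Type) (r : seq I) (f : I -> V -> R^o) x v (df : I -> R^o) :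
  (forall i, is_derive x v (f i) (df i)) ->
  is_derive x v (fun y => \sum_(i <- r) f i y : R^o) (\sum_(i <- r) df i).
Proof.
move=> H; elim: r => [|a r IH].
  rewrite big_nil; have -> : (fun y => \sum_(i <- [::]) f i y : R^o) = cst 0.
    by apply/funext => y; rewrite big_nil.
  exact: is_derive_cst.
rewrite big_cons; have -> : (fun y => \sum_(i <- a :: r) f i y : R^o) =
  f a + (fun y => \sum_(i <- r) f i y : R^o).
  by apply/funext => y; rewrite big_cons.
exact: is_deriveD.
Qed.

Lemma is_derive_mulmx m n p (F : V -> 'M[R]_(m, n)) (G : V -> 'M[R]_(n, p)) x v dF dG :
  is_derive x v F dF -> is_derive x v G dG ->
  is_derive x v (fun y => F y *m G y) (dF *m G x + F x *m dG).
Proof.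
move=> /is_derive_mxP hF /is_derive_mxP hG; apply/is_derive_mxP => i j.
have -> : (fun y => (F y *m G y) i j : R^o) = (fun y => \sum_k F y i k * G y k j : R^o).
  by apply/funext => y; rewrite mxE.
rewrite !mxE -big_split; apply: is_derive_bigsum => k /=.
apply: is_derive_eq (@is_deriveM _ _ (fun y => F y i k) (fun y => G y k j) x v _ _ (hF i k) (hG k j)) _.
by rewrite addrC /GRing.scale /= [G x k j * _]mulrC.
Qed.

Lemma is_derive_mulmxr m n p (F : V -> 'M[R]_(m, n)) (A : 'M[R]_(n, p)) x v dF :
  is_derive x v F dF -> is_derive x v (fun y => F y *m A) (dF *m A).
Proof.
move=> hF; apply: is_derive_eq (is_derive_mulmx hF (is_derive_cst A x v)) _.
by rewrite mulmx0 addr0.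
Qed.

Lemma is_derive_mulmxl m n p (F : V -> 'M[R]_(m, n)) (A : 'M[R]_(p, m)) x v dF :
  is_derive x v F dF -> is_derive x v (fun y => A *m F y) (A *m dF).
Proof.
move=> hF; apply: is_derive_eq (is_derive_mulmx (is_derive_cst A x v) hF) _.
by rewrite mul0mx add0r.
Qed.

Lemma is_derive_trmx m n (F : V -> 'M[R]_(m, n)) x v dF :
  is_derive x v F dF -> is_derive x v (fun y => (F y)^T) dF^T.
Proof.
move=> /is_derive_mxP H; apply/is_derive_mxP => i j; rewrite mxE.
have -> : (fun y => (F y)^T i j : R^o) = (fun y => F y j i : R^o).
  by apply/funext => y; rewrite mxE.
exact: H.
Qed.

End DeriveMx.

Section SmoothInvmx.
Context {R : realType} {V : normedModType R}.

Lemma smooth_on_det n (S : set V) (A : V -> 'M[R]_n) : open S ->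
  smooth_on S A -> smooth_on S (fun z => \det (A z) : R^o).
Proof.
move=> oS /(smooth_on_mxP _ oS) sA.
apply: smooth_on_sum => // s _; apply: smooth_onM => //; first exact: smooth_on_cst.
by apply: smooth_on_prod => // i _; exact: sA.
Qed.

Lemma smooth_on_invmx n (S : set V) (A : V -> 'M[R]_n) : open S ->
  (forall z, S z -> A z \in unitmx) ->
  smooth_on S A -> smooth_on S (fun z => invmx (A z)).
Proof.
move=> oS uA sA; have := (smooth_on_mxP _ oS).1 sA => sA'.
apply/(smooth_on_mxP _ oS) => i j.
have H : smooth_on S (fun z => (\det (A z))^-1 * ((-1) ^+ (j + i) * \det (row' j (col' i (A z)))) : R^o).
  apply: smooth_onM => //.
    apply: smooth_onV => //; last exact: smooth_on_det.
    by move=> z /uA; rewrite unitmxE unitfE.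
  apply: smooth_onM => //; first exact: smooth_on_cst.
  apply: smooth_on_det => //; apply/(smooth_on_mxP _ oS) => a b.
  by apply: smooth_on_eq (sA' (lift j a) (lift i b)) => // z _; rewrite !mxE.
by apply: smooth_on_eq H => // z Sz; rewrite /invmx uA// !mxE.
Qed.

End SmoothInvmx.

(** * Lipschitz estimates and dyadic limits *)

Section LipschitzBall.
Context {R : realType} {n : nat}.

(** [mvt_line] yields a parameter of either sign with |t| <= 1, so the intermediate point may leave
    the ball that contains the end points; three radii suffice. *)
Lemma ball_line (z x y : 'rV[R]_n) (r t : R) : ball z r x -> ball z r y -> `|t| <= 1 ->
  ball z (3 * r) (t *: (x - y) + y).
Proof.
rewrite -!ball_normE /= => zx zy t1.
have -> : z - (t *: (x - y) + y) = (z - y) - t *: ((z - y) - (z - x)).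
  by rewrite [z - y - _]addrC opprB subrKA opprD addrA addrAC.
apply: le_lt_trans (ler_normB _ _) _.
have h : `|t *: ((z - y) - (z - x))| <= `|z - y| + `|z - x|.
  rewrite normrZ; apply: le_trans (ler_normB _ _).
  by rewrite -[leRHS]mul1r ler_wpM2r.
apply: (le_lt_trans (lerD (lexx _) h)).
have -> : 3 * r = r + (r + r) by lra.
by rewrite ltrD// ltrD.
Qed.

Lemma lipschitz_ball (S : set 'rV[R]_n) (f : 'rV[R]_n -> R^o) (z : 'rV[R]_n) (r C : R) :
  open S -> smooth_on S f -> ball z (3 * r) `<=` S ->
  (forall y j, ball z (3 * r) y -> `|'D_('e_j) f y| <= C) ->
  forall x y, ball z r x -> ball z r y -> `|f x - f y| <= n%:R * C * `|x - y|.
Proof.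
move=> oS sf BS HC x y Bx By.
have [|t t1 E] := @mvt_line _ _ f y (x - y) 1.
  move=> t; rewrite normr1 => t1; apply: smooth_on_derivable sf _; apply: BS.
  exact: ball_line.
rewrite normr1 in t1; rewrite scale1r subrK mul1r in E; rewrite E.
have Bt := ball_line Bx By t1.
rewrite derive_partials; last exact: (smooth_on_differentiableR oS (BS _ Bt)).
apply: le_trans (ler_norm_sum _ _ _) _.
have -> : n%:R * C * `|x - y| = \sum_(j < n) (C * `|x - y|).
  by rewrite sumr_const card_ord -mulrA mulr_natl.
apply: ler_sum => j _; rewrite normrM mulrC ler_pM ?HC//.
exact: row_coord_le.
Qed.

Lemma lipschitz_ball_row m (S : set 'rV[R]_n) (f : 'rV[R]_n -> 'rV[R]_m) (z : 'rV[R]_n) (r C : R) :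
  open S -> smooth_on S f -> ball z (3 * r) `<=` S -> 0 <= C ->
  (forall y j i, ball z (3 * r) y -> `|'D_('e_j) f y 0 i| <= C) ->
  forall x y, ball z r x -> ball z r y -> `|f x - f y| <= n%:R * C * `|x - y|.
Proof.
move=> oS sf BS C0 HC x y Bx By.
apply/row_normE; first by rewrite !mulr_ge0.
move=> i; rewrite !mxE.
apply: (@lipschitz_ball S (fun x => f x 0 i : R^o) z r C) => //.
  by move: sf => /(smooth_on_mxP _ oS).
move=> {x y Bx By} y j By; have := HC y j i By; rewrite derive_mx ?mxE//.
by apply: smooth_on_derivable sf _; exact: BS.
Qed.

Lemma smooth_lipschitz m (S : set 'rV[R]_n) (f : 'rV[R]_n -> 'rV[R]_m) (z : 'rV[R]_n) :
  open S -> S z -> smooth_on S f -> exists r L : R, [/\ 0 < r, 0 <= L, ball z r `<=` S &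
  forall x y, ball z r x -> ball z r y -> `|f x - f y| <= L * `|x - y|].
Proof.
move=> oS Sz sf.
pose F (p : 'I_n * 'I_m) : R := `|'D_('e_(p.1)) f z 0 p.2|.
have Fle p : F p <= \sum_q F q.
  by rewrite (bigD1 p)//= lerDl sumr_ge0// => q _; exact: normr_ge0.
pose C : R := \sum_q F q + 1.
have C0 : 0 <= C by rewrite addr_ge0// sumr_ge0// => q _; exact: normr_ge0.
have h : \forall y \near z, forall p : 'I_n * 'I_m, `|'D_('e_(p.1)) f y 0 p.2| <= C.
  apply: (@filter_forall _ _ (fun (p : 'I_n * 'I_m) y => `|'D_('e_(p.1)) f y 0 p.2| <= C) (nbhs z)).
  move=> [j i] /=.
  have cD := smooth_on_cont (smooth_on_derive 'e_j sf) Sz.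
  have /cvgrPdist_le/(_ _ ltr01) := (continuous_mxP _ _).1 cD 0 i.
  apply: filterS => y Hy.
  rewrite -[X in `|X|](subrK ('D_('e_j) f z 0 i)) addrC.
  apply: le_trans (ler_normD _ _) _; rewrite /C; apply: lerD; first exact: (Fle (j, i)).
  by rewrite distrC.
have /nbhs_ballP[r /= r0 rP] : \forall y \near z, S y /\
    forall p : 'I_n * 'I_m, `|'D_('e_(p.1)) f y 0 p.2| <= C.
  by apply: filterI h; exact: open_nbhs_nbhs.
have E : 3 * (r / 3) = r by rewrite mulrC divfK.
exists (r / 3), (n%:R * C); split.
- by rewrite divr_gt0.
- by rewrite mulr_ge0.
- move=> y yB; have := @le_ball _ _ z (r / 3) r _ y yB.
  move=> H; have [] := rP y _ => //; apply: H; rewrite ler_pdivrMr// ler_pMr//; lra.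
apply: (@lipschitz_ball_row m S) => //; rewrite E.
  by move=> y /rP[].
by move=> y j i /rP[_ /(_ (j, i))].
Qed.

End LipschitzBall.

Lemma half_powers {R : realType} (C e : R) : 0 < e -> exists k : nat, C * 2^-1 ^+ k < e.
Proof.
move=> e0.
exists (Num.truncn (`|C| / e)).+1.
have h : (`|C| / e) < (2 : R) ^+ (Num.truncn (`|C| / e)).+1.
  apply: (lt_trans (truncnS_gt _)); rewrite -natrX ltr_nat; exact: ltn_expl.
rewrite exprVn ltr_pdivrMr ?exprn_gt0//.
by rewrite ltr_pdivrMr// mulrC in h; exact: le_lt_trans (ler_norm _) h.
Qed.

(** With [d k] the tail of the geometric series, the intervals [u k - d k, u k + d k] are nested;
    the limit is the supremum of their left ends. *)
Lemma half_seq_limR {R : realType} (u : nat -> R) (C : R) :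
  (forall k, `|u k.+1 - u k| <= C * 2^-1 ^+ k) ->
  exists l, forall k, `|u k - l| <= 2 * C * 2^-1 ^+ k.
Proof.
move=> H.
pose d k := 2 * C * 2^-1 ^+ k.
have dS k : d k = d k.+1 + C * 2^-1 ^+ k.
  rewrite /d exprS; move: (2^-1 ^+ k) => q.
  by field.
have d0 k : 0 <= C * 2^-1 ^+ k by apply: le_trans (H k).
have dge k : 0 <= d k by rewrite /d -mulrA mulr_ge0.
have lo k m : u k - d k <= u (k + m)%N - d (k + m)%N.
  elim: m => [|m IH]; first by rewrite addn0.
  apply: (le_trans IH); rewrite addnS.
  have := H (k + m)%N; rewrite ler_norml => /andP[h1 _].
  rewrite (dS (k + m)%N); move: h1; move: (u _) (u _) (d _) (C * _) => a b c e h; lra.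
have hi k m : u (k + m)%N + d (k + m)%N <= u k + d k.
  elim: m => [|m IH]; first by rewrite addn0.
  apply: le_trans IH; rewrite addnS.
  have := H (k + m)%N; rewrite ler_norml => /andP[_ h1].
  rewrite (dS (k + m)%N); move: h1; move: (u _) (u _) (d _) (C * _) => a b c e h; lra.
have lohi k m : u k - d k <= u m + d m.
  apply: (le_trans (lo k m)); apply: le_trans (hi m k); rewrite [(m + k)%N]addnC.
  by rewrite lerD2l; apply: le_trans (dge _); rewrite oppr_le0.
pose A := range (fun k => u k - d k).
have supA : has_sup A.
  split; first by exists (u 0%N - d 0%N); exists 0%N.
  by exists (u 0%N + d 0%N) => _ [k _ <-]; exact: lohi.
exists (sup A) => k; rewrite distrC ler_distl; apply/andP; split.
  by apply: ub_le_sup; [exact: supA.2|exists k].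
by apply: ge_sup supA.1 _ => _ [m _ <-]; exact: lohi.
Qed.

Lemma half_seq_lim {R : realType} n (u : nat -> 'rV[R]_n) (C : R) :
  (forall k, `|u k.+1 - u k| <= C * 2^-1 ^+ k) ->
  exists l, forall k, `|u k - l| <= 2 * C * 2^-1 ^+ k.
Proof.
move=> H.
have d0 k : 0 <= C * 2^-1 ^+ k by apply: le_trans (H k).
have Hj (j : 'I_n) : exists l, forall k, `|u k 0 j - l| <= 2 * C * 2^-1 ^+ k.
  apply: half_seq_limR => k; apply: le_trans (H k).
  by have := row_coord_le (u k.+1 - u k) j; rewrite !mxE.
have [l Hl] := choice Hj.
exists (\row_j l j) => k; apply/row_normE; first by rewrite -mulrA mulr_ge0.
by move=> j; rewrite !mxE; exact: Hl.
Qed.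

Lemma norm_mulmx_row {R : realType} m n (u : 'rV[R]_m) (B : 'M[R]_(m, n)) :
  `|u *m B| <= m%:R * `|u| * `|B|.
Proof.
apply/row_normE; first by rewrite !mulr_ge0.
move=> j; rewrite mxE; apply: (le_trans (ler_norm_sum _ _ _)).
have -> : m%:R * `|u| * `|B| = \sum_(i < m) `|u| * `|B|.
  by rewrite sumr_const card_ord -mulrA mulr_natl.
apply: ler_sum => i _; rewrite normrM; apply: ler_pM => //; first exact: row_coord_le.
rewrite [leRHS]mx_normrE; exact: (le_bigmax _ (fun p : 'I_m * 'I_n => `|B p.1 p.2|) (i, j)).
Qed.

(** * Inverse functions and ordinary differential equations *)

Section IFT.
Context {R : realType} {n : nat}.
Variables (S : set 'rV[R]_n) (F : 'rV[R]_n -> 'rV[R]_n) (z : 'rV[R]_n).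
Hypotheses (oS : open S) (Sz : S z) (sF : smooth_on S F).

Lemma jacobianE x i j : S x -> jacobian F x i j = 'D_('e_i) F x 0 j.
Proof.
by move=> Sx; rewrite mxE deriveE//; exact: smooth_on_differentiable sF.
Qed.

Hypothesis uJ : jacobian F z \in unitmx.
Let A := invmx (jacobian F z).
(** The Newton map for the value 0, with the derivative frozen at [z]: its own derivative vanishes
    at [z], so it contracts by one half nearby. *)
Let g (x : 'rV[R]_n) : 'rV[R]_n := x - F x *m A.

Let sg : smooth_on S g.
Proof.
apply/(smooth_on_mxP _ oS) => i j; rewrite (ord1 i).
have := smooth_on_mulmx oS sF (@smooth_on_cstmx R _ _ _ S A).
move=> /(smooth_on_mxP _ oS)/(_ 0 j) h.
have := smooth_onB oS (@smooth_on_coord R n S j) h.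
by apply: smooth_on_eq => // y _; rewrite /g !mxE.
Qed.

Let Dg (x v : 'rV[R]_n) : S x -> 'D_v g x = v - v *m jacobian F x *m A.
Proof.
move=> Sx; have dF := smooth_on_differentiable oS Sx sF.
have -> : v *m jacobian F x = 'D_v F x by rewrite -deriveEjacobian.
pose h (y : 'rV[R]_n) : 'rV[R]_n := F y *m A.
have d2 : is_derive x v (fun y => F y *m A) ('D_v F x *m A).
  by apply: is_derive_mulmxr; apply: derivableP; exact: diff_derivable.
have H : is_derive x v ((id : 'rV[R]_n -> 'rV[R]_n) - h) (v - 'D_v F x *m A).
  exact: is_deriveB (is_derive_id x v) d2.
by have [_] := H.
Qed.

Let small : exists r, [/\ 0 < r, ball z (3 * r) `<=` S,
  (forall x y, ball z r x -> ball z r y -> `|g x - g y| <= 2^-1 * `|x - y|) &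
  (forall x, ball z r x -> jacobian F x \in unitmx)].
Proof.
(* The Lipschitz constant is [n%:R] times a bound on the partials; this bound brings it to at most
   one half. *)
pose C : R := 2^-1 / n.+1%:R.
have C0 : 0 < C by rewrite divr_gt0// invr_gt0.
have sdet : smooth_on S (fun x => \det (jacobian F x) : R^o).
  apply: smooth_on_det => //; apply/(smooth_on_mxP _ oS) => i j.
  have := smooth_on_derive 'e_i sF; move=> /(smooth_on_mxP _ oS)/(_ 0 j).
  by apply: smooth_on_eq => // x Sx; rewrite jacobianE.
have h1 : \forall y \near z, forall p : 'I_n * 'I_n, `|'D_('e_(p.1)) g y 0 p.2| <= C.
  apply: (@filter_forall _ _ (fun (p : 'I_n * 'I_n) y => `|'D_('e_(p.1)) g y 0 p.2| <= C) (nbhs z)).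
  move=> [j i] /=.
  have cD := smooth_on_cont (smooth_on_derive 'e_j sg) Sz.
  have Dz0 : 'D_('e_j) g z = 0 by rewrite (Dg 'e_j Sz) -mulmxA (mulmxV uJ) mulmx1 subrr.
  have /cvgrPdist_le/(_ _ C0) := (continuous_mxP _ _).1 cD 0 i.
  apply: filterS => y h; apply: le_trans h; rewrite le_eqVlt; apply/orP; left; apply/eqP.
  by rewrite [X in X - _](_ : _ = 0) ?sub0r ?normrN// Dz0 mxE.
have h2 : \forall y \near z, \det (jacobian F y) != 0.
  have d0 : 0 < `|\det (jacobian F z)|.
    by rewrite normr_gt0; move: uJ; rewrite unitmxE unitfE.
  have /cvgrPdist_lt/(_ _ d0) := smooth_on_cont sdet Sz.
  have aux (a b : R) : `|a - b| < `|a| -> b != 0.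
    by apply: contraTneq => ->; rewrite subr0 ltxx.
  by apply: filterS => y; exact: aux.
have h3 : \forall y \near z, S y /\ \det (jacobian F y) != 0.
  by apply: filterI h2; exact: open_nbhs_nbhs.
have /nbhs_ballP[r /= r0 rP] : \forall y \near z,
    (forall p : 'I_n * 'I_n, `|'D_('e_(p.1)) g y 0 p.2| <= C) /\
    (S y /\ \det (jacobian F y) != 0).
  by apply: filterI h3.
have E : 3 * (r / 3) = r by rewrite mulrC divfK.
have BS : ball z (3 * (r / 3)) `<=` S by rewrite E => y /rP[_ []].
exists (r / 3); split; [by rewrite divr_gt0|exact: BS| |].
  move=> x y Bx By.
  have := @lipschitz_ball_row _ _ n S g z (r / 3) C oS sg BS (ltW C0).
  move=> /(_ _ x y Bx By) H.
  apply: (le_trans (H _)).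
    by move=> y' j i; rewrite E => /rP[/(_ (j, i))].
  apply: ler_wpM2r => //; rewrite /C mulrCA ler_piMr ?invr_ge0//.
  by rewrite ler_pdivrMr// mul1r ler_nat.
move=> x Bx; rewrite unitmxE unitfE.
suff /rP[_ []] : ball z r x by [].
by apply: le_ball Bx; rewrite ler_pdivrMr// ler_pMr//; lra.
Qed.

(* Newton's iteration [x |-> x + (y - F x) A] contracts. *)
Theorem inverse_function (N : set 'rV[R]_n) : nbhs z N ->
  exists U V K, [/\ open U /\ open V, U z /\ U `<=` S `&` N,
    (forall x, U x -> V (F x) /\ K (F x) = x),
    (forall y, V y -> U (K y) /\ F (K y) = y) & smooth_on V K].
Proof.
move=> /nbhs_ballP[rN /= rN0 BN].
have [r1 [r10 BS' glip' unitJ']] := small.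
pose r := Num.min r1 rN.
have r0 : 0 < r by rewrite lt_min r10.
have Br x : ball z r x -> ball z r1 x /\ N x.
  move=> Bx; split; first by apply: le_ball Bx; rewrite ge_min lexx.
  by apply: BN; apply: le_ball Bx; rewrite ge_min lexx orbT.
have BS x : ball z r x -> S x.
  move=> /Br[Bx _]; apply: BS'; apply: le_ball Bx; rewrite ler_pMl//; lra.
have glip x y : ball z r x -> ball z r y -> `|g x - g y| <= 2^-1 * `|x - y|.
  by move=> /Br[Bx _] /Br[By _]; exact: glip'.
have unitJ x : ball z r x -> jacobian F x \in unitmx by move=> /Br[/unitJ'].
have Flip x y : ball z r x -> ball z r y -> `|x - y| <= 2 * `|(F x - F y) *m A|.
  move=> Bx By; have := glip x y Bx By.
  have -> : x - y = (g x - g y) + (F x - F y) *m A.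
    rewrite /g mulmxBl; move: (F x *m A) (F y *m A) => a b.
    by rewrite opprD [x - a + _]addrACA -opprD subrK.
  have := ler_normD (g x - g y) ((F x - F y) *m A).
  move: (`|g x - g y|) (`|_ *m A|) (`|_ + _|) => a b c; lra.
have A0 (u : 'rV[R]_n) : u *m A = 0 -> u = 0.
  move=> /(congr1 (mulmx^~ (jacobian F z))).
  by rewrite -mulmxA (mulVmx uJ) mulmx1 mul0mx.
(* The values [y] for which the first Newton step from [z] is shorter than r / 4; with contraction
   by one half the iterates stay within r / 2 of [z]. *)
pose V : set 'rV[R]_n := [set y | `|(y - F z) *m A| < r / 4].
have oV : open V.
  have -> : V = (fun y => (y - F z) *m A) @^-1` (ball 0 (r / 4)).
    by apply/funext => y; rewrite /V /= -ball_normE /= sub0r normrN.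
  apply: open_comp => [y _|]; last exact: ball_open.
  apply: differentiable_continuous; apply: (@smooth_on_differentiable _ _ _ _ setT) => //.
    exact: openT.
  apply: smooth_on_mulmx; [exact: openT| |exact: smooth_on_cstmx].
  apply/(smooth_on_mxP _ openT) => i j; rewrite (ord1 i).
  have := smooth_onB openT (@smooth_on_coord R n setT j) (@smooth_on_cst _ _ setT (F z 0 j)).
  by apply: smooth_on_eq; [exact: openT|move=> t _; rewrite !mxE].
pose U : set 'rV[R]_n := [set x | ball z r x /\ V (F x)].
have oU : open U.
  rewrite openE => x [Bx Vx]; rewrite /interior.
  have h1 : \forall y \near x, ball z r y by apply: open_nbhs_nbhs; split => //; exact: ball_open.
  have h2 : \forall y \near x, V (F y).
    by apply: (smooth_on_cont sF (BS _ Bx)); apply: open_nbhs_nbhs.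
  by apply: filterI.
have Uz : U z.
  by split; [exact: ballxx|rewrite /V /= subrr mul0mx normr0 divr_gt0].
have surj y : V y -> exists x, U x /\ F x = y.
  move=> Vy; have Vy' : `|(y - F z) *m A| < r / 4 by [].
  pose T x := g x + y *m A.
  pose u k := iter k T z.
  pose q k : R := 2^-1 ^+ k.
  have q0 k : 0 < q k by rewrite exprn_gt0// invr_gt0.
  have P k : `|u k - z| <= r / 2 - r / 2 * q k /\ `|u k.+1 - u k| <= r / 4 * q k.
    elim: k => [|k [P1 P2]].
      rewrite /u /= /q expr0 !mulr1 !subrr normr0; split => //.
      apply: ltW; rewrite /T /g; suff -> : z - F z *m A + y *m A - z = (y - F z) *m A by [].
      by rewrite mulmxBl addrAC [z - _]addrC addrK addrC.
    have qS : q k.+1 = 2^-1 * q k by rewrite /q exprS.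
    have P3 : `|u k.+1 - z| <= r / 2 - r / 2 * q k.+1.
      have -> : u k.+1 - z = (u k.+1 - u k) + (u k - z) by rewrite addrA subrK.
      apply: (le_trans (ler_normD _ _)); rewrite qS.
      move: P1 P2; move: (`|_|) (`|_|) (q k) => a b c; lra.
    split => //.
    have Bk x c : `|x - z| <= r / 2 - r / 2 * q c -> ball z r x.
      rewrite -ball_normE /= distrC => /le_lt_trans; apply.
      have := q0 c; have := mulr_gt0 r0 (q0 c); move: (q c) => d; lra.
    have -> : u k.+2 - u k.+1 = g (u k.+1) - g (u k).
      have uS j : u j.+1 = T (u j) by [].
      by rewrite (uS k.+1) [X in _ - X](uS k) /T opprD addrACA subrr addr0.
    apply: (le_trans (glip _ _ (Bk _ _ P3) (Bk _ _ P1))).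
    rewrite qS mulrCA; apply: ler_wpM2l => //; by rewrite invr_ge0.
  have [l Hl] := half_seq_lim (fun k => (P k).2).
  have Bl : ball z r l.
    rewrite -ball_normE /=; apply: (le_lt_trans (Hl 0%N)); rewrite expr0; lra.
  have Bu k : ball z r (u k).
    rewrite -ball_normE /= distrC; apply: (le_lt_trans (P k).1).
    have := mulr_gt0 r0 (q0 k); move: (r * q k) (q k) => a d; lra.
  have Tl : T l = l.
    apply/eqP; rewrite -subr_eq0 -normr_le0 leNgt; apply/negP => e0.
    have [k Hk] := half_powers (r) e0.
    have : `|T l - l| <= r * q k.
      have -> : T l - l = (g l - g (u k)) + (u k.+1 - l).
        have -> : u k.+1 = T (u k) by [].
        by rewrite /T -[g (u k) + _ - l]addrA subrKA addrA.
      apply: (le_trans (ler_normD _ _)).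
      have h1 := glip _ _ Bl (Bu k); have h2 := Hl k; have h3 := Hl k.+1.
      rewrite distrC in h2; rewrite exprS -/(q k) in h3; rewrite -/(q k) in h2.
      move: h1 h2 h3; move: (`|_|) (`|_|) (`|_|) => a b c.
      have := q0 k; have := mulr_gt0 r0 (q0 k); move: (q k) => d; lra.
    by rewrite leNgt Hk.
  have Fl : F l = y.
    apply/eqP; rewrite eq_sym -subr_eq0; apply/eqP; apply: A0.
    move: Tl; rewrite /T /g mulmxBl => /(congr1 (fun t => t - l)).
    by rewrite subrr addrAC [l - _]addrC addrK addrC.
  by exists l; split=> //; split => //; rewrite Fl.
have [K HK] : exists K, forall y, V y -> U (K y) /\ F (K y) = y.
  have ex y : exists x, V y -> U x /\ F x = y.
    have [Vy|nVy] := pselect (V y); last by exists z.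
    by have [x Hx] := surj y Vy; exists x.
  by have [K HK] := choice ex; exists K.
have KF x : U x -> K (F x) = x.
  move=> [Bx Vx]; have [[BK _] FK] := HK _ Vx.
  have := Flip _ _ BK Bx; rewrite FK subrr mul0mx normr0 mulr0 normr_le0 subr_eq0.
  by move=> /eqP.
exists U, V, K; split => //.
- by split => // x [Bx _]; split; [exact: BS|have [] := Br x Bx].
- by move=> x Ux; split; [have [] := Ux|exact: KF].
have KV y w : V y -> is_derive y w K (w *m invmx (jacobian F (K y))).
  move=> Vy; have [[BK _] FK] := HK _ Vy.
  pose x0 := K y; pose B := invmx (jacobian F x0).
  have uB : jacobian F x0 \in unitmx by exact: unitJ.
  have dF : differentiable F x0 by apply: smooth_on_differentiable oS (BS _ BK) sF.
  pose D (h : R) := K (h *: w + y) - x0.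
  have Vh : \forall h \near (0 : R), V (h *: w + y).
    have c : {for (0 : R), continuous (fun h : R => h *: w + y)}.
      exact: line_continuous.
    apply: c; apply: open_nbhs_nbhs; split => //; by rewrite scale0r add0r.
  have Dle h : V (h *: w + y) -> `|D h| <= 2 * `|w *m A| * `|h|.
    move=> Vhw; have [[BKh _] FKh] := HK _ Vhw.
    have := Flip _ _ BKh BK; rewrite FKh FK addrK -scalemxAl normrZ.
    by rewrite [`|h| * _]mulrC mulrA.
  (* [K] moves by at most 2 |w A| |h|, and multiplication by [B] costs a factor n |B|; the two [+ 1]
     keep [M] positive. *)
  pose M : R := (n%:R * `|B| + 1) * (2 * `|w *m A| + 1).
  have M0 : 0 < M by rewrite mulr_gt0// ltr_wpDl// mulr_ge0.
  have lim : (fun h : R => h^-1 *: ((K \o shift y) (h *: w) - K y)) @ 0^' --> w *m B.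
    apply/cvgrPdist_le => e e0.
    pose e1 := e / M; have e10 : 0 < e1 by rewrite divr_gt0.
    have /nbhs_ballP[d /= d0 Hd] := differentiable_expand dF e10.
    have Dd : \forall h \near (0 : R), `|D h| < d.
      have q0 : 0 < d / (2 * `|w *m A| + 1) by rewrite divr_gt0// ltr_wpDl// mulr_ge0.
      have hq := near0_ltR q0.
      apply: filterS2 Vh hq => h Vhw.
      move=> hlt; apply: (le_lt_trans (Dle _ Vhw)); move: hlt.
      rewrite ltr_pdivlMr ?ltr_wpDl// ?mulr_ge0// mulrC => h1.
      by apply: le_lt_trans h1; rewrite ler_wpM2r// lerDl.
    near=> h.
    have h0 : h != 0 by near: h; exact: nbhs_dnbhs_neq.
    have Vhw : V (h *: w + y) by near: h; exact: nbhs_dnbhs.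
    have Dhd : `|D h| < d by near: h; exact: nbhs_dnbhs.
    have [_ FKh] := HK _ Vhw.
    have HdD : `|F (D h + x0) - (F x0 + D h *m jacobian F x0)| <= e1 * `|D h|.
      have := Hd (D h); rewrite -ball_normE /= sub0r normrN => /(_ Dhd).
      by rewrite /jacobian mul_rV_lin1.
    have -> : w *m B - h^-1 *: ((K \o shift y) (h *: w) - K y) =
       h^-1 *: ((F (D h + x0) - (F x0 + D h *m jacobian F x0)) *m B).
      have -> : F (D h + x0) = h *: w + y by rewrite /D subrK FKh.
      rewrite -[K y]/x0 FK opprD addrA addrK mulmxBl -mulmxA (mulmxV uB) mulmx1.
      by rewrite -scalemxAl [RHS]scalerBr scalerA mulVf// scale1r.
    rewrite normrZ normfV ler_pdivrMl ?normr_gt0//.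
    apply: (le_trans (norm_mulmx_row _ _)).
    have h1 := Dle _ Vhw.
    have eM : e = e1 * M by rewrite /e1 divfK// gt_eqF.
    rewrite eM.
    have h2 : `|F (D h + x0) - (F x0 + D h *m jacobian F x0)| <= e1 * ((2 * `|w *m A| + 1) * `|h|).
      apply: (le_trans HdD); apply: ler_wpM2l; first exact: ltW.
      by apply: (le_trans h1); apply: ler_wpM2r => //; rewrite lerDl.
    apply: (@le_trans _ _ ((n%:R * `|B|) * (e1 * ((2 * `|w *m A| + 1) * `|h|)))).
      by rewrite -mulrA [`|_| * `|B|]mulrC mulrA; apply: ler_wpM2l => //; rewrite mulr_ge0.
    have -> : `|h| * (e1 * M) = (n%:R * `|B| + 1) * (e1 * ((2 * `|w *m A| + 1) * `|h|)).
      by rewrite /M; ring.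
    apply: ler_wpM2r; last by rewrite lerDl.
    by apply: mulr_ge0 (ltW e10) _; rewrite mulr_ge0// addr_ge0// mulr_ge0.
  split; first by apply/cvg_ex; exists (w *m B).
  exact: (cvg_lim (@norm_hausdorff _ _) lim).
have cK y : V y -> {for y, continuous K}.
  move=> Vy; have [[BK _] FK] := HK _ Vy.
  apply: (@continuous_lip_at _ _ _ K y (2 * (n%:R * `|A|))); first by rewrite !mulr_ge0.
  have Vn : \forall t \near y, V t by apply: open_nbhs_nbhs.
  apply: filterS Vn => t Vt; have [[BKt _] FKt] := HK _ Vt.
  apply: (le_trans (Flip _ _ BK BKt)); rewrite FK FKt -mulrA; apply: ler_wpM2l => //.
  by apply: (le_trans (norm_mulmx_row _ _)); rewrite mulrAC.
(* Bootstrapping: the derivative of [K] is a smooth function of [K], so it inherits the order of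
   differentiability already known for [K]. *)
apply/smooth_onP; elim=> [|k IH]; first by split.
split=> // w; split=> [y Vy|]; first by have [] := KV y w Vy.
have oUV : open V := oV.
apply: (@Ck_eq _ _ _ _ _ ((fun x => w *m invmx (jacobian F x)) \o K)) => //.
  by move=> y Vy; have [_ ->] := KV y w Vy.
have sJ : smooth_on U (fun x => w *m invmx (jacobian F x)).
  apply: smooth_on_mulmx => //; first exact: smooth_on_cstmx.
  apply: (smooth_on_invmx oU); first by move=> x [Bx _]; exact: unitJ.
  apply/(smooth_on_mxP _ oU) => i j.
  have sDF : smooth_on U ('D_('e_i) F).
    by apply: smooth_on_derive; apply: smooth_on_sub sF => x [Bx _]; exact: BS.
  move: sDF => /(smooth_on_mxP _ oU)/(_ 0 j).
  by apply: smooth_on_eq => // x [Bx _]; rewrite jacobianE//; exact: BS.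
apply: Ck_mx => // i j.
have sJij : smooth_on U (fun x => (w *m invmx (jacobian F x)) i j : R^o).
  exact: ((smooth_on_mxP _ oU).1 sJ i j).
exact: (Ck_comp oV oU (fun y Vy => (HK y Vy).1) IH ((smooth_onP _ _).1 sJij k)).
Unshelve. all: by end_near. Qed.

End IFT.

(** * Primitives, curves and Picard iteration *)

Section Primitive.
Context {R : realType}.
Notation mu := (@lebesgue_measure R).

Lemma primitive (f : R -> R) (T : R) : continuous f ->
  exists F : R -> R, forall x, `|x| < T -> is_derive x (1 : R) F (f x).
Proof.
move=> cf; pose F x : R := (\int[mu]_(t in [set` `[- T, x]]) (f t))%R.
exists F => x; rewrite ltr_norml => /andP[Tx xT].
have fi : mu.-integrable `[- T, T] (EFin \o f).
  apply: continuous_compact_integrable; first exact: segment_compact.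
  exact: continuous_subspaceT.
have [d e] := @continuous_FTC1_closed R f (- T) x T xT fi Tx (cf x).
by split; [exact: d|exact: etrans (esym (derive1E F x)) e].
Qed.

End Primitive.

Section Curves.
Context {R : realType} {n : nat}.

Lemma curve_bound (y : R -> 'rV[R]_n) (dy : R -> 'rV[R]_n) (T C : R) (s t : R) :
  (forall x, `|x| < T -> is_derive x (1 : R) y (dy x)) ->
  `|s| < T -> `|t| < T -> 0 <= C ->
  (forall x, Num.min s t <= x <= Num.max s t -> `|dy x| <= C) ->
  `|y s - y t| <= C * `|s - t|.
Proof.
move=> Hd; wlog st : s t / t <= s => [W|].
  move=> hs ht C0 HC; have [ts|/ltW st] := leP t s; first exact: W.
  rewrite distrC [`|s - t|]distrC; apply: W => // x; rewrite minC maxC; exact: HC.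
move=> hs ht C0; rewrite (min_idPr st) (max_idPl st) => HC.
apply/row_normE; first by rewrite mulr_ge0.
move=> j; rewrite !mxE.
have inT x : t <= x <= s -> `|x| < T.
  move=> /andP[tx xs]; rewrite ltr_norml.
  move: hs ht; rewrite !ltr_norml => /andP[_ h2] /andP[h3 _].
  by rewrite (lt_le_trans h3 tx) (le_lt_trans xs h2).
have Hj x : t <= x <= s -> is_derive x (1 : R) (fun x => y x 0 j : R) (dy x 0 j).
  move=> /inT/Hd[d1 d2]; split; first exact: ((derivable_mxP y x 1).1 d1).
  by rewrite -d2 derive_mx// mxE.
have [| |c] := @MVT_segment R (fun x => y x 0 j) (fun x => dy x 0 j) t s st.
- by move=> x; rewrite in_itv /= => /andP[tx xs]; apply: Hj; rewrite !ltW.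
- apply: derivable_within_continuous => x; rewrite in_itv /= => /Hj[]//.
rewrite in_itv /= => cts ->; rewrite normrM; apply: ler_wpM2r => //.
by apply: le_trans (HC c cts); exact: row_coord_le.
Qed.

Lemma curve_const (y : R -> 'rV[R]_n) (T : R) (s t : R) :
  (forall x, `|x| < T -> is_derive x (1 : R) y 0) ->
  `|s| < T -> `|t| < T -> y s = y t.
Proof.
move=> H hs ht; apply/eqP; rewrite -subr_eq0 -normr_le0.
have := @curve_bound y (fun=> 0) T 0 s t H hs ht (lexx _).
by rewrite mul0r; apply => x _; rewrite normr0.
Qed.

Lemma curve_primitive (f : R -> 'rV[R]_n) (T : R) (a : 'rV[R]_n) : continuous f -> 0 < T ->
  exists F : R -> 'rV[R]_n, F 0 = a /\ forall x, `|x| < T -> is_derive x (1 : R) F (f x).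
Proof.
move=> cf T0.
have H (j : 'I_n) : exists F : R -> R, forall x, `|x| < T -> is_derive x (1 : R) F (f x 0 j).
  by apply: primitive => x; exact: ((continuous_mxP f x).1 (cf x) 0 j).
have [F HF] := choice H.
exists (fun x => \row_j (F j x - F j 0 + a 0 j)); split.
  by apply/rowP => j; rewrite !mxE subrr add0r.
move=> x xT.
have HFj j : is_derive x (1 : R) (fun x => F j x - F j 0 + a 0 j : R) (f x 0 j).
  have := HF j x xT => h.
  have E : (fun x => F j x - F j 0 + a 0 j : R) = F j + cst (- F j 0 + a 0 j).
    by apply/funext => u; rewrite fctE /cst addrA.
  rewrite E; apply: is_derive_eq (is_deriveD h (is_derive_cst _ _ _)) _.
  exact: addr0.
apply/is_derive_mxP => i j; rewrite (ord1 i).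
have -> : (fun y => (\row_j0 (F j0 y - F j0 0 + a 0 j0)) 0 j : R^o) =
  (fun y => F j y - F j 0 + a 0 j) by apply/funext => u; rewrite mxE.
exact: HFj.
Qed.

End Curves.

Section Picard.
Context {R : realType} {n : nat}.

(** Projection of [t] to the segment of centre [a] and radius [r], for nonnegative [r]. *)
Definition clampR (r a t : R) : R := Num.max (a - r) (Num.min (a + r) t).

Lemma clampR_mono (r a s t : R) : 0 <= r -> s <= t ->
  0 <= clampR r a t - clampR r a s <= t - s.
Proof.
move=> r0 st; rewrite /clampR /Num.max /Num.min.
have [h1|h1] := ltP (a + r) s; have [h2|h2] := ltP (a + r) t;
  (have [h3|h3] := ltP (a - r) (a + r)); (have [h4|h4] := ltP (a - r) s);
  (have [h5|h5] := ltP (a - r) t); apply/andP; split; lra.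
Qed.

Lemma clampR_lip (r a s t : R) : 0 <= r -> `|clampR r a s - clampR r a t| <= `|s - t|.
Proof.
move=> r0; wlog st : s t / t <= s => [W|].
  by have [/W//|/ltW/W] := leP t s; rewrite distrC [leRHS]distrC.
have /andP[h1 h2] := clampR_mono a r0 st.
by rewrite !ger0_norm// subr_ge0.
Qed.

Lemma clampR_in (r a t : R) : 0 <= r -> `|a - clampR r a t| <= r.
Proof.
move=> r0; rewrite /clampR /Num.max /Num.min ler_norml.
have [h2|h2] := ltP (a + r) t;
  (have [h3|h3] := ltP (a - r) (a + r)); 
  (have [h5|h5] := ltP (a - r) t); apply/andP; split; lra.
Qed.

Lemma clampR_id (r a t : R) : `|a - t| <= r -> clampR r a t = t.
Proof.
rewrite ler_norml /clampR /Num.max /Num.min => /andP[h1 h2].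
have [h3|h3] := ltP (a + r) t; first lra.
have [h5|h5] := ltP (a - r) t; lra.
Qed.

Definition clamp (r : R) (a u : 'rV[R]_n) : 'rV[R]_n := \row_j clampR r (a 0 j) (u 0 j).

Lemma clamp_lip (r : R) (a s t : 'rV[R]_n) : 0 <= r -> `|clamp r a s - clamp r a t| <= `|s - t|.
Proof.
move=> r0; apply/row_normE => // j; rewrite !mxE.
apply: (le_trans (clampR_lip _ _ _ r0)).
by have := row_coord_le (s - t) j; rewrite !mxE.
Qed.

Lemma clamp_in (r : R) (a t : 'rV[R]_n) : 0 <= r -> `|a - clamp r a t| <= r.
Proof.
by move=> r0; apply/row_normE => // j; rewrite !mxE; exact: clampR_in.
Qed.

Lemma clamp_id (r : R) (a t : 'rV[R]_n) : `|a - t| <= r -> clamp r a t = t.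
Proof.
move=> h; apply/rowP => j; rewrite mxE; apply: clampR_id; apply: le_trans h.
by have := row_coord_le (a - t) j; rewrite !mxE.
Qed.

(* Picard iteration for the field [G], with time and space clamped so that all
   iterates are globally defined. *)
Lemma picard_lipschitz (G : 'rV[R]_n -> 'rV[R]_n) (a : 'rV[R]_n) (L B : R) :
  0 < L -> (forall x y, `|G x - G y| <= L * `|x - y|) -> (forall x, `|G x| <= B) ->
  exists e y, [/\ 0 < e, y (0 : R) = a &
    forall t, `|t| < e -> is_derive t (1 : R) y (G (y t))].
Proof.
move=> L0 GL GB.
have B0 : 0 <= B by apply: le_trans (GB 0).
(* Makes the Picard operator contract by one half on the segment of radius [e]. *)
pose e : R := (2 * L)^-1.
have e0 : 0 < e by rewrite invr_gt0 mulr_gt0.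
have eL : e * L = 2^-1 by rewrite /e invfM -mulrA mulVf ?mulr1// gt_eqF.
have clampC (f : R -> 'rV[R]_n) (C : R) : (forall s t, `|s| <= e -> `|t| <= e -> `|f s - f t| <= C * `|s - t|) ->
  0 <= C -> continuous (fun t => G (f (clampR e 0 t))).
  move=> fC C0 t; apply/cvgrPdist_le => d d0.
  have K0 : 0 < L * (C + 1) by rewrite mulr_gt0// ltr_wpDl.
  apply/nbhs_ballP; exists (d / (L * (C + 1))) => /=; first by rewrite divr_gt0.
  move=> s; rewrite /ball /= ltr_pdivlMr// => ts.
  apply: (le_trans (GL _ _)); rewrite mulrC; apply: le_trans (ltW ts); rewrite [leRHS]mulrC -mulrA mulrC.
  apply: ler_wpM2l; first exact: ltW.
  have cin x : `|clampR e 0 x| <= e.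
    by have := clampR_in 0 x (ltW e0); rewrite sub0r normrN.
  apply: (le_trans (fC _ _ (cin t) (cin s))).
  apply: ler_pM => //; first by rewrite lerDl.
  exact: clampR_lip (ltW e0).
have next (f : R -> 'rV[R]_n) : (forall s t, `|s| <= e -> `|t| <= e -> `|f s - f t| <= B * `|s - t|) ->
  exists g : R -> 'rV[R]_n, [/\ g 0 = a,
    (forall t, `|t| < 2 * e -> is_derive t (1 : R) g (G (f (clampR e 0 t)))) &
    (forall s t, `|s| <= e -> `|t| <= e -> `|g s - g t| <= B * `|s - t|)].
  move=> fB.
  have [|g [g0 Hg]] := @curve_primitive R n _ (2 * e) a (clampC f B fB B0).
    by rewrite mulr_gt0.
  have e2e (x : R) : `|x| <= e -> `|x| < 2 * e by lra.
  exists g; split => // s t se te.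
  exact: (curve_bound Hg (e2e _ se) (e2e _ te) B0 (fun x _ => GB _)).
pose P (f : R -> 'rV[R]_n) := forall s t, `|s| <= e -> `|t| <= e -> `|f s - f t| <= B * `|s - t|.
(* The Picard operator. The Lipschitz bound carried by the argument makes the integrand continuous,
   and the image, a chosen primitive, carries the same bound. *)
pose T0 (f : {f | P f}) : {f | P f} :=
  let: exist g H := cid (next (sval f) (svalP f)) in
  exist _ g (let: And3 _ _ h := H in h).
have T0P f : sval (T0 f) 0 = a /\
  forall t, `|t| < 2 * e -> is_derive t (1 : R) (sval (T0 f)) (G (sval f (clampR e 0 t))).
  by rewrite /T0; case: cid => g [h1 h2 h3].
have P0 : P (fun=> a) by move=> s t _ _; rewrite subrr normr0 mulr_ge0.
pose u k := iter k T0 (exist _ _ P0).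
have e2e (x : R) : `|x| <= e -> `|x| < 2 * e by lra.
have e02 : `|0 : R| < 2 * e by rewrite normr0 mulr_gt0.
have cin x : `|clampR e 0 x| <= e.
  by have := clampR_in 0 x (ltW e0); rewrite sub0r normrN.
have diffT (f g : {f | P f}) (D : R) : (forall t, `|t| <= e -> `|sval f t - sval g t| <= D) -> 0 <= D ->
  forall t, `|t| <= e -> `|sval (T0 f) t - sval (T0 g) t| <= 2^-1 * D.
  move=> HD D0 t te.
  have [f0 df] := T0P f; have [g0 dg] := T0P g.
  have dfg x : `|x| < 2 * e -> is_derive x (1 : R) (sval (T0 f) - sval (T0 g))
     (G (sval f (clampR e 0 x)) - G (sval g (clampR e 0 x))).
    by move=> xe; apply: is_deriveB; [exact: df|exact: dg].
  have LD0 : 0 <= L * D by rewrite mulr_ge0// ltW.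
  have := curve_bound dfg (e2e _ te) e02 LD0.
  rewrite !fctE f0 g0 subrr !subr0 => H.
  apply: (le_trans (H _)).
    move=> x _; apply: (le_trans (GL _ _)); apply: ler_wpM2l; first exact: ltW.
    by apply: HD; exact: cin.
  rewrite -eL [e * L]mulrC -!mulrA; apply: ler_wpM2l; first exact: ltW.
  by rewrite mulrC; exact: ler_wpM2r.
have Be0 : 0 <= B * e by rewrite mulr_ge0// ltW.
have stepu k t : `|t| <= e -> `|sval (u k.+1) t - sval (u k) t| <= B * e * 2^-1 ^+ k.
  elim: k t => [|k IH] t te.
    rewrite expr0 mulr1 /u /=.
    have [f0 df] := T0P (exist _ _ P0).
    rewrite -[X in _ - X]f0.
    apply: (le_trans (svalP (T0 (exist _ _ P0)) t 0 te _)).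
      by rewrite normr0 ltW.
    by rewrite subr0; exact: ler_wpM2l.
  rewrite exprS mulrCA; apply: (diffT (u k.+1) (u k)) => //.
  by rewrite mulr_ge0// exprn_ge0// invr_ge0.
have lim t : exists l, `|t| <= e -> forall k, `|sval (u k) t - l| <= 2 * (B * e) * 2^-1 ^+ k.
  have [te|te] := pselect (`|t| <= e); last by exists 0.
  have [l Hl] := half_seq_lim (fun k => stepu k t te).
  by exists l.
have [y Hy] := choice lim.
have yP : P y.
  move=> s t se te; apply/ler_addgt0Pr => d d0.
  have [k Hk] := half_powers (4 * (B * e)) d0.
  have -> : y s - y t = (sval (u k) s - sval (u k) t) - (sval (u k) s - y s) + (sval (u k) t - y t).
    have aux (p q b c : 'rV[R]_n) : b - c = p - q - (p - b) + (q - c).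
      by rewrite opprB [p - q + _]addrC !subrKA.
    exact: aux.
  apply: (le_trans (ler_normD _ _)).
  have h1 := svalP (u k) s t se te; have h2 := Hy s se k; have h3 := Hy t te k.
  have h4 := ler_normB (sval (u k) s - sval (u k) t) (sval (u k) s - y s).
  move: h1 h2 h3 h4 Hk; move: (`|_|) (`|_|) (`|_|) (`|_|) (2^-1 ^+ k) (`|_|) => p1 p2 p3 p4 q p5.
  move: (B * `|s - t|) (B * e) => b be; lra.
pose uy : {f | P f} := exist _ y yP.
have yE t : `|t| <= e -> y t = sval (T0 uy) t.
  move=> te; apply/eqP; rewrite -subr_eq0 -normr_le0 leNgt; apply/negP => d0.
  have [k Hk] := half_powers (2 * (B * e)) d0.
  have qS : 2^-1 ^+ k.+1 = 2^-1 * 2^-1 ^+ k :> R by rewrite exprS.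
  have q0 : 0 <= 2^-1 ^+ k :> R by rewrite exprn_ge0 ?invr_ge0.
  have h1 : `|sval (u k.+1) t - sval (T0 uy) t| <= 2^-1 * (2 * (B * e) * 2^-1 ^+ k).
    apply: (diffT (u k) uy) => //; last by rewrite mulr_ge0// mulr_ge0.
    by move=> s se; exact: Hy.
  have h2 := Hy t te k.+1.
  have : `|y t - sval (T0 uy) t| <= 2 * (B * e) * 2^-1 ^+ k.
    rewrite -[y t](subrK (sval (u k.+1) t)) -addrA.
    apply: (le_trans (ler_normD _ _)); rewrite distrC.
    move: h1 h2; rewrite qS; move: (`|_|) (`|_|) (2^-1 ^+ k) (B * e) => p1 p2 q be; lra.
  by rewrite leNgt Hk.
(* The solution returned is the image of the limit under the Picard operator: it is derivable by
   construction, and [yE] identifies it with the limit. *)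
exists e, (sval (T0 uy)); have [y0 dy] := T0P uy; split => // t te.
have := dy t (e2e _ (ltW te)); rewrite clampR_id; last by rewrite sub0r normrN ltW.
by rewrite -[sval uy t]/(y t) yE// ltW.
Qed.

End Picard.

(* Only the local behaviour of [G] matters: compose it with [clamp]. *)
Lemma ode_exists {R : realType} {n : nat} (S : set 'rV[R]_n) (G : 'rV[R]_n -> 'rV[R]_n)
    (a : 'rV[R]_n) : open S -> S a -> smooth_on S G ->
  exists e y, [/\ 0 < e, y (0 : R) = a, (forall t, `|t| < e -> S (y t)) &
    forall t, `|t| < e -> is_derive t (1 : R) y (G (y t))].
Proof.
move=> oS Sa sG.
have [r [L [r0 L0 BS GL]]] := smooth_lipschitz oS Sa sG.
pose q := r / 2.
have q0 : 0 < q by rewrite divr_gt0.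
have qr : q < r by rewrite /q; lra.
have inB x : ball a r (clamp q a x).
  by rewrite -ball_normE /=; apply: le_lt_trans qr; apply: clamp_in; exact: ltW.
have GL' x y : `|(G \o clamp q a) x - (G \o clamp q a) y| <= (L + 1) * `|x - y|.
  apply: (le_trans (GL _ _ (inB x) (inB y))); apply: ler_pM => //; first by rewrite lerDl.
  by apply: clamp_lip; exact: ltW.
have L10 : 0 < L + 1 by rewrite ltr_wpDl.
have GB x : `|(G \o clamp q a) x| <= `|G a| + L * r.
  have -> : (G \o clamp q a) x = G a + ((G \o clamp q a) x - G a) by rewrite addrC subrK.
  apply: (le_trans (ler_normD _ _)); rewrite lerD2l.
  have aB : ball a r a by exact: ballxx.
  apply: (le_trans (GL _ _ (inB x) aB)); apply: ler_wpM2l => //.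
  by apply: ltW; have := inB x; rewrite -ball_normE /= distrC.
have [e [y [e0 y0 dy]]] := picard_lipschitz a L10 GL' GB.
have cy : {for 0, continuous y}.
  apply: differentiable_continuous; apply/derivable1_diffP.
  by have [] := dy 0; rewrite ?normr0.
have /nbhs_ballP[d /= d0 dP] : \forall t \near (0 : R), `|a - y t| <= q.
  by move: cy => /cvgrPdist_le/(_ _ q0); rewrite y0.
exists (Num.min e d), y.
have yin t : `|t| < Num.min e d -> `|a - y t| <= q.
  by move=> te; apply: dP; rewrite /ball /= sub0r normrN (lt_le_trans te)// ge_min lexx orbT.
split => //; first by rewrite lt_min e0.
  by move=> t /yin h; apply: BS; rewrite -ball_normE /=; exact: le_lt_trans qr.
move=> t te; have := dy t _; rewrite /= clamp_id; last exact: yin.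
by apply; apply: lt_le_trans te _; rewrite ge_min lexx.
Qed.

(** * Bump functions and averages *)

Section FlatExp.
Context {R : realType}.
Implicit Types (p : {poly R}) (t : R).

(** The polynomial factor makes the family closed under differentiation, with [flat_step] as the
    action on [p], so that it is a tower in the sense of [smooth_on_tower]. *)
Definition flat_exp p t : R := if 0 < t then p.[t^-1] * expR (- t^-1) else 0.

Definition flat_step p : {poly R} := 'X^2 * (p - p^`()).

Lemma poly_bound p : exists C, 0 <= C /\ forall x : R, 1 <= x -> `|p.[x]| <= C * x ^+ (size p).
Proof.
exists (\sum_(i < size p) `|p`_i|); split; first exact: sumr_ge0.
move=> x x1; rewrite horner_coef; apply: (le_trans (ler_norm_sum _ _ _)).
rewrite mulr_suml; apply: ler_sum => i _; rewrite normrM; apply: ler_wpM2l => //.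
rewrite ger0_norm ?exprn_ge0 ?(le_trans ler01)//.
by rewrite ler_weXn2l// ltnW.
Qed.

Lemma expR_decay p : exists C, 0 <= C /\ forall x : R, 1 <= x -> `|p.[x]| * expR (- x) <= C * x^-1.
Proof.
have [C [C0 HC]] := poly_bound p.
exists (C * ((size p).+1)`!%:R); split; first by rewrite mulr_ge0.
move=> x x1; have x0 : 0 < x by apply: lt_le_trans x1.
have h : x ^+ (size p).+1 / ((size p).+1)`!%:R <= expR x.
  by apply: le_trans (expR_ge1Dxn (size p) (ltW x0)); rewrite lerDr.
rewrite expRN ler_pdivrMr ?expR_gt0//.
apply: (le_trans (HC x x1)).
have f0 : 0 < ((size p).+1)`!%:R :> R by rewrite ltr0n fact_gt0.
apply: (@le_trans _ _ (C * ((size p).+1)`!%:R * x^-1 * (x ^+ (size p).+1 / ((size p).+1)`!%:R))).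
  rewrite exprS le_eqVlt; apply/orP; left; apply/eqP.
  by field; rewrite !gt_eqF.
by apply: ler_wpM2l => //; rewrite !mulr_ge0// invr_ge0 ltW.
Qed.

Lemma flat_exp_bound p : exists C, 0 <= C /\ forall t, `|t| <= 1 -> `|flat_exp p t| <= C * `|t|.
Proof.
have [C [C0 HC]] := expR_decay p.
exists C; split=> // t t1; rewrite /flat_exp; case: ifP => [t0|_]; last first.
  by rewrite normr0 mulr_ge0.
rewrite normrM [`|expR _|]ger0_norm ?expR_ge0// (gtr0_norm t0) -[X in C * X]invrK.
by apply: HC; rewrite invf_ge1// (le_trans (ler_norm _)).
Qed.

Lemma is_derive_flat_exp p t : is_derive t (1 : R) (flat_exp p) (flat_exp (flat_step p) t).
Proof.
have [t0|t0|t0] := ltgtP t 0.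
- apply: (@near_eq_is_derive _ _ _ (cst (0 : R))).
    have h : \forall s \near t, s < 0 by apply: open_nbhs_nbhs; split; [exact: open_lt|].
    by apply: filterS h => s s0; rewrite /flat_exp /cst ltNge (ltW s0).
  by rewrite /flat_exp ltNge (ltW t0) /=; exact: is_derive_cst.
- apply: (@near_eq_is_derive _ _ _ (fun s : R => p.[s^-1] * expR (- s^-1))).
    have h : \forall s \near t, 0 < s by apply: open_nbhs_nbhs; split; [exact: open_gt|].
    by apply: filterS h => s s0; rewrite /flat_exp s0.
  rewrite /flat_exp t0.
  have tn0 : t != 0 by rewrite gt_eqF.
  have dV : is_derive t (1 : R) (fun s : R => s^-1) (- t ^- 2).
    split; first by apply: (@derivableV _ _ id) => //; exact: derivable_id.
    by rewrite (@deriveV _ _ id)// derive_id -[_ *: _]/(_ * _) mulr1.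
  have dVN : is_derive t (1 : R) (fun s : R => - s^-1) (t ^- 2).
    by apply: is_derive_eq (is_deriveN dV) _; rewrite opprK.
  have d1 : is_derive t (1 : R) (fun s : R => p.[s^-1]) (p^`().[t^-1] * - t ^- 2).
    exact: (@is_derive1_comp R (horner p) (fun s : R => s^-1)).
  have d2 : is_derive t (1 : R) (fun s : R => expR (- s^-1)) (expR (- t^-1) * t ^- 2).
    exact: (@is_derive1_comp R expR (fun s : R => - s^-1)).
  apply: is_derive_eq (@is_deriveM _ _ _ _ _ _ _ _ d1 d2) _.
  rewrite /flat_step !hornerE /= -[_ *: _]/(_ * _) -[X in _ + X]/(_ * _) -exprVn.
  by ring.
- rewrite t0 [X in is_derive _ _ _ X](_ : _ = 0); last by rewrite /flat_exp ltxx.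
  have f0 : flat_exp p 0 = 0 by rewrite /flat_exp ltxx.
  (* At 0 the difference quotient is the flat exponential of ['X * p], which is bounded by a
     multiple of the absolute value. *)
  have [C [C0 HC]] := flat_exp_bound ('X * p).
  have lim : (fun h : R => h^-1 *: ((flat_exp p \o shift 0) (h *: 1) - flat_exp p 0)) @ 0^' --> (0 : R).
    apply/cvgrPdist_le => e e0.
    have C1 : 0 < C + 1 by rewrite ltr_wpDl.
    have h1 := near0_ltR (@ltr01 R).
    have h2 := near0_ltR (divr_gt0 e0 C1).
    near=> h.
    have hn0 : h != 0 by near: h; exact: nbhs_dnbhs_neq.
    have hh1 : `|h| < 1 by near: h; exact: nbhs_dnbhs.
    have hh2 : `|h| < e / (C + 1) by near: h; exact: nbhs_dnbhs.
    rewrite f0 subr0 sub0r normrN /= addr0 -[h *: 1]/(h * 1) mulr1.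
    have -> : h^-1 *: flat_exp p h = flat_exp ('X * p) h.
      rewrite /flat_exp; case: ifP => _; last by rewrite scaler0.
      by rewrite -[_ *: _]/(_ * _) hornerM hornerX mulrA.
    apply: (le_trans (HC _ (ltW hh1))).
    move: hh2; rewrite ltr_pdivlMr// => hh2; apply: le_trans (ltW hh2).
    by rewrite mulrC ler_wpM2l// lerDl.
  split; first by apply/cvg_ex; exists 0.
  exact: (cvg_lim (@norm_hausdorff _ _) lim).
Unshelve. all: by end_near. Qed.

Definition step_fun t : R := flat_exp 1 t.

Lemma step_fun_ge0 t : 0 <= step_fun t.
Proof. by rewrite /step_fun /flat_exp; case: ifP => // _; rewrite hornerC mul1r expR_ge0. Qed.

Lemma step_fun_gt0 t : (0 < step_fun t) = (0 < t).
Proof.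
by rewrite /step_fun /flat_exp; case: ifP => // _; rewrite ?ltxx// hornerC mul1r expR_gt0.
Qed.

Lemma step_fun_eq0 t : t <= 0 -> step_fun t = 0.
Proof. by rewrite /step_fun /flat_exp leNgt => /negbTE ->. Qed.

Lemma smooth_on_step (V : normedModType R) (S : set V) (u : V -> R^o) :
  open S -> smooth_on S u -> smooth_on S (fun z => step_fun (u z) : R^o).
Proof.
move=> oS su.
apply: (@smooth_on_tower _ _ S setT u (fun k => flat_exp (iter k flat_step 1))) => //.
by move=> k t _; rewrite iterS; exact: is_derive_flat_exp.
Qed.

End FlatExp.

Section Bump.
Context {R : realType} {n : nat}.

(** Equal to 1 on |t| <= 1/2 and to 0 for |t| >= 1. Squares stand for absolute values to stay
    smooth, and the two terms of the denominator never vanish together since 1/4 < 1. *)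
Definition bump1 (t : R) : R :=
  step_fun (1 - t ^+ 2) / (step_fun (1 - t ^+ 2) + step_fun (t ^+ 2 - 4^-1)).

Lemma bump1_den (t : R) : 0 < step_fun (1 - t ^+ 2) + step_fun (t ^+ 2 - 4^-1).
Proof.
have [h|h] := ltP (t ^+ 2) 1.
  by rewrite ltr_wpDr ?step_fun_ge0// step_fun_gt0 subr_gt0.
rewrite ltr_wpDl ?step_fun_ge0// step_fun_gt0 subr_gt0 (lt_le_trans _ h)//.
by rewrite invf_lt1// ltr1n.
Qed.

Lemma bump1_1 (t : R) : `|t| <= 2^-1 -> bump1 t = 1.
Proof.
move=> t2; have t4 : t ^+ 2 <= 4^-1.
  rewrite -real_normK ?num_real// -[4]/(2 * 2)%:R natrM invfM -expr2.
  by rewrite lerXn2r// nnegrE invr_ge0.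
have z : step_fun (t ^+ 2 - 4^-1) = 0 by rewrite step_fun_eq0// subr_le0.
have := bump1_den t; rewrite /bump1 z addr0 => /lt0r_neq0; exact: divff.
Qed.

Lemma bump1_0 (t : R) : bump1 t != 0 -> `|t| < 1.
Proof.
apply: contraNT; rewrite -leNgt => t1; rewrite /bump1 step_fun_eq0 ?mul0r//.
by rewrite subr_le0 -real_normK ?num_real// exprn_ege1.
Qed.

Lemma bump_exists (a : 'rV[R]_n) (r : R) : 0 < r -> exists b : 'rV[R]_n -> R^o,
  [/\ smooth_on setT b, (forall z, `|z - a| <= r / 2 -> b z = 1) &
      (forall z, b z != 0 -> `|z - a| < r)].
Proof.
move=> r0.
(* A product over the coordinates, because the norm is the sup norm. *)
exists (fun z => \prod_j bump1 ((z 0 j - a 0 j) / r) : R^o); split.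
- apply: smooth_on_prod => [|j _]; first exact: openT.
  have su : smooth_on setT (fun z : 'rV[R]_n => (z 0 j - a 0 j) / r : R^o).
    apply: smooth_onM; [exact: openT| |exact: smooth_on_cst].
    by apply: smooth_onB; [exact: openT|exact: smooth_on_coord|exact: smooth_on_cst].
  have su2 : smooth_on setT (fun z : 'rV[R]_n => ((z 0 j - a 0 j) / r) ^+ 2 : R^o).
    exact: (smooth_onM openT su su).
  have h1 : smooth_on setT (fun z : 'rV[R]_n => step_fun (1 - ((z 0 j - a 0 j) / r) ^+ 2) : R^o).
    apply: smooth_on_step; first exact: openT.
    by apply: smooth_onB; [exact: openT|exact: smooth_on_cst|exact: su2].
  have h2 : smooth_on setT (fun z : 'rV[R]_n => step_fun (((z 0 j - a 0 j) / r) ^+ 2 - 4^-1) : R^o).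
    apply: smooth_on_step; first exact: openT.
    by apply: smooth_onB; [exact: openT|exact: su2|exact: smooth_on_cst].
  apply: (smooth_onM openT h1); apply: smooth_onV; first exact: openT.
    by move=> z _; exact: lt0r_neq0 (bump1_den _).
  exact: (smooth_onD openT h1 h2).
- move=> z za; apply: big1 => j _; apply: bump1_1.
  rewrite normrM normfV (gtr0_norm r0) ler_pdivrMr// mulrC.
  by apply: le_trans za; have := row_coord_le (z - a) j; rewrite !mxE.
- move=> z /prodf_neq0 bz.
  rewrite ltNge; apply/negP => rz.
  have : `|z - a| <= \big[Num.max/0]_j `|z 0 j - a 0 j|.
    apply/row_normE; first exact: bigmax_ge_id.
    by move=> j; rewrite !mxE; exact: (le_bigmax 0 (fun j => `|z 0 j - a 0 j|) j).
  rewrite leNgt => /negP; apply; apply: lt_le_trans rz; apply: bigmax_lt => // j _.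
  have := bump1_0 (bz j isT); rewrite normrM normfV (gtr0_norm r0).
  by rewrite ltr_pdivrMr// mul1r.
Qed.

End Bump.

(** * Hadamard's lemma *)

Section Hadamard.
Context {R : realType} {n : nat}.

Lemma compact_closed_ball (a : 'rV[R]_n) (r : R) : 0 < r -> compact [set x | `|a - x| <= r].
Proof.
move=> r0.
apply: bounded_closed_compact.
  exists (`|a| + r); split; first exact: num_real.
  move=> M hM x /= xr; apply: le_trans (ltW hM).
  rewrite -[x](subrK a) addrC; apply: (le_trans (ler_normD _ _)).
  by rewrite lerD2l distrC.
have -> : [set x | `|a - x| <= r] = closed_ball a r.
  by rewrite closed_ballE.
exact: closed_ball_closed.
Qed.

Lemma lipschitz_compact (S : set 'rV[R]_n) (h : 'rV[R]_n -> R^o) (a : 'rV[R]_n) (r : R) :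
  open S -> smooth_on S h -> 0 < r -> [set x | `|a - x| <= 3 * r] `<=` S ->
  exists L, 0 <= L /\ forall x y, ball a r x -> ball a r y -> `|h x - h y| <= L * `|x - y|.
Proof.
move=> oS sh r0 BS.
have H (j : 'I_n) : exists C, forall x, `|a - x| <= 3 * r -> `|'D_('e_j) h x| <= C.
  have [|||c _ Hc] := @EVT_max_rV R n (fun x => `|'D_('e_j) h x|) [set x | `|a - x| <= 3 * r].
  - by exists a; rewrite /= subrr normr0 mulr_ge0// ltW.
  - by apply: compact_closed_ball; rewrite mulr_gt0.
  - apply: continuous_in_subspaceT => x; rewrite inE => /BS Sx.
    apply: (@continuous_comp _ _ _ ('D_('e_j) h) (@Num.norm R R^o)); last exact: norm_continuous.
    exact: smooth_on_cont (smooth_on_derive 'e_j sh) Sx.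
  by exists `|'D_('e_j) h c| => x xr; apply: Hc; rewrite inE.
have [C HC] := choice H.
pose C0 := \sum_j `|C j|.
have CC j : C j <= C0.
  apply: (le_trans (ler_norm _)); rewrite /C0 (bigD1 j)//= lerDl.
  by apply: sumr_ge0 => i _; exact: normr_ge0.
have C00 : 0 <= C0 by apply: sumr_ge0 => i _; exact: normr_ge0.
exists (n%:R * C0); split; first by rewrite mulr_ge0.
apply: (@lipschitz_ball _ _ S) => //.
  by move=> y; rewrite -ball_normE /= => /ltW /BS.
by move=> y j; rewrite -ball_normE /= => /ltW /HC h1; apply: le_trans (h1 j) (CC j).
Qed.

(** Projection to [0, 1], which makes the integrand of [avg] continuous on the whole line, as
    [primitive] requires. *)
Definition tau01 (t : R) : R := clampR 2^-1 2^-1 t.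

Lemma tau01_in t : 0 <= tau01 t <= 1.
Proof.
have h : 0 <= 2^-1 :> R by rewrite invr_ge0.
have := clampR_in 2^-1 t h; rewrite ler_norml /tau01 => /andP[h1 h2].
by apply/andP; split; lra.
Qed.

Lemma tau01_id t : 0 <= t <= 1 -> tau01 t = t.
Proof. by move=> /andP[t0 t1]; apply: clampR_id; rewrite ler_norml; apply/andP; split; lra. Qed.

Lemma tau01_cont : continuous tau01.
Proof.
move=> t; apply: (@continuous_lip_at R R R tau01 t 1) => //.
near=> s; rewrite mul1r clampR_lip// invr_ge0.
Unshelve. all: by end_near. Qed.

(** A primitive on |x| < 2 picked by choice, with the zero function as default. For continuous [f]
    its increment from 0 to 1 is the integral and does not depend on the choice. *)
Definition prim01 (f : R -> R) : R -> R :=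
  xget (fun=> 0) [set F : R -> R | forall x, `|x| < 2 -> is_derive x (1 : R) F (f x)].

Lemma prim01P (f : R -> R) : continuous f ->
  forall x, `|x| < 2 -> is_derive x (1 : R) (prim01 f) (f x).
Proof.
move=> cf; have [F HF] := @primitive R f 2 cf.
by rewrite /prim01; case: xgetP => [G -> //|/(_ F)].
Qed.

Lemma mvt01 (F f : R -> R) (e : R) : (forall x, `|x| < 2 -> is_derive x (1 : R) F (f x)) ->
  (forall x, 0 <= x <= 1 -> `|f x| <= e) -> `|F 1 - F 0| <= e.
Proof.
move=> HF Hf.
have in2 (x : R) : 0 <= x <= 1 -> `|x| < 2 by move=> /andP[x0 x1]; rewrite ger0_norm//; lra.
have [||c] := @MVT_segment R F f 0 1 ler01.
- by move=> x; rewrite in_itv /= => /andP[x0 x1]; apply: HF; apply: in2; rewrite !ltW.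
- apply: derivable_within_continuous => x; rewrite in_itv /= => /in2/HF[]//.
by rewrite in_itv /= => c01 ->; rewrite subr0 mulr1; exact: Hf.
Qed.

Section Avg.
Variables (S : set 'rV[R]_n) (a : 'rV[R]_n) (r : R).
Hypotheses (oS : open S) (r0 : 0 < r) (BS : [set x | `|a - x| <= 3 * r] `<=` S).

Definition ray (z : 'rV[R]_n) (t : R) : 'rV[R]_n := a + tau01 t *: (z - a).

Lemma ray_in z t : ball a r z -> ball a r (ray z t).
Proof.
rewrite -!ball_normE /= => za; rewrite /ray opprD addrA subrr sub0r normrN normrZ.
have /andP[t0 t1] := tau01_in t.
rewrite ger0_norm// distrC; apply: le_lt_trans za.
by rewrite -[leRHS]mul1r; apply: ler_wpM2r.
Qed.

Lemma ball_sub z : ball a r z -> S z.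
Proof.
rewrite -ball_normE /= => za; apply: BS; rewrite /=; apply: (le_trans (ltW za)).
by rewrite ler_pMl//; lra.
Qed.

(* [\int_0^1 t^k h(a + t (z - a)) dt] *)
Definition avg_fun (k : nat) (h : 'rV[R]_n -> R^o) (z : 'rV[R]_n) (t : R) : R :=
  tau01 t ^+ k * h (ray z t).

Definition avg (k : nat) (h : 'rV[R]_n -> R^o) (z : 'rV[R]_n) : R^o :=
  prim01 (avg_fun k h z) 1 - prim01 (avg_fun k h z) 0.

Lemma avg_fun_cont k h z : smooth_on S h -> ball a r z -> continuous (avg_fun k h z).
Proof.
move=> sh Bz t.
apply: (@continuousM R R (fun t => tau01 t ^+ k) (fun t => h (ray z t)) t).
  apply: (@continuous_comp _ _ _ tau01 (fun x : R => x ^+ k)); first exact: tau01_cont.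
  exact: exprn_continuous.
apply: (@continuous_comp _ _ _ (ray z) h); last first.
  by apply: smooth_on_cont sh _; apply: ball_sub; exact: ray_in.
apply: continuousD; first exact: cst_continuous.
by apply: cvgZr_tmp; exact: tau01_cont.
Qed.

(** Differentiation under the integral: the derivative of [avg k h] along [v] is
    [avg k.+1 ('D_v h)], the extra power of t coming from the ray. Hence the induction quantifies
    over [k] and [h]. *)
Lemma smooth_avg k h : smooth_on S h -> smooth_on (ball a r) (avg k h).
Proof.
move=> sh; apply/smooth_onP => m; elim: m k h sh => [|m IH] k h sh.
  split=> // z Bz.
  have [L [L0 HL]] := lipschitz_compact oS sh r0 BS.
  apply: (@continuous_lip_at _ _ _ _ _ L) => //.
  have oB : open (ball a r) by exact: ball_open.
  apply: filterS (open_nbhs_nbhs (conj oB Bz)) => y By.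
  have dF t : `|t| < 2 -> is_derive t (1 : R)
     (prim01 (avg_fun k h z) - prim01 (avg_fun k h y)) (avg_fun k h z t - avg_fun k h y t).
    by move=> t2; apply: is_deriveB; apply: prim01P => //; exact: avg_fun_cont.
  have -> : avg k h z - avg k h y =
     (prim01 (avg_fun k h z) - prim01 (avg_fun k h y)) 1 -
     (prim01 (avg_fun k h z) - prim01 (avg_fun k h y)) 0.
    by rewrite /avg !fctE; ring.
  apply: (mvt01 dF) => t t01; rewrite /avg_fun -mulrBr normrM.
  have /andP[u0 u1] := tau01_in t.
  rewrite -[leRHS]mul1r; apply: ler_pM => //.
    by rewrite ger0_norm ?exprn_ge0// exprn_ile1.
  apply: (le_trans (HL _ _ (ray_in t Bz) (ray_in t By))); apply: ler_wpM2l => //.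
  rewrite /ray opprD addrACA subrr add0r -scalerBr opprB addrA subrK normrZ ger0_norm//.
  by rewrite -[leRHS]mul1r; apply: ler_wpM2r.
have oB : open (ball a r) by exact: ball_open.
suff D z v : ball a r z -> is_derive z v (avg k h) (avg k.+1 ('D_v h) z).
  split=> [z Bz|v].
    exact: Ck_cont (IH k h sh) _ Bz.
  split=> [z Bz|]; first by have [] := D z v Bz.
  have sDh := smooth_on_derive v sh.
  by apply: Ck_eq (IH k.+1 _ sDh) => // z Bz; have [_ ->] := D z v Bz.
move=> Bz.
have sDh := smooth_on_derive v sh.
have [L [L0 HL]] := lipschitz_compact oS sDh r0 BS.
have lim : (fun s : R => s^-1 *: ((avg k h \o shift z) (s *: v) - avg k h z)) @ 0^' --> avg k.+1 ('D_v h) z.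
  apply/cvgrPdist_le => e e0.
  have C1 : 0 < L * `|v| + 1 by rewrite ltr_wpDl// mulr_ge0.
  have n1 := near0_ltR (divr_gt0 e0 C1).
  have n2 : \forall s \near (0 : R), ball a r (s *: v + z).
    apply: line_continuous; rewrite scale0r add0r; exact: open_nbhs_nbhs.
  have /nbhs_ballP[d /= d0 Hd] := n2.
  near=> s.
  have s0 : s != 0 by near: s; exact: nbhs_dnbhs_neq.
  have s1 : `|s| < e / (L * `|v| + 1) by near: s; exact: nbhs_dnbhs.
  have sd : `|s| < d by near: s; apply: nbhs_dnbhs; exact: near0_ltR.
  have Bs (u : R) : `|u| <= `|s| -> ball a r (u *: v + z).
    by move=> us; apply: Hd; rewrite /ball /= sub0r normrN; apply: le_lt_trans sd.
  pose P1 := prim01 (avg_fun k h (s *: v + z)); pose P2 := prim01 (avg_fun k h z).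
  pose P3 := prim01 (avg_fun k.+1 ('D_v h) z).
  have dF t : `|t| < 2 -> is_derive t (1 : R)
     (P3 - s^-1 *: (P1 - P2)) (avg_fun k.+1 ('D_v h) z t -
       s^-1 *: (avg_fun k h (s *: v + z) t - avg_fun k h z t : R)).
    move=> t2; apply: is_deriveB; first by apply: prim01P => //; exact: avg_fun_cont.
    apply: is_deriveZ; apply: is_deriveB; apply: prim01P => //; apply: avg_fun_cont => //.
    exact: Bs.
  have -> : avg k.+1 ('D_v h) z - s^-1 *: ((avg k h \o shift z) (s *: v) - avg k h z) =
     (P3 - s^-1 *: (P1 - P2)) 1 - (P3 - s^-1 *: (P1 - P2)) 0.
    rewrite /avg /= !fctE -/P1 -/P2 -/P3 -![_ *: _]/(_ * _).
    by move: (P3 1) (P3 0) (P1 1) (P1 0) (P2 1) (P2 0) => ? ? ? ? ? ?; ring.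
  apply: (mvt01 dF) => t t01; rewrite /avg_fun.
  have /andP[u0 u1] := tau01_in t.
  have rayE : ray (s *: v + z) t = (tau01 t * s) *: v + ray z t.
    by rewrite /ray -addrA scalerDr scalerA addrCA.
  have Bu (u : R) : `|u| <= `|tau01 t * s| -> ball a r (u *: v + ray z t).
    move=> us; have [t00|t00] := eqVneq (tau01 t) 0.
      move: us; rewrite t00 mul0r normr0 normr_le0 => /eqP ->.
      by rewrite scale0r add0r; exact: ray_in.
    have -> : u *: v + ray z t = ray ((u / tau01 t) *: v + z) t.
      by rewrite /ray -[in RHS]addrA [in RHS]scalerDr scalerA [tau01 t * _]mulrC divfK// addrCA.
    apply: ray_in; apply: Bs; rewrite normrM normfV ler_pdivrMr ?normr_gt0//.
    by rewrite mulrC -normrM.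
  have [|c cs E] := @mvt_line _ _ h (ray z t) v (tau01 t * s).
    by move=> c cs; apply: smooth_on_derivable sh _; apply: ball_sub; exact: Bu.
  rewrite rayE -mulrBr E exprS -[_ *: _]/(_ * _).
  have -> : tau01 t * tau01 t ^+ k * 'D_v h (ray z t) -
     s^-1 * (tau01 t ^+ k * (tau01 t * s * 'D_v h (c *: v + ray z t))) =
     tau01 t * tau01 t ^+ k * ('D_v h (ray z t) - 'D_v h (c *: v + ray z t)).
    move: ('D_v h _) ('D_v h _) (tau01 t ^+ k) => x y w; by field.
  rewrite normrM -[leRHS]mul1r; apply: ler_pM => //.
    by rewrite ger0_norm ?mulr_ge0 ?exprn_ge0// -exprS exprn_ile1.
  apply: (le_trans (HL _ _ (ray_in t Bz) (Bu c cs))).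
  rewrite opprD addrCA subrr addr0 normrN normrZ.
  have cs' : `|c| <= `|s|.
    apply: (le_trans cs); rewrite normrM ger0_norm// -[leRHS]mul1r; exact: ler_wpM2r.
  move: s1; rewrite ltr_pdivlMr// => s1.
  apply: le_trans (ltW s1); rewrite mulrDr mulr1; apply: ler_wpDr => //.
  by rewrite mulrCA; apply: ler_pM => //; rewrite ?mulr_ge0.
split; first by apply/cvg_ex; exists (avg k.+1 ('D_v h) z).
exact: (cvg_lim (@norm_hausdorff _ _) lim).
Unshelve. all: by end_near. Qed.

(** The fundamental theorem of calculus along the ray from [a] to [z]; [g j] averages the j-th
    partial derivative over that ray. *)
Lemma hadamard_ball (f : 'rV[R]_n -> R^o) : smooth_on S f ->
  exists g : 'I_n -> 'rV[R]_n -> R^o,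
  [/\ forall j, smooth_on (ball a r) (g j), forall j, g j a = 'D_('e_j) f a &
      forall z, ball a r z -> f z = f a + \sum_j (z 0 j - a 0 j) * g j z].
Proof.
move=> sf; exists (fun j => avg 0 ('D_('e_j) f)); split.
- by move=> j; apply: smooth_avg; exact: smooth_on_derive.
- move=> j; have sDf := smooth_on_derive 'e_j sf.
  have Ba : ball a r a by exact: ballxx.
  have c t : avg_fun 0 ('D_('e_j) f) a t = 'D_('e_j) f a.
    by rewrite /avg_fun expr0 mul1r /ray subrr scaler0 addr0.
  have dF t : `|t| < 2 -> is_derive t (1 : R)
     (prim01 (avg_fun 0 ('D_('e_j) f) a) - (fun t : R => t * 'D_('e_j) f a))
     (avg_fun 0 ('D_('e_j) f) a t - 'D_('e_j) f a).
    move=> t2; apply: is_deriveB; first by apply: prim01P => //; exact: avg_fun_cont.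
    apply: is_derive_eq (@is_deriveM _ _ id (cst ('D_('e_j) f a)) t 1 _ _ _ _) _.
    by rewrite scaler0 add0r -[_ *: _]/(_ * _) mulr1.
  have := @mvt01 _ _ 0 dF; rewrite !fctE mul1r mul0r subr0 => H.
  have : `|prim01 (avg_fun 0 ('D_('e_j) f) a) 1 - 'D_('e_j) f a -
        prim01 (avg_fun 0 ('D_('e_j) f) a) 0| <= 0.
    by apply: H => x _; rewrite c subrr normr0.
  by rewrite normr_le0 addrAC subr_eq0 => /eqP.
move=> z Bz.
pose P j := prim01 (avg_fun 0 ('D_('e_j) f) z).
pose G (t : R) : R := f (t *: (z - a) + a).
have St (t : R) : `|t| < 2 -> S (t *: (z - a) + a).
  move=> t2; apply: BS; rewrite /= opprD addrCA subrr addr0 normrN normrZ.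
  move: Bz; rewrite -ball_normE /= distrC => za.
  apply: (@le_trans _ _ (2 * r)); last by rewrite ler_pM2r//; lra.
  by apply: ler_pM => //; exact: ltW.
have dG t : `|t| < 2 -> is_derive t (1 : R) G ('D_(z - a) f (t *: (z - a) + a)).
  by move=> /St h; apply: line_is_derive; exact: smooth_on_derivable sf _.
have dP t : `|t| < 2 -> is_derive t (1 : R)
   (G - (fun t => \sum_j (z 0 j - a 0 j) * P j t : R))
   ('D_(z - a) f (t *: (z - a) + a) - \sum_j (z 0 j - a 0 j) * avg_fun 0 ('D_('e_j) f) z t).
  move=> t2; apply: is_deriveB; first exact: dG.
  apply: is_derive_bigsum => j.
  have h : is_derive t (1 : R) (P j) (avg_fun 0 ('D_('e_j) f) z t).
    have c : continuous (avg_fun 0 ('D_('e_j) f) z).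
      exact: avg_fun_cont (smooth_on_derive 'e_j sf) Bz.
    have c2 := prim01P c t2.
    exact: c2.
  apply: is_derive_eq (@is_deriveM _ _ (cst (z 0 j - a 0 j)) (P j) t 1 _ _ _ h) _.
  by rewrite scaler0 addr0.
have := @mvt01 _ _ 0 dP; rewrite !fctE /G scale0r add0r scale1r subrK => H.
have {}H : `|f z - \sum_j (z 0 j - a 0 j) * P j 1 - (f a - \sum_j (z 0 j - a 0 j) * P j 0)| <= 0.
  apply: H => t t01.
  rewrite derive_partials; last first.
    apply: (smooth_on_differentiableR oS) sf; apply: St.
    by move: t01 => /andP[t0 t1]; rewrite ger0_norm//; lra.
  rewrite -sumrB big1 ?normr0// => j _.
  by rewrite /avg_fun expr0 mul1r /ray tau01_id// [a + _]addrC !mxE subrr.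
move: H; rewrite normr_le0 subr_eq0 => /eqP H.
rewrite -[f z](subrK (\sum_j (z 0 j - a 0 j) * P j 1)) H -addrA; congr (_ + _).
rewrite -sumrN -big_split; apply: eq_bigr => j _ /=.
by rewrite /avg -/(P j) mulrBr addrC.
Qed.

End Avg.

End Hadamard.

Lemma open_nbhsP (T : topologicalType) (A : set T) :
  (forall x, A x -> nbhs x A) -> open A.
Proof. by move=> H; rewrite openE => x /H. Qed.

Lemma norm_nbhs (R : realType) (V : normedModType R) (z : V) (A : set V) :
  nbhs z A -> exists2 r, 0 < r & forall y, `|y - z| < r -> A y.
Proof.
move=> /nbhs_ballP[r r0 rA]; exists r => // y yz; apply: rA.
by rewrite -ball_normE /ball_ /= distrC.
Qed.

(** * Smooth maps between manifolds *)

Section Charts.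
Context {R : realType} {n : nat} (M : manifoldType R n).
Implicit Types (c : chart R n M) (p q : M).

Definition cimg c := cfun c @` cdom c.

Lemma cdom_open c : atlas M c -> open (cdom c).
Proof. by move=> /atlas_homeo[]. Qed.

Lemma cimg_open c : atlas M c -> open (cimg c).
Proof. by move=> /atlas_homeo[]. Qed.

Lemma cinvK c p : atlas M c -> cdom c p -> cinv c (cfun c p) = p.
Proof. by move=> /atlas_homeo[_ _ h _ _]; exact: h. Qed.

Lemma cimgP c z : atlas M c -> cimg c z -> cdom c (cinv c z) /\ cfun c (cinv c z) = z.
Proof. by move=> ac [p dp <-]; rewrite cinvK. Qed.

Lemma cimg_cfun c p : cdom c p -> cimg c (cfun c p).
Proof. by move=> h; exists p. Qed.

Lemma cfun_cont c p : atlas M c -> cdom c p -> {for p, continuous (cfun c)}.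
Proof.
move=> ac dp; have [oD _ _ + _] := atlas_homeo c ac.
by rewrite continuous_open_subspace// => /(_ p); apply; rewrite inE.
Qed.

Lemma cinv_cont c z : atlas M c -> cimg c z -> {for z, continuous (cinv c)}.
Proof.
move=> ac dz; have [_ oI _ _] := atlas_homeo c ac.
by rewrite continuous_open_subspace// => /(_ z); apply; rewrite inE.
Qed.

Lemma open_cimg_pre c (W : set M) : atlas M c -> open W -> open (cimg c `&` cinv c @^-1` W).
Proof.
move=> ac oW; apply: open_nbhsP => z [Iz Wz]; apply: filterI.
  by apply: open_nbhs_nbhs; split => //; exact: cimg_open.
by apply: (cinv_cont ac Iz); exact: open_nbhs_nbhs.
Qed.

Lemma cimgI c (W : set M) : atlas M c ->
  cfun c @` (cdom c `&` W) = cimg c `&` cinv c @^-1` W.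
Proof.
move=> ac; apply/seteqP; split=> z.
  by move=> [p [dp Wp] <-]; split; [exact: cimg_cfun|rewrite /= cinvK].
by move=> [Iz Wz]; have [h1 h2] := cimgP ac Iz; exists (cinv c z).
Qed.

Lemma bump_smooth_mul (r : R) (z0 : 'rV[R]_n) (U : set 'rV[R]_n) (b u : 'rV[R]_n -> R^o) :
  open U -> smooth_on U u -> smooth_on setT b ->
  (forall z, b z != 0 -> `|z - z0| < r) -> (forall z, `|z - z0| <= r -> U z) ->
  smooth_on setT (fun z => b z * u z : R^o).
Proof.
move=> oU su sb b0 rU; apply: smooth_on_loc => z _.
have [zr|zr] := leP `|z - z0| r.
  exists U; split; [exact: oU|exact: rU|].
  exact: (smooth_onM oU (smooth_on_sub (fun _ _ => I) sb) su).
have oT : open [set z | r < `|z - z0|].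
  apply: open_nbhsP => y /= ry; apply/nbhs_ballP; exists (`|y - z0| - r); first by rewrite /= subr_gt0.
  move=> w; rewrite -ball_normE /ball_ /= ltrBrDl addrC -ltrBrDl => h; apply: (lt_le_trans h).
  by rewrite lerBlDl (le_trans _ (ler_normD _ _))// addrA subrK.
exists [set z | r < `|z - z0|]; split => //.
apply: smooth_on_eq (smooth_on_cst 0) => // y /= ry.
have [->|/b0] := eqVneq (b y) 0; first by rewrite mul0r.
by rewrite ltNge (ltW ry).
Qed.

(** Multiply by a bump function in the chart and extend by 0. The support lies in [K], the image of
    a closed ball, which is compact and hence closed in a Hausdorff space; so the extension is
    smooth also at points outside the chart domain. *)
Lemma chart_extend c p (U : set 'rV[R]_n) (u : 'rV[R]_n -> R^o) (W : set M) :
  atlas M c -> cdom c p -> open U -> U (cfun c p) -> smooth_on U u -> nbhs p W ->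
  exists f : M -> R^o, [/\ smooth_fun f,
    (\forall q \near p, cdom c q /\ f q = u (cfun c q)) &
    (forall q, f q != 0 -> W q)].
Proof.
move=> ac dp oU Up su; rewrite nbhsE => -[W' [oW' W'p] W'W]; set z0 := cfun c p in Up.
have Iz0 : cimg c z0 by exact: cimg_cfun.
have /norm_nbhs[e e0 eP] : nbhs z0 (U `&` (cimg c `&` cinv c @^-1` W')).
  apply: open_nbhs_nbhs; split; first by apply: openI => //; exact: open_cimg_pre.
  by split => //; split => //=; rewrite cinvK.
pose r := e / 2; have r0 : 0 < r by rewrite divr_gt0.
have rP z : `|z - z0| <= r -> U z /\ (cimg c z /\ W' (cinv c z)).
  by move=> h; apply: eP; apply: le_lt_trans h _; rewrite ltr_pdivrMr// ltr_pMr// ltr1n.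
have [b [sb b1 b0]] := bump_exists z0 r0.
pose bu z := b z * u z : R^o.
have sbu : smooth_on setT bu.
  by apply: (bump_smooth_mul oU su sb b0) => z /rP[].
pose f q : R^o := if `[< cdom c q >] then bu (cfun c q) else 0.
pose K := cinv c @` [set z | `|z0 - z| <= r].
have cK : closed K.
  apply: compact_closed; first exact: manifold_hausdorff.
  apply: continuous_compact; last exact: compact_closed_ball.
  have [_ _ _ _] := atlas_homeo c ac; apply: continuous_subspaceW.
  by move=> z /=; rewrite distrC => /rP[_ []].
have fK q : f q != 0 -> K q /\ W' q.
  rewrite /f; case: asboolP => [dq|]; last by rewrite eqxx.
  rewrite /bu mulf_eq0 negb_or => /andP[/b0 h _].
  split; last by have [_ [_]] := rP _ (ltW h); rewrite cinvK.
  by exists (cfun c q); rewrite ?cinvK//= distrC ltW.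
exists f; split; last by move=> q /fK[_ /W'W].
  move=> c1 ac1; apply: smooth_on_loc => z1 Iz1.
  have [d1 e1] := cimgP ac1 Iz1.
  have [dq|dq] := pselect (cdom c (cinv c1 z1)).
    have oT := open_cimg_pre ac1 (cdom_open ac).
    exists (cimg c1 `&` cinv c1 @^-1` cdom c); split => //.
    have H := atlas_compat c1 c ac1 ac; rewrite cimgI// in H.
    have {}H := smooth_on_comp oT openT (fun z _ => I) H sbu.
    apply: smooth_on_eq H => // z [_ /= dz]; rewrite /f /=.
    by case: asboolP.
  have nK : ~ K (cinv c1 z1).
    move=> [z /=]; rewrite distrC => /rP[_ [Iz _]] E; apply: dq; rewrite -E.
    by have [] := cimgP ac Iz.
  have oT := open_cimg_pre ac1 (closed_openC cK).
  exists (cimg c1 `&` cinv c1 @^-1` (~` K)); split => //.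
  apply: smooth_on_eq (smooth_on_cst 0) => // z [_ /= nz].
  by apply/esym/eqP/negPn/negP => /fK[].
have hc : \forall q \near p, `|cfun c q - z0| <= r / 2.
  apply: ((cfun_cont ac dp) [set z | `|z - z0| <= r / 2]).
  apply/nbhs_ballP; exists (r / 2); first exact: divr_gt0.
  by move=> y; rewrite -ball_normE /ball_ /= distrC => /ltW.
have hd : \forall q \near p, cdom c q by apply: open_nbhs_nbhs; split => //; exact: cdom_open.
apply: filterS2 hc hd => q h1 h2; split => //; rewrite /f; case: asboolP => // _.
by rewrite /bu b1// mul1r.
Qed.

Lemma chart_at p : exists2 c, atlas M c & cdom c p.
Proof. exact: atlas_cover. Qed.

Lemma manifold_bump p (W : set M) : nbhs p W ->
  exists f : M -> R^o, [/\ smooth_fun f, (\forall q \near p, f q = 1) & forall q, f q != 0 -> W q].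
Proof.
move=> nW; have [c ac dp] := chart_at p.
have [f [h1 h2 h3]] := chart_extend ac dp openT I (smooth_on_cst 1) nW.
by exists f; split => //; apply: filterS h2 => q [].
Qed.

(** Reduces equalities of points, such as uniqueness of integral curves, to equalities of real
    functions, which can be proved by differentiation. *)
Lemma smooth_separates p q : (forall f : M -> R^o, smooth_fun f -> f p = f q) -> p = q.
Proof.
move=> H; apply: contrapT => pq.
have nW : nbhs p (~` [set q]).
  apply: open_nbhs_nbhs; split; last by move=> /= /pq.
  apply: closed_openC; apply: accessible_closed_set1; apply: hausdorff_accessible.
  exact: manifold_hausdorff.
have [f [sf f1 f0]] := manifold_bump nW.
have fp : f p = 1 by exact: nbhs_singleton f1.
by apply: (f0 q) => //; rewrite -(H f sf) fp oner_neq0.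
Qed.

Lemma chart_coords c p : atlas M c -> cdom c p -> exists x : 'I_n -> M -> R^o,
  (forall j, smooth_fun (x j)) /\ \forall q \near p, cdom c q /\ forall j, x j q = cfun c q 0 j.
Proof.
move=> ac dp.
have H j : exists x : M -> R^o, smooth_fun x /\ \forall q \near p, cdom c q /\ x q = cfun c q 0 j.
  have [f [h1 h2 _]] := chart_extend ac dp openT I (@smooth_on_coord R n setT j) (filterT (F := nbhs p)).
  by exists f.
have [x hx] := choice H; exists x; split; first by move=> j; have [] := hx j.
have hd : \forall q \near p, cdom c q by apply: open_nbhs_nbhs; split => //; exact: cdom_open.
have := filter_forall (nbhs_filter p) (fun j => (hx j).2).
by apply: filterS2 hd => q dq h; split => // j; have [] := h j.
Qed.

End Charts.

(** * Smooth maps from R^r to a manifold *)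

Section TestSmooth.
Context {R : realType}.

(* Smooth maps from open subsets of R^r, recognized by their compositions with
   smooth functions. *)
Definition tsmooth (r n : nat) (M : manifoldType R n) (S : set 'rV[R]_r) (F : 'rV[R]_r -> M) :=
  forall f : M -> R^o, smooth_fun f -> smooth_on S (f \o F).

Section Basic.
Context {r n : nat} {M : manifoldType R n}.
Implicit Types (S : set 'rV[R]_r) (F : 'rV[R]_r -> M).

Lemma tsmooth_sub S T F : T `<=` S -> tsmooth S F -> tsmooth T F.
Proof. by move=> TS sF f /sF; exact: smooth_on_sub. Qed.

Lemma tsmooth_eq S F G : open S -> (forall z, S z -> F z = G z) -> tsmooth S F -> tsmooth S G.
Proof.
by move=> oS FG sF f /sF; apply: smooth_on_eq => // z Sz /=; rewrite FG.
Qed.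

Lemma tsmooth_loc S F : (forall z, S z -> exists T, [/\ open T, T z & tsmooth T F]) -> tsmooth S F.
Proof.
move=> H f sf; apply: smooth_on_loc => z /H[T [oT Tz sF]]; exists T; split => //.
exact: sF.
Qed.

Lemma tsmooth_cst S (p : M) : tsmooth S (fun _ => p).
Proof. by move=> f sf; exact: smooth_on_cst. Qed.

(** A smooth function equal to 1 at the image point and vanishing off the given neighborhood pulls
    this neighborhood back to one of [t]. *)
Lemma tsmooth_cont S F t : S t -> tsmooth S F -> {for t, continuous F}.
Proof.
move=> St sF W nW; have [f [sf f1 f0]] := manifold_bump nW.
have fp : f (F t) = 1 by exact: nbhs_singleton f1.
have cf := smooth_on_cont (sF f sf) St.
have h : nbhs ((f \o F) t) [set y : R^o | y != 0].
  apply: open_nbhs_nbhs; split; last by rewrite /= fp oner_neq0.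
  exact: open_neq.
have h2 : nbhs t ((f \o F) @^-1` [set y : R^o | y != 0]) := cf _ h.
have h3 : nbhs t (F @^-1` W) by apply: filterS h2 => s /= /f0.
exact: h3.
Qed.

Lemma tsmooth_open S F (W : set M) : open S -> tsmooth S F -> open W -> open (S `&` F @^-1` W).
Proof.
move=> oS sF oW; apply: open_nbhsP => t [St Wt]; apply: filterI; first exact: open_nbhs_nbhs.
by apply: (tsmooth_cont St sF); exact: open_nbhs_nbhs.
Qed.

Lemma tsmooth_chart S F c : open S -> tsmooth S F -> atlas M c ->
  smooth_on (S `&` F @^-1` cdom c) (cfun c \o F).
Proof.
move=> oS sF ac; apply: smooth_on_loc => t [St dt].
have [x [sx]] := chart_coords ac dt.
rewrite /prop_near1 nbhsE => -[W [oW Wt] hx].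
have oT := tsmooth_open oS sF oW.
exists (S `&` F @^-1` W); split => //.
apply/(smooth_on_mxP _ oT) => i j; rewrite (ord1 i).
have H := smooth_on_sub (@subIsetl _ S (F @^-1` W)) (sF _ (sx j)).
by apply: (smooth_on_eq oT _ H) => z [_ /= /hx[_ ->]].
Qed.

Lemma chart_tsmooth c : atlas M c -> tsmooth (cimg c) (cinv c : 'rV[R]_n -> M).
Proof. by move=> ac f; exact. Qed.

End Basic.

Lemma tsmooth_comp r s n (M : manifoldType R n) (S : set 'rV[R]_r) (T : set 'rV[R]_s)
    (u : 'rV[R]_r -> 'rV[R]_s) (F : 'rV[R]_s -> M) :
  open S -> open T -> (forall z, S z -> T (u z)) -> smooth_on S u -> tsmooth T F -> tsmooth S (F \o u).
Proof.
by move=> oS oT ST su sF f /sF sf; exact: (smooth_on_comp oS oT ST su sf).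
Qed.

Lemma tsmooth_of_chart r n (M : manifoldType R n) (S : set 'rV[R]_r) (F : 'rV[R]_r -> M) c :
  open S -> atlas M c -> (forall t, S t -> cdom c (F t)) -> smooth_on S (cfun c \o F) -> tsmooth S F.
Proof.
move=> oS ac dF sF.
have H : tsmooth S (cinv c \o (cfun c \o F)).
  apply: tsmooth_comp (chart_tsmooth ac) => //; first exact: cimg_open.
  by move=> t /dF; exact: cimg_cfun.
by apply: tsmooth_eq H => // t /dF dt /=; rewrite cinvK.
Qed.

Lemma smooth_map_on_dom m n (M : manifoldType R m) (N : manifoldType R n) (U : set M) (F : M -> N) c c' :
  open U -> smooth_map_on U F -> atlas M c -> atlas N c' ->
  open (cfun c @` (U `&` cdom c `&` F @^-1` cdom c')).
Proof.
move=> oU [cF _] ac ac'.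
have oW : open (U `&` F @^-1` cdom c').
  apply: open_nbhsP => p [Up dp]; apply: filterI; first exact: open_nbhs_nbhs.
  by apply: (cF p Up); apply: open_nbhs_nbhs; split => //; exact: cdom_open.
rewrite (_ : _ `&` _ `&` _ = cdom c `&` (U `&` F @^-1` cdom c')).
  by rewrite cimgI//; exact: open_cimg_pre.
by rewrite [U `&` _]setIC -setIA.
Qed.

Lemma tsmooth_map r m n (M : manifoldType R m) (N : manifoldType R n) (U : set M) (F : M -> N)
    (S : set 'rV[R]_r) (A : 'rV[R]_r -> M) :
  open S -> open U -> smooth_map_on U F -> tsmooth S A -> (forall t, S t -> U (A t)) -> tsmooth S (F \o A).
Proof.
move=> oS oU sF sA SU; apply: tsmooth_loc => t St.
have [c ac dc] := chart_at (A t); have [c' ac' dc'] := chart_at (F (A t)).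
have oD := smooth_map_on_dom oU sF ac ac'.
have sD := sF.2 c c' ac ac'.
have oW : open (U `&` F @^-1` cdom c').
  apply: open_nbhsP => p [Up dp]; apply: filterI; first exact: open_nbhs_nbhs.
  by apply: (sF.1 p Up); apply: open_nbhs_nbhs; split => //; exact: cdom_open.
have oT := tsmooth_open oS sA (openI (cdom_open ac) oW).
exists (S `&` A @^-1` (cdom c `&` (U `&` F @^-1` cdom c'))); split => //.
  by split => //; split => //; split => //; exact: SU.
apply: (tsmooth_of_chart oT ac') => [s [_ [_ [_]]] //|].
have H : smooth_on (S `&` A @^-1` (cdom c `&` (U `&` F @^-1` cdom c')))
    ((cfun c' \o F \o cinv c) \o (cfun c \o A)).
  apply: (smooth_on_comp_mx oT oD _ _ sD).
    by move=> s [Ss [d1 [d2 d3]]]; exists (A s).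
  apply: smooth_on_sub (tsmooth_chart oS sA ac) => s [Ss [d1 _]]; by split.
apply: smooth_on_eq H => // s [_ [d1 _]] /=; by rewrite cinvK.
Qed.

Lemma smooth_fun_comp m n (M : manifoldType R m) (N : manifoldType R n) (F : M -> N) (f : N -> R^o) :
  smooth_map F -> smooth_fun f -> smooth_fun (f \o F).
Proof.
move=> sF sf c ac.
have H : tsmooth (cimg c) (F \o cinv c).
  exact: (tsmooth_map (cimg_open ac) openT sF (chart_tsmooth ac) (fun _ _ => I)).
exact: H.
Qed.

Lemma is_derive_chart r m (M : manifoldType R m) (S : set 'rV[R]_r) (A : 'rV[R]_r -> M)
    c (f : M -> R^o) t v :
  open S -> S t -> tsmooth S A -> atlas M c -> cdom c (A t) -> smooth_fun f ->
  is_derive t v (f \o A) ('D_('D_v (cfun c \o A) t) (f \o cinv c) (cfun c (A t))).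
Proof.
move=> oS St sA ac dt sf.
have oT := tsmooth_open oS sA (cdom_open ac).
have sT := tsmooth_chart oS sA ac.
have Tt : (S `&` A @^-1` cdom c) t by [].
have d1 := smooth_on_differentiable oT Tt sT.
have d2 := smooth_on_differentiableR (cimg_open ac) (cimg_cfun dt) (sf c ac).
have d3 : differentiable ((f \o cinv c) \o (cfun c \o A)) t by exact: differentiable_comp.
have d4 : is_derive t v ((f \o cinv c) \o (cfun c \o A)) ('D_('D_v (cfun c \o A) t) (f \o cinv c) (cfun c (A t))).
  apply: DeriveDef; first exact: diff_derivable.
  by rewrite !deriveE// diff_comp.
apply: near_eq_is_derive d4; near=> s.
have [_ ds] : (S `&` A @^-1` cdom c) s by near: s; exact: open_nbhs_nbhs.
by rewrite /= cinvK.
Unshelve. all: by end_near.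
Qed.

Lemma derive_chart_map r m n (M : manifoldType R m) (N : manifoldType R n) (U : set M) (F : M -> N)
    (S : set 'rV[R]_r) (A : 'rV[R]_r -> M) c c' t v :
  open S -> S t -> open U -> smooth_map_on U F -> tsmooth S A -> U (A t) ->
  atlas M c -> atlas N c' -> cdom c (A t) -> cdom c' (F (A t)) ->
  'D_v (cfun c' \o (F \o A)) t = 'D_v (cfun c \o A) t *m local_jacobian F c c' (A t).
Proof.
move=> oS St oU sF sA Ut ac ac' dt dt'.
have oD := smooth_map_on_dom oU sF ac ac'.
have sD := sF.2 c c' ac ac'.
have Dt : (cfun c @` (U `&` cdom c `&` F @^-1` cdom c')) (cfun c (A t)) by exists (A t).
have oT := tsmooth_open oS sA (cdom_open ac).
have sT := tsmooth_chart oS sA ac.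
have Tt : (S `&` A @^-1` cdom c) t by [].
have d1 := smooth_on_differentiable oT Tt sT.
have d2 := smooth_on_differentiable oD Dt sD.
have d3 : differentiable ((cfun c' \o F \o cinv c) \o (cfun c \o A)) t by exact: differentiable_comp.
transitivity ('D_v ((cfun c' \o F \o cinv c) \o (cfun c \o A)) t).
  apply: near_eq_derive; near=> s.
  have [_ ds] : (S `&` A @^-1` cdom c) s by near: s; exact: open_nbhs_nbhs.
  by rewrite /= cinvK.
by rewrite deriveE// diff_comp//= -deriveE// -deriveE// deriveEjacobian.
Unshelve. all: by end_near.
Qed.

Lemma tsmooth_map2 r l m n (L : manifoldType R l) (M : manifoldType R m) (N : manifoldType R n)
    (F : L -> M -> N) (S : set 'rV[R]_r) (A : 'rV[R]_r -> L) (B : 'rV[R]_r -> M) :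
  open S -> smooth_map2 F -> tsmooth S A -> tsmooth S B -> tsmooth S (fun t => F (A t) (B t)).
Proof.
move=> oS [cF sF] sA sB; apply: tsmooth_loc => t St.
have [c1 a1 d1] := chart_at (A t); have [c2 a2 d2] := chart_at (B t).
have [c3 a3 d3] := chart_at (F (A t) (B t)).
have := sF c1 c2 c3 a1 a2 a3; set D := [set z | _] => sD.
(* [D] is where [smooth_map2] gives smoothness; it is open because [F] is continuous on the
   product. *)
have oD : open D.
  apply: open_nbhsP => z [p [q [dp dq dF zE]]].
  have hp : nbhs (F p q) (cdom c3) by apply: open_nbhs_nbhs; split => //; exact: cdom_open.
  have /= [[P Q] /= [nP nQ] PQ] := cF (p, q) _ hp.
  have cl : {for z, continuous (@lsubmx R 1 l m)} by exact: (smooth_on_cont (smooth_on_lsub openT)).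
  have cr : {for z, continuous (@rsubmx R 1 l m)} by exact: (smooth_on_cont (smooth_on_rsub openT)).
  have lz : lsubmx z = cfun c1 p by rewrite zE row_mxKl.
  have rz : rsubmx z = cfun c2 q by rewrite zE row_mxKr.
  have hl : \forall w \near z, cimg c1 (lsubmx w) /\ P (cinv c1 (lsubmx w)).
    apply: (cl (fun w => cimg c1 w /\ P (cinv c1 w))); rewrite /= lz; apply: filterI.
      by apply: open_nbhs_nbhs; split; [exact: cimg_open|exact: cimg_cfun].
    by apply: (cinv_cont a1 (cimg_cfun dp)); rewrite cinvK.
  have hr : \forall w \near z, cimg c2 (rsubmx w) /\ Q (cinv c2 (rsubmx w)).
    apply: (cr (fun w => cimg c2 w /\ Q (cinv c2 w))); rewrite /= rz; apply: filterI.
      by apply: open_nbhs_nbhs; split; [exact: cimg_open|exact: cimg_cfun].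
    by apply: (cinv_cont a2 (cimg_cfun dq)); rewrite cinvK.
  apply: filterS2 hl hr => w [h1 h2] [h3 h4].
  have [e1 e2] := cimgP a1 h1; have [e3 e4] := cimgP a2 h3.
  exists (cinv c1 (lsubmx w)), (cinv c2 (rsubmx w)); split => //.
    exact: (PQ (_, _)).
  by rewrite e2 e4 hsubmxK.
have oA := tsmooth_open oS sA (cdom_open a1).
have oB := tsmooth_open oS sB (cdom_open a2).
have sA' := tsmooth_chart oS sA a1; have sB' := tsmooth_chart oS sB a2.
have oAB := openI oA oB.
set SA := S `&` A @^-1` _ in oA oAB sA'; set SB := S `&` B @^-1` _ in oB oAB sB'.
pose u s := row_mx ((cfun c1 \o A) s) ((cfun c2 \o B) s).
have su : smooth_on (SA `&` SB) u.
  apply: smooth_on_row_mx => //.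
    by apply: smooth_on_sub sA' => s [].
  by apply: smooth_on_sub sB' => s [].
have oT : open ((SA `&` SB) `&` u @^-1` D).
  apply: open_nbhsP => s [Ss Ds]; apply: filterI; first exact: open_nbhs_nbhs.
  by apply: (smooth_on_cont su Ss); exact: open_nbhs_nbhs.
have DF s : (SA `&` SB) s -> u s \in D -> cdom c3 (F (A s) (B s)).
  move=> [[_ dA] [_ dB]]; rewrite inE => -[p [q [dp dq dF]]] /eq_row_mx[/= E1 E2].
  by rewrite -(cinvK a1 dA) -(cinvK a2 dB) E1 E2 !cinvK.
exists ((SA `&` SB) `&` u @^-1` D); split => //.
  split; first by split; split.
  by exists (A t), (B t).
apply: (tsmooth_of_chart oT a3).
  by move=> s [h1 h2]; apply: DF => //; rewrite inE.
have su' : smooth_on ((SA `&` SB) `&` u @^-1` D) u by apply: smooth_on_sub su => s [].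
have H := smooth_on_comp_mx oT oD (fun s h => h.2) su' sD.
apply: smooth_on_eq H => // s [[[_ dA] [_ dB]] _].
by rewrite /u /= row_mxKl row_mxKr !cinvK.
Qed.

End TestSmooth.

Section SmoothFunctions.
Context {R : realType} {n : nat} (M : manifoldType R n).
Implicit Types (f h : M -> R^o) (p : M).

Lemma smooth_fun_cst (a : R) : smooth_fun (fun _ : M => a : R^o).
Proof. by move=> c ac; exact: smooth_on_cst. Qed.

Lemma smooth_funD f h : smooth_fun f -> smooth_fun h -> smooth_fun (fun p => f p + h p : R^o).
Proof. by move=> sf sh c ac; exact: (smooth_onD (cimg_open ac) (sf c ac) (sh c ac)). Qed.

Lemma smooth_funM f h : smooth_fun f -> smooth_fun h -> smooth_fun (fun p => f p * h p : R^o).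
Proof. by move=> sf sh c ac; exact: (smooth_onM (cimg_open ac) (sf c ac) (sh c ac)). Qed.

Lemma smooth_funZ (a : R) f : smooth_fun f -> smooth_fun (fun p => a * f p : R^o).
Proof. exact: (smooth_funM (smooth_fun_cst a)). Qed.

Lemma smooth_fun_lin (a : R) f h : smooth_fun f -> smooth_fun h -> smooth_fun (a *: f + h : M -> R^o).
Proof. by move=> sf sh; exact: (smooth_funD (smooth_funZ a sf) sh). Qed.

Lemma smooth_funB f h : smooth_fun f -> smooth_fun h -> smooth_fun (fun p => f p - h p : R^o).
Proof.
move=> sf sh; have := smooth_fun_lin (-1) sh sf.
by congr smooth_fun; apply/funext => p; rewrite /= scaleN1r addrC.
Qed.

Lemma smooth_fun0 : smooth_fun (0 : M -> R^o).
Proof. exact: (smooth_fun_cst 0). Qed.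

End SmoothFunctions.

Lemma is_derive_line (R : realType) (V W : normedModType R) (f : V -> W) (g : R -> W) x v (s : R) dg :
  (forall h : R, f (h *: v + x) = g (h + s)) -> is_derive s (1 : R) g dg -> is_derive x v f dg.
Proof.
move=> E; apply: is_derive_along => h; rewrite E.
by rewrite -[h *: 1]/(h * 1) mulr1.
Qed.

(** * Left-invariant fields and one-parameter subgroups *)

Section VectorFields.
Context {R : realType} {d : nat} (G : lieGroupType R d).
Implicit Types (f h : G -> R^o) (a b p q : G) (X Y : operator G).

Lemma smooth_fun_mull a f : smooth_fun f -> smooth_fun (fun p => f (a * p)%g).
Proof.
move=> sf c ac.
have H : tsmooth (cimg c) (fun t => (a * cinv c t)%g).
  exact: (tsmooth_map2 (cimg_open ac) smooth_mul (tsmooth_cst a) (chart_tsmooth ac)).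
exact: H.
Qed.

Lemma smooth_fun_mulr a f : smooth_fun f -> smooth_fun (fun p => f (p * a)%g).
Proof.
move=> sf c ac.
have H : tsmooth (cimg c) (fun t => (cinv c t * a)%g).
  exact: (tsmooth_map2 (cimg_open ac) smooth_mul (chart_tsmooth ac) (tsmooth_cst a)).
exact: H.
Qed.

Lemma smooth_fun_inv f : smooth_fun f -> smooth_fun (fun p => f (p^-1)%g).
Proof. exact: (smooth_fun_comp smooth_inv). Qed.

Lemma smooth_fun_mullE a f : smooth_fun (fun p => f (a * p)%g) -> smooth_fun f.
Proof.
move=> /(smooth_fun_mull (a^-1)%g); congr smooth_fun; apply/funext => p.
by rewrite mulVKg.
Qed.

Lemma smooth_fun_mulrE a f : smooth_fun (fun p => f (p * a)%g) -> smooth_fun f.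
Proof.
move=> /(smooth_fun_mulr (a^-1)%g); congr smooth_fun; apply/funext => p.
by rewrite mulgVK.
Qed.

Lemma tsmooth_mul r (S : set 'rV[R]_r) (A B : 'rV[R]_r -> G) : open S ->
  tsmooth S A -> tsmooth S B -> tsmooth S (fun t => (A t * B t)%g).
Proof. by move=> oS; exact: (tsmooth_map2 oS smooth_mul). Qed.

Lemma tsmooth_inv r (S : set 'rV[R]_r) (A : 'rV[R]_r -> G) : open S ->
  tsmooth S A -> tsmooth S (fun t => (A t)^-1%g).
Proof. by move=> oS sA; exact: (tsmooth_map oS openT smooth_inv sA). Qed.

Lemma vf0 X : vector_field X -> X 0 = 0.
Proof.
move=> [_ lin _ _]; have := lin 1 0 0 (@smooth_fun0 _ _ _) (@smooth_fun0 _ _ _).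
rewrite scale1r addr0 scale1r => /eqP; rewrite eq_sym -subr_eq0 addrK => /eqP.
by [].
Qed.

Lemma vf_cst X (a : R) : vector_field X -> X (fun _ => a) = 0.
Proof.
move=> vX; have [_ lin leib _] := vX.
have X1 : X (fun _ => 1) = 0.
  have := leib (fun _ => 1) (fun _ => 1) (smooth_fun_cst 1) (smooth_fun_cst 1).
  rewrite mulr1 => E; apply/funext => p.
  have := congr1 (fun F : G -> R^o => F p) E; rewrite mulr1 mul1r => /eqP.
  by rewrite eq_sym -subr_eq0 addrK => /eqP.
have := lin a (fun _ => 1) 0 (smooth_fun_cst 1) (@smooth_fun0 _ _ _).
rewrite (vf0 vX) X1 scaler0 !addr0.
suff -> : a *: (fun _ : G => 1) = (fun _ : G => a) :> (G -> R^o) by [].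
by apply/funext => p; rewrite -[LHS]/(a * 1) mulr1.
Qed.

Lemma vfD X f h : vector_field X -> smooth_fun f -> smooth_fun h ->
  X (fun p => f p + h p) = fun p => X f p + X h p.
Proof.
move=> [_ lin _ _] sf sh; have := lin 1 f h sf sh; rewrite !scale1r => E.
by rewrite -[LHS]/(X (f + h)) E.
Qed.

(** For [b] equal to 1 near [p] and vanishing where [f] does not, the product of [b] and [f] is 0,
    and the Leibniz rule at [p] leaves [X f p]. *)
Lemma vf_local X f p : vector_field X -> smooth_fun f -> (\forall q \near p, f q = 0) -> X f p = 0.
Proof.
move=> vX sf f0; have [b [sb b1 bW]] := manifold_bump f0.
have [_ _ leib _] := vX.
have E : (fun p => b p * f p) = 0 :> (G -> R^o).
  apply/funext => q; have [->|/bW ->] := eqVneq (b q) 0; [exact: mul0r|exact: mulr0].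
have := leib b f sb sf; rewrite E vf0// => /(congr1 (fun F : G -> R^o => F p)).
by rewrite (nbhs_singleton b1) (nbhs_singleton f0) mul1r mulr0 addr0 => <-.
Qed.

Lemma vf_germ X f h p : vector_field X -> smooth_fun f -> smooth_fun h ->
  (\forall q \near p, f q = h q) -> X f p = X h p.
Proof.
move=> vX sf sh fh; apply/eqP; rewrite -subr_eq0; apply/eqP.
have sfh := smooth_fun_lin (-1) sh sf; have [_ lin _ _] := vX.
have : X (-1 *: h + f) p = 0.
  apply: (vf_local vX sfh); apply: filterS fh => q E.
  by rewrite -[LHS]/(-1 *: h q + f q) scaleN1r E addNr.
by rewrite lin// /= scaleN1r addrC.
Qed.

Lemma vf_sum X (I : Type) (r : seq I) (u : I -> G -> R^o) : vector_field X ->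
  (forall i, smooth_fun (u i)) ->
  smooth_fun (fun p => \sum_(i <- r) u i p : R^o) /\
  X (fun p => \sum_(i <- r) u i p) = fun p => \sum_(i <- r) X (u i) p.
Proof.
move=> vX su; elim: r => [|i r [IH1 IH2]].
  have E : (fun p => \sum_(i <- [::]) u i p) = (0 : G -> R^o) by apply/funext => p; rewrite big_nil.
  rewrite E; split; first exact: smooth_fun0.
  by rewrite vf0//; apply/funext => p; rewrite big_nil.
have E : (fun p => \sum_(j <- i :: r) u j p) = (fun p => u i p + \sum_(j <- r) u j p : R^o).
  by apply/funext => p; rewrite big_cons.
rewrite E; split; first exact: (smooth_funD (su i) IH1).
by rewrite (vfD vX (su i) IH1) IH2; apply/funext => p; rewrite big_cons.
Qed.

(* Hadamard's lemma: a derivation is a directional derivative. *)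
Lemma vf_expand X c p (x : 'I_d -> G -> R^o) f : vector_field X -> atlas G c -> cdom c p ->
  (forall j, smooth_fun (x j)) ->
  (\forall q \near p, cdom c q /\ forall j, x j q = cfun c q 0 j) -> smooth_fun f ->
  X f p = \sum_j X (x j) p * 'D_('e_j) (f \o cinv c) (cfun c p).
Proof.
move=> vX ac dp sx hx sf; set z0 := cfun c p.
have /norm_nbhs[e e0 eP] : nbhs z0 (cimg c).
  by apply: open_nbhs_nbhs; split; [exact: cimg_open|exact: cimg_cfun].
pose r := e / 4; have r0 : 0 < r by rewrite divr_gt0.
have rS : [set y | `|z0 - y| <= 3 * r] `<=` cimg c.
  move=> y /=; rewrite distrC => h; apply: eP; apply: le_lt_trans h _.
  by rewrite /r mulrA ltr_pdivrMr// mulrC ltr_pM2l// ltr_nat.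
have [g [sg gz0 gE]] := hadamard_ball (cimg_open ac) r0 rS (sf c ac).
have Hg j : exists u : G -> R^o, smooth_fun u /\ \forall q \near p, cdom c q /\ u q = g j (cfun c q).
  have ob : open (ball z0 r) by exact: ball_open.
  have [u [su hu _]] := chart_extend ac dp ob (ballxx z0 r0) (sg j) (filterT (F := nbhs p)).
  by exists u.
have [u hu] := choice Hg.
have su j : smooth_fun (u j) by have [] := hu j.
pose w j q : R^o := x j q - z0 0 j.
have sw j : smooth_fun (w j) := smooth_funB (sx j) (smooth_fun_cst (z0 0 j)).
have [sS XS] := vf_sum (index_enum 'I_d) vX (fun j => smooth_funM (sw j) (su j)).
have hball : \forall q \near p, ball z0 r (cfun c q).
  by apply: (cfun_cont ac dp); exact: nbhsx_ballx.
have hu' := filter_forall (nbhs_filter p) (fun j => (hu j).2).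
have xp j : x j p = z0 0 j by have [_] := nbhs_singleton hx; exact.
have up j : u j p = 'D_('e_j) (f \o cinv c) z0.
  by have [_ ->] := nbhs_singleton (hu j).2; exact: gz0.
have E : \forall q \near p, f q = f p + \sum_j w j q * u j q.
  apply: filterS2 hball (filterI hx hu') => q bq [[dq xq] uq].
  have := gE _ bq; rewrite /= !cinvK// => ->; congr (_ + _).
  by apply: eq_bigr => j _; rewrite /w xq; have [_ ->] := uq j.
rewrite (vf_germ vX sf (smooth_funD (smooth_fun_cst (f p)) sS) E).
rewrite (vfD vX (smooth_fun_cst (f p)) sS) vf_cst// add0r XS; apply: eq_bigr => j _.
have [_ lin leib _] := vX; rewrite (leib _ _ (sw j) (su j)) {1}/w xp subrr mul0r add0r up.
congr (_ * _).
have := lin (-1) (fun _ => z0 0 j) (x j) (smooth_fun_cst (z0 0 j)) (sx j).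
rewrite (vf_cst _ vX) scaler0 add0r.
suff -> : -1 *: (fun _ : G => z0 0 j) + x j = w j :> (G -> R^o) by move=> ->.
by apply/funext => q; rewrite -[LHS]/(-1 * z0 0 j + x j q) mulN1r addrC.
Qed.

(** Holds for every [f]: translations preserve smoothness both ways, and on nonsmooth functions both
    sides are 0. *)
Lemma lie_alg_mull X a f p : lie_algebra G X -> X (fun q => f (a * q)%g) p = X f (a * p)%g.
Proof.
move=> [vX lX]; have [sf|nsf] := pselect (smooth_fun f); first by rewrite lX.
have [_ _ _ h] := vX; rewrite (h _ nsf).
have nsf' : ~ smooth_fun (fun q => f (a * q)%g) by move=> /smooth_fun_mullE; exact: nsf.
by rewrite (h _ nsf').
Qed.

Lemma lie_bracket_alg X Y : lie_algebra G X -> lie_algebra G Y -> lie_algebra G (lie_bracket G X Y).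
Proof.
move=> lX lY; have [vX _] := lX; have [vY _] := lY.
have [sX linX leibX nX] := vX; have [sY linY leibY nY] := vY.
split.
  split.
  - move=> f sf; rewrite /lie_bracket.
    by have := smooth_funB (sX _ (sY _ sf)) (sY _ (sX _ sf)).
  - move=> a f h sf sh; rewrite /lie_bracket (linX _ _ _ sf sh) (linY _ _ _ sf sh).
    rewrite (linX _ _ _ (sY _ sf) (sY _ sh)) (linY _ _ _ (sX _ sf) (sX _ sh)).
    by rewrite scalerBr opprD addrACA.
  - move=> f h sf sh; rewrite /lie_bracket leibX// leibY//.
    rewrite (vfD vX); [|exact: (smooth_funM sf (sY _ sh))|exact: (smooth_funM (sY _ sf) sh)].
    rewrite (vfD vY); [|exact: (smooth_funM sf (sX _ sh))|exact: (smooth_funM (sX _ sf) sh)].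
    rewrite (leibX _ _ sf (sY _ sh)) (leibX _ _ (sY _ sf) sh).
    rewrite (leibY _ _ sf (sX _ sh)) (leibY _ _ (sX _ sf) sh).
    apply/funext => p.
    rewrite -[LHS]/((f p * X (Y h) p + X f p * Y h p + (Y f p * X h p + X (Y f) p * h p)) -
      (f p * Y (X h) p + Y f p * X h p + (X f p * Y h p + Y (X f) p * h p)) : R).
    rewrite -[RHS]/(f p * (X (Y h) p - Y (X h) p) + (X (Y f) p - Y (X f) p) * h p : R).
    by move: (f p) (h p) (X (Y h) p) (Y (X h) p) (X f p) (X h p) (Y f p) (Y h p) (X (Y f) p) (Y (X f) p) => *; ring.
  - by move=> f nf; rewrite /lie_bracket (nX _ nf) (nY _ nf) (vf0 vX) (vf0 vY) subrr.
move=> a f sf; apply/funext => p; rewrite /lie_bracket.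
rewrite -[LHS]/(X (Y (fun p => f (a * p)%g)) p - Y (X (fun p => f (a * p)%g)) p).
have -> : Y (fun p => f (a * p)%g) = fun p => Y f (a * p)%g by have [_ ->] := lY.
have -> : X (fun p => f (a * p)%g) = fun p => X f (a * p)%g by have [_ ->] := lX.
by rewrite !lie_alg_mull.
Qed.

Lemma lie_alg_lin (a : R) X Y : lie_algebra G X -> lie_algebra G Y -> lie_algebra G (a *: X + Y).
Proof.
move=> lX lY; have [vX _] := lX; have [vY _] := lY.
have [sX linX leibX nX] := vX; have [sY linY leibY nY] := vY.
have E f p : (a *: X + Y) f p = a * X f p + Y f p by [].
split.
  split.
  - by move=> f sf; exact: (smooth_fun_lin a (sX _ sf) (sY _ sf)).
  - move=> s f h sf sh; apply/funext => p; rewrite E (linX _ _ _ sf sh) (linY _ _ _ sf sh).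
    rewrite -[RHS]/(s * (a * X f p + Y f p) + (a * X h p + Y h p) : R).
    rewrite -[LHS]/(a * (s * X f p + X h p) + (s * Y f p + Y h p) : R).
    by move: (X f p) (X h p) (Y f p) (Y h p) => *; ring.
  - move=> f h sf sh; apply/funext => p; rewrite !E (leibX _ _ sf sh) (leibY _ _ sf sh).
    by move: (f p) (h p) (X f p) (X h p) (Y f p) (Y h p) => *; ring.
  - move=> f nf; apply/funext => p; rewrite E nX// nY//.
    by rewrite -[RHS]/(0 : R) -[(0 : G -> R^o) p]/(0 : R) mulr0 addr0.
move=> b f sf; apply/funext => p; rewrite !E.
by rewrite !lie_alg_mull.
Qed.

End VectorFields.

Section UnitChart.
Context {R : realType} {d : nat} (G : lieGroupType R d).
Implicit Types (f h : G -> R^o) (a b p q : G) (X Y : operator G) (v w : 'rV[R]_d).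

(** Derivations see only globally defined smooth functions, so the coordinates of a chart at 1 are
    replaced by smooth functions [x j] on all of [G] that agree with them near 1. *)
Record unit_chart (c : chart R d G) (x : 'I_d -> G -> R^o) : Prop := UnitChart {
  uc_atlas : atlas G c;
  uc_dom : cdom c 1%g;
  uc_smooth : forall j, smooth_fun (x j);
  uc_near : \forall q \near (1%g : G), cdom c q /\ forall j, x j q = cfun c q 0 j }.

Lemma unit_chart_exists : exists c x, unit_chart c x.
Proof.
have [c ac dc] := chart_at (1%g : G).
by have [x [sx hx]] := chart_coords ac dc; exists c, x.
Qed.

Variables (c : chart R d G) (x : 'I_d -> G -> R^o).
Hypothesis U : unit_chart c x.
Let ac := uc_atlas U.
Let dc := uc_dom U.
Let z0 := cfun c 1%g.

(** The tangent vector of [X] at 1 in the chart; with [xfield] as inverse it identifies the Lie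
    algebra with R^d. *)
Definition xi X : 'rV[R]_d := \row_j X (x j) 1%g.

Lemma smooth_on_transl a f : smooth_fun f -> smooth_on (cimg c) (fun z => f (a * cinv c z)%g : R^o).
Proof. by move=> sf; exact: (smooth_fun_mull a sf ac). Qed.

Lemma unit_img : cimg c z0. Proof. exact: cimg_cfun. Qed.

Lemma transl_diff a f : smooth_fun f -> differentiable (fun z => f (a * cinv c z)%g : R^o) z0.
Proof. by move=> sf; exact: (smooth_on_differentiableR (cimg_open ac) unit_img (smooth_on_transl a sf)). Qed.

Lemma lie_derive X f a : lie_algebra G X -> smooth_fun f ->
  X f a = 'D_(xi X) (fun z => f (a * cinv c z)%g : R^o) z0.
Proof.
move=> lX sf; have [vX _] := lX.
rewrite -{1}[a]mulg1 -(lie_alg_mull a f 1%g lX).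
rewrite (vf_expand vX ac dc (uc_smooth U) (uc_near U) (smooth_fun_mull a sf)).
rewrite (derive_partials (xi X) (transl_diff a sf)).
by apply: eq_bigr => j _; rewrite mxE.
Qed.

Lemma xi_inj X Y : lie_algebra G X -> lie_algebra G Y -> xi X = xi Y -> X = Y.
Proof.
move=> lX lY E; apply/funext => f; apply/funext => a.
have [sf|nsf] := pselect (smooth_fun f); first by rewrite !lie_derive// E.
by have [[_ _ _ h1] _] := lX; have [[_ _ _ h2] _] := lY; rewrite (h1 _ nsf) (h2 _ nsf).
Qed.

Lemma xi_lin (s : R) X Y : xi (s *: X + Y) = s *: xi X + xi Y.
Proof. by apply/rowP => j; rewrite !mxE. Qed.

Definition xfield v : operator G := fun f a =>
  if `[< smooth_fun f >] then 'D_v (fun z => f (a * cinv c z)%g : R^o) z0 else 0.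

Lemma xfieldE v f a : smooth_fun f -> xfield v f a = 'D_v (fun z => f (a * cinv c z)%g : R^o) z0.
Proof. by move=> sf; rewrite /xfield; case: asboolP. Qed.

Lemma transl_deriv a f v : smooth_fun f ->
  is_derive z0 v (fun z => f (a * cinv c z)%g : R^o) (xfield v f a).
Proof.
move=> sf; rewrite xfieldE//; apply: DeriveDef => //.
exact: diff_derivable (transl_diff a sf).
Qed.

(** A partial derivative, in the second factor, of the smooth function (a, z) |-> f (a * cinv c z),
    restricted to z = z0. *)
Lemma smooth_xfield v f : smooth_fun f -> smooth_fun (xfield v f).
Proof.
move=> sf c1 ac1.
pose D := [set w : 'rV[R]_(d + d) | cimg c1 (lsubmx w) /\ cimg c (rsubmx w)].
have sl : smooth_on [set: 'rV[R]_(d + d)] (@lsubmx R 1 d d) by exact: (smooth_on_lsub openT).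
have sr : smooth_on [set: 'rV[R]_(d + d)] (@rsubmx R 1 d d) by exact: (smooth_on_rsub openT).
have oD : open D.
  apply: open_nbhsP => w [w1 w2]; apply: filterI.
    by apply: (smooth_on_cont sl (z := w) I); apply: open_nbhs_nbhs; split => //; exact: cimg_open.
  by apply: (smooth_on_cont sr (z := w) I); apply: open_nbhs_nbhs; split => //; exact: cimg_open.
pose H (w : 'rV[R]_(d + d)) : R^o := f (cinv c1 (lsubmx w) * cinv c (rsubmx w))%g.
have sH : smooth_on D H.
  have tl : tsmooth D (cinv c1 \o @lsubmx R 1 d d).
    apply: (tsmooth_comp oD (cimg_open ac1) _ _ (chart_tsmooth ac1)) => [w []//|].
    exact: (smooth_on_lsub oD).
  have tr : tsmooth D (cinv c \o @rsubmx R 1 d d).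
    apply: (tsmooth_comp oD (cimg_open ac) _ _ (chart_tsmooth ac)) => [w []//|].
    exact: (smooth_on_rsub oD).
  exact: (tsmooth_mul oD tl tr sf).
have sDH := smooth_on_derive (row_mx 0 v) sH.
have oI := cimg_open ac1.
have su : smooth_on (cimg c1) (fun z : 'rV[R]_d => row_mx z z0).
  apply: (smooth_on_row_mx oI); last exact: smooth_on_cstmx.
  apply/(smooth_on_mxP _ oI) => i j.
  apply: (smooth_on_eq oI _ (@smooth_on_coord R d (cimg c1) j)) => z _.
  by rewrite (ord1 i).
have DI z : cimg c1 z -> D (row_mx z z0).
  by move=> hz; split; rewrite ?row_mxKl ?row_mxKr//; exact: unit_img.
have := smooth_on_comp oI oD DI su sDH.
apply: (smooth_on_eq oI) => z hz; rewrite /= xfieldE//.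
apply: derive_along => h; rewrite /H scale_row_mx add_row_mx row_mxKl row_mxKr scaler0 add0r.
by [].
Qed.

Lemma xfield_alg v : lie_algebra G (xfield v).
Proof.
split.
  split.
  - exact: smooth_xfield.
  - move=> s f h sf sh; apply/funext => a.
    have dfh := is_deriveD (is_deriveZ s (transl_deriv a v sf)) (transl_deriv a v sh).
    rewrite (xfieldE v a (smooth_fun_lin s sf sh)); exact: derive_val.
  - move=> f h sf sh; apply/funext => a.
    have dfh := is_deriveM (transl_deriv a v sf) (transl_deriv a v sh).
    rewrite (xfieldE v a (smooth_funM sf sh)); have [_ E] := dfh; rewrite E.
    by rewrite /z0 !cinvK// mulg1 [_ *: xfield v f a]mulrC.
  - by move=> f nf; apply/funext => a; rewrite /xfield; case: asboolP.
move=> a f sf; apply/funext => b; rewrite (xfieldE v b (smooth_fun_mull a sf)) (xfieldE v _ sf).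
by apply: derive_along => h; rewrite mulgA.
Qed.

Lemma xi_xfield v : xi (xfield v) = v.
Proof.
apply/rowP => j; rewrite mxE (xfieldE v _ (uc_smooth U j)).
have E : \forall z \near z0, x j (1 * cinv c z)%g = z 0 j.
  have h2 : \forall z \near z0, cdom c (cinv c z) /\ forall j, x j (cinv c z) = cfun c (cinv c z) 0 j.
    have h3 := uc_near U; rewrite -{1}(cinvK ac dc) in h3.
    exact: (cinv_cont ac unit_img h3).
  have hI : \forall z \near z0, cimg c z.
    by apply: open_nbhs_nbhs; split; [exact: cimg_open|exact: unit_img].
  apply: filterS2 h2 hI => z [_ hz] Iz.
  by rewrite mul1g hz (cimgP ac Iz).2.
rewrite (near_eq_derive _ E).
have lin : linear (fun z : 'rV[R]_d => z 0 j : R^o) by move=> s u w; rewrite !mxE.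
pose g : {linear 'rV[R]_d -> R^o} := HB.pack (fun z : 'rV[R]_d => z 0 j : R^o)
  (GRing.isLinear.Build _ _ _ _ _ lin).
have dg : differentiable g z0 by apply: linear_differentiable; exact: coord_continuous.
by rewrite -[LHS]/('D_v g z0) deriveE// diff_lin//; exact: coord_continuous.
Qed.

End UnitChart.

Lemma real_curve_const (R : realType) (y : R -> R^o) (T : R) (s t : R) :
  (forall x, `|x| < T -> is_derive x (1 : R) y 0) -> `|s| < T -> `|t| < T -> y s = y t.
Proof.
move=> H sT tT.
have H' x : `|x| < T -> is_derive x (1 : R) (fun u => const_mx (y u) : 'rV[R]_1) 0.
  move=> /H hx; apply/is_derive_mxP => i j; rewrite mxE.
  suff -> : (fun y0 : R => (const_mx (y y0) : 'rV[R]_1) i j : R^o) = y by [].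
  by apply/funext => u; rewrite mxE.
by have /matrixP/(_ 0 0) := curve_const H' sT tT; rewrite !mxE.
Qed.

(** * Integral curves and one-parameter subgroups *)

Section IntegralCurves.
Context {R : realType} {d : nat} (G : lieGroupType R d).
Implicit Types (f h : G -> R^o) (a b p q : G) (X Y : operator G) (e : R).

Definition icurve X e (g : R -> G) : Prop :=
  forall f, smooth_fun f -> forall t, `|t| < e -> is_derive t (1 : R) (fun s => f (g s) : R^o) (X f (g t)).

(** Along the curve the derivative of [f] is [X f], so the iterates [iter k X f] form a tower for
    [smooth_on_tower]. *)
Lemma icurve_tsmooth X e g r (S : set 'rV[R]_r) (u : 'rV[R]_r -> R^o) :
  vector_field X -> icurve X e g -> open S -> smooth_on S u -> (forall z, S z -> `|u z| < e) ->
  tsmooth S (g \o u).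
Proof.
move=> [sX _ _ _] gX oS su ue f sf.
pose h k t := iter k X f (g t) : R.
apply: (@smooth_on_tower _ _ S [set t | `|t| < e] u h oS ue su) => k t te.
have sk : smooth_fun (iter k X f).
  by elim: k => [|k IH]; [exact: sf|rewrite iterS; exact: sX].
exact: (gX _ sk t te).
Qed.

(** Smoothness is stated on row vectors, so the real line is viewed as the space of rows of length
    1. *)
Definition coord0 (z : 'rV[R]_1) : R^o := z 0 0.

Definition smooth_curve e (A : R -> G) := tsmooth [set z : 'rV[R]_1 | `|coord0 z| < e] (A \o coord0).

Lemma open_coord_lt r (j : 'I_r) e : open [set z : 'rV[R]_r | `|z 0 j| < e].
Proof.
apply: open_nbhsP => z /= ze; apply/nbhs_ballP; exists (e - `|z 0 j|); first by rewrite /= subr_gt0.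
move=> w; rewrite -ball_normE /ball_ /= => h.
rewrite -[w 0 j](subrK (z 0 j)); apply: (le_lt_trans (ler_normD _ _)).
rewrite -ltrBrDr; apply: le_lt_trans h; rewrite distrC.
by have := row_coord_le (z - w) j; rewrite !mxE.
Qed.

Lemma icurve_smooth X e g : vector_field X -> icurve X e g -> smooth_curve e g.
Proof.
move=> vX gX; apply: (icurve_tsmooth vX gX) => //; first exact: open_coord_lt.
exact: smooth_on_coord.
Qed.

Lemma smooth_curve_coord e A r (S : set 'rV[R]_r) (u : 'rV[R]_r -> R^o) :
  smooth_curve e A -> open S -> smooth_on S u -> (forall z, S z -> `|u z| < e) ->
  tsmooth S (fun z => A (u z)).
Proof.
move=> sA oS su ue.
have oT : open [set z : 'rV[R]_1 | `|coord0 z| < e] by exact: open_coord_lt.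
have H : tsmooth S ((A \o coord0) \o (fun z => const_mx (u z) : 'rV[R]_1)).
  apply: (tsmooth_comp oS oT _ _ sA) => [z Sz|]; first by rewrite /= /coord0 mxE; exact: ue.
  apply/(smooth_on_mxP _ oS) => i j; apply: (smooth_on_eq oS _ su) => z _.
  by rewrite mxE.
by apply: (tsmooth_eq oS _ H) => z _ /=; rewrite /coord0 mxE.
Qed.

Lemma smooth_curve_inv e A : smooth_curve e A -> smooth_curve e (fun t => (A t)^-1%g).
Proof. by move=> sA; apply: tsmooth_inv sA; exact: open_coord_lt. Qed.

(** The curve is the diagonal of a smooth function of two real variables, so its derivative is the
    sum of the two partial ones. *)
Lemma product_rule e (A B : R -> G) f t (da db : R) : smooth_curve e A -> smooth_curve e B ->
  smooth_fun f -> `|t| < e ->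
  is_derive t (1 : R) (fun s => f (A s * B t)%g : R^o) da ->
  is_derive t (1 : R) (fun s => f (A t * B s)%g : R^o) db ->
  is_derive t (1 : R) (fun s => f (A s * B s)%g : R^o) (da + db).
Proof.
move=> sA sB sf te hA hB.
pose D := [set z : 'rV[R]_2 | `|z 0 0| < e] `&` [set z : 'rV[R]_2 | `|z 0 1| < e].
have oD : open D by apply: openI; exact: open_coord_lt.
pose j1 : 'I_2 := 1.
pose F (z : 'rV[R]_2) : R^o := f (A (z 0 0) * B (z 0 j1))%g.
have sF : smooth_on D F.
  apply: (tsmooth_mul oD _ _ sf).
    by apply: (smooth_curve_coord sA oD (@smooth_on_coord R 2 D 0)) => z [].
  by apply: (smooth_curve_coord sB oD (@smooth_on_coord R 2 D j1)) => z [].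
pose z : 'rV[R]_2 := const_mx t.
have Dz : D z by split; rewrite /= mxE.
have dF := smooth_on_differentiableR oD Dz sF.
have n01 : ((1 : 'I_2) == 0) = false by [].
have h0 : 'D_('e_0) F z = da.
  have E (h : R) : F (h *: 'e_0 + z) = f (A (h + t)%R * B t)%g.
    by rewrite /F !mxE /= mulr1 mulr0 add0r.
  by have [_ <-] := @is_derive_line R _ _ F (fun s => f (A s * B t)%g : R^o) z 'e_0 t da E hA.
have h1 : 'D_('e_1) F z = db.
  have E (h : R) : F (h *: 'e_1 + z) = f (A t * B (h + t)%R)%g.
    by rewrite /F !mxE /= mulr1 mulr0 add0r.
  by have [_ <-] := @is_derive_line R _ _ F (fun s => f (A t * B s)%g : R^o) z 'e_1 t db E hB.
have h2 : is_derive z (1 *: 'e_0 + 'e_1) F (1 *: da + db).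
  apply: DeriveDef; first exact: diff_derivable.
  by rewrite derive_linearv// h0 h1.
have h3 : is_derive z (1 *: 'e_0 + 'e_1) F (da + db).
  by apply: is_derive_eq h2 _; rewrite scale1r.
have E (h : R) : f (A (h *: 1 + t) * B (h *: 1 + t))%g = F (h *: (1 *: 'e_0 + 'e_1) + z).
  by rewrite /F !mxE /= !mulr1 !mulr0 addr0 add0r mulr1 -[h *: 1]/(h * 1)%R mulr1.
exact: (is_derive_along E h3).
Qed.

End IntegralCurves.

Section OneParameter.
Context {R : realType} {d : nat} (G : lieGroupType R d).
Implicit Types (f h : G -> R^o) (a b p q : G) (X Y : operator G) (e : R).
Variables (c : chart R d G) (x : 'I_d -> G -> R^o).
Hypothesis U : unit_chart c x.
Let ac := uc_atlas U.
Let dc := uc_dom U.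
Let z0 := cfun c 1%g.

(** The function (z, w) |-> f (z * w^-1) is constant on the diagonal, so its two partial derivatives
    at (1, 1) cancel. *)
Lemma lie_inv_unit X f : lie_algebra G X -> smooth_fun f ->
  X (fun p => f (p^-1)%g) 1%g = - X f 1%g.
Proof.
move=> lX sf; have sfi := smooth_fun_inv sf.
rewrite (lie_derive U _ lX sf) (lie_derive U _ lX sfi); set v := xi x X.
have Iz0 : cimg c z0 by exact: cimg_cfun.
pose D := [set w : 'rV[R]_(d + d) | cimg c (lsubmx w) /\ cimg c (rsubmx w)].
have sl : smooth_on [set: 'rV[R]_(d + d)] (@lsubmx R 1 d d) by exact: (smooth_on_lsub openT).
have sr : smooth_on [set: 'rV[R]_(d + d)] (@rsubmx R 1 d d) by exact: (smooth_on_rsub openT).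
have oD : open D.
  apply: open_nbhsP => w [w1 w2]; apply: filterI.
    by apply: (smooth_on_cont sl (z := w) I); apply: open_nbhs_nbhs; split => //; exact: cimg_open.
  by apply: (smooth_on_cont sr (z := w) I); apply: open_nbhs_nbhs; split => //; exact: cimg_open.
pose H (w : 'rV[R]_(d + d)) : R^o := f (cinv c (lsubmx w) * (cinv c (rsubmx w))^-1)%g.
have sH : smooth_on D H.
  have tl : tsmooth D (cinv c \o @lsubmx R 1 d d).
    apply: (tsmooth_comp oD (cimg_open ac) _ _ (chart_tsmooth ac)) => [w []//|].
    exact: (smooth_on_lsub oD).
  have tr : tsmooth D (cinv c \o @rsubmx R 1 d d).
    apply: (tsmooth_comp oD (cimg_open ac) _ _ (chart_tsmooth ac)) => [w []//|].
    exact: (smooth_on_rsub oD).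
  exact: (tsmooth_mul oD tl (tsmooth_inv oD tr) sf).
have Dz : D (row_mx z0 z0) by split; rewrite ?row_mxKl ?row_mxKr.
have dH := smooth_on_differentiableR oD Dz sH.
have c1 : cinv c z0 = 1%g by exact: cinvK.
have hl : 'D_v (fun z => f (1 * cinv c z)%g : R^o) z0 = 'D_(row_mx v 0) H (row_mx z0 z0).
  apply: derive_along => h; rewrite /H scale_row_mx add_row_mx row_mxKl row_mxKr scaler0 add0r c1.
  by rewrite invg1 mulg1 mul1g.
have hr : 'D_v (fun z => f ((1 * cinv c z)^-1)%g : R^o) z0 = 'D_(row_mx 0 v) H (row_mx z0 z0).
  apply: derive_along => h; rewrite /H scale_row_mx add_row_mx row_mxKl row_mxKr scaler0 add0r c1.
  by rewrite !mul1g.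
rewrite hl hr; apply/eqP; rewrite -addr_eq0 addrC.
have := derive_linearv 1 (row_mx v 0) (row_mx 0 v) dH.
rewrite !scale1r => <-; rewrite add_row_mx addr0 add0r.
have -> : 'D_(row_mx v v) H (row_mx z0 z0) = 'D_v (fun _ : 'rV[R]_d => f 1%g : R^o) z0.
  apply: derive_along => h; rewrite /H scale_row_mx add_row_mx row_mxKl row_mxKr.
  by rewrite mulgV.
by rewrite derive_cst.
Qed.

Lemma lie_inv X f a b : lie_algebra G X -> smooth_fun f ->
  X (fun q => f (a * q^-1)%g) b = - X (fun q => f (q * b^-1)%g) a.
Proof.
move=> lX sf.
rewrite -{1}[b]mulg1 -(lie_alg_mull b _ 1%g lX) -[in RHS](mulg1 a) -(lie_alg_mull a _ 1%g lX).
have sh : smooth_fun (fun q => f (a * q * b^-1)%g).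
  exact: (smooth_fun_mull a (smooth_fun_mulr (b^-1)%g sf)).
rewrite -(lie_inv_unit lX sh); congr (X _ _); apply/funext => p.
by rewrite invgM mulgA.
Qed.

(** The product of [al] with the inverse of [be] is constant: by [lie_inv] the contributions of the
    two factors to its derivative cancel. *)
Lemma icurve_unique X e al be : lie_algebra G X -> icurve X e al -> icurve X e be ->
  al 0 = be 0 -> forall t, `|t| < e -> al t = be t.
Proof.
move=> lX hal hbe E0 t te; have [vX _] := lX.
have e0 : 0 < e by apply: le_lt_trans te; exact: normr_ge0.
have sal := icurve_smooth vX hal; have sbe := icurve_smooth vX hbe.
suff H : (al t * (be t)^-1 = 1)%g by apply/eqP; rewrite -divg_eq1; apply/eqP.
apply: smooth_separates => f sf.
have K s : `|s| < e -> is_derive s (1 : R) (fun s => f (al s * (be s)^-1)%g : R^o) 0.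
  move=> se.
  have h1 := hal _ (smooth_fun_mulr (be s)^-1%g sf) s se.
  have sk : smooth_fun (fun q => f (al s * q^-1)%g).
    exact: (smooth_fun_inv (smooth_fun_mull (al s) sf)).
  have h2 := hbe _ sk s se; rewrite (lie_inv _ _ lX sf) in h2.
  by have := product_rule sal (smooth_curve_inv sbe) sf se h1 h2; rewrite subrr.
have := real_curve_const K te (_ : `|0| < e); rewrite normr0 => /(_ e0) ->.
by rewrite E0 mulgV.
Qed.

Lemma icurve_mull X e g a : lie_algebra G X -> icurve X e g -> icurve X e (fun t => a * g t)%g.
Proof.
move=> lX hg f sf t te; rewrite -(lie_alg_mull a f (g t) lX).
exact: (hg _ (smooth_fun_mull a sf) t te).
Qed.

Lemma icurve_shift X e g s : icurve X e g -> icurve X (e - `|s|) (fun t => g (s + t)).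
Proof.
move=> hg f sf t; rewrite ltrBrDl => te.
have h : `|s + t| < e by apply: le_lt_trans te; exact: ler_normD.
apply: (is_derive_line (s := s + t)) (hg f sf _ h) => u.
by rewrite -[u *: 1]/(u * 1) mulr1 addrCA addrA.
Qed.

Lemma icurve_exists X : lie_algebra G X -> exists e g, [/\ 0 < e, g 0 = 1%g & icurve X e g].
Proof.
move=> [vX _]; have [sX _ _ _] := vX.
have := uc_near U; rewrite /prop_near1 nbhsE => -[W [oW W1] hW].
pose S := cimg c `&` cinv c @^-1` W.
have oS : open S by exact: open_cimg_pre.
have Sz0 : S z0 by split; [exact: cimg_cfun|rewrite /= cinvK].
pose F (z : 'rV[R]_d) : 'rV[R]_d := \row_j X (x j) (cinv c z).
have sF : smooth_on S F.
  apply/(smooth_on_mxP _ oS) => i j.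
  apply: (smooth_on_eq oS _ (smooth_on_sub (@subIsetl _ _ _) (sX _ (uc_smooth U j) c ac))) => z _.
  by rewrite mxE.
have [e [y [e0 y0 Sy dy]]] := ode_exists oS Sz0 sF.
exists e, (fun t => cinv c (y t)); split => //; first by rewrite y0; exact: cinvK.
move=> f sf t te; have [Iy Wy] := Sy t te; have [dg cg] := cimgP ac Iy.
have hnear : \forall q \near cinv c (y t), cdom c q /\ forall j, x j q = cfun c q 0 j.
  by apply: filterS hW _; apply: open_nbhs_nbhs.
rewrite (vf_expand vX ac dg (uc_smooth U) hnear sf) cg.
have [d1 d2] := dy t te.
have dfc := smooth_on_differentiableR (cimg_open ac) Iy (sf c ac).
apply: is_derive_eq (derive_comp_row d1 dfc) _.
by apply: eq_bigr => j _; rewrite d2 mxE.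
Qed.

(** By uniqueness a local integral curve through 1 is a local homomorphism; it extends by taking the
    N-th power of g (t / N), with N so large that t / N lies in its domain. *)
Lemma one_parameter_exists X : lie_algebra G X -> exists g, one_parameter_subgroup X g.
Proof.
move=> lX; have [e [g [e0 g0 hg]]] := icurve_exists lX.
have hom s t : `|s| + `|t| < e -> g (s + t) = (g s * g t)%g.
  move=> st; have te : `|t| < e - `|s| by rewrite ltrBrDl.
  have hg' : icurve X (e - `|s|) g.
    by move=> f sf u ue; apply: (hg f sf u); apply: lt_le_trans ue _; rewrite gerBl.
  have E0 : g (s + 0) = (g s * g 0)%g by rewrite addr0 g0 mulg1.
  exact: (icurve_unique lX (icurve_shift hg) (icurve_mull (g s) lX hg') E0 te).
have powj u k j : (0 < k)%N -> (j <= k)%N -> `|u| < e -> g (j%:R * (u / k%:R)) = (g (u / k%:R)%R ^+ j)%g.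
  move=> k0 + ue; have k0' : 0 < k%:R :> R by rewrite ltr0n.
  elim: j => [|j IH] jk; first by rewrite mul0r g0 expg0.
  rewrite expgSr -IH; last exact: ltnW.
  rewrite -hom; first by rewrite -natr1 mulrDl mul1r.
  have -> : `|j%:R * (u / k%:R)| + `|u / k%:R| = j.+1%:R / k%:R * `|u|.
    by rewrite !normrM normfV !normr_nat -natr1; ring.
  apply: le_lt_trans ue; rewrite ler_piMl// ler_pdivrMr// mul1r ler_nat.
  by [].
have pow u k : (0 < k)%N -> `|u| < e -> g u = (g (u / k%:R)%R ^+ k)%g.
  move=> k0 ue; rewrite -(powj u k k)// mulrCA divff ?mulr1//.
  by rewrite pnatr_eq0 -lt0n.
(* Gives |t / N t| < e / 2, half of [e] so that two such parameters can be added. *)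
pose N (t : R) := (Num.truncn (`|t| * 2 / e)).+1.
have Nt (t : R) : `|t / (N t)%:R| < e / 2.
  rewrite normrM normfV normr_nat ltr_pdivrMr ?ltr0n// mulrC mulrA ltr_pdivlMr// -ltr_pdivrMr//.
  exact: truncnS_gt.
pose gam (t : R) := (g (t / (N t)%:R)%R ^+ N t)%g.
have e2 : e / 2 < e by rewrite ltr_pdivrMr// ltr_pMr// ltr1n.
have gamE (t : R) M : (0 < M)%N -> `|t / M%:R| < e -> gam t = (g (t / M%:R)%R ^+ M)%g.
  move=> M0 te; rewrite /gam.
  rewrite (pow (t / (N t)%:R) M)//; last exact: lt_trans (Nt t) e2.
  rewrite (pow (t / M%:R) (N t))// -!expgnA mulnC; congr (g _ ^+ _)%g.
  by rewrite -!mulrA [_^-1 * _^-1]mulrC.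
have small (s : R) k : (0 < k)%N -> `|s / (N s * k)%:R| < e / 2.
  move=> k0; apply: le_lt_trans (Nt s); rewrite natrM invfM mulrA normrM.
  by rewrite ler_piMr// normfV normr_nat invf_le1 ?ltr0n// ler1n.
have gam_hom (s t : R) : gam (s + t) = (gam s * gam t)%g.
  (* A common multiple serves both parameters; by [gamE] the power defining [gam] does not depend on
     the multiple. *)
  pose M := (N s * N t)%N; have M0 : (0 < M)%N by rewrite muln_gt0.
  have hs : `|s / M%:R| < e / 2 by exact: small.
  have ht : `|t / M%:R| < e / 2 by rewrite /M mulnC; exact: small.
  have hst : `|s / M%:R| + `|t / M%:R| < e by rewrite (splitr e) ltrD.
  rewrite !(gamE _ M)//; [|exact: lt_trans ht e2|exact: lt_trans hs e2|].
    rewrite mulrDl hom// expgMn//.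
    by rewrite /commute -!hom// 1?addrC// addrC.
  by rewrite mulrDl; apply: le_lt_trans (ler_normD _ _) hst.
exists gam; split => // f sf t.
have h0 : `|0 : R| < e by rewrite normr0.
have := hg _ (smooth_fun_mull (gam t) sf) 0 h0.
rewrite (lie_alg_mull (gam t) f _ lX) g0 mulg1 => h1.
have h2 : is_derive t (1 : R) (fun s => f (gam t * g (s - t)%R)%g : R^o) (X f (gam t)).
  apply: is_derive_line h1 => h; rewrite -[h *: 1]/(h * 1) mulr1 addrK addr0.
  by [].
apply: near_eq_is_derive h2; near=> s.
have st : `|t - s| < e by near: s; apply/nbhs_ballP; exists e => // s; rewrite -ball_normE.
rewrite -[in RHS](subrK t s) [in RHS]addrC gam_hom; congr (f (_ * _)%g).
by rewrite (gamE (s - t) 1)// ?divr1 ?expg1// distrC.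
Unshelve. all: by end_near.
Qed.

End OneParameter.

(** * The adjoint action on left-invariant fields *)

Section Adjoint.
Context {R : realType} {d : nat} (G : lieGroupType R d).
Implicit Types (f h : G -> R^o) (a b p q : G) (X Y : operator G) (e : R) (g : R -> G).

Lemma ops_icurve X g e : one_parameter_subgroup X g -> icurve X e g.
Proof. by move=> [_ h] f sf t _; exact: h. Qed.

Lemma ops0 X g : one_parameter_subgroup X g -> g 0 = 1%g.
Proof.
move=> [h _]; have := h 0 0; rewrite addr0 => /(congr1 (fun p => (g 0)^-1 * p)%g).
by rewrite mulKg mulVg.
Qed.

Lemma opsN X g t : one_parameter_subgroup X g -> g (- t) = (g t)^-1%g.
Proof.
move=> hg; have [h _] := hg; have := h t (- t); rewrite subrr (ops0 hg) => E.
by rewrite (mulg1_eq (esym E)).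
Qed.

Lemma ops_derive X g f a b t : lie_algebra G X -> one_parameter_subgroup X g -> smooth_fun f ->
  is_derive t (1 : R) (fun s => f (a * g s * b)%g : R^o) (X (fun p => f (p * b)%g) (a * g t)%g).
Proof.
move=> lX [_ h] sf; rewrite -(lie_alg_mull a _ _ lX).
exact: (h _ (smooth_fun_mull a (smooth_fun_mulr b sf)) t).
Qed.

Lemma ops_derive_at0 X g f a b : lie_algebra G X -> one_parameter_subgroup X g -> smooth_fun f ->
  is_derive 0 (1 : R) (fun s => f (a * g s * b)%g : R^o) (X (fun p => f (p * b)%g) a).
Proof. by move=> lX hg sf; have := ops_derive a b 0 lX hg sf; rewrite (ops0 hg) mulg1. Qed.

Lemma lie_alg_eq1 X Y : lie_algebra G X -> lie_algebra G Y ->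
  (forall f, smooth_fun f -> X f 1%g = Y f 1%g) -> X = Y.
Proof.
move=> lX lY H; apply/funext => f; apply/funext => a.
have [sf|nsf] := pselect (smooth_fun f).
  rewrite -[a]mulg1 -(lie_alg_mull a f _ lX) -(lie_alg_mull a f _ lY).
  exact: (H _ (smooth_fun_mull a sf)).
by have [[_ _ _ h1] _] := lX; have [[_ _ _ h2] _] := lY; rewrite (h1 _ nsf) (h2 _ nsf).
Qed.

Lemma ops_inj X Y g : lie_algebra G X -> lie_algebra G Y ->
  one_parameter_subgroup X g -> one_parameter_subgroup Y g -> X = Y.
Proof.
move=> lX lY hX hY; apply: (lie_alg_eq1 lX lY) => f sf.
have h1 := hX.2 f sf 0; have h2 := hY.2 f sf 0; rewrite (ops0 hX) in h1 h2.
by have [_ <-] := h1; have [_ <-] := h2.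
Qed.

(** The adjoint action: for a left-invariant field, pushing forward by conjugation with [a] amounts
    to pushing forward by right multiplication with the inverse of [a]. *)
Definition AdOp a X : operator G := fun f b => X (fun p => f (p * a^-1)%g) (b * a)%g.

Lemma AdOpM a b X : AdOp (a * b)%g X = AdOp a (AdOp b X).
Proof.
apply/funext => f; apply/funext => q; rewrite /AdOp mulgA; congr (X _ _).
by apply/funext => p; rewrite invgM mulgA.
Qed.

Lemma AdOp1 X : AdOp 1%g X = X.
Proof.
apply/funext => f; apply/funext => q; rewrite /AdOp mulg1; congr (X _ _).
by apply/funext => p; rewrite invg1 mulg1.
Qed.

Lemma AdOp_bracket a X Y : AdOp a (lie_bracket G X Y) = lie_bracket G (AdOp a X) (AdOp a Y).
Proof.
apply/funext => f; apply/funext => q; rewrite /lie_bracket.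
rewrite -[LHS]/(X (Y (fun p => f (p * a^-1)%g)) (q * a)%g - Y (X (fun p => f (p * a^-1)%g)) (q * a)%g).
rewrite -[RHS]/(X (fun p => Y (fun p => f (p * a^-1)%g) (p * a^-1 * a)%g) (q * a)%g -
  Y (fun p => X (fun p => f (p * a^-1)%g) (p * a^-1 * a)%g) (q * a)%g).
have E (u : G -> R^o) : (fun p : G => u (p * a^-1 * a)%g) = u by apply/funext => p; rewrite mulgVK.
by rewrite !E.
Qed.

Lemma AdOp_alg a X : lie_algebra G X -> lie_algebra G (AdOp a X).
Proof.
move=> lX; have [vX iX] := lX; have [sX linX leibX nX] := vX; split.
  split.
  - by move=> f sf; exact: (smooth_fun_mulr a (sX _ (smooth_fun_mulr _ sf))).
  - move=> s f h sf sh; apply/funext => b; rewrite /AdOp.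
    have := linX s _ _ (smooth_fun_mulr (a^-1)%g sf) (smooth_fun_mulr (a^-1)%g sh).
    by move=> /(congr1 (fun u : G -> R^o => u (b * a)%g)).
  - move=> f h sf sh; apply/funext => b; rewrite /AdOp.
    have := leibX _ _ (smooth_fun_mulr (a^-1)%g sf) (smooth_fun_mulr (a^-1)%g sh).
    by move=> /(congr1 (fun u : G -> R^o => u (b * a)%g)) ->; rewrite mulgK.
  - move=> f nf; apply/funext => b; rewrite /AdOp.
    have nf' : ~ smooth_fun (fun p => f (p * a^-1)%g) by move=> /smooth_fun_mulrE; exact: nf.
    by rewrite (nX _ nf').
move=> b f sf; apply/funext => q; rewrite /AdOp -mulgA -(lie_alg_mull b _ _ lX).
by congr (X _ _); apply/funext => p; rewrite mulgA.
Qed.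

Lemma AdOp_at1 a X f : lie_algebra G X -> AdOp a X f 1%g = X (fun p => f (a * p * a^-1)%g) 1%g.
Proof. move=> lX; rewrite /AdOp mul1g -{2}(mulg1 a).
by rewrite -(lie_alg_mull a (fun p => f (p * a^-1)%g) 1%g lX). Qed.

Lemma AdOp_ops a X g : lie_algebra G X -> one_parameter_subgroup X g ->
  one_parameter_subgroup (AdOp a X) (fun t => a * g t * a^-1)%g.
Proof.
move=> lX hg; have [hom _] := hg; split.
  by move=> s t; rewrite hom !mulgA mulgVK.
move=> f sf t; rewrite /AdOp mulgVK.
exact: ops_derive.
Qed.

Lemma AdOp_self X g t : lie_algebra G X -> one_parameter_subgroup X g -> AdOp (g t) X = X.
Proof.
move=> lX hg; apply: (ops_inj (AdOp_alg _ lX) lX _ hg).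
have := AdOp_ops (g t) lX hg; congr one_parameter_subgroup; apply/funext => s.
by rewrite -hg.1 addrC hg.1 mulgK.
Qed.

Lemma ops_unique X g1 g2 t (c : chart R d G) x : unit_chart c x -> lie_algebra G X ->
  one_parameter_subgroup X g1 -> one_parameter_subgroup X g2 -> g1 t = g2 t.
Proof.
move=> U lX h1 h2.
apply: (icurve_unique U lX (ops_icurve (e := `|t| + 1) h1) (ops_icurve h2)).
  by rewrite !(ops0 h1, ops0 h2).
by rewrite ltrDl.
Qed.

Lemma ops_tsmooth X g r (S : set 'rV[R]_r) (u : 'rV[R]_r -> R^o) : lie_algebra G X ->
  one_parameter_subgroup X g -> open S -> smooth_on S u -> tsmooth S (fun z => g (u z)).
Proof.
move=> [[sX _ _ _] _] hg oS su f sf.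
pose h k t := iter k X f (g t) : R.
apply: (@smooth_on_tower _ _ S setT u h oS (fun _ _ => I) su) => k t _.
have sk : smooth_fun (iter k X f).
  by elim: k => [|k IH]; [exact: sf|rewrite iterS; exact: sX].
exact: (hg.2 _ sk t).
Qed.

(** [AdOp (g s) Y f] at 1 is the t-derivative at 0 of f (g s * g' t * g (- s)). With the three
    exponents as independent variables, its s-derivative at 0 is the difference of two mixed
    partials, X (Y f) and Y (X f) at 1. *)
Lemma AdOp_derive0 X Y g f : lie_algebra G X -> lie_algebra G Y ->
  (exists g', one_parameter_subgroup Y g') ->
  one_parameter_subgroup X g -> smooth_fun f ->
  is_derive 0 (1 : R) (fun s => AdOp (g s) Y f 1%g : R^o) (lie_bracket G X Y f 1%g).
Proof.
move=> lX lY [g' hg'] hg sf.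
pose j0 : 'I_3 := inord 0; pose j1 : 'I_3 := inord 1; pose j2 : 'I_3 := inord 2.
have d01 : (j1 == j0) = false by rewrite -(inj_eq val_inj) /= !inordK.
have d02 : (j2 == j0) = false by rewrite -(inj_eq val_inj) /= !inordK.
have d12 : (j2 == j1) = false by rewrite -(inj_eq val_inj) /= !inordK.
have d10 : (j0 == j1) = false by rewrite eq_sym d01.
have d20 : (j0 == j2) = false by rewrite eq_sym d02.
have d21 : (j1 == j2) = false by rewrite eq_sym d12.
pose F (z : 'rV[R]_3) : R^o := f (g (z 0 j0) * g' (z 0 j1) * g (z 0 j2))%g.
have oT : open [set: 'rV[R]_3] by exact: openT.
have sc Z k (gg : R -> G) : lie_algebra G Z -> one_parameter_subgroup Z gg ->
    tsmooth setT (fun z : 'rV[R]_3 => gg (z 0 k)).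
  by move=> lZ hgg; exact: (ops_tsmooth lZ hgg oT (@smooth_on_coord R 3 _ k)).
have sF : smooth_on setT F.
  exact: (tsmooth_mul oT (tsmooth_mul oT (sc X j0 g lX hg) (sc Y j1 g' lY hg')) (sc X j2 g lX hg) sf).
have g0 := ops0 hg; have g'0 := ops0 hg'.
have sK := smooth_on_derive 'e_j1 sF.
have KE (z : 'rV[R]_3) : z 0 j1 = 0 -> 'D_('e_j1) F z = Y (fun p => f (p * g (z 0 j2))%g) (g (z 0 j0)).
  move=> z1; have hd := ops_derive_at0 (g (z 0 j0)) (g (z 0 j2)) lY hg' sf.
  have E (h : R) : F (h *: 'e_j1 + z) = f (g (z 0 j0) * g' (h + 0)%R * g (z 0 j2))%g.
    by rewrite /F !mxE /= !eqxx d10 d12 z1 mulr1 !mulr0 !add0r.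
  by have [_ ->] := is_derive_line E hd.
have DE (z : 'rV[R]_3) : z 0 j2 = 0 -> z 0 j0 = 0 -> 'D_('e_j2) F z = X f (g' (z 0 j1)).
  move=> z2 z0; have hd := ops_derive_at0 (g' (z 0 j1)) 1%g lX hg sf.
  have E (h : R) : F (h *: 'e_j2 + z) = f (g' (z 0 j1) * g (h + 0)%R * 1)%g.
    by rewrite /F !mxE /= !eqxx d20 d21 z2 z0 mulr1 !mulr0 !add0r g0 mul1g mulg1.
  have [_ ->] := is_derive_line E hd; congr (X _ _).
  by apply/funext => p; rewrite mulg1.
have dK := smooth_on_differentiableR (z := 0) oT I sK.
have [sX _ _ _] := lX.1; have [sY _ _ _] := lY.1.
have k0 : 'D_('e_j0) ('D_('e_j1) F) 0 = X (Y f) 1%g.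
  have hd := hg.2 _ (sY f sf) 0; rewrite g0 in hd.
  have E (h : R) : 'D_('e_j1) F (h *: 'e_j0 + 0) = Y f (g (h + 0)).
    rewrite KE !mxE ?d01 /= ?eqxx ?d20 ?d02 ?mulr0 ?mulr1 ?addr0//.
    by rewrite g0; congr (Y _ _); apply/funext => p; rewrite mulg1.
  by have [_ ->] := @is_derive_line R _ _ ('D_('e_j1) F) (fun s => Y f (g s) : R^o) 0 'e_j0 0 _ E hd.
have k2 : 'D_('e_j2) ('D_('e_j1) F) 0 = Y (X f) 1%g.
  (* Differentiating the rightmost factor first gives [X f] along [g'], and from there [Y (X f)]. *)
  rewrite (derive_comm 'e_j2 'e_j1 oT I sF).
  have hd := hg'.2 _ (sX f sf) 0; rewrite g'0 in hd.
  have E (h : R) : 'D_('e_j2) F (h *: 'e_j1 + 0) = X f (g' (h + 0)).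
    by rewrite DE !mxE ?d12 ?d21 ?d10 /= ?eqxx ?mulr0 ?mulr1 ?addr0.
  by have [_ ->] := @is_derive_line R _ _ ('D_('e_j2) F) (fun s => X f (g' s) : R^o) 0 'e_j1 0 _ E hd.
have h3 : is_derive (0 : 'rV[R]_3) ((-1) *: 'e_j2 + 'e_j0) ('D_('e_j1) F) (lie_bracket G X Y f 1%g).
  apply: DeriveDef; first exact: diff_derivable.
  by rewrite derive_linearv// k0 k2 addrC scaleN1r.
have E (s : R) : AdOp (g (s *: 1 + 0)) Y f 1%g = 'D_('e_j1) F (s *: ((-1) *: 'e_j2 + 'e_j0) + 0).
  rewrite KE !mxE ?d12 ?d21 ?d10 ?d20 ?d02 ?d01 /= ?eqxx ?mulr0 ?mulr1 ?addr0 ?add0r ?mulr0//.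
  rewrite /AdOp mul1g -[s *: 1]/(s * 1) mulr1 mulrN1; congr (Y _ _).
  by apply/funext => p; rewrite (opsN _ hg).
exact: (is_derive_along E h3).
Qed.

Lemma AdOp_derive X Y g f s : lie_algebra G X -> lie_algebra G Y ->
  (exists g', one_parameter_subgroup Y g') ->
  one_parameter_subgroup X g -> smooth_fun f ->
  is_derive s (1 : R) (fun s => AdOp (g s) Y f 1%g : R^o) (AdOp (g s) (lie_bracket G X Y) f 1%g).
Proof.
move=> lX lY hY hg sf.
have sf' : smooth_fun (fun p => f (g s * p * (g s)^-1)%g).
  exact: (smooth_fun_mull (g s) (smooth_fun_mulr (g s)^-1%g sf)).
have := AdOp_derive0 lX lY hY hg sf'.
rewrite -(AdOp_at1 _ _ (lie_bracket_alg lX lY)) => h.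
apply: (is_derive_line (s := 0)) h => u.
rewrite -[u *: 1]/(u * 1) mulr1 addr0 addrC hg.1 AdOpM.
by rewrite (AdOp_at1 _ _ (AdOp_alg _ lY)).
Qed.

(** The function exp (- k u) Ad (g u) Y, tested on [f] at 1, has derivative 0. *)
Lemma AdOp_eigen X Y g (k : R) s : lie_algebra G X -> lie_algebra G Y ->
  (exists g', one_parameter_subgroup Y g') -> one_parameter_subgroup X g ->
  lie_bracket G X Y = k *: Y -> AdOp (g s) Y = expR (k * s) *: Y.
Proof.
move=> lX lY hY hg E.
have l0 : lie_algebra G (0 : operator G).
  by have := lie_alg_lin (-1) lY lY; rewrite scaleN1r addNr.
have lZ : lie_algebra G (expR (k * s) *: Y).
  by rewrite -[_ *: Y]addr0; exact: lie_alg_lin.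
apply: (lie_alg_eq1 (AdOp_alg _ lY) lZ) => f sf.
pose y (u : R) : R^o := expR (- (k * u)) * AdOp (g u) Y f 1%g.
have dy u : is_derive u (1 : R) y 0.
  have h1 := AdOp_derive u lX lY hY hg sf; rewrite E in h1.
  have h2 : is_derive u (1 : R) (fun u => expR (- (k * u)) : R^o) (- k * expR (- (k * u))).
    have h3 : is_derive u (1 : R) (fun u => - (k * u) : R^o) (- k).
      by apply: is_derive_eq; rewrite ?scaler0 ?addr0 -[k *: 1]/(k * 1) mulr1.
    have h4 := @is_derive1_comp R expR (fun u => - (k * u) : R^o) u _ _ (is_derive_expR (- (k * u))) h3.
    by apply: is_derive_eq h4 _; rewrite mulrC.
  apply: is_derive_eq (is_deriveM h2 h1) _.
  rewrite -[AdOp (g u) (k *: Y) f 1%g]/(k * AdOp (g u) Y f 1%g).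
  rewrite -![_ *: _]/(_ * _); move: (expR _) (AdOp _ _ _ _) => *; ring.
have y0 : y s = y 0.
  have hs : `|s| < `|s| + 1 by rewrite ltrDl ltr01.
  have h0 : `|0 : R| < `|s| + 1 by rewrite normr0 ltr_wpDl// ltr01.
  exact: (real_curve_const (fun u _ => dy u) hs h0).
move: y0; rewrite /y mulr0 oppr0 expR0 mul1r (ops0 hg) AdOp1 => y0.
rewrite -[RHS]/(expR (k * s) * Y f 1%g) -y0 mulrA -expRD subrr expR0 mul1r.
by [].
Qed.

Section ProductMap.
Context {r : nat}.
Variables (X : 'I_r -> operator G) (g : 'I_r -> R -> G).
Hypothesis lX : forall j, lie_algebra G (X j).
Hypothesis hg : forall j, one_parameter_subgroup (X j) (g j).

(** Canonical coordinates of the second kind. *)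
Definition prod_exp (t : 'rV[R]_r) : G := (\prod_(j < r) g j (t 0 j))%g.

Lemma prod_exp_smooth : tsmooth setT prod_exp.
Proof.
have oT : open [set: 'rV[R]_r] by exact: openT.
rewrite /prod_exp; elim: (index_enum _) => [|j s IH].
  by apply: (tsmooth_eq oT _ (tsmooth_cst (1%g : G))) => z _; rewrite big_nil.
have H := tsmooth_mul oT (ops_tsmooth (lX j) (hg j) oT (@smooth_on_coord R r _ j)) IH.
by apply: (tsmooth_eq oT _ H) => z _; rewrite big_cons.
Qed.

Lemma prod_exp0 : prod_exp 0 = 1%g.
Proof. by rewrite /prod_exp big1// => j _; rewrite mxE (ops0 (hg j)). Qed.

Lemma prod_exp_axis (h : R) j : prod_exp (h *: 'e_j) = g j h.
Proof.
have H (s : seq 'I_r) : uniq s ->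
    (\prod_(i <- s) g i ((h *: 'e_j : 'rV[R]_r) 0 i) = if j \in s then g j h else 1)%g.
  elim: s => [|i s IH] /=; first by rewrite big_nil.
  move=> /andP[si us]; rewrite big_cons IH// inE !mxE eqxx.
  have [E|ij] := eqVneq i j.
    by rewrite E in si *; rewrite mulr1 (negPf si) mulg1.
  by rewrite mulr0 (ops0 (hg i)) mul1g.
by rewrite /prod_exp H ?index_enum_uniq// mem_index_enum.
Qed.

Lemma prod_exp_derive0 j f : smooth_fun f ->
  is_derive (0 : 'rV[R]_r) 'e_j (f \o prod_exp) (X j f 1%g).
Proof.
move=> sf; have h1 := (hg j).2 f sf 0; rewrite (ops0 (hg j)) in h1.
by apply: is_derive_line h1 => h; rewrite !addr0 /= prod_exp_axis.
Qed.

End ProductMap.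

End Adjoint.

(** An open subgroup is closed, its complement being a union of cosets. This is how facts about
    one-parameter subgroups spread from a neighborhood of 1 to [G]. *)
Lemma connected_subgroup (R : realType) (d : nat) (G : lieGroupType R d) (S : set G) :
  connected [set: G] -> nbhs (1%g : G) S ->
  (forall a b, S a -> S b -> S (a * b)%g) -> (forall a, S a -> S (a^-1)%g) -> forall a, S a.
Proof.
move=> cG nS SM SV.
have S1 : S 1%g by exact: nbhs_singleton.
have cont a : continuous (fun p : G => a * p)%g.
  move=> p; have [cm _] := (@smooth_mul R d G).
  apply: (@continuous_comp _ _ _ (fun p : G => (a, p)) (fun pq : G * G => pq.1 * pq.2)%g) (cm (a, p)).
  by apply: cvg_pair => //=; exact: cvg_cst.
have nb a : nbhs a [set q | S (a^-1 * q)%g].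
  have h : nbhs (a^-1 * a)%g S by rewrite mulVg.
  exact: (cont (a^-1)%g a S h).
have oS : open S.
  apply: open_nbhsP => a Sa; apply: filterS (nb a) => q /= h.
  by rewrite -(mulVKg a q); exact: SM.
have oC : open (~` S).
  apply: open_nbhsP => a nSa; apply: filterS (nb a) => q /= h Sq; apply: nSa.
  have := SM _ _ Sq (SV _ h); by rewrite invgM invgK mulgA mulgV mul1g.
have cS : closed S by rewrite -[S]setCK; exact: open_closedC.
have -> : S = setT; last by [].
by apply: cG; [exists 1%g|exists S|exists S]; rewrite ?setTI.
Qed.

Section InverseFunction.
Context {R : realType} {n : nat} (M : manifoldType R n).

Lemma manifold_ift (S N : set 'rV[R]_n) (F : 'rV[R]_n -> M) t c : open S -> S t -> tsmooth S F ->
  atlas M c -> cdom c (F t) -> jacobian (cfun c \o F) t \in unitmx -> nbhs t N ->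
  exists U V (K : M -> 'rV[R]_n), [/\ open U /\ open V, U t /\ U `<=` S `&` N,
    (forall z, U z -> V (F z) /\ K (F z) = z),
    (forall q, V q -> U (K q) /\ F (K q) = q) & smooth_map_on V K].
Proof.
move=> oS St sF ac dt uJ nN.
have oT := tsmooth_open oS sF (cdom_open ac).
have sT := tsmooth_chart oS sF ac.
have Tt : (S `&` F @^-1` cdom c) t by [].
have [U [V [K [[oU oV] [Ut US] UV VU sK]]]] := inverse_function oT Tt sT uJ nN.
pose V' := cdom c `&` cfun c @^-1` V; pose K' := K \o cfun c.
have oV' : open V'.
  apply: open_nbhsP => q [dq Vq]; apply: filterI.
    by apply: open_nbhs_nbhs; split => //; exact: cdom_open.
  by apply: (cfun_cont ac dq); exact: open_nbhs_nbhs.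
have US' z : U z -> S z /\ cdom c (F z) by move=> /US[[]].
exists U, V', K'; split => //.
- by split => // z Uz; have [[Sz _] Nz] := US z Uz.
- move=> z Uz; have [Vz Kz] := UV z Uz; have [_ dz] := US' z Uz.
  by split => //; split.
- move=> q [dq Vq]; have [UK FK] := VU _ Vq; split => //.
  by rewrite -[RHS](cinvK ac dq) -FK /= cinvK//; have [] := US' _ UK.
split.
  move=> q [dq Vq]; apply: continuous_comp; first exact: cfun_cont.
  exact: (smooth_on_cont sK Vq).
move=> c1 c2 ac1 ->.
have -> : cfun c1 @` (V' `&` cdom c1 `&` K' @^-1` cdom id_chart) = cimg c1 `&` cinv c1 @^-1` V'.
  rewrite -cimgI//; congr (_ @` _); apply/seteqP; split=> q.
    by move=> [[h1 h2] _].
  by move=> [h1 h2].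
have oD := open_cimg_pre ac1 oV'.
have H1 : smooth_on (cimg c1 `&` cinv c1 @^-1` V') (cfun c \o cinv c1).
  have := atlas_compat c1 c ac1 ac; rewrite cimgI//.
  by apply: smooth_on_sub => z [Iz [dz _]].
have := smooth_on_comp_mx oD oV _ H1 sK; apply.
by move=> z [Iz [_ Vz]].
Qed.

End InverseFunction.

Section ExpNbhs.
Context {R : realType} {d : nat} (G : lieGroupType R d).
Variables (c : chart R d G) (x : 'I_d -> G -> R^o).
Hypothesis U : unit_chart c x.
Variable (g : 'I_d -> R -> G).
Hypothesis hg : forall j, one_parameter_subgroup (xfield c 'e_j) (g j).

Let lX j : lie_algebra G (xfield c 'e_j) := xfield_alg U 'e_j.

Lemma prod_exp_jacobian : jacobian (cfun c \o prod_exp g) 0 = 1%:M.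
Proof.
have oT : open [set: 'rV[R]_d] by exact: openT.
have sE := prod_exp_smooth lX hg.
have ac := uc_atlas U.
have oS := tsmooth_open oT sE (cdom_open ac).
have sS := tsmooth_chart oT sE ac.
have E0 : prod_exp g 0 = 1%g := prod_exp0 hg.
have S0 : (setT `&` prod_exp g @^-1` cdom c) 0 by split => //; rewrite /= E0; exact: uc_dom U.
apply/matrixP => i j; rewrite (jacobianE oS sS)//.
have hd := prod_exp_derive0 hg i (uc_smooth U j).
have near0 : \forall z \near (0 : 'rV[R]_d), x j (prod_exp g z) = (cfun c \o prod_exp g) z 0 j.
  have h3 := uc_near U; rewrite -E0 in h3.
  have h4 : \forall z \near (0 : 'rV[R]_d), cdom c (prod_exp g z) /\
      forall j, x j (prod_exp g z) = cfun c (prod_exp g z) 0 j := tsmooth_cont I sE h3.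
  by apply: filterS h4 => z [_ ->].
have dfd : derivable (cfun c \o prod_exp g) 0 'e_i.
  exact: diff_derivable (smooth_on_differentiable oS S0 sS).
have := (is_derive_mxP (cfun c \o prod_exp g) 0 'e_i ('D_('e_i) (cfun c \o prod_exp g) 0)).1 (DeriveDef dfd erefl) 0 j.
move=> [_ <-]; rewrite -(near_eq_derive _ near0).
have [_ ->] := hd.
have := xi_xfield U 'e_i; move=> /rowP/(_ j); rewrite !mxE => ->.
by rewrite eqxx /= eq_sym.
Qed.

Lemma exp_nbhs (N : set 'rV[R]_d) : nbhs (0 : 'rV[R]_d) N -> nbhs (1%g : G) (prod_exp g @` N).
Proof.
move=> nN; have oT : open [set: 'rV[R]_d] by exact: openT.
have E0 : prod_exp g 0 = 1%g := prod_exp0 hg.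
have sE := prod_exp_smooth lX hg.
have d1 : cdom c (prod_exp g 0) by rewrite E0; exact: uc_dom U.
have uJ : jacobian (cfun c \o prod_exp g) 0 \in unitmx by rewrite prod_exp_jacobian unitmx1.
have [W [V [K [[oW oV] [W0 WN] UV VU _]]]] := manifold_ift oT I sE (uc_atlas U) d1 uJ nN.
have V1 : V 1%g by rewrite -E0; have [] := UV _ W0.
have nV : nbhs (1%g : G) V by exact: open_nbhs_nbhs.
apply: filterS nV => q Vq; have [WK EK] := VU _ Vq.
by exists (K q) => //; have [] := WN _ WK.
Qed.

End ExpNbhs.

(** * The Lie algebra o(p, q) *)

Section Wedge.
Context {R : realType} {p q : nat}.
Notation N := (p + q)%N.
Local Notation J := (Defs.eta R p q).
Implicit Types (x y z : 'cV[R]_N) (X Y Z : 'M[R]_N) (i j : 'I_N).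

Definition sgn_idx (i : 'I_N) : R := if (i < p)%N then -1 else 1.

Lemma sgn_idx2 i : sgn_idx i * sgn_idx i = 1.
Proof. by rewrite /sgn_idx; case: ifP => _; rewrite ?mulrNN mulr1. Qed.

Lemma etaE i j : J i j = sgn_idx i *+ (i == j).
Proof.
rewrite /Defs.eta /sgn_idx; case: (split_ordP i) => a ->; case: (split_ordP j) => b ->.
- by rewrite block_mxEul !mxE ?ltn_ord (inj_eq (@lshift_inj _ _)) mulNrn.
- by rewrite block_mxEur mxE eq_lrshift mulr0n.
- by rewrite block_mxEdl mxE eq_rlshift mulr0n.
- by rewrite block_mxEdr mxE ?ltnNge ?leq_addr (inj_eq (@rshift_inj _ _)).
Qed.

Lemma eta_diag : J = diag_mx (\row_i sgn_idx i).
Proof. by apply/matrixP => i j; rewrite etaE !mxE. Qed.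

Lemma eta_tr : J^T = J.
Proof. by rewrite eta_diag tr_diag_mx. Qed.

Lemma eta_eta : J *m J = 1%:M.
Proof.
rewrite eta_diag mulmx_diag; apply/matrixP => i j; rewrite !mxE sgn_idx2.
by [].
Qed.

Definition bform x y : R := \sum_i sgn_idx i * (x i 0 * y i 0).

Lemma bformE x y : x^T *m J *m y = (bform x y)%:M.
Proof.
rewrite eta_diag; apply/matrixP => a b; rewrite (ord1 a) (ord1 b) mul_mx_diag !mxE eqxx mulr1n.
by apply: eq_bigr => i _; rewrite !mxE mulrA [sgn_idx i * _]mulrC.
Qed.

Lemma bformC x y : bform x y = bform y x.
Proof. by apply: eq_bigr => i _; rewrite [x i 0 * _]mulrC. Qed.

Lemma bformP (a : R) x y z : bform (a *: x + y) z = a * bform x z + bform y z.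
Proof.
rewrite /bform mulr_sumr -big_split; apply: eq_bigr => i _; rewrite !mxE /=; ring.
Qed.

Lemma bformDl x y z : bform (x + y) z = bform x z + bform y z.
Proof. by rewrite -[x]scale1r bformP mul1r scale1r. Qed.

Lemma bform0l z : bform 0 z = 0.
Proof. by apply: big1 => i _; rewrite mxE mul0r mulr0. Qed.

Lemma bformZl (a : R) x z : bform (a *: x) z = a * bform x z.
Proof. by rewrite -[a *: x]addr0 bformP bform0l addr0. Qed.

Lemma bformNl x z : bform (- x) z = - bform x z.
Proof. by rewrite -scaleN1r bformZl mulN1r. Qed.

Lemma bformDr x y z : bform z (x + y) = bform z x + bform z y.
Proof. by rewrite bformC bformDl !(bformC z). Qed.

Lemma bformZr (a : R) x z : bform z (a *: x) = a * bform z x.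
Proof. by rewrite bformC bformZl (bformC z). Qed.

Lemma bformNr x z : bform z (- x) = - bform z x.
Proof. by rewrite bformC bformNl (bformC z). Qed.

Lemma bformBl x y z : bform (x - y) z = bform x z - bform y z.
Proof. by rewrite bformDl bformNl. Qed.

Lemma bformBr x y z : bform z (x - y) = bform z x - bform z y.
Proof. by rewrite bformDr bformNr. Qed.

Definition bE := (bformDl, bformDr, bformZl, bformZr, bformNl, bformNr).

Definition evec i : 'cV[R]_N := delta_mx i 0.

Lemma bform_evec i y : bform (evec i) y = sgn_idx i * y i 0.
Proof.
rewrite /bform (bigD1 i)//= big1 ?addr0; last first.
  by move=> j ji; rewrite mxE (negPf ji) mul0r mulr0.
by rewrite mxE !eqxx mul1r.
Qed.

Lemma bform_evec2 i j : bform (evec i) (evec j) = sgn_idx i *+ (i == j).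
Proof. by rewrite bform_evec mxE eqxx andbT mulr_natr. Qed.

Lemma col_evec x : x = \sum_i x i 0 *: evec i.
Proof.
rewrite [LHS]matrix_sum_delta; apply: eq_bigr => i _.
by rewrite big_ord1.
Qed.

(** The bivector x /\ y as an element of o(p, q), with the action given by [wedge_mul]. *)
Definition wedge x y : 'M[R]_N := x *m (y^T *m J) - y *m (x^T *m J).

Lemma wedge_mul x y z : wedge x y *m z = bform y z *: x - bform x z *: y.
Proof. by rewrite mulmxBl -!mulmxA !(mulmxA _ J) !bformE !mul_mx_scalar. Qed.

Lemma wedgeC x y : wedge y x = - wedge x y.
Proof. by rewrite opprB. Qed.

Lemma wedgexx x : wedge x x = 0.
Proof. exact: subrr. Qed.

Lemma wedgeP (a : R) x y z : wedge (a *: x + y) z = a *: wedge x z + wedge y z.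
Proof.
rewrite /wedge mulmxDl -scalemxAl linearP /= mulmxDl -scalemxAl mulmxDr -scalemxAr.
by rewrite scalerBr opprD addrACA.
Qed.

Lemma wedgeDl x y z : wedge (x + y) z = wedge x z + wedge y z.
Proof. by rewrite -[x]scale1r wedgeP !scale1r. Qed.

Lemma wedge0l z : wedge 0 z = 0.
Proof. by rewrite /wedge trmx0 !mul0mx mulmx0 subrr. Qed.

Lemma wedgeZl (a : R) x z : wedge (a *: x) z = a *: wedge x z.
Proof. by rewrite -[a *: x]addr0 wedgeP wedge0l addr0. Qed.

Lemma wedgeNl x z : wedge (- x) z = - wedge x z.
Proof. by rewrite -scaleN1r wedgeZl scaleN1r. Qed.

Lemma wedgeDr x y z : wedge z (x + y) = wedge z x + wedge z y.
Proof. by rewrite wedgeC wedgeDl opprD -!wedgeC. Qed.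

Lemma wedgeZr (a : R) x z : wedge z (a *: x) = a *: wedge z x.
Proof. by rewrite wedgeC wedgeZl -scalerN -wedgeC. Qed.

Lemma wedgeNr x z : wedge z (- x) = - wedge z x.
Proof. by rewrite -scaleN1r wedgeZr scaleN1r. Qed.

Lemma wedge0r z : wedge z 0 = 0.
Proof. by rewrite wedgeC wedge0l oppr0. Qed.

Lemma o_trJ Z : o_pq R p q Z -> Z^T *m J = - (J *m Z).
Proof. by move=> /eqP; rewrite addr_eq0 => /eqP. Qed.

Lemma wedge_o x y : o_pq R p q (wedge x y).
Proof.
rewrite /o_pq /= /wedge linearB /= !trmx_mul !trmxK eta_tr mulmxBl mulmxBr !mulmxA.
by rewrite addrC addrA subrK subrr.
Qed.

Lemma o_form Z x y : o_pq R p q Z -> bform (Z *m x) y = - bform x (Z *m y).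
Proof.
move=> /o_trJ ZJ.
suff /matrixP/(_ 0 0) : (bform (Z *m x) y)%:M = (- bform x (Z *m y))%:M :> 'M[R]_1.
  by rewrite !mxE eqxx !mulr1n.
by rewrite -bformE trmx_mul -(mulmxA x^T) ZJ mulmxN mulNmx raddfN /= -bformE !mulmxA.
Qed.

Lemma o_isotropic Z x : o_pq R p q Z -> bform x (Z *m x) = 0.
Proof. by move=> oZ; have := o_form x x oZ; rewrite bformC; lra. Qed.

Lemma bracket_wedge Z x y : o_pq R p q Z ->
  mx_bracket R N Z (wedge x y) = wedge (Z *m x) y + wedge x (Z *m y).
Proof.
move=> oZ; rewrite /mx_bracket /wedge !trmx_mul mulmxBr mulmxBl -!mulmxA.
have ZJ := o_trJ oZ.
rewrite ZJ !mulmxN opprB.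
by rewrite opprK addrACA; congr (_ + _); exact: addrC.
Qed.

Lemma o_opq_linear (a : R) X Y : o_pq R p q X -> o_pq R p q Y -> o_pq R p q (a *: X + Y).
Proof.
rewrite /o_pq /= => hX hY.
rewrite linearP /= mulmxDl mulmxDr -scalemxAl -scalemxAr addrACA -scalerDr hX hY.
by rewrite scaler0 addr0.
Qed.

Lemma o_opq_bracket X Y : o_pq R p q X -> o_pq R p q Y -> o_pq R p q (mx_bracket R N X Y).
Proof.
move=> oX oY; have hX := o_trJ oX; have hY := o_trJ oY.
rewrite /o_pq /= /mx_bracket linearB /= !trmx_mul mulmxBl mulmxBr -!mulmxA hX hY.
rewrite !mulmxN !(mulmxA _ J) hX hY !mulNmx !opprK !mulmxA.
by rewrite addrC addrA subrK subrr.
Qed.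

(** An expansion over pairs of basis vectors; each plane is met twice, whence the factor 1/2. *)
Lemma o_wedge_sum Z : o_pq R p q Z ->
  Z = 2^-1 *: \sum_i sgn_idx i *: wedge (Z *m evec i) (evec i).
Proof.
move=> oZ; apply/matrixP => a b; rewrite !mxE summxE.
have E (i : 'I_N) : (sgn_idx i *: wedge (Z *m evec i) (evec i)) a b =
   sgn_idx i * sgn_idx b * (Z a i *+ (i == b) - Z b i *+ (i == a)).
  rewrite /evec -colE !mxE !big_ord1 eta_diag !mul_mx_diag !mxE eqxx.
  rewrite andbT andbT ![b == i]eq_sym ![a == i]eq_sym.
  case: eqP; case: eqP; rewrite ?mulr1n ?mulr0n => _ _; ring.
under eq_bigr do rewrite E.
rewrite (eq_bigr (fun i => (sgn_idx i * sgn_idx b * Z a i) *+ (i == b)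
   - (sgn_idx i * sgn_idx b * Z b i) *+ (i == a))); last first.
  by move=> i _; case: eqP; case: eqP; rewrite ?mulr1n ?mulr0n => _ _; ring.
rewrite sumrB (bigD1 b)//= eqxx mulr1n big1 ?addr0; last first.
  by move=> i ib; rewrite (negPf ib) mulr0n.
rewrite (bigD1 a)//= eqxx mulr1n big1 ?addr0; last first.
  by move=> i ib; rewrite (negPf ib) mulr0n.
rewrite sgn_idx2 mul1r.
have : (Z^T *m J + J *m Z) a b = 0 by rewrite oZ mxE.
rewrite eta_diag mul_mx_diag mul_diag_mx !mxE => h.
have -> : sgn_idx a * sgn_idx b * Z b a = - Z a b.
  have := sgn_idx2 a; have : sgn_idx a * (Z b a * sgn_idx b + sgn_idx a * Z a b) = 0 by rewrite h mulr0.
  rewrite mulrDr mulrA mulrA => h1 h2; rewrite h2 mul1r in h1.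
  by rewrite mulrAC; apply/eqP; rewrite -addr_eq0; apply/eqP.
by lra.
Qed.

End Wedge.

Section SubspaceOfO.
Context {R : realType} {p q : nat}.
Notation N := (p + q)%N.
Local Notation br := (mx_bracket R N).
Local Notation o := (o_pq R p q).

Definition subspace (V : lmodType R) (h : set V) : Prop :=
  h 0 /\ forall (a : R) X Y, h X -> h Y -> h (a *: X + Y).

Lemma subspaceD (V : lmodType R) (h : set V) X Y : subspace h -> h X -> h Y -> h (X + Y).
Proof. by move=> [_ H] hX hY; rewrite -[X]scale1r; exact: H. Qed.

Lemma subspaceZ (V : lmodType R) (h : set V) (a : R) X : subspace h -> h X -> h (a *: X).
Proof. by move=> [h0 H] hX; rewrite -[_ *: _]addr0; exact: H. Qed.

Lemma subspaceN (V : lmodType R) (h : set V) X : subspace h -> h X -> h (- X).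
Proof. by move=> sh hX; rewrite -scaleN1r; exact: subspaceZ. Qed.

Lemma subspaceB (V : lmodType R) (h : set V) X Y : subspace h -> h X -> h Y -> h (X - Y).
Proof. by move=> sh hX hY; apply: subspaceD => //; exact: subspaceN. Qed.

Lemma subspaceZV (V : lmodType R) (h : set V) (a : R) X : subspace h -> a != 0 -> h (a *: X) -> h X.
Proof.
by move=> sh a0 /(subspaceZ a^-1 sh); rewrite scalerA mulVf// scale1r.
Qed.

Lemma subspace_sum (V : lmodType R) (h : set V) (I : Type) (r : seq I) (P : pred I) (F : I -> V) :
  subspace h -> (forall i, P i -> h (F i)) -> h (\sum_(i <- r | P i) F i).
Proof. by move=> sh H; elim/big_ind: _ => //; [exact: sh.1|move=> x y; exact: subspaceD]. Qed.

Lemma bracketC (X Y : 'M[R]_N) : br Y X = - br X Y.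
Proof. by rewrite /mx_bracket opprB. Qed.

Lemma bracketDl (X Y Z : 'M[R]_N) : br (X + Y) Z = br X Z + br Y Z.
Proof. by rewrite /mx_bracket mulmxDl mulmxDr opprD addrACA. Qed.

Lemma bracketZl (a : R) (X Y : 'M[R]_N) : br (a *: X) Y = a *: br X Y.
Proof. by rewrite /mx_bracket -scalemxAl -scalemxAr scalerBr. Qed.

Lemma bracketNl (X Y : 'M[R]_N) : br (- X) Y = - br X Y.
Proof. by rewrite -scaleN1r bracketZl scaleN1r. Qed.

Lemma bracketDr (X Y Z : 'M[R]_N) : br Z (X + Y) = br Z X + br Z Y.
Proof. by rewrite /mx_bracket mulmxDl mulmxDr opprD addrACA. Qed.

Lemma bracketZr (a : R) (X Y : 'M[R]_N) : br Y (a *: X) = a *: br Y X.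
Proof. by rewrite /mx_bracket -scalemxAl -scalemxAr scalerBr. Qed.

Lemma bracketNr (X Y : 'M[R]_N) : br Y (- X) = - br Y X.
Proof. by rewrite -scaleN1r bracketZr scaleN1r. Qed.

Lemma bracket_jacobi (X Y Z : 'M[R]_N) :
  br (br X Y) Z = br X (br Y Z) - br Y (br X Z).
Proof.
rewrite /mx_bracket !mulmxBl !mulmxBr !mulmxA.
move: (X *m Y *m Z) (Y *m X *m Z) (Z *m X *m Y) (Z *m Y *m X) (X *m Z *m Y) (Y *m Z *m X) => a b c d e f.
by apply/matrixP => i j; rewrite !mxE; ring.
Qed.

(** The bracket of [wedge u w] with [wedge v w] is a multiple of [wedge v u] when [u] is orthogonal
    to [v] and [w]; that of [wedge v v'] is [wedge v w] itself; that of [wedge v' w] is a multiple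
    of the boost [wedge v v'] up to [wedge v w]. The multiples are by [bform w w]. *)
Lemma wedge_contract (h : set 'M[R]_N) (v w v' : 'cV[R]_N) : subspace h ->
  bform v v = 0 -> bform v w = 0 -> bform w w != 0 -> bform v v' = 1 -> bform v' v' = 0 ->
  (forall Z, o Z -> h (br Z (wedge v w))) ->
  (forall u, bform v u = 0 -> h (wedge v u)) /\ h (wedge v v').
Proof.
move=> sh vv vw ww vv' v'v' H.
have H1 x y : h (wedge (wedge x y *m v) w + wedge v (wedge x y *m w)).
  by rewrite -(bracket_wedge _ _ (wedge_o x y)); apply: H; exact: wedge_o.
have H2 u : bform v u = 0 -> bform w u = 0 -> h (wedge v u).
  move=> vu wu; have := H1 u w; rewrite !wedge_mul.
  rewrite [bform w v]bformC vw [bform u v]bformC vu [bform u w]bformC wu !scale0r !subr0 wedge0l add0r.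
  by rewrite wedgeZr; exact: subspaceZV.
have vwh : h (wedge v w).
  have := H1 v v'; rewrite !wedge_mul [bform v' v]bformC vv' vv vw scale1r !scale0r !subr0.
  rewrite wedgeZr wedgexx scaler0 addr0; exact.
have H3 u : bform v u = 0 -> h (wedge v u).
  move=> vu; pose c := bform w u / bform w w.
  rewrite -[u](subrK (c *: w)) wedgeDr; apply: subspaceD => //.
    apply: H2; rewrite bformBr bformZr ?vu ?vw ?mulr0 ?subr0// /c divfK// subrr.
    by [].
  by rewrite wedgeZr; exact: subspaceZ.
split => //.
have := H1 v' w; rewrite !wedge_mul [bform v' v]bformC vv' [bform w v]bformC vw.
rewrite scale0r sub0r scale1r wedgeNl wedgexx oppr0 add0r wedgeDr wedgeNr !wedgeZr => h1.
have h2 : h (bform v' w *: wedge v w) by apply: subspaceZ.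
apply: (subspaceZV sh ww).
rewrite -[_ *: _](subrK (bform v' w *: wedge v w)); exact: subspaceD.
Qed.

(** The bracket of [wedge v u] with [wedge v' u'] supplies [wedge u u'] modulo the boost; projecting
    along the hyperbolic plane of [v] and [v'] reduces every bivector to these kinds. *)
Lemma null_spans_o (h : set 'M[R]_N) (v v' : 'cV[R]_N) : subspace h ->
  (forall X Y, h X -> h Y -> h (br X Y)) ->
  bform v v = 0 -> bform v v' = 1 -> bform v' v' = 0 -> h (wedge v v') ->
  (forall u, bform v u = 0 -> bform v' u = 0 -> h (wedge v u)) ->
  (forall u, bform v u = 0 -> bform v' u = 0 -> h (wedge v' u)) ->
  forall Z, o Z -> h Z.
Proof.
move=> sh hb vv vv' v'v' hA hv hv'.
have v'v : bform v' v = 1 by rewrite bformC.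
pose pr (x : 'cV[R]_N) := x - bform x v' *: v - bform x v *: v'.
have prv x : bform v (pr x) = 0.
  by rewrite /pr !bE vv vv' [bform v x]bformC; ring.
have prv' x : bform v' (pr x) = 0.
  by rewrite /pr !bE v'v v'v' [bform v' x]bformC; ring.
have prE x : x = pr x + (bform x v' *: v + bform x v *: v').
  by rewrite /pr -[x - _ - _]addrA -opprD subrK.
clearbody pr.
have hww u u' : bform v u = 0 -> bform v' u = 0 -> bform v u' = 0 -> bform v' u' = 0 -> h (wedge u u').
  move=> vu v'u vu' v'u'.
  have := hb _ _ (hv u vu v'u) (hv' u' vu' v'u').
  rewrite (bracket_wedge _ _ (wedge_o v u)) !wedge_mul vv' vu' [bform u v']bformC v'u.
  rewrite !scale0r sub0r scale1r subr0 wedgeNl wedgeZr => h1.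
  have : h (- (wedge u u')).
    rewrite -[- _](addrK (bform u u' *: wedge v' v)); apply: subspaceB => //.
    by rewrite wedgeC scalerN; apply: subspaceN => //; exact: subspaceZ.
  by move=> /(subspaceN sh); rewrite opprK.
have hvy y : h (wedge v y).
  rewrite (prE y) !wedgeDr !wedgeZr wedgexx scaler0 add0r.
  by apply: (subspaceD sh); [exact: hv|exact: subspaceZ].
have hv'y y : h (wedge v' y).
  rewrite (prE y) !wedgeDr !wedgeZr wedgexx scaler0 addr0.
  apply: (subspaceD sh); first exact: hv'.
  by apply: (subspaceZ _ sh); rewrite wedgeC; exact: subspaceN.
have hxy x y : h (wedge x y).
  rewrite (prE x) !wedgeDl !wedgeZl; apply: (subspaceD sh); last first.
    by apply: (subspaceD sh); apply: (subspaceZ _ sh).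
  rewrite (prE y) !wedgeDr !wedgeZr; apply: (subspaceD sh); first exact: hww.
  by apply: (subspaceD sh); apply: (subspaceZ _ sh); rewrite wedgeC; exact: subspaceN.
move=> Z oZ; rewrite (o_wedge_sum oZ); apply: subspaceZ => //.
by apply: subspace_sum => // i _; exact: subspaceZ.
Qed.

End SubspaceOfO.

(** * Semidefinite forms on o(p, q) with large symmetry *)

Section PsdForm.
Context {R : realType} {p q : nat}.
Notation N := (p + q)%N.
Local Notation br := (mx_bracket R N).
Local Notation o := (o_pq R p q).

(* [b] plays the role of the pulled-back metric on the Lie algebra, [h] of the
   isotropy algebra and [X0] of a vector spanning the kernel of the metric
   modulo [h]. *)
Record lightlike_pair (h : set 'M[R]_N) (b : 'M[R]_N -> 'M[R]_N -> R) (X0 : 'M[R]_N) : Prop :=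
  LightlikePair {
  ll_sub : subspace h;
  ll_o : forall X, h X -> o X;
  ll_br : forall X Y, h X -> h Y -> h (br X Y);
  ll_lin : forall a X Y Z, b (a *: X + Y) Z = a * b X Z + b Y Z;
  ll_sym : forall X Y, b X Y = b Y X;
  ll_pos : forall X, o X -> 0 <= b X X;
  ll_inv : forall X Y Z, h X -> o Y -> o Z -> b (br X Y) Z + b Y (br X Z) = 0;
  ll_null : forall X, h X -> b X X = 0;
  ll_rad : forall X, o X -> b X X = 0 -> exists c, h (X - c *: X0);
  ll_X0 : [/\ o X0, b X0 X0 = 0 & ~ h X0] }.

Variables (h : set 'M[R]_N) (b : 'M[R]_N -> 'M[R]_N -> R) (X0 : 'M[R]_N).
Hypothesis H : lightlike_pair h b X0.

Definition rad : set 'M[R]_N := [set X | o X /\ b X X = 0].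

Lemma ll_linr a X Y Z : b Z (a *: X + Y) = a * b Z X + b Z Y.
Proof. by rewrite ![b Z _](ll_sym H) (ll_lin H). Qed.

Lemma ll_0l Z : b 0 Z = 0.
Proof. by have := ll_lin H (-1) Z Z Z; rewrite scaleN1r addNr mulN1r addNr. Qed.

Lemma ll_Zl a X Z : b (a *: X) Z = a * b X Z.
Proof. by rewrite -[a *: X]addr0 (ll_lin H) ll_0l addr0. Qed.

Lemma ll_Zr a X Z : b Z (a *: X) = a * b Z X.
Proof. by rewrite ![b Z _](ll_sym H) ll_Zl. Qed.

Lemma ll_Dr X Y Z : b Z (X + Y) = b Z X + b Z Y.
Proof. by rewrite -[X]scale1r ll_linr mul1r scale1r. Qed.

Lemma ll_Dl X Y Z : b (X + Y) Z = b X Z + b Y Z.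
Proof. by rewrite ![b _ Z](ll_sym H) ll_Dr. Qed.

Lemma rad_orth X Y : rad X -> o Y -> b X Y = 0.
Proof.
move=> [oX X0'] oY; apply/eqP/negP => /negP n0.
(* Makes the value of the form at [t *: X + Y] equal to -1. *)
pose t := - (b Y Y + 1) / (2 * b X Y).
have := ll_pos H (o_opq_linear t oX oY).
rewrite (ll_lin H) !ll_linr X0' mulr0 add0r (ll_sym H Y X).
have -> : t * b X Y + (t * b X Y + b Y Y) = -1 by rewrite /t; field.
by rewrite lerNr oppr0 ler10.
Qed.

Lemma rad_sub : subspace rad.
Proof.
split; first by split; [rewrite /o_pq /= trmx0 mul0mx mulmx0 addr0|rewrite ll_0l].
move=> a X Y rX rY; have [oX qX] := rX; have [oY qY] := rY; split; first exact: o_opq_linear.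
by rewrite (ll_lin H) !ll_linr qX qY (ll_sym H Y X) (rad_orth rX oY) !(mulr0, addr0).
Qed.

Lemma h_rad X : h X -> rad X.
Proof. by move=> hX; split; [exact: (ll_o H)|exact: (ll_null H)]. Qed.

Lemma h_bracket_rad X Y : h X -> rad Y -> rad (br X Y).
Proof.
move=> hX rY; have oX := ll_o H hX; have oY : o Y by case: rY.
have oXY := o_opq_bracket oX oY.
split=> //; have := ll_inv H hX oY oXY.
by rewrite (rad_orth rY) ?addr0//; exact: o_opq_bracket.
Qed.

(** Modulo [h] the radical is spanned by [X0], which commutes with itself, and bracketing with [h]
    preserves the radical. *)
Lemma rad_bracket X Y : rad X -> rad Y -> rad (br X Y).
Proof.
move=> rX rY; have [oX qX] := rX; have [oY qY] := rY.
have [c hc] := ll_rad H oX qX; have [d hd] := ll_rad H oY qY.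
have rX0 : rad X0 by have [] := ll_X0 H.
rewrite -[X](subrK (c *: X0)) bracketDl; apply: (subspaceD rad_sub); first exact: h_bracket_rad.
rewrite -[Y](subrK (d *: X0)) bracketDr; apply: (subspaceD rad_sub).
  rewrite bracketC; apply: (subspaceN rad_sub); apply: h_bracket_rad => //.
  exact: (subspaceZ _ rad_sub).
by rewrite bracketZl bracketZr /mx_bracket subrr !scaler0; exact: rad_sub.1.
Qed.

(** Both elements are multiples of [X0] modulo [h], hence dependent there. *)
Lemma rad_combination X Y : rad X -> rad Y ->
  exists s t, (s != 0 \/ t != 0) /\ h (s *: X + t *: Y).
Proof.
move=> [oX qX] [oY qY].
have [c hc] := ll_rad H oX qX; have [d hd] := ll_rad H oY qY.
have [c0|c0] := eqVneq c 0.
  exists 1, 0; split; first by left; exact: oner_neq0.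
  by rewrite scale0r addr0 scale1r; move: hc; rewrite c0 scale0r subr0.
exists (- d), c; split; first by right.
have -> : - d *: X + c *: Y = - d *: (X - c *: X0) + c *: (Y - d *: X0).
  rewrite !scalerBr !scalerA mulNr addrACA -[LHS]addr0; congr (_ + _).
  by rewrite mulrC scaleNr opprK subrr.
by apply: (subspaceD (ll_sub H)); apply: (subspaceZ _ (ll_sub H)).
Qed.

(* [ad (v /\ u)] is nilpotent, and skew for the semidefinite form [b]. *)
Lemma null_wedge_rad (v u : 'cV[R]_N) Z : bform v v = 0 -> bform v u = 0 ->
  h (wedge v u) -> o Z -> rad (br (wedge v u) Z).
Proof.
move=> vv vu hY oZ; set Y := wedge v u in hY *.
have oY : o Y := wedge_o v u.
have Yz x : Y *m x = bform u x *: v - bform v x *: u by rewrite wedge_mul.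
clearbody Y.
(* The rank one operator onto [v]: [Y *m Y] is a multiple of it, its products with [Y] vanish on
   both sides, and K Z K = 0 because [Z] is skew. *)
pose K : 'M[R]_N := v *m (v^T *m Defs.eta R p q).
have Kx (x : 'cV[R]_N) : K *m x = bform v x *: v.
  by rewrite -!mulmxA (mulmxA _ _ x) bformE mul_mx_scalar.
clearbody K.
have mxeq (A B : 'M[R]_N) : (forall x : 'cV[R]_N, A *m x = B *m x) -> A = B.
  by move=> E; apply/matrixP => i j; have := congr1 (fun c : 'cV[R]_N => c i 0) (E (evec j));
   rewrite -!colE !mxE.
have YY : Y *m Y = - bform u u *: K.
  apply: mxeq => x; rewrite -mulmxA !Yz -scalemxAl Kx.
  rewrite !bE vv vu [bform u v]bformC vu !mulr0 !subr0 sub0r scale0r subr0 scalerA.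
  by congr (_ *: _); ring.
have KY : K *m Y = 0.
  apply: mxeq => x; rewrite -mulmxA Kx Yz mul0mx !bE vv vu !mulr0 subr0 scale0r.
  by [].
have YK : Y *m K = 0.
  by apply: mxeq => x; rewrite -mulmxA Kx mul0mx -scalemxAr Yz vv [bform u v]bformC vu !scale0r subr0 scaler0.
have KZK : K *m Z *m K = 0.
  by apply: mxeq => x; rewrite mul0mx -!mulmxA Kx Kx -scalemxAr bformZr (o_isotropic _ oZ) mulr0 scale0r.
pose S A := br Y A.
(* As Y^3 = 0, the fourth power of ad Y sends [Z] to 6 Y^2 Z Y^2, a multiple of K Z K. *)
have S4 : S (S (S (S Z))) = 0.
  pose k := - bform u u.
  have E2 : S (S Z) = k *: (K *m Z + Z *m K) - 2 *: (Y *m Z *m Y).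
    rewrite /S /mx_bracket mulmxBr mulmxBl (mulmxA Y Y) -(mulmxA Z Y) YY -scalemxAl -scalemxAr.
    rewrite (mulmxA Y Z); move: (Y *m Z *m Y) (K *m Z) (Z *m K) => U V W.
    by apply/matrixP => i j; rewrite !mxE /k; ring.
  have E3 : S (S (S Z)) = (3 * k) *: (Y *m Z *m K - K *m Z *m Y).
    rewrite E2 /S /mx_bracket mulmxBr mulmxBl -!scalemxAl -!scalemxAr mulmxDr mulmxDl.
    rewrite -(mulmxA Z K) KY mulmx0 (mulmxA Y K) YK mul0mx !(mulmxA Y) YY -(mulmxA (Y *m Z)) YY.
    rewrite -!scalemxAl -!scalemxAr.
    move: (K *m Z *m Y) (Y *m Z *m K) => U V.
    by apply/matrixP => i j; rewrite !mxE /k; ring.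
  rewrite E3 /S /mx_bracket -scalemxAr -scalemxAl mulmxBr mulmxBl !(mulmxA Y) YY YK !mul0mx.
  rewrite -(mulmxA (Y *m Z)) KY mulmx0 -(mulmxA (K *m Z)) YY -!scalemxAl -scalemxAr KZK.
  by rewrite !(subr0, scaler0).
have oS A : o A -> o (S A) by exact: o_opq_bracket.
have skew A B : o A -> o B -> b (S A) B = - b A (S B).
  by move=> oA oB; apply/eqP; rewrite -addr_eq0; apply/eqP; exact: (ll_inv H).
have oS1 := oS _ oZ; have oS2 := oS _ oS1; have oS3 := oS _ oS2.
(* Skewness turns b (S^2 Z, S^2 Z) into b (Z, S^4 Z) = 0. Being in the radical, S^2 Z is orthogonal
   to [Z], and skewness once more gives b (S Z, S Z) = 0. *)
have r2 : rad (S (S Z)).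
  split => //; rewrite skew// skew// S4 opprK (ll_sym H) ll_0l.
  by [].
split; first exact: oS1.
by rewrite -/(S Z) skew// (ll_sym H) (rad_orth r2) ?oppr0.
Qed.

Lemma null_wedge_contract (v w v' : 'cV[R]_N) :
  bform v v = 0 -> bform v w = 0 -> bform w w != 0 -> bform v v' = 1 -> bform v' v' = 0 ->
  h (wedge v w) ->
  (forall u, bform v u = 0 -> rad (wedge v u)) /\ rad (wedge v v').
Proof.
move=> vv vw ww vv' v'v' hvw; apply: (wedge_contract rad_sub vv vw ww vv' v'v') => Z oZ.
by rewrite bracketC; apply: (subspaceN rad_sub); exact: null_wedge_rad.
Qed.

End PsdForm.

(** * The isotropy algebra in a null frame *)

Section NullFrame.
Context {R : realType} {p q : nat}.
Notation N := (p + q)%N.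
Local Notation br := (mx_bracket R N).
Local Notation o := (o_pq R p q).

(** A hyperbolic pair with two orthonormal spacelike vectors orthogonal to it: two, so that some
    combination of [wedge v f] and [wedge v g] falls into a subspace of codimension one. *)
Record null_frame (v v' f g : 'cV[R]_N) : Prop := NullFrame {
  nf_v : [/\ bform v v = 0, bform v' v' = 0 & bform v v' = 1];
  nf_f : [/\ bform f f = 1, bform g g = 1 & bform f g = 0];
  nf_vf : bform v f = 0 /\ bform v' f = 0;
  nf_vg : bform v g = 0 /\ bform v' g = 0 }.

Lemma null_frame_swap v v' f g : null_frame v v' f g -> null_frame v' v f g.
Proof.
move=> [[h1 h2 h3] h4 [h5 h6] [h7 h8]]; split => //; split => //.
by rewrite bformC.
Qed.

(* Modulo [h] the adjoint action is one dimensional, and [v /\ w] is an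
   eigenvector of [v /\ v']. *)
Lemma codim1_contract (h : set 'M[R]_N) X0 v v' f g : null_frame v v' f g ->
  subspace h -> (forall X Y, h X -> h Y -> h (br X Y)) -> o X0 ->
  (forall X, o X -> exists c, h (X - c *: X0)) ->
  (forall u, bform v u = 0 -> h (wedge v u)) /\ h (wedge v v').
Proof.
move=> [[vv v'v' vv'] [ff gg fg] [vf v'f] [vg v'g]] sh hb oX0 hc.
(* In codimension one a combination of [wedge v f] and [wedge v g] lies in [h]; it is [wedge v w]
   for the same combination [w] of [f] and [g], which is spacelike. *)
have [w [vw v'w ww hvw]] : exists w, [/\ bform v w = 0, bform v' w = 0,
    bform w w != 0 & h (wedge v w)].
  have [c hc1] := hc _ (wedge_o v f); have [d hd] := hc _ (wedge_o v g).
  have [c0|c0] := eqVneq c 0.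
    exists f; split => //; first by rewrite ff oner_neq0.
    by move: hc1; rewrite c0 scale0r subr0.
  exists (- d *: f + c *: g); split.
  - by rewrite !bE vf vg !mulr0 addr0.
  - by rewrite !bE v'f v'g !mulr0 addr0.
  - rewrite !bE [bform g f]bformC ff gg fg !mulr0 addr0 add0r !mulr1 mulrNN.
    by rewrite gt_eqF// -!expr2 ltr_wpDl ?sqr_ge0// exprn_even_gt0.
  - rewrite wedgeDr !wedgeZr.
    have -> : - d *: wedge v f + c *: wedge v g =
       - d *: (wedge v f - c *: X0) + c *: (wedge v g - d *: X0).
      move: (wedge v f) (wedge v g) => U V.
      by apply/matrixP => i j; rewrite !mxE; ring.
    by apply: (subspaceD sh); apply: (subspaceZ _ sh).
have v'v : bform v' v = 1 by rewrite bformC.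
pose A := wedge v v'.
have oA : o A := wedge_o v v'.
have Av : A *m v = v by rewrite wedge_mul v'v vv scale1r scale0r subr0.
have Aw : A *m w = 0 by rewrite wedge_mul v'w vw !scale0r subr0.
have AY : br A (wedge v w) = wedge v w.
  by rewrite bracket_wedge// Av Aw wedge0r addr0.
apply: (wedge_contract sh vv vw ww vv' v'v') => Z oZ.
set Y := wedge v w in hvw AY *.
have [a hA] := hc _ oA.
(* If [a] is nonzero, the boost can replace [X0] as a complement of [h], and its action on [Y] is
   known. If [a] is 0, the boost is in [h] and [X0] is handled by the Jacobi identity. *)
have [a0|a0] := eqVneq a 0; last first.
  have [c hZ] := hc _ oZ.
  have -> : Z = (Z - c *: X0) - (c / a) *: (A - a *: X0) + (c / a) *: A.
    rewrite scalerBr scalerA divfK// opprB.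
    by apply/matrixP => i j; rewrite !mxE; ring.
  rewrite bracketDl bracketZl AY; apply: (subspaceD sh); last exact: (subspaceZ _ sh).
  by apply: hb => //; apply: (subspaceB sh) => //; exact: (subspaceZ _ sh).
move: hA; rewrite a0 scale0r subr0 => hA.
have [c hZ] := hc _ oZ.
suff hX : h (br X0 Y).
  rewrite -[Z](subrK (c *: X0)) bracketDl bracketZl; apply: (subspaceD sh); last exact: (subspaceZ _ sh).
  exact: hb.
have [c2 h2] := hc _ (o_opq_bracket oX0 (wedge_o v w)).
have [c3 h3] := hc _ (o_opq_bracket oX0 oA).
(* The Jacobi identity for [X0], [A] and [Y] with [A, Y] = Y, arranged so that every term on the
   right is in [h]. *)
have E : c2 *: X0 = br (br X0 A - c3 *: X0) Y + c3 *: (br X0 Y - c2 *: X0)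
    + br A (br X0 Y - c2 *: X0) - c2 *: (br X0 A - c3 *: X0) - (br X0 Y - c2 *: X0).
  have J := bracket_jacobi X0 A Y; rewrite AY in J.
  have -> : br (br X0 A - c3 *: X0) Y = br X0 Y - br A (br X0 Y) - c3 *: br X0 Y.
    by rewrite bracketDl bracketNl bracketZl J.
  have -> : br A (br X0 Y - c2 *: X0) = br A (br X0 Y) + c2 *: br X0 A.
    by rewrite bracketDr bracketNr bracketZr [br A X0]bracketC scalerN opprK.
  move: (br A (br X0 Y)) (br X0 Y) (br X0 A) => U V W.
  by apply/matrixP => i j; rewrite !mxE; ring.
have h4 : h (c2 *: X0).
  rewrite E; apply: (subspaceB sh) => //; apply: (subspaceB sh); last exact: (subspaceZ _ sh).
  apply: (subspaceD sh); last exact: hb.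
  by apply: (subspaceD sh); [exact: hb|exact: (subspaceZ _ sh)].
by rewrite -[br _ _](subrK (c2 *: X0)); exact: (subspaceD sh).
Qed.

(** The contraction applies to [v] and, the frame being symmetric, to [v']. So o(p, q) has no
    subalgebra of codimension one, which in [rad_proper] keeps the radical from being everything. *)
Lemma codim1_full (h : set 'M[R]_N) X0 v v' f g : null_frame v v' f g ->
  subspace h -> (forall X Y, h X -> h Y -> h (br X Y)) -> o X0 ->
  (forall X, o X -> exists c, h (X - c *: X0)) -> forall Z, o Z -> h Z.
Proof.
move=> F sh hb oX0 hc.
have [h1 h2] := codim1_contract F sh hb oX0 hc.
have [h3 _] := codim1_contract (null_frame_swap F) sh hb oX0 hc.
have [[vv v'v' vv'] _ _ _] := F.
by apply: (null_spans_o sh hb vv vv' v'v' h2) => u vu v'u; [exact: h1|exact: h3].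
Qed.

Section Isotropy.
Variables (h : set 'M[R]_N) (b : 'M[R]_N -> 'M[R]_N -> R) (X0 : 'M[R]_N).
Hypothesis H : lightlike_pair h b X0.
Variables (v v' f g : 'cV[R]_N).
Hypothesis F : null_frame v v' f g.
Variable (w : 'cV[R]_N).
Hypotheses (vw : bform v w = 0) (ww : bform w w != 0) (hvw : h (wedge v w)).
Local Notation rad := (rad b).

Let vv : bform v v = 0. Proof. by case: (nf_v F). Qed.
Let v'v' : bform v' v' = 0. Proof. by case: (nf_v F). Qed.
Let vv' : bform v v' = 1. Proof. by case: (nf_v F). Qed.
Let v'v : bform v' v = 1. Proof. by rewrite bformC. Qed.
Let sr : subspace rad := rad_sub H.

Lemma rad_proper : ~ (forall X, o X -> rad X).
Proof.
move=> ro; have [oX0 _] := ll_X0 H; apply.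
apply: (codim1_full F (ll_sub H) (ll_br H) oX0) => // X oX.
by have [_] := ro _ oX; exact: (ll_rad H).
Qed.

Lemma rad_null u : bform v u = 0 -> rad (wedge v u).
Proof. by case: (null_wedge_contract H vv vw ww vv' v'v' hvw) => H1 _; exact: H1. Qed.

Lemma rad_boost v2 : bform v v2 = 1 -> bform v2 v2 = 0 -> rad (wedge v v2).
Proof. by move=> vv2 v2v2; case: (null_wedge_contract H vv vw ww vv2 v2v2 hvw). Qed.

Lemma rad_dual_false v2 : bform v v2 = 1 -> bform v2 v2 = 0 ->
  ~ (forall u, bform v u = 0 -> bform v2 u = 0 -> rad (wedge v2 u)).
Proof.
move=> vv2 v2v2 H2; apply: rad_proper.
apply: (null_spans_o sr _ vv vv2 v2v2 (rad_boost vv2 v2v2)) => //.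
- exact: (rad_bracket H).
- by move=> u vu _; exact: rad_null.
Qed.

Lemma boost_bracket v2 u : bform v v2 = 1 -> bform v2 v2 = 0 -> bform v u = 0 -> bform v2 u = 0 ->
  br (wedge v v2) (wedge v2 u) = - wedge v2 u.
Proof.
move=> vv2 v2v2 vu v2u; rewrite bracket_wedge; last exact: wedge_o.
rewrite !wedge_mul vv2 v2v2 vu v2u !scale0r scale1r sub0r subrr wedge0r addr0.
by rewrite wedgeNl.
Qed.

(** The elements [wedge v2 u] are eigenvectors of the boost for the eigenvalue -1. Were the boost in
    [h], invariance of [b] would make them null, and the radical would be everything. *)
Lemma boost_notin v2 : bform v v2 = 1 -> bform v2 v2 = 0 -> ~ h (wedge v v2).
Proof.
move=> vv2 v2v2 hA; apply: (rad_dual_false vv2 v2v2) => u vu v2u.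
have oY := wedge_o v2 u; split => //.
have := ll_inv H hA oY oY; rewrite boost_bracket// -scaleN1r (ll_Zl H) (ll_Zr H); lra.
Qed.

Let A := wedge v v'.

Lemma rad_mod_boost X : rad X -> exists c, h (X - c *: A).
Proof.
move=> rX; have rA : rad A := rad_boost vv' v'v'.
have [s [t [st hc]]] := rad_combination H rX rA.
have [s0|s0] := eqVneq s 0.
  case: st => [|t0]; first by rewrite s0 eqxx.
  move: hc; rewrite s0 scale0r add0r => /(subspaceZV (ll_sub H) t0).
  by move=> /(boost_notin vv' v'v').
exists (- (t / s)); apply: (subspaceZV (ll_sub H) s0).
by rewrite scalerBr scalerA mulrN scaleNr opprK mulrC divfK.
Qed.

(** If [wedge v u] were [c] times the boost modulo [h] with [c] nonzero, replacing [v'] by a null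
    vector v' - u / c + s v would give a boost lying in [h], against [boost_notin]. *)
Lemma h_null_wedge u : bform v u = 0 -> h (wedge v u).
Proof.
move=> vu; have [c hc] := rad_mod_boost (rad_null vu).
have [c0|c0] := eqVneq c 0; first by move: hc; rewrite c0 scale0r subr0.
(* The value of [s] for which the new dual vector is null. *)
pose s := bform v' u / c - bform u u / (2 * c ^+ 2).
case: (@boost_notin (v' - c^-1 *: u + s *: v)).
- by rewrite !bE vv vu vv' !mulr0 subr0 addr0.
- rewrite !bE v'v' v'v vv [bform u v']bformC [bform v u]vu [bform u v]bformC vu vv' /s.
  by field.
- apply: (subspaceZV (ll_sub H) (a := - c)); first by rewrite oppr_eq0.
  rewrite !wedgeDr wedgeNr !wedgeZr wedgexx scaler0 addr0 scalerBr scalerA mulNr divff//.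
  by rewrite scaleN1r opprK addrC scaleNr.
Qed.

(** Up to sign and a multiple of the boost, this is the bracket of [wedge v u], an element of [h],
    with [wedge v' u']. *)
Lemma rad_wedge_perp u u' : bform v u = 0 -> bform v' u = 0 -> bform v u' = 0 -> bform v' u' = 0 ->
  rad (wedge u u').
Proof.
move=> vu v'u vu' v'u'.
have := null_wedge_rad H vv vu (h_null_wedge vu) (wedge_o v' u').
rewrite (bracket_wedge _ _ (wedge_o v u)) !wedge_mul vv' vu' [bform u v']bformC v'u.
rewrite !scale0r sub0r scale1r subr0 wedgeNl wedgeZr => h1.
have : rad (- (wedge u u')).
  rewrite -[- _](addrK (bform u u' *: wedge v' v)); apply: subspaceB => //.
  rewrite wedgeC scalerN; apply: subspaceN => //; apply: subspaceZ => //.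
  exact: rad_boost.
by move=> /(subspaceN sr); rewrite opprK.
Qed.

(** One such element with [u] not null would give every [wedge v' u'], by bracketing with
    [wedge u u'], which moves [u] to a multiple of [u'] up to a multiple of [u]. *)
Lemma rad_opposite u : bform v u = 0 -> bform v' u = 0 -> bform u u != 0 -> ~ rad (wedge v' u).
Proof.
move=> vu v'u uu ru; apply: (rad_dual_false vv' v'v') => u' vu' v'u'.
have := rad_bracket H (rad_wedge_perp vu v'u vu' v'u') ru.
rewrite (bracket_wedge _ _ (wedge_o u u')) !wedge_mul.
rewrite [bform u' v']bformC v'u' [bform u v']bformC v'u !scale0r subr0 wedge0l add0r.
rewrite wedgeDr wedgeNr !wedgeZr => h1.
apply: (subspaceZV sr uu); rewrite -[_ *: _]opprK; apply: (subspaceN sr).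
rewrite -[- _](addKr (bform u' u *: wedge v' u)) addrC; apply: (subspaceB sr) => //.
exact: subspaceZ.
Qed.

(** Excludes p = 2. The bivector C = e /\ f is in the radical, so C - c A is in [h] for some [c],
    with A the boost. For s = 1 or -1 it has v' /\ (e + s f) as eigenvector for the eigenvalue s +
    c. One of these is nonzero, so invariance of [b] puts that eigenvector in the radical;
    bracketing with f /\ g gives v' /\ g there, against [rad_opposite]. *)
Lemma no_second_timelike e : bform e e = -1 ->
  bform v e = 0 -> bform v' e = 0 -> bform e f = 0 -> bform e g = 0 -> False.
Proof.
move=> ee ve v'e ef eg.
have [_ [ff gg fg] [vf v'f] [vg v'g]] := F.
have [c hc] := rad_mod_boost (rad_wedge_perp ve v'e vf v'f).
pose C := wedge e f.
have key (s : R) : s * s = 1 -> s + c != 0 -> False.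
  move=> ss sc; pose u := e + s *: f.
  have vu : bform v u = 0 by rewrite !bE ve vf mulr0 addr0.
  have v'u : bform v' u = 0 by rewrite !bE v'e v'f mulr0 addr0.
  have brE : br (C - c *: A) (wedge v' u) = (s + c) *: wedge v' u.
    rewrite bracketDl bracketNl bracketZl (boost_bracket vv' v'v' vu v'u).
    rewrite (bracket_wedge _ _ (wedge_o e f)) !wedge_mul.
    rewrite [bform f v']bformC v'f [bform e v']bformC v'e !scale0r subr0 wedge0l add0r.
    rewrite /u !bE [bform f e]bformC ef ee ff mulr0 addr0 add0r mulr1 scalerN opprK scalerDl.
    congr (_ + _); rewrite -[s *: wedge _ _]wedgeZr; congr (wedge _ _).
    by rewrite scaleN1r opprK scalerDr scalerA ss scale1r addrC.
  have oY := wedge_o v' u.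
  have ru : rad (wedge v' u).
    split => //; have := ll_inv H hc oY oY; rewrite brE (ll_Zl H) (ll_Zr H) => h1.
    apply/eqP; have : (s + c) * b (wedge v' u) (wedge v' u) = 0 by lra.
    by move/eqP; rewrite mulf_eq0 (negPf sc).
  apply: (rad_opposite vg v'g); first by rewrite gg oner_neq0.
  have s0 : - s != 0.
    by rewrite oppr_eq0; apply/eqP => s0; move: ss; rewrite s0 mul0r => /eqP; rewrite eq_sym oner_eq0.
  have := rad_bracket H (rad_wedge_perp vf v'f vg v'g) ru.
  rewrite (bracket_wedge _ _ (wedge_o f g)) !wedge_mul.
  rewrite [bform f v']bformC v'f [bform g v']bformC v'g !scale0r subr0 wedge0l add0r.
  rewrite /u !bE [bform f e]bformC ef [bform g e]bformC eg [bform g f]bformC fg ff.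
  rewrite mulr0 !add0r mulr1 scale0r sub0r -scaleNr wedgeZr; exact: subspaceZV.
have [c1|c1] := eqVneq (1 + c) 0; last by apply: (key 1) => //; rewrite mulr1.
apply: (key (-1)); first by rewrite mulrNN mulr1.
have -> : c = -1 by lra.
by rewrite -opprD oppr_eq0 -[1 + 1]/(2%:R) pnatr_eq0.
Qed.

(** Some e1 /\ e2 - c A is in [h]; on the plane of v' /\ e1 and v' /\ e2 it acts as a rotation
    generator plus [c] times the identity. Invariance of a semidefinite form that is nonzero on this
    plane forces c = 0, and the form is then a multiple of the Euclidean one. *)
Lemma h_wedge_perp e1 e2 : bform v e1 = 0 -> bform v' e1 = 0 -> bform v e2 = 0 -> bform v' e2 = 0 ->
  bform e1 e1 = 1 -> bform e2 e2 = 1 -> bform e1 e2 = 0 ->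
  [/\ h (wedge e1 e2), b (wedge v' e1) (wedge v' e2) = 0 &
     b (wedge v' e1) (wedge v' e1) = b (wedge v' e2) (wedge v' e2)].
Proof.
move=> v1 v'1 v2 v'2 e11 e22 e12.
have [c hc] := rad_mod_boost (rad_wedge_perp v1 v'1 v2 v'2).
have o1 := wedge_o v' e1; have o2 := wedge_o v' e2.
have E x : bform v x = 0 -> bform v' x = 0 -> br (wedge e1 e2 - c *: A) (wedge v' x) =
    bform e2 x *: wedge v' e1 - bform e1 x *: wedge v' e2 + c *: wedge v' x.
  move=> vx v'x; rewrite bracketDl bracketNl bracketZl (boost_bracket vv' v'v' vx v'x).
  rewrite (bracket_wedge _ _ (wedge_o e1 e2)) !wedge_mul.
  rewrite [bform e1 v']bformC v'1 [bform e2 v']bformC v'2 !scale0r subr0 wedge0l add0r.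
  by rewrite scalerN opprK wedgeDr wedgeNr !wedgeZr.
have E1 : br (wedge e1 e2 - c *: A) (wedge v' e1) = (-1) *: wedge v' e2 + c *: wedge v' e1.
  by rewrite E// e11 [bform e2 e1]bformC e12 scale0r sub0r scaleN1r scale1r.
have E2 : br (wedge e1 e2 - c *: A) (wedge v' e2) = 1 *: wedge v' e1 + c *: wedge v' e2.
  by rewrite E// e22 e12 scale0r subr0.
have := ll_inv H hc o1 o1; have := ll_inv H hc o2 o2; have := ll_inv H hc o1 o2.
rewrite E1 E2 !(ll_lin H) !(ll_linr H) !(ll_Zl H) !(ll_Zr H) (ll_sym H (wedge v' e2) (wedge v' e1)).
have p1 := ll_pos H o1; have p2 := ll_pos H o2.
have n1 : b (wedge v' e1) (wedge v' e1) != 0.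
  apply/eqP => n1; apply: (rad_opposite v1 v'1); first by rewrite e11 oner_neq0.
  by split.
move: (b (wedge v' e1) (wedge v' e1)) (b (wedge v' e2) (wedge v' e2)) (b (wedge v' e1) (wedge v' e2)) p1 p2 n1 hc => x y z p1 p2 n1 hc k1 k2 k3.
have c0 : c = 0.
  have : c * (x + y) = 0 by lra.
  move/eqP; rewrite mulf_eq0 => /orP[/eqP//|]; rewrite paddr_eq0// (negPf n1).
  by [].
rewrite c0 in hc k1 k2 k3; rewrite scale0r subr0 in hc; split => //; lra.
Qed.

End Isotropy.
End NullFrame.

(** * Limits of rescaled isotropy elements *)

Lemma closed_zero_set (R : realType) (n : nat) (f : 'rV[R]_n -> R^o) :
  smooth_on setT f -> closed [set z | f z = 0].
Proof.
move=> sf.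
have -> : [set z | f z = 0] = f @^-1` [set 0] by [].
apply: closed_comp => [z _|]; first exact: (smooth_on_cont sf (z := z)).
by apply: accessible_closed_set1; apply: hausdorff_accessible; exact: norm_hausdorff.
Qed.

Section LimitOperator.
Context {R : realType} {p q : nat}.
Notation N := (p + q)%N.
Local Notation J := (Defs.eta R p q).
Local Notation o := (o_pq R p q).
Variables (h : set 'M[R]_N) (b : 'M[R]_N -> 'M[R]_N -> R) (X0 : 'M[R]_N).
Hypothesis H : lightlike_pair h b X0.

Lemma ll_suml (I : Type) (r : seq I) (P : pred I) (F : I -> 'M[R]_N) Y :
  b (\sum_(i <- r | P i) F i) Y = \sum_(i <- r | P i) b (F i) Y.
Proof.
apply: (big_morph (fun X => b X Y)) => [X Z|]; [exact: (ll_Dl H)|exact: (ll_0l H)].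
Qed.

Lemma ll_expand X Y : b X Y = \sum_i \sum_j X i j * b (delta_mx i j) Y.
Proof.
rewrite {1}(matrix_sum_delta X) ll_suml; apply: eq_bigr => i _.
by rewrite ll_suml; apply: eq_bigr => j _; rewrite (ll_Zl H).
Qed.

Lemma smooth_on_ll n (F : 'rV[R]_n -> 'M[R]_N) :
  smooth_on setT F -> smooth_on setT (fun z => b (F z) (F z) : R^o).
Proof.
have oT : open [set: 'rV[R]_n] by exact: openT.
move=> /(smooth_on_mxP _ oT) sF.
have S1 (f : 'I_N -> 'rV[R]_n -> R^o) : (forall i, smooth_on setT (f i)) ->
    smooth_on setT (fun z => \sum_i f i z : R^o).
  by move=> sf; apply: smooth_on_sum.
have E : smooth_on setT (fun z => \sum_i (\sum_j (F z i j *
    (\sum_i' (\sum_j' F z i' j' * b (delta_mx i' j') (delta_mx i j) : R^o) : R^o) : R^o) : R^o) : R^o).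
  apply: (S1) => i; apply: (S1) => j; apply: (smooth_onM oT).
    exact: sF.
  apply: (S1) => i'; apply: (S1) => j'; apply: (smooth_onM oT).
    exact: sF.
  exact: smooth_on_cst.
apply: (smooth_on_eq oT _ E) => z _; rewrite ll_expand.
apply: eq_bigr => i _; apply: eq_bigr => j _; congr (_ * _).
by rewrite (ll_sym H) ll_expand.
Qed.

(** As J P^T J is the inverse of P, this reads P (x /\ P^-1 w) P^-1 = P x /\ w. Both P x and P^-1 w
    = J P^T J w are linear in P, so the invariance of [b] written this way is homogeneous and
    survives rescaling. *)
Lemma conj_wedge (P : 'M[R]_N) x w : P^T *m J *m P = J ->
  P *m wedge x (J *m P^T *m J *m w) *m (J *m P^T *m J) = wedge (P *m x) w.
Proof.
move=> hP.
have PiP : J *m P^T *m J *m P = 1%:M by rewrite -!mulmxA (mulmxA P^T) hP eta_eta.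
have PPi := mulmx1C PiP.
have JPi : J *m (J *m P^T *m J) = P^T *m J by rewrite !mulmxA eta_eta mul1mx.
have PiJ : (J *m P^T *m J)^T *m J *m (J *m P^T *m J) = J.
  rewrite !trmx_mul !eta_tr trmxK -!mulmxA (mulmxA J J) eta_eta mul1mx !mulmxA.
  by rewrite -!mulmxA !mulmxA -(mulmxA _ P^T) -(mulmxA J P) -!mulmxA (mulmxA J P^T) PPi mulmx1.
move: (J *m P^T *m J) PPi JPi PiJ => Q PPi JPi PiJ.
rewrite -mulmxA JPi in PiJ.
rewrite /wedge mulmxBr mulmxBl (mulmxA P (Q *m w)) (mulmxA P Q) PPi mul1mx.
rewrite !trmx_mul -!(mulmxA _ _ Q) JPi; congr (_ - _).
  by rewrite -!mulmxA PiJ.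
by rewrite -!mulmxA.
Qed.

Variable (P : set 'M[R]_N).
Hypothesis P_o : forall A, P A -> A^T *m J *m A = J.
Hypothesis P_b : forall A X, P A -> o X ->
  b (A *m X *m (J *m A^T *m J)) (A *m X *m (J *m A^T *m J)) = b X X.
Hypothesis P_unbounded : forall C : R, exists2 A, P A & C < `|mxvec A|.

(* Rescaled elements of [P] accumulate at a nonzero [Q] with totally isotropic
   image. *)
Lemma limit_operator : exists Q : 'M[R]_N, [/\ Q != 0, Q^T *m J *m Q = 0 &
  forall x w : 'cV[R]_N, Q^T *m J *m w = 0 -> rad b (wedge (Q *m x) w)].
Proof.
pose F1 (x w : 'cV[R]_N) (z : 'rV[R]_(N * N)) := wedge (vec_mx z *m x) w.
pose F2 (x w : 'cV[R]_N) (z : 'rV[R]_(N * N)) := wedge x (J *m (vec_mx z)^T *m J *m w).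
have oT : open [set: 'rV[R]_(N * N)] by exact: openT.
have sv : smooth_on setT (@vec_mx R N N).
  apply/(smooth_on_mxP _ oT) => i j.
  apply: (smooth_on_eq oT _ (@smooth_on_coord R _ setT (mxvec_index i j))) => z _.
  by rewrite mxE.
have strmx m1 m2 (f : 'rV[R]_(N * N) -> 'M[R]_(m1, m2)) : smooth_on setT f -> smooth_on setT (fun z => (f z)^T).
  move=> /(smooth_on_mxP _ oT) sf; apply/(smooth_on_mxP _ oT) => i j.
  by apply: (smooth_on_eq oT _ (sf j i)) => z _; rewrite mxE.
have sw (f1 f2 : 'rV[R]_(N * N) -> 'cV[R]_N) : smooth_on setT f1 -> smooth_on setT f2 ->
    smooth_on setT (fun z : 'rV[R]_(N * N) => wedge (f1 z) (f2 z)).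
  move=> s1 s2; have sM g1 g2 : smooth_on setT g1 -> smooth_on setT g2 ->
      smooth_on setT (fun z : 'rV[R]_(N * N) => (g1 z : 'cV[R]_N) *m ((g2 z : 'cV[R]_N)^T *m J)).
    move=> h1 h2; apply: (smooth_on_mulmx oT h1); apply: (smooth_on_mulmx oT); first exact: strmx.
    exact: smooth_on_cstmx.
  have /(smooth_on_mxP _ oT) h1 := sM _ _ s1 s2.
  have /(smooth_on_mxP _ oT) h2 := sM _ _ s2 s1.
  apply/(smooth_on_mxP _ oT) => i j.
  apply: (smooth_on_eq oT _ (smooth_onB oT (h1 i j) (h2 i j))) => z _.
  by rewrite !mxE.
have sF1 x w : smooth_on setT (F1 x w).
  apply: (sw); last exact: smooth_on_cstmx.
  by apply: (smooth_on_mulmx oT sv); exact: smooth_on_cstmx.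
have sF2 x w : smooth_on setT (F2 x w).
  apply: (sw); first exact: smooth_on_cstmx.
  apply: (smooth_on_mulmx oT); last exact: smooth_on_cstmx.
  apply: (smooth_on_mulmx oT); last exact: smooth_on_cstmx.
  apply: (smooth_on_mulmx oT); first exact: smooth_on_cstmx.
  exact: strmx.
(* Unit matrices satisfying the invariance of [b] in the form of [conj_wedge]. Homogeneity puts the
   rescaled elements of [P] in [K], and the condition is closed, so [K] is compact. *)
pose K := [set z : 'rV[R]_(N * N) | `|z| = 1] `&`
  \bigcap_(xw in [set: 'cV[R]_N * 'cV[R]_N])
    [set z | b (F1 xw.1 xw.2 z) (F1 xw.1 xw.2 z) - b (F2 xw.1 xw.2 z) (F2 xw.1 xw.2 z) = 0].
have Kc : compact K.
  apply: bounded_closed_compact.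
    exists 1; split; first exact: num_real.
    by move=> M M1 z [/= z1 _]; rewrite z1 ltW.
  apply: closedI.
    have -> : [set z : 'rV[R]_(N * N) | `|z| = 1] = (fun z : 'rV[R]_(N * N) => `|z|) @^-1` [set 1] by [].
    apply: closed_comp => [z _|]; first exact: norm_continuous.
    by apply: accessible_closed_set1; apply: hausdorff_accessible; exact: norm_hausdorff.
  apply: closed_bigI => -[x w] _ /=; apply: closed_zero_set.
  exact: (smooth_onB oT (smooth_on_ll (sF1 x w)) (smooth_on_ll (sF2 x w))).
have KP A : P A -> A != 0 -> K (`|mxvec A|^-1 *: mxvec A).
  move=> PA A0; have nA : `|mxvec A| != 0 by rewrite normr_eq0 mxvec_eq0.
  split; first by rewrite /= normrZ normfV normr_id mulVf.
  move=> [x w] _ /=; rewrite /F1 /F2 linearZ /= mxvecK linearZ /= -!scalemxAl -!scalemxAr -!scalemxAl.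
  rewrite wedgeZl wedgeZr !(ll_Zl H) !(ll_Zr H) -(conj_wedge _ _ (P_o PA)) P_b ?subrr//.
  exact: wedge_o.
have [A0 PA0 A0n] := P_unbounded 0.
(* A minimizer of the size of z^T J z on [K]. At a rescaled element A of [P] this size is |J| /
   |A|^2, so unboundedness forces the minimum to be 0. *)
have [z0 Kz0 z0min] : exists2 z, z \in K & forall t, t \in K ->
   `|mxvec ((vec_mx z)^T *m J *m vec_mx z)| <= `|mxvec ((vec_mx t)^T *m J *m vec_mx t)|.
  apply: (@EVT_min_rV R (N * N) (fun z : 'rV[R]_(N * N) => `|mxvec ((vec_mx z)^T *m J *m vec_mx z)|) K _ Kc).
    by exists (`|mxvec A0|^-1 *: mxvec A0); apply: KP => //; apply: contraL A0n => /eqP->; rewrite linear0 normr0 ltxx.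
  apply: continuous_subspaceT => z.
  apply: (@continuous_comp _ _ _ (fun z : 'rV[R]_(N * N) => mxvec ((vec_mx z)^T *m J *m vec_mx z)) (fun u => `|u|)); last exact: norm_continuous.
  have sm : smooth_on setT (fun z : 'rV[R]_(N * N) => (vec_mx z)^T *m J *m vec_mx z).
    exact: (smooth_on_mulmx oT (smooth_on_mulmx oT (strmx _ _ _ sv) (@smooth_on_cstmx R _ N N _ J)) sv).
  apply/continuous_mxP => i j; rewrite (ord1 i); case/mxvec_indexP: j => j1 j2.
  have := (continuous_mxP _ _).1 (smooth_on_cont sm (z := z) I) j1 j2.
  rewrite [X in _ -> {for z, continuous X}](_ : _ = fun x0 : 'rV[R]_(N * N) =>
    ((vec_mx x0)^T *m J *m vec_mx x0) j1 j2)//.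
  by apply/funext => t; rewrite mxvecE.
have [z01 z0b] : K z0 by rewrite -inE.
have Q0 : (vec_mx z0)^T *m J *m vec_mx z0 = 0.
  apply/eqP; rewrite -mxvec_eq0 -normr_eq0; apply/negPn/negP => n0.
  set c := `|_| in n0 z0min.
  have c0 : 0 < c by rewrite lt_def n0 normr_ge0.
  have [A PA An] := P_unbounded (Num.max 1 (`|mxvec J| / c)).
  have A1 : 1 < `|mxvec A| by apply: le_lt_trans An; rewrite le_max lexx.
  have AJ : `|mxvec J| / c < `|mxvec A| by apply: le_lt_trans An; rewrite le_max lexx orbT.
  have A0' : A != 0 by apply: contraTneq A1 => ->; rewrite linear0 normr0 ltNge ler01.
  have := z0min (`|mxvec A|^-1 *: mxvec A); rewrite inE => /(_ (KP _ PA A0')).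
  have -> : vec_mx (`|mxvec A|^-1 *: mxvec A) = `|mxvec A|^-1 *: A by rewrite linearZ /= mxvecK.
  have -> : (`|mxvec A|^-1 *: A)^T = `|mxvec A|^-1 *: A^T by rewrite linearZ.
  rewrite -!scalemxAl -!scalemxAr P_o// scalerA.
  have -> a : mxvec (a *: J) = a *: mxvec J by rewrite linearZ.
  rewrite normrZ normrM !normfV !normr_id -invfM leNgt => /negP; apply.
  rewrite ltr_pdivrMl; last by rewrite mulr_gt0// (lt_trans ltr01).
  rewrite ltr_pdivrMr// in AJ; apply: (lt_trans AJ); rewrite mulrC [ltRHS]mulrC ltr_pM2l//.
  by rewrite ltr_pMl// (lt_trans ltr01).
exists (vec_mx z0); split => //.
  by rewrite vec_mx_eq0 -normr_eq0 z01 oner_neq0.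
move=> x w Qw; split; first exact: wedge_o.
have := z0b (x, w) I; rewrite /= /F1 /F2 => /eqP; rewrite subr_eq0 => /eqP ->.
by rewrite -!mulmxA (mulmxA _ J) Qw mulmx0 wedge0r (ll_0l H).
Qed.

Lemma gram_eq0 m n (M : 'M[R]_(m, n)) : M^T *m M = 0 -> M = 0.
Proof.
move=> MM; apply/matrixP => i j; rewrite mxE.
have : (M^T *m M) j j = 0 by rewrite MM mxE.
rewrite mxE => /eqP; rewrite psumr_eq0; last by move=> k _; rewrite mxE -expr2 sqr_ge0.
by move=> /allP/(_ i (mem_index_enum _)) /=; rewrite mxE -expr2 sqrf_eq0 => /eqP.
Qed.

Lemma eta_block m n (Au : 'M[R]_(p, m)) (Al : 'M[R]_(q, m)) (Bu : 'M[R]_(p, n)) (Bl : 'M[R]_(q, n)) :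
  (col_mx Au Al)^T *m J *m col_mx Bu Bl = Al^T *m Bl - Au^T *m Bu.
Proof.
rewrite -mulmxA /Defs.eta mul_block_col !mul0mx addr0 add0r mul1mx mulNmx mul1mx.
by rewrite tr_col_mx mul_row_col mulmxN addrC.
Qed.

(** The image of the limit operator is totally isotropic, of dimension r <= p <= 2, and the
    spacelike factor contains at least q - r independent vectors orthogonal to it. Either r = 2,
    with two null vectors v and one w, or r = 1, with one v and two vectors w. Both cases give two
    bivectors of the radical sharing a factor, so the combination in [h] is again a single
    [wedge v w]. *)
Lemma isotropic_pair : (p <= 2)%N -> (3 <= q)%N -> exists v w : 'cV[R]_N,
  [/\ v != 0, bform v v = 0, bform v w = 0, bform w w != 0 & h (wedge v w)].
Proof.
move=> p2 q3; have [Q [Q0 QJQ Qrad]] := limit_operator.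
pose B := col_base Q; pose C := row_base Q.
have BC : B *m C = Q := mulmx_base Q.
have CVC : C *m pinvmx C = 1%:M := mulmxVp (row_base_free Q).
have BE : B = Q *m pinvmx C by rewrite -[LHS]mulmx1 -CVC mulmxA BC.
have VBB : pinvmx B *m B = 1%:M := mulVpmx (col_base_full Q).
have BJB : B^T *m J *m B = 0.
  rewrite BE; move: (pinvmx C) => D.
  by rewrite trmx_mul -!mulmxA (mulmxA J) (mulmxA Q^T) (mulmxA Q^T) QJQ mul0mx mulmx0.
have Brad x w : B^T *m J *m w = 0 -> rad b (wedge (B *m x) w).
  move=> Bw; rewrite BE -mulmxA; apply: Qrad.
  by rewrite -BC trmx_mul -!mulmxA (mulmxA B^T) Bw mulmx0.
have r0 : (0 < \rank Q)%N by rewrite lt0n mxrank_eq0.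
move: (\rank Q) r0 B C BC CVC BE VBB BJB Brad => r r0 B C BC CVC BE VBB BJB Brad.
pose Bu := usubmx B; pose Bl := dsubmx B.
have Bul : B = col_mx Bu Bl by rewrite vsubmxK.
have Bgram : Bl^T *m Bl = Bu^T *m Bu.
  by apply/eqP; rewrite -subr_eq0 -eta_block -Bul BJB.
(* By [Bgram], a vector of the image with vanishing timelike components has vanishing spacelike
   ones, so the image injects into the timelike factor. *)
have rp : (r <= p)%N.
  suff : row_full Bu by move=> /eqP <-; exact: rank_leq_row.
  rewrite -cokermx_eq0; set K := cokermx Bu.
  have BuK : Bu *m K = 0 by apply: mulmx_coker.
  have BlK : Bl *m K = 0.
    apply: gram_eq0; rewrite trmx_mul -!mulmxA (mulmxA Bl^T) Bgram -mulmxA BuK !mulmx0.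
    by [].
  by rewrite -[K]mul1mx -VBB -mulmxA Bul mul_col_mx BuK BlK col_mx0 mulmx0.
(* Its rows are the spacelike vectors orthogonal to the image, at least q - r of them. *)
pose K := row_base (kermx Bl).
have KBl : K *m Bl = 0 by apply/eqP; rewrite -sub_kermx /K eq_row_base.
have KVK : K *m pinvmx K = 1%:M := mulmxVp (row_base_free _).
have kr : (q - r <= \rank (kermx Bl))%N by rewrite mxrank_ker leq_sub2l// rank_leq_col.
move: (\rank (kermx Bl)) kr K KBl KVK => k kr K KBl KVK.
pose W (y : 'rV[R]_k) : 'cV[R]_N := col_mx 0 (y *m K)^T.
have BW y : B^T *m J *m W y = 0.
  by rewrite Bul /W eta_block mulmx0 subr0 -trmx_mul -mulmxA KBl mulmx0 trmx0.
have bBB x : bform (B *m x) (B *m x) = 0.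
  have : (bform (B *m x) (B *m x))%:M = 0 :> 'M[R]_1.
    by rewrite -bformE trmx_mul -!mulmxA (mulmxA J) (mulmxA B^T) (mulmxA B^T) BJB mul0mx mulmx0.
  by move=> /matrixP/(_ 0 0); rewrite !mxE eqxx mulr1n.
have bBW x y : bform (B *m x) (W y) = 0.
  have : (bform (B *m x) (W y))%:M = 0 :> 'M[R]_1.
    by rewrite -bformE trmx_mul -!mulmxA (mulmxA B^T) BW mulmx0.
  by move=> /matrixP/(_ 0 0); rewrite !mxE eqxx mulr1n.
have bWW y : y != 0 -> bform (W y) (W y) != 0.
  apply: contra => /eqP W0.
  have : (bform (W y) (W y))%:M = 0 :> 'M[R]_1 by rewrite W0 raddf0.
  rewrite -bformE /W eta_block trmx0 mul0mx subr0 => /gram_eq0 /(congr1 trmx).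
  rewrite trmxK trmx0 => h1.
  by rewrite -[y]mulmx1 -KVK mulmxA h1 mul0mx.
have B0 x : x != 0 -> B *m x != 0.
  by apply: contra => /eqP Bx; rewrite -[x]mul1mx -VBB -mulmxA Bx mulmx0.
have WD s t y y' : W (s *: y + t *: y') = s *: W y + t *: W y'.
  rewrite /W mulmxDl -!scalemxAl linearD !linearZ /= !scale_col_mx add_col_mx.
  by rewrite !scaler0 addr0.
have ev0 m (i j : 'I_m) (s t : R) : i != j -> s != 0 \/ t != 0 ->
    s *: delta_mx i 0 + t *: delta_mx j 0 != 0 :> 'cV[R]_m.
  move=> ij st; apply/eqP => /matrixP E; case: st => /eqP; apply.
    by have := E i 0; rewrite !mxE !eqxx (negPf ij) mulr1 mulr0 addr0.
  by have := E j 0; rewrite !mxE !eqxx eq_sym (negPf ij) mulr1 mulr0 add0r.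
have ev0' m (i j : 'I_m) (s t : R) : i != j -> s != 0 \/ t != 0 ->
    s *: delta_mx 0 i + t *: delta_mx 0 j != 0 :> 'rV[R]_m.
  move=> ij st; apply/eqP => /matrixP E; case: st => /eqP; apply.
    by have := E 0 i; rewrite !mxE !eqxx (negPf ij) mulr1 mulr0 addr0.
  by have := E 0 j; rewrite !mxE !eqxx eq_sym (negPf ij) mulr1 mulr0 add0r.
have [r1|r1] := leqP r 1; last first.
  have k0 : (0 < k)%N by apply: leq_trans kr; rewrite subn_gt0 (leq_ltn_trans rp)// (leq_ltn_trans p2).
  pose i0 : 'I_r := Ordinal r0; pose i1 : 'I_r := Ordinal r1.
  pose y : 'rV[R]_k := delta_mx 0 (Ordinal k0).
  have y0 : y != 0.
    by apply/eqP => /matrixP/(_ 0 (Ordinal k0)); rewrite !mxE !eqxx => /eqP; rewrite oner_eq0.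
  have [s [t [st hc]]] := rad_combination H (Brad (delta_mx i0 0) _ (BW y)) (Brad (delta_mx i1 0) _ (BW y)).
  exists (B *m (s *: delta_mx i0 0 + t *: delta_mx i1 0)), (W y); split => //.
  - by apply: B0; exact: ev0.
  - exact: bWW.
  - by rewrite mulmxDr -!scalemxAr wedgeDl !wedgeZl.
have k1 : (1 < k)%N by apply: leq_trans kr; rewrite ltn_subRL addn1 (leq_trans _ q3)// ltnS.
have k0 : (0 < k)%N by exact: ltnW.
pose i0 : 'I_k := Ordinal k0; pose i1 : 'I_k := Ordinal k1.
pose x : 'cV[R]_r := delta_mx (Ordinal r0) 0.
have x0 : x != 0.
  by apply/eqP => /matrixP/(_ (Ordinal r0) 0); rewrite !mxE !eqxx => /eqP; rewrite oner_eq0.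
have [s [t [st hc]]] := rad_combination H (Brad x _ (BW (delta_mx 0 i0))) (Brad x _ (BW (delta_mx 0 i1))).
exists (B *m x), (W (s *: delta_mx 0 i0 + t *: delta_mx 0 i1)); split => //.
- exact: B0.
- by apply: bWW; exact: ev0'.
- by rewrite WD wedgeDr !wedgeZr.
Qed.

End LimitOperator.

(** * Normal forms of a null vector and of the isotropy algebra *)

Section Normalization.
Context {R : realType}.

(** The reflection in the hyperplane orthogonal to x - c e_0, where c is the length of x, or the
    identity when that vector is 0. *)
Lemma householder n (x : 'cV[R]_n.+1) : exists (A : 'M[R]_n.+1) (c : R),
  [/\ A^T *m A = 1%:M, A *m x = c *: delta_mx 0 0 , 0 <= c & (c ^+ 2)%:M = x^T *m x].
Proof.
pose dot (y z : 'cV[R]_n.+1) := (y^T *m z) 0 0.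
have dotE y z : y^T *m z = (dot y z)%:M.
  by apply/matrixP => i j; rewrite (ord1 i) (ord1 j) [RHS]mxE eqxx mulr1n.
have dotC y z : dot y z = dot z y.
  by rewrite /dot -[y^T *m z]trmxK trmx_mul trmxK mxE.
have dotB y z t : dot (y - z) t = dot y t - dot z t.
  by rewrite /dot linearB mulmxBl !mxE.
have dotZ a y t : dot (a *: y) t = a * dot y t.
  by rewrite /dot linearZ /= -scalemxAl mxE.
have dot_ge0 y : 0 <= dot y y.
  by rewrite /dot mxE sumr_ge0// => i _; rewrite mxE -expr2 sqr_ge0.
pose c := Num.sqrt (dot x x); have c2 : c ^+ 2 = dot x x by rewrite sqr_sqrtr.
pose e : 'cV[R]_n.+1 := delta_mx 0 0.
have ee : dot e e = 1.
  rewrite /dot mxE (bigD1 0)//= big1 ?addr0; last by move=> i i0; rewrite !mxE (negPf i0) mul0r.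
  by rewrite !mxE eqxx mulr1.
pose u := x - c *: e.
have [u0|u0] := eqVneq (dot u u) 0.
  exists 1%:M, c; split; rewrite ?trmx1 ?mulmx1 ?mul1mx ?sqrtr_ge0//; last by rewrite c2 dotE.
  have /gram_eq0 : u^T *m u = 0 by rewrite dotE u0 raddf0.
  by move=> /eqP; rewrite subr_eq0 => /eqP.
exists (1%:M - (2 / dot u u) *: (u *m u^T)), c; split; rewrite ?sqrtr_ge0//; last by rewrite c2 dotE.
  have -> : (1%:M - (2 / dot u u) *: (u *m u^T))^T = 1%:M - (2 / dot u u) *: (u *m u^T).
    by rewrite linearB /= trmx1 linearZ /= trmx_mul trmxK.
  rewrite mulmxBl mul1mx mulmxBr mulmx1 -!scalemxAl -scalemxAr -mulmxA (mulmxA u^T) dotE.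
  rewrite mul_scalar_mx -scalemxAr !scalerA -mulrA divfK//.
  by apply/matrixP => i j; rewrite !mxE; ring.
rewrite mulmxBl mul1mx -scalemxAl -mulmxA dotE mul_mx_scalar scalerA.
have -> : 2 / dot u u * dot u x = 1.
  have E : dot u u = 2 * dot u x.
    rewrite {1}/u dotB dotZ (dotC x) (dotC e) /u !dotB !dotZ ee -c2 (dotC e x); ring.
  by rewrite E in u0 *; field; move: u0; rewrite mulf_eq0 negb_or => /andP[].
by rewrite scale1r opprB addrC subrK.
Qed.

End Normalization.

Section Conj.
Context {R : realType} {p q : nat}.
Notation N := (p + q)%N.
Local Notation J := (Defs.eta R p q).
Local Notation o := (o_pq R p q).
Local Notation br := (mx_bracket R N).

Definition orth (A : 'M[R]_N) : Prop := A^T *m J *m A = J.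
(** The inverse on O(p, q), by a formula that is linear in [A] and makes sense for all matrices. *)
Definition oinv (A : 'M[R]_N) : 'M[R]_N := J *m A^T *m J.
Definition cj (A X : 'M[R]_N) : 'M[R]_N := A *m X *m oinv A.

Lemma oinvK A : oinv (oinv A) = A.
Proof.
rewrite /oinv !trmx_mul !eta_tr trmxK -!mulmxA eta_eta mulmx1 mulmxA eta_eta mul1mx.
by [].
Qed.

Lemma oinvM A B : oinv (A *m B) = oinv B *m oinv A.
Proof. by rewrite /oinv trmx_mul -!mulmxA (mulmxA J J) eta_eta mul1mx. Qed.

Lemma orth_mulV A : orth A -> oinv A *m A = 1%:M.
Proof. by move=> oA; rewrite /oinv -!mulmxA (mulmxA _^T) oA eta_eta. Qed.

Lemma orth_mul A : orth A -> A *m oinv A = 1%:M.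
Proof. by move=> /orth_mulV/mulmx1C. Qed.

Lemma orthE A : oinv A *m A = 1%:M -> orth A.
Proof.
by move=> h; rewrite /orth -[RHS]mulmx1 -h /oinv !mulmxA eta_eta mul1mx.
Qed.

Lemma orth_oinv A : orth A -> orth (oinv A).
Proof. by move=> oA; apply: orthE; rewrite oinvK orth_mul. Qed.

Lemma orthM A B : orth A -> orth B -> orth (A *m B).
Proof.
move=> oA oB; apply: orthE; rewrite oinvM mulmxA -(mulmxA (oinv B) (oinv A) A).
by rewrite !orth_mulV// mulmx1 orth_mulV.
Qed.

Lemma cjM A B X : cj (A *m B) X = cj A (cj B X).
Proof. by rewrite /cj oinvM !mulmxA. Qed.

Lemma cj1 X : cj 1%:M X = X.
Proof. by rewrite /cj /oinv trmx1 mulmx1 eta_eta mul1mx mulmx1. Qed.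

Lemma cjK A X : orth A -> cj (oinv A) (cj A X) = X.
Proof. by move=> oA; rewrite -cjM orth_mulV// cj1. Qed.

Lemma cjVK A X : orth A -> cj A (cj (oinv A) X) = X.
Proof. by move=> oA; rewrite -cjM orth_mul// cj1. Qed.

Lemma cj_linear A (a : R) X Y : cj A (a *: X + Y) = a *: cj A X + cj A Y.
Proof. by rewrite /cj mulmxDr mulmxDl -scalemxAr -scalemxAl. Qed.

Lemma cj0 A : cj A 0 = 0.
Proof. by rewrite /cj mulmx0 mul0mx. Qed.

Lemma cj_bracket A X Y : orth A -> cj A (br X Y) = br (cj A X) (cj A Y).
Proof.
move=> oA; rewrite /cj /mx_bracket mulmxBr mulmxBl.
move: (oinv A) (orth_mulV oA) => B BA.
by rewrite -!mulmxA !(mulmxA B A) BA !mul1mx.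
Qed.

Lemma cj_wedge A x y : orth A -> cj A (wedge x y) = wedge (A *m x) (A *m y).
Proof.
move=> oA; have := conj_wedge x (A *m y) oA.
by rewrite (mulmxA (_ *m J) A) -/(oinv A) orth_mulV// mul1mx.
Qed.

Lemma cj_o A X : orth A -> o X -> o (cj A X).
Proof.
move=> oA oX; rewrite /o_pq /= /cj /oinv !trmx_mul !eta_tr trmxK !mulmxA.
have ZJ := o_trJ oX.
have e : J *m A *m J *m X^T *m A^T *m J = - (J *m (A *m X *m J *m A^T *m J)).
  have JXT : J *m X^T = - (X *m J).
    by rewrite -[J *m _]mulmx1 -eta_eta mulmxA -(mulmxA J X^T) ZJ mulmxN mulNmx mulmxA eta_eta mul1mx.
  by rewrite -!mulmxA (mulmxA J X^T) JXT !mulNmx !mulmxN !mulmxA.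
by rewrite e !mulmxA addNr.
Qed.

Lemma orth_bform A x y : orth A -> bform (A *m x) (A *m y) = bform x y.
Proof.
move=> oA; have : (bform (A *m x) (A *m y))%:M = (bform x y)%:M :> 'M[R]_1.
  by rewrite -!bformE trmx_mul -!mulmxA (mulmxA J) (mulmxA A^T) (mulmxA A^T) oA !mulmxA.
by move=> /matrixP/(_ 0 0); rewrite !mxE eqxx !mulr1n.
Qed.

Lemma lightlike_conj h b X0 A : lightlike_pair h b X0 -> orth A ->
  lightlike_pair [set X | h (cj A X)] (fun X Y => b (cj A X) (cj A Y)) (cj (oinv A) X0).
Proof.
move=> H oA.
have oV X : o (cj A X) -> o X.
  by move=> /(cj_o (orth_oinv oA)); rewrite cjK.
split.
- split; first by rewrite /= cj0; exact: (ll_sub H).1.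
  by move=> a X Y; rewrite /= cj_linear; apply: (ll_sub H).2.
- by move=> X /(ll_o H)/oV.
- by move=> X Y hX hY; rewrite /= cj_bracket//; exact: (ll_br H).
- by move=> a X Y Z; rewrite cj_linear (ll_lin H).
- by move=> X Y; exact: (ll_sym H).
- by move=> X oX; apply: (ll_pos H); exact: cj_o.
- by move=> X Y Z hX oY oZ; rewrite !cj_bracket//; apply: (ll_inv H) => //; exact: cj_o.
- by move=> X; exact: (ll_null H).
- move=> X oX bX; have [c hc] := ll_rad H (cj_o oA oX) bX; exists c.
  by rewrite /= addrC -scaleNr cj_linear cjVK// addrC scaleNr.
- have [oX0 bX0 hX0] := ll_X0 H; split; rewrite ?cjVK//.
    by apply: cj_o => //; exact: orth_oinv.
  by rewrite /= cjVK.
Qed.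

End Conj.

Section StandardForm.
Context {R : realType} {p q : nat}.
Notation N := (p.+1 + q.+1)%N.
Local Notation J := (Defs.eta R p.+1 q.+1).
Local Notation o := (o_pq R p.+1 q.+1).

(** With [vdual], the hyperbolic pair built from the first timelike and the first spacelike basis
    vector; the factor 1/2 in [vdual] normalizes their product to 1. *)
Definition vnull : 'cV[R]_N := evec (lshift _ 0) + evec (rshift _ 0).
Definition vdual : 'cV[R]_N := 2^-1 *: (evec (rshift _ 0) - evec (lshift _ 0)).
Definition sevec (i : 'I_q) : 'cV[R]_N := evec (rshift _ (lift 0 i)).

Lemma sgn_l (i : 'I_p.+1) : sgn_idx (lshift q.+1 i) = -1 :> R.
Proof. by rewrite /sgn_idx /= ltn_ord. Qed.

Lemma sgn_r (i : 'I_q.+1) : sgn_idx (rshift p.+1 i) = 1 :> R.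
Proof. by rewrite /sgn_idx /= ltnNge leq_addr. Qed.

Lemma bform_sevec i j : bform (sevec i) (sevec j) = (i == j)%:R.
Proof.
rewrite bform_evec2 sgn_r (inj_eq (@rshift_inj _ _)) (inj_eq lift_inj).
by case: eqP.
Qed.

Lemma bform_vnull_sevec i : bform vnull (sevec i) = 0.
Proof.
rewrite /vnull bformDl !bform_evec2 eq_lrshift (inj_eq (@rshift_inj _ _)).
by rewrite -(inj_eq val_inj) /= !mulr0n addr0.
Qed.

Lemma bform_vdual_sevec i : bform vdual (sevec i) = 0.
Proof.
rewrite /vdual bformZl bformBl !bform_evec2 eq_lrshift (inj_eq (@rshift_inj _ _)).
by rewrite -(inj_eq val_inj) /= !mulr0n subr0 mulr0.
Qed.

Lemma bform_vnull : [/\ bform vnull vnull = 0, bform vdual vdual = 0 & bform vnull vdual = 1].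
Proof.
rewrite /vnull /vdual; split; rewrite !bE !bform_evec2 sgn_l sgn_r !eqxx eq_lrshift eq_rlshift !mulr0n !mulr1n; by field.
Qed.

Lemma standard_frame (f g : 'I_q) : f != g -> null_frame vnull vdual (sevec f) (sevec g).
Proof.
move=> fg; split; first exact: bform_vnull.
- by rewrite !bform_sevec !eqxx (negPf fg).
- by rewrite bform_vnull_sevec bform_vdual_sevec.
- by rewrite bform_vnull_sevec bform_vdual_sevec.
Qed.

(* Householder reflections in both factors bring a null vector to [vnull]. *)
Lemma null_normal_form (v : 'cV[R]_N) : v != 0 -> bform v v = 0 ->
  exists A c, [/\ orth A, c != 0 & A *m v = c *: vnull].
Proof.
move=> v0 vv.
have [Ap [c [oAp Ap_v c0 cE]]] := householder (usubmx v).
have [Aq [d [oAq Aq_v d0 dE]]] := householder (dsubmx v).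
have vE : v = col_mx (usubmx v) (dsubmx v) by rewrite vsubmxK.
have cd : c = d.
  apply/eqP; rewrite -(eqrXn2 (n := 2))//; apply/eqP.
  have : (bform v v)%:M = 0 :> 'M[R]_1 by rewrite vv raddf0.
  rewrite -bformE vE eta_block -cE -dE => /matrixP/(_ 0 0); rewrite !mxE eqxx !mulr1n.
  by move/eqP; rewrite subr_eq0 => /eqP.
pose A : 'M[R]_N := block_mx Ap 0 0 Aq.
have oA : orth A.
  rewrite /orth /A {1}/Defs.eta tr_block_mx !mulmx_block !trmx0 !mul0mx !mulmx0 !addr0 !add0r.
  by rewrite !mul0mx mulmxN mulmx1 mulNmx oAp mulmx1 oAq.
have Av : A *m v = c *: vnull.
  rewrite vE /A mul_block_col !mul0mx addr0 add0r Ap_v Aq_v -cd -scale_col_mx; congr (_ *: _).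
  rewrite /vnull /evec; apply/matrixP => i j; rewrite (ord1 j); case: (split_ordP i) => k ->.
    by rewrite col_mxEu !mxE (inj_eq (@lshift_inj _ _)) eq_lrshift /= addr0.
  by rewrite col_mxEd !mxE (inj_eq (@rshift_inj _ _)) eq_rlshift /= add0r.
exists A, c; split => //; apply: contra v0 => /eqP c00.
by rewrite -[v]mul1mx -(orth_mulV oA) -mulmxA Av c00 scale0r mulmx0.
Qed.

Lemma evec_l0 : evec (lshift q.+1 0) = 2^-1 *: vnull - vdual :> 'cV[R]_N.
Proof. by rewrite /vnull /vdual; apply/matrixP => i j; rewrite !mxE; field. Qed.

Lemma evec_r0 : evec (rshift p.+1 0) = 2^-1 *: vnull + vdual :> 'cV[R]_N.
Proof. by rewrite /vnull /vdual; apply/matrixP => i j; rewrite !mxE; field. Qed.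

End StandardForm.

Section Lorentz.
Context {R : realType} {q : nat}.
Notation N := (1 + q.+1)%N.
Local Notation J := (Defs.eta R 1 q.+1).
Local Notation o := (o_pq R 1 q.+1).
Local Notation vnull := (@vnull R 0 q).
Local Notation vdual := (@vdual R 0 q).
Local Notation sevec := (@sevec R 0 q).

(** This is [o_wedge_sum] in the null frame, where [vnull] and [vdual] are dual to each other. *)
Lemma o_frame_sum (Z : 'M[R]_N) : o Z ->
  Z = 2^-1 *: (wedge (Z *m vdual) vnull + wedge (Z *m vnull) vdual + \sum_i wedge (Z *m sevec i) (sevec i)).
Proof.
move=> oZ; rewrite [LHS](o_wedge_sum oZ); congr (_ *: _).
rewrite big_split_ord /= big_ord1 big_ord_recl /= addrA.
rewrite (@sgn_l R 0 q) (@sgn_r R 0 q) (@evec_l0 R 0 q) (@evec_r0 R 0 q).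
rewrite scaleN1r scale1r; congr (_ + _).
  move: (vnull) (vdual) => a b.
  rewrite mulmxBr mulmxDr -!scalemxAr; move: (Z *m a) (Z *m b) => x y.
  rewrite !wedgeDl !wedgeDr !wedgeNl !wedgeNr !wedgeZl !wedgeZr.
  move: (wedge x a) (wedge y a) (wedge x b) (wedge y b) => c d e f.
  by apply/matrixP => i j; rewrite !mxE; field.
by apply: eq_bigr => i _; rewrite (@sgn_r R 0 q) scale1r.
Qed.

Lemma cV_frame (x : 'cV[R]_N) :
  x = bform vdual x *: vnull + bform vnull x *: vdual + \sum_i bform (sevec i) x *: sevec i.
Proof.
rewrite {1}(col_evec x) big_split_ord /= big_ord1 big_ord_recl /= addrA; congr (_ + _).
  rewrite /vdual /vnull !bE !bform_evec (@sgn_l R 0 q) (@sgn_r R 0 q).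
  by apply/matrixP => i j; rewrite !mxE; field.
by apply: eq_bigr => i _; rewrite bform_evec (@sgn_r R 0 q) mul1r.
Qed.

(** Elements that kill [vnull] are combinations of the bivectors assumed in [h]. Conversely, let X
    in [h] send [vnull] to al v + y. Up to an element that kills [vnull], X is al times the boost
    minus v' /\ y, so v' /\ y is in the radical; this forces y = 0, and then al = 0 since the boost
    is not in [h]. *)
Lemma null_stabilizer h b X0 : lightlike_pair h b X0 ->
  (forall u, bform vnull u = 0 -> h (wedge vnull u)) ->
  (forall i j, i != j -> h (wedge (sevec i) (sevec j))) ->
  ~ h (wedge vnull vdual) -> rad b (wedge vnull vdual) ->
  (forall u, bform vnull u = 0 -> bform vdual u = 0 -> bform u u != 0 -> ~ rad b (wedge vdual u)) ->
  forall X, o X -> h X <-> X *m vnull = 0.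
Proof.
move=> H hv hw nA rA ru.
have sh := ll_sub H; have sr := rad_sub H.
have [nn dd nd] := @bform_vnull R 0 q.
have dn : bform vdual vnull = 1 by rewrite bformC.
have hZ Z : o Z -> Z *m vnull = 0 -> h Z.
  move=> oZ Zv; rewrite (o_frame_sum oZ) Zv wedge0l addr0; apply: (subspaceZ _ sh).
  apply: (subspaceD sh).
    rewrite wedgeC; apply: (subspaceN sh); apply: hv.
    by have := o_form vnull vdual oZ; rewrite Zv bform0l; lra.
  apply: subspace_sum => // i _.
  have nZ : bform vnull (Z *m sevec i) = 0.
    by have := o_form vnull (sevec i) oZ; rewrite Zv bform0l; lra.
  rewrite (cV_frame (Z *m sevec i)) nZ scale0r addr0 wedgeDl wedgeZl.
  apply: (subspaceD sh); first by apply: (subspaceZ _ sh); apply: hv; exact: bform_vnull_sevec.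
  have -> : wedge (\sum_j bform (sevec j) (Z *m sevec i) *: sevec j) (sevec i) =
      \sum_j bform (sevec j) (Z *m sevec i) *: wedge (sevec j) (sevec i).
    rewrite (big_morph (fun x => wedge x (sevec i)) (fun x y => wedgeDl x y (sevec i)) (wedge0l _)).
    by apply: eq_bigr => j _; rewrite wedgeZl.
  apply: subspace_sum => // j _; apply: (subspaceZ _ sh).
  have [->|ji] := eqVneq j i; last exact: hw.
  by rewrite wedgexx; exact: sh.1.
move=> X oX; split; last exact: hZ.
move=> hX; set x := X *m vnull.
pose al := bform vdual x.
pose y : 'cV[R]_N := \sum_i bform (sevec i) x *: sevec i.
have ny : bform vnull y = 0.
  rewrite bformC /y (big_morph (fun x => bform x vnull) (fun x y => bformDl x y vnull) (bform0l _)).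
  by apply: big1 => i _; rewrite bformZl [bform (sevec i) vnull]bformC bform_vnull_sevec mulr0.
have dy : bform vdual y = 0.
  rewrite bformC /y (big_morph (fun x => bform x vdual) (fun x y => bformDl x y vdual) (bform0l _)).
  by apply: big1 => i _; rewrite bformZl [bform (sevec i) vdual]bformC bform_vdual_sevec mulr0.
have yi i : bform y (sevec i) = bform (sevec i) x.
  rewrite /y (big_morph (fun x => bform x (sevec i)) (fun x y => bformDl x y (sevec i)) (bform0l _)).
  rewrite (bigD1 i)//= big1 ?addr0; last first.
    by move=> j ji; rewrite bformZl bform_sevec (negPf ji) mulr0.
  by rewrite bformZl bform_sevec eqxx mulr1.
have xE : x = al *: vnull + y.
  by rewrite {1}(cV_frame x) [bform vnull x](o_isotropic _ oX) scale0r addr0.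
clearbody y.
pose Z := al *: wedge vnull vdual - wedge vdual y.
have Zv : Z *m vnull = x.
  rewrite xE mulmxBl -scalemxAl !wedge_mul dn nn [bform y _]bformC ny !scale0r subr0 sub0r opprK.
  by rewrite !scale1r.
have oZ : o Z.
  rewrite /Z -scaleN1r addrC; apply: o_opq_linear; first exact: wedge_o.
  by rewrite -[_ *: _]addr0; apply: o_opq_linear; [exact: wedge_o|exact: (rad_sub H).1.1].
have hXZ : h Z.
  rewrite -[Z](subKr X); apply: (subspaceB sh) => //; apply: hZ.
    by rewrite -scaleN1r addrC; exact: o_opq_linear.
  by rewrite mulmxBl Zv subrr.
have ry : rad b (wedge vdual y).
  have -> : wedge vdual y = al *: wedge vnull vdual - Z by rewrite /Z subKr.
  by apply: (subspaceB sr); [exact: subspaceZ|exact: (h_rad H)].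
have y0 : y = 0.
  have [yy|/(ru y ny dy)//] := eqVneq (bform y y) 0.
  have E : bform y y = \sum_i bform (sevec i) y ^+ 2.
    rewrite {2}(cV_frame y) dy ny !scale0r !add0r.
    rewrite bformC (big_morph (fun x => bform x y) (fun x z => bformDl x z y) (bform0l _)).
    by apply: eq_bigr => i _; rewrite bformZl expr2.
  rewrite (cV_frame y) dy ny !scale0r !add0r; apply: big1 => i _.
  move: yy; rewrite E => /eqP; rewrite psumr_eq0; last by move=> k _; exact: sqr_ge0.
  by move=> /allP/(_ i (mem_index_enum _)) /=; rewrite sqrf_eq0 => /eqP ->; rewrite scale0r.
rewrite xE y0 addr0; have [->|al0] := eqVneq al 0; first by rewrite scale0r.
by case: nA; apply: (subspaceZV sh al0); move: hXZ; rewrite /Z y0 wedge0r subr0.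
Qed.

End Lorentz.

Section IsotropyNormalForm.
Context {R : realType}.

(** The null vector of [isotropic_pair] is moved to [vnull], after which the results on null frames
    apply with the [sevec i] as orthonormal spacelike vectors. *)
Lemma isotropy_normal_form p q (h : set 'M[R]_(p.+1 + q.+1)) b X0 (P : set 'M[R]_(p.+1 + q.+1)) :
  let o := o_pq R p.+1 q.+1 in let N := (p.+1 + q.+1)%N in
  (p <= 1)%N -> (2 <= q)%N ->
  lightlike_pair h b X0 -> (forall A, P A -> orth A) ->
  (forall A X, P A -> o X -> b (cj A X) (cj A X) = b X X) ->
  (forall C : R, exists2 A, P A & C < `|mxvec A|) ->
  exists S : 'M[R]_N, [/\ orth S, p = 0,
    (forall X, o X -> h (cj S X) <-> X *m vnull = 0),
    (forall X, o X -> b (cj S (wedge vnull vdual)) (cj S X) = 0) &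
    exists2 kappa, 0 < kappa & forall i j,
      b (cj S (wedge vdual (sevec i))) (cj S (wedge vdual (sevec j))) = kappa *+ (i == j)].
Proof.
move=> o N p1 q2 H0 Po Pb Pu.
have [v [w [v0 vv vw ww hvw]]] := isotropic_pair H0 Po Pb Pu p1 q2.
have [T [c [oT c0 Tv]]] := null_normal_form v0 vv.
pose S := oinv T; have oS : orth S := orth_oinv oT.
have H := lightlike_conj H0 oS.
set h' := [set X | _] in H; set b' := (fun _ _ => _) in H; set X1 := cj _ _ in H.
pose w' := T *m w.
have vw' : bform vnull w' = 0.
  have := orth_bform v w oT; rewrite Tv bformZl vw => /eqP.
  by rewrite mulf_eq0 (negPf c0) => /eqP.
have ww' : bform w' w' != 0 by rewrite (orth_bform _ _ oT).
have hvw' : h' (wedge vnull w').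
  rewrite /h' /= -(scale1r vnull) -(mulVf c0) -scalerA -Tv wedgeZl -[_ *: _]addr0 cj_linear cj0 addr0.
  apply: (subspaceZ _ (ll_sub H0)); rewrite -(cj_wedge v w oT) /S cjK//.
have i01 : exists i j : 'I_q, i != j.
  by exists (Ordinal (ltnW q2)), (Ordinal q2).
have [f0 [g0 fg]] := i01.
have F := standard_frame (R := R) (p := p) fg.
have [nn dd nd] := @bform_vnull R p q.
have p0 : p = 0.
  case: (posnP p) => // pp; exfalso.
  pose e : 'cV[R]_N := evec (lshift _ (Ordinal (n := p.+1) (m := 1) pp)).
  have l0 : (lshift q.+1 (Ordinal (n := p.+1) (m := 1) pp) == lshift q.+1 0) = false.
    by rewrite (inj_eq (@lshift_inj _ _)).
  apply: (no_second_timelike H F vw' ww' hvw' (e := e)); rewrite /e ?bform_evec2.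
  - by rewrite sgn_l eqxx.
  - by rewrite bformC /vnull !bE !bform_evec2 l0 eq_lrshift !mulr0n addr0.
  - by rewrite bformC /vdual !bE !bform_evec2 l0 eq_lrshift !mulr0n subrr mulr0.
  - by rewrite eq_lrshift.
  - by rewrite eq_lrshift.
have perp i j : i != j -> [/\ h' (wedge (sevec i) (sevec j)),
     b' (wedge vdual (sevec i)) (wedge vdual (sevec j)) = 0 &
     b' (wedge vdual (sevec i)) (wedge vdual (sevec i)) = b' (wedge vdual (sevec j)) (wedge vdual (sevec j))].
  move=> ij; apply: (h_wedge_perp H F vw' ww' hvw'); rewrite ?bform_vnull_sevec ?bform_vdual_sevec ?bform_sevec ?eqxx//.
  by rewrite (negPf ij).
have sh' := ll_sub H.
have hvu u : bform vnull u = 0 -> h' (wedge vnull u) by exact: (h_null_wedge H F vw' ww' hvw').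
have Av := boost_notin H F vw' ww' hvw' nd dd.
have Ar := rad_boost H F vw' ww' hvw' nd dd.
have ro u : bform vnull u = 0 -> bform vdual u = 0 -> bform u u != 0 -> ~ rad b' (wedge vdual u).
  exact: (rad_opposite H F vw' ww' hvw').
have os (i : 'I_q) : o (wedge vdual (sevec i)) := wedge_o vdual (sevec i).
exists S; split => //.
(* [null_stabilizer] lives in signature (1, q + 1), so 0 is substituted for [p]; what stands in the
   way is abstracted or cleared. *)
- change (forall X, o X -> h' X <-> X *m vnull = 0); clearbody h' b' X1; clear S oS Tv vw' ww' hvw' Pb Po Pu H0 w' hvw vv vw ww v v0 w oT T P; subst p.
  apply: (null_stabilizer H hvu) => // i j ij; by have [] := perp i j ij.
- by move=> X oX; exact: (rad_orth H Ar oX).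
- exists (b' (wedge vdual (sevec f0)) (wedge vdual (sevec f0))).
    rewrite lt_def (ll_pos H (os f0)) andbT; apply/eqP => e0.
    apply: (ro (sevec f0)).
    - exact: bform_vnull_sevec.
    - exact: bform_vdual_sevec.
    - by rewrite bform_sevec eqxx pnatr_eq0.
    - by split; [exact: os|exact: e0].
  move=> i j; rewrite -[LHS]/(b' (wedge vdual (sevec i)) (wedge vdual (sevec j))).
  have [<-|ij] := eqVneq i j; last by have [_ -> _] := perp _ _ ij.
  rewrite mulr1n; have [->//|if0] := eqVneq i f0; by have [_ _ ->] := perp _ _ if0.
Qed.

End IsotropyNormalForm.

(** * The adjoint action of a group locally isomorphic to O(p, q) *)

Section LieIso.
Context {R : realType} {d : nat} (G : lieGroupType R d) {p q : nat}.
Notation N := (p + q)%N.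
Local Notation J := (Defs.eta R p q).
Local Notation o := (o_pq R p q).
Local Notation br := (mx_bracket R N).
Local Notation lie := (lie_algebra G).
Implicit Types (X Y : operator G) (A Z : 'M[R]_N) (a : G).

(** An isomorphism with a chosen inverse. Nothing is known of [phi] off the Lie algebra, nor of
    [psi] off o(p, q). *)
Record lie_iso_o (phi : operator G -> 'M[R]_N) (psi : 'M[R]_N -> operator G) : Prop := LieIsoO {
  li_o : forall X, lie X -> o (phi X);
  li_lin : forall (s : R) X Y, lie X -> lie Y -> phi (s *: X + Y) = s *: phi X + phi Y;
  li_br : forall X Y, lie X -> lie Y -> phi (lie_bracket G X Y) = br (phi X) (phi Y);
  li_alg : forall Z, o Z -> lie (psi Z);
  li_phiK : forall Z, o Z -> phi (psi Z) = Z;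
  li_psiK : forall X, lie X -> psi (phi X) = X }.

Lemma lie_iso_exists : lie_isomorphic lie (lie_bracket G) o br ->
  exists phi psi, lie_iso_o phi psi.
Proof.
move=> [phi [[phi_o phi_inj phi_surj] phi_lin phi_br]].
have H Z : exists X, o Z -> lie X /\ phi X = Z.
  have [oZ|nZ] := pselect (o Z); last by exists 0 => /nZ.
  by have [X lX E] := phi_surj Z oZ; exists X.
have [psi hpsi] := choice H; exists phi, psi; split.
- exact: phi_o.
- by move=> s X Y; exact: phi_lin.
- by move=> X Y; exact: phi_br.
- by move=> Z /hpsi[].
- by move=> Z /hpsi[].
- move=> X lX; have [l1 E] := hpsi _ (phi_o X lX).
  by apply: (phi_inj _ _ _ _ E); rewrite inE.
Qed.

Variables (phi : operator G -> 'M[R]_N) (psi : 'M[R]_N -> operator G).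
Hypothesis L : lie_iso_o phi psi.

Lemma li_inj X Y : lie X -> lie Y -> phi X = phi Y -> X = Y.
Proof. by move=> lX lY E; rewrite -(li_psiK L lX) E li_psiK. Qed.

Lemma li_psi_lin (s : R) (Y Z : 'M[R]_N) : o Y -> o Z -> psi (s *: Y + Z) = s *: psi Y + psi Z.
Proof.
move=> oY oZ; have lY := li_alg L oY; have lZ := li_alg L oZ.
apply: li_inj; [exact: (li_alg L (o_opq_linear s oY oZ))|exact: lie_alg_lin|].
by rewrite (li_lin L s lY lZ) (li_phiK L oY) (li_phiK L oZ) (li_phiK L (o_opq_linear s oY oZ)).
Qed.

Lemma o0 : o (0 : 'M[R]_N).
Proof. by rewrite /o_pq /= trmx0 mul0mx mulmx0 addr0. Qed.

Lemma lie0 : lie (0 : operator G).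
Proof. by have lX := li_alg L o0; have := lie_alg_lin (-1) lX lX; rewrite scaleN1r addNr. Qed.

Lemma li_phi0 : phi 0 = 0.
Proof. by have := li_lin L (-1) lie0 lie0; rewrite scaleN1r addNr scaleN1r addNr. Qed.

Lemma li_psi0 : psi 0 = 0.
Proof. by rewrite -li_phi0 (li_psiK L lie0). Qed.

Variables (c : chart R d G) (x : 'I_d -> G -> R^o).
Hypothesis U : unit_chart c x.
Local Notation X_ j := (xfield c 'e_j : operator G).
Let lX_ j : lie (X_ j) := xfield_alg U 'e_j.

Lemma ops_of X : lie X -> exists g, one_parameter_subgroup X g.
Proof. exact: (one_parameter_exists U). Qed.

Lemma lie_sum (I : Type) (r : seq I) (s : I -> R) (F : I -> operator G) :
  (forall i, lie (F i)) -> lie (\sum_(i <- r) s i *: F i) /\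
  phi (\sum_(i <- r) s i *: F i) = \sum_(i <- r) s i *: phi (F i).
Proof.
move=> lF; elim: r => [|i r [IH1 IH2]]; first by rewrite !big_nil li_phi0; split; [exact: lie0|].
rewrite !big_cons; split; first exact: (lie_alg_lin (s i) (lF i) IH1).
by rewrite (li_lin L _ (lF i) IH1) IH2.
Qed.

Lemma xi_sum (I : Type) (r : seq I) (s : I -> R) (F : I -> operator G) :
  xi x (\sum_(i <- r) s i *: F i) = \sum_(i <- r) s i *: xi x (F i).
Proof.
elim: r => [|i r IH]; last by rewrite !big_cons xi_lin IH.
by rewrite !big_nil; apply/rowP => j; rewrite !mxE.
Qed.

Lemma lie_expand X : lie X -> X = \sum_j xi x X 0 j *: X_ j.
Proof.
move=> lX; have [lS _] := lie_sum (index_enum _) (fun j => xi x X 0 j) lX_.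
apply: (xi_inj U lX lS); rewrite xi_sum [LHS]row_sum_delta; apply: eq_bigr => j _.
by rewrite (xi_xfield U).
Qed.

Lemma phi_expand X : lie X -> phi X = \sum_j xi x X 0 j *: phi (X_ j).
Proof.
move=> lX; rewrite {1}(lie_expand lX).
by have [_ ->] := lie_sum (index_enum _) (fun j => xi x X 0 j) lX_.
Qed.

(** [phi] is only known to be linear; expanded in the basis [X_ j] it is a finite sum with constant
    matrix coefficients, which can be differentiated term by term. *)
Lemma phi_Ad_derive X Y g s : lie X -> lie Y -> one_parameter_subgroup X g ->
  is_derive s (1 : R) (fun s => phi (AdOp (g s) Y)) (br (phi X) (phi (AdOp (g s) Y))).
Proof.
move=> lX lY hg; have lA a : lie (AdOp a Y) := AdOp_alg a lY.
have lB := lie_bracket_alg lX (lA (g s)).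
rewrite -(li_br L lX (lA _)).
have -> : lie_bracket G X (AdOp (g s) Y) = AdOp (g s) (lie_bracket G X Y).
  by rewrite AdOp_bracket (AdOp_self _ lX hg).
have lC := AdOp_alg (g s) (lie_bracket_alg lX lY).
rewrite (phi_expand lC); apply/is_derive_mxP => i j.
have E : (fun u => phi (AdOp (g u) Y) i j : R^o) =
    (fun u => \sum_k AdOp (g u) Y (x k) 1%g * phi (X_ k) i j : R^o).
  apply/funext => u; rewrite (phi_expand (lA _)) summxE; apply: eq_bigr => k _.
  by rewrite !mxE.
rewrite E summxE.
have -> : \sum_k (xi x (AdOp (g s) (lie_bracket G X Y)) 0 k *: phi (X_ k)) i j =
    \sum_k AdOp (g s) (lie_bracket G X Y) (x k) 1%g * phi (X_ k) i j.
  by apply: eq_bigr => k _; rewrite !mxE.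
apply: is_derive_bigsum => k.
have h := AdOp_derive s lX lY (ops_of lY) hg (uc_smooth U k).
apply: is_derive_eq (is_deriveM h (is_derive_cst (phi (X_ k) i j : R^o) s 1)) _.
by rewrite scaler0 add0r -[_ *: _]/(_ * _) mulrC.
Qed.

Lemma mx_ode Z : exists e P, [/\ 0 < e, P 0 = 1%:M &
  forall t : R, `|t| < e -> is_derive t (1 : R) P (Z *m P t)].
Proof.
have oT : open [set: 'rV[R]_(N * N)] by exact: openT.
pose F (z : 'rV[R]_(N * N)) := mxvec (Z *m vec_mx z).
have sv : smooth_on setT (@vec_mx R N N).
  apply/(smooth_on_mxP _ oT) => i j.
  apply: (smooth_on_eq oT _ (@smooth_on_coord R _ setT (mxvec_index i j))) => z _.
  by rewrite mxE.
have sF : smooth_on setT F.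
  have /(smooth_on_mxP _ oT) h := smooth_on_mulmx oT (@smooth_on_cstmx R _ N N setT Z) sv.
  apply/(smooth_on_mxP _ oT) => i j; rewrite (ord1 i); case/mxvec_indexP: j => j1 j2.
  by apply: (smooth_on_eq oT _ (h j1 j2)) => z _; rewrite mxvecE.
have [e [y [e0 y0 _ dy]]] := ode_exists oT (I : setT (mxvec (1%:M : 'M[R]_N))) sF.
exists e, (fun t => vec_mx (y t)); split => //; first by rewrite y0 mxvecK.
move=> t te; apply/is_derive_mxP => i j.
have := (is_derive_mxP _ _ _ _).1 (dy t te) 0 (mxvec_index i j).
rewrite mxvecE; suff -> : (fun u => y u 0 (mxvec_index i j) : R^o) = (fun u => vec_mx (y u) i j : R^o) by [].
by apply/funext => u; rewrite mxE.
Qed.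

(** A relation rather than a function of [a]: the matrix - A implements the same element as [A]. *)
Definition implements (A : 'M[R]_N) (a : G) : Prop :=
  orth A /\ forall Y, lie Y -> phi (AdOp a Y) = cj A (phi Y).

Lemma implementsM A B a b : implements A a -> implements B b -> implements (A *m B) (a * b)%g.
Proof.
move=> [oA hA] [oB hB]; split; first exact: orthM.
by move=> Y lY; rewrite AdOpM (hA _ (AdOp_alg b lY)) (hB _ lY) cjM.
Qed.

Lemma implements1 : implements 1%:M 1%g.
Proof.
split; first by rewrite /orth trmx1 mul1mx mulmx1.
by move=> Y lY; rewrite AdOp1 cj1.
Qed.

Lemma implementsV A a : implements A a -> implements (oinv A) (a^-1)%g.
Proof.
move=> [oA hA]; split; first exact: orth_oinv.
move=> Y lY; rewrite -[RHS](_ : cj (oinv A) (phi (AdOp a (AdOp (a^-1)%g Y))) = _).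
  by rewrite (hA _ (AdOp_alg _ lY)) (cjK _ oA).
by rewrite -AdOpM mulgV AdOp1.
Qed.

(** With P the solution of P' = Z P for Z = [phi X], the matrix P^-1 phi (Ad (g t) Y) P has
    derivative 0, and so has P^T J P. *)
Lemma implements_ops X g : lie X -> one_parameter_subgroup X g ->
  exists e P, [/\ 0 < e, P 0 = 1%:M,
    (forall t : R, `|t| < e -> is_derive t (1 : R) P (phi X *m P t)) &
    forall t : R, `|t| < e -> implements (P t) (g t)].
Proof.
move=> lX hg; have oZ := li_o L lX; set Z := phi X in oZ *.
have [e [P [e0 P0 dP]]] := mx_ode Z.
exists e, P; split => // t te.
have cst_mx (D : R -> 'M[R]_N) : (forall u : R, `|u| < e -> is_derive u (1 : R) D 0) ->
    forall u : R, `|u| < e -> D u = D 0.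
  move=> dD u ue; apply/matrixP => i j.
  apply: (@real_curve_const R (fun u => D u i j) e) => //; last by rewrite normr0.
  by move=> v ve; have := (is_derive_mxP _ _ _ _).1 (dD v ve) i j; rewrite mxE.
have oP (u : R) : `|u| < e -> orth (P u).
  move=> ue; rewrite /orth.
  have := cst_mx (fun u => (P u)^T *m J *m P u); rewrite P0 trmx1 mul1mx mulmx1; apply; last exact: ue.
  move=> v ve; have h := dP v ve.
  apply: is_derive_eq (is_derive_mulmx (is_derive_mulmxr J (is_derive_trmx h)) h) _.
  rewrite trmx_mul -!mulmxA (mulmxA Z^T) (o_trJ oZ) mulNmx mulmxN -!mulmxA.
  by rewrite addNr.
split; first exact: oP.
move=> Y lY.
have dO : forall u : R, `|u| < e ->
    is_derive u (1 : R) (fun u => oinv (P u)) (J *m (Z *m P u)^T *m J).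
  by move=> u ue; exact: (is_derive_mulmxr J (is_derive_mulmxl J (is_derive_trmx (dP u ue)))).
have := cst_mx (fun u => oinv (P u) *m phi (AdOp (g u) Y) *m P u).
rewrite P0 (ops0 hg) AdOp1 mulmx1 /oinv trmx1 mulmx1 eta_eta mul1mx -/(oinv _) => H.
have {}H : oinv (P t) *m phi (AdOp (g t) Y) *m P t = phi Y.
  apply: (H _ _ te) => u ue; have h1 := dP u ue; have h2 := dO u ue; have h3 := phi_Ad_derive u lX lY hg.
  apply: is_derive_eq (is_derive_mulmx (is_derive_mulmx h2 h3) h1) _.
  set W := phi _; rewrite /mx_bracket -/Z trmx_mul.
  have -> : J *m ((P u)^T *m Z^T) *m J = - (oinv (P u) *m Z).
    by rewrite -!mulmxA (o_trJ oZ) /oinv !mulmxN !mulmxA.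
  rewrite mulmxBr mulmxDl mulmxBl !mulNmx !mulmxA.
  move: (_ *m _ *m W *m P u) (_ *m W *m Z *m P u) => S T.
  by rewrite addKr addNr.
rewrite -H /cj; move: (oinv (P t)) (orth_mul (oP t te)) => Q PQ.
by rewrite !mulmxA PQ mul1mx -mulmxA PQ mulmx1.
Qed.

End LieIso.

(** * Matrix norms and the skew part *)

Section MatrixNorm.
Context {R : realType}.

Lemma mxvec_norm_le m n (A : 'M[R]_(m, n)) (C : R) : 0 <= C ->
  `|mxvec A| <= C <-> forall i j, `|A i j| <= C.
Proof.
move=> C0; split=> [/(row_normE _ C0) h i j|h]; first by have := h (mxvec_index i j); rewrite mxvecE.
by apply/(row_normE _ C0) => k; case/mxvec_indexP: k => i j; rewrite mxvecE.
Qed.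

Lemma mxvec_norm_ge m n (A : 'M[R]_(m, n)) i j : `|A i j| <= `|mxvec A|.
Proof. by apply: (mxvec_norm_le A (normr_ge0 _)).1. Qed.

Lemma mxvec_norm_mul m n r (A : 'M[R]_(m, n)) (B : 'M[R]_(n, r)) :
  `|mxvec (A *m B)| <= n%:R * (`|mxvec A| * `|mxvec B|).
Proof.
apply/mxvec_norm_le => [|i j]; first by rewrite !mulr_ge0.
rewrite mxE; apply: (le_trans (ler_norm_sum _ _ _)).
apply: (@le_trans _ _ (\sum_(k < n) (`|mxvec A| * `|mxvec B|))).
  apply: ler_sum => k _; rewrite normrM; apply: ler_pM => //; exact: mxvec_norm_ge.
by rewrite sumr_const card_ord mulr_natl.
Qed.

Lemma mxvec_normD m n (A B : 'M[R]_(m, n)) : `|mxvec (A + B)| <= `|mxvec A| + `|mxvec B|.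
Proof. by rewrite linearD; exact: ler_normD. Qed.

Lemma mxvec_norm_eq0 m n (A : 'M[R]_(m, n)) : (`|mxvec A| == 0) = (A == 0).
Proof. by rewrite normr_eq0 mxvec_eq0. Qed.

Context {p q : nat}.
Notation N := (p + q)%N.
Local Notation J := (Defs.eta R p q).
Local Notation o := (o_pq R p q).

Lemma oinvE (A : 'M[R]_N) i j : oinv A i j = sgn_idx i * A j i * sgn_idx j.
Proof. by rewrite /oinv eta_diag mul_mx_diag mul_diag_mx !mxE. Qed.

Lemma sgn_idx_norm (i : 'I_N) : `|sgn_idx i : R| = 1.
Proof. by rewrite /sgn_idx; case: ifP; rewrite ?normrN normr1. Qed.

Lemma mxvec_norm_oinv (A : 'M[R]_N) : `|mxvec (oinv A)| <= `|mxvec A|.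
Proof.
apply/mxvec_norm_le => // i j; rewrite oinvE !normrM !sgn_idx_norm mul1r mulr1.
exact: mxvec_norm_ge.
Qed.

Lemma oinvD (A B : 'M[R]_N) : oinv (A + B) = oinv A + oinv B.
Proof. by rewrite /oinv linearD mulmxDr mulmxDl. Qed.

Lemma oinvZ (s : R) (A : 'M[R]_N) : oinv (s *: A) = s *: oinv A.
Proof. by rewrite /oinv linearZ -scalemxAr -scalemxAl. Qed.

Lemma oinv1 : oinv (1%:M : 'M[R]_N) = 1%:M.
Proof. by rewrite /oinv trmx1 mulmx1 eta_eta. Qed.

(** A linear projection of all matrices onto o(p, q). It extends to all matrices what is meaningful
    on o(p, q) only, and near 1 it stands in for the logarithm. *)
Definition skew_part (A : 'M[R]_N) : 'M[R]_N := 2^-1 *: (A - oinv A).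

Lemma skew_part_lin (s : R) A B : skew_part (s *: A + B) = s *: skew_part A + skew_part B.
Proof.
rewrite /skew_part oinvD oinvZ; move: (oinv A) (oinv B) => A' B'.
by apply/matrixP => i j; rewrite !mxE; ring.
Qed.

Lemma o_oinv Z : o Z -> oinv Z = - Z.
Proof. by move=> oZ; rewrite /oinv -mulmxA (o_trJ oZ) mulmxN mulmxA eta_eta mul1mx. Qed.

Lemma oinv_o Z : oinv Z = - Z -> o Z.
Proof.
move=> E; rewrite /o_pq /= -[Z^T *m J]mul1mx -eta_eta -mulmxA [J *m (Z^T *m J)]mulmxA -/(oinv Z) E.
by rewrite mulmxN addNr.
Qed.

Lemma skew_part_o A : o (skew_part A).
Proof.
apply: oinv_o; rewrite /skew_part oinvZ oinvD -[- oinv A]scaleN1r oinvZ oinvK scaleN1r -scalerN opprB.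
by rewrite scaleN1r.
Qed.

Lemma skew_part_id Z : o Z -> skew_part Z = Z.
Proof.
move=> oZ; rewrite /skew_part o_oinv// opprK; apply/matrixP => i j; rewrite !mxE.
by field.
Qed.

(* [A = S + C] with [S] the skew part and [C^2 = 1 + S^2]; near 1 the square
   root [C] is determined. *)
Lemma skew_part_inj : exists2 r : R, 0 < r & forall A B : 'M[R]_N, orth A -> orth B ->
  `|mxvec (A - 1%:M)| < r -> `|mxvec (B - 1%:M)| < r -> skew_part A = skew_part B -> A = B.
Proof.
(* The norm is the largest entry, so a product costs a factor [N]; this radius makes [N%:R * r] less
   than 1. *)
exists ((N.+1)%:R^-1); first by rewrite invr_gt0.
set r := _^-1 => A B oA oB Ar Br E.
pose C (A : 'M[R]_N) := 2^-1 *: (A + oinv A).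
have CS A' : A' = skew_part A' + C A'.
  by rewrite /skew_part /C; apply/matrixP => i j; rewrite !mxE; field.
have C2 A' : orth A' -> C A' *m C A' = 1%:M + skew_part A' *m skew_part A'.
  move=> oA'; rewrite /C /skew_part -!scalemxAl -!scalemxAr.
  rewrite !(mulmxDl, mulmxDr, mulmxN, mulNmx) (orth_mul oA') (orth_mulV oA').
  move: (A' *m A') (oinv A' *m oinv A') => U V.
  by apply/matrixP => i j; rewrite !mxE; case: eqP => _; rewrite ?mulr1n ?mulr0n; field.
have C1 A' : `|mxvec (A' - 1%:M)| < r -> `|mxvec (C A' - 1%:M)| < r.
  move=> h; apply: le_lt_trans h.
  have -> : C A' - 1%:M = 2^-1 *: ((A' - 1%:M) + oinv (A' - 1%:M)).
    rewrite oinvD -[- 1%:M]scaleN1r oinvZ oinv1 /C; move: (oinv A') => B'.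
    by apply/matrixP => i j; rewrite !mxE; field.
  rewrite linearZ /= normrZ ger0_norm ?invr_ge0// ler_pdivrMl//.
  apply: (le_trans (mxvec_normD _ _)); rewrite mulr2n mulrDl mul1r lerD2l.
  exact: mxvec_norm_oinv.
have E2 : C A *m C A = C B *m C B by rewrite !C2// E.
suff CC : C A = C B by rewrite (CS A) (CS B) E CC.
have := C1 _ Ar; have := C1 _ Br.
set a := C A - 1%:M; set b := C B - 1%:M => br ar.
have Ea : C A = a + 1%:M by rewrite subrK.
have Eb : C B = b + 1%:M by rewrite subrK.
set D := C A - C B.
(* Equality of the squares of [C A] and [C B] says that C A D + D C B = 0; as both are close to 1,
   this is a perturbation of 2 D = 0. *)
have ED : 2%:R *: D = - (a *m D + D *m b).
  have : C A *m D + D *m C B = 0.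
    by rewrite mulmxBr mulmxBl E2 addrA subrK subrr.
  rewrite {1}Ea Eb (mulmxDl a 1%:M D) (mulmxDr D b 1%:M) mul1mx mulmx1 addrACA => /eqP.
  rewrite addrC [D + D](_ : _ = 2%:R *: D).
    by rewrite addr_eq0 => /eqP.
  by apply/matrixP => i j; rewrite !mxE; ring.
apply/eqP; rewrite -subr_eq0 -/D -mxvec_norm_eq0; apply/negPn/negP => n0.
have D0 : 0 < `|mxvec D| by rewrite lt_def n0 normr_ge0.
have h1 : 2 * `|mxvec D| <= N%:R * (`|mxvec a| * `|mxvec D|) + N%:R * (`|mxvec D| * `|mxvec b|).
  have -> : 2 * `|mxvec D| = `|mxvec (2%:R *: D)| by rewrite linearZ normrZ ger0_norm.
  rewrite ED linearN normrN; apply: (le_trans (mxvec_normD _ _)).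
  by apply: lerD; exact: mxvec_norm_mul.
have hN : N%:R * r <= 1 by rewrite ler_pdivrMr ?ltr0n// mul1r ler_nat.
have h2 : N%:R * (`|mxvec a| * `|mxvec D|) <= N%:R * r * `|mxvec D|.
  by rewrite -mulrA ler_wpM2l// ler_wpM2r// ltW.
have h3 : N%:R * (`|mxvec D| * `|mxvec b|) <= N%:R * r * `|mxvec D|.
  by rewrite -mulrA [r * _]mulrC ler_wpM2l// ler_wpM2l// ltW.
have r1 : N%:R * r < 1 by rewrite ltr_pdivrMr ?ltr0n// mul1r ltr_nat.
have h4 : 2 * `|mxvec D| <= 2 * (N%:R * r * `|mxvec D|).
  by apply: (le_trans h1); rewrite mulr2n mulrDl mul1r; exact: lerD.
move: h4; rewrite ler_pM2l// leNgt => /negP; apply.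
by rewrite gtr_pMl.
Qed.

End MatrixNorm.

Section AdjointGroup.
Context {R : realType} {d : nat} (G : lieGroupType R d) {p q : nat}.
Notation N := (p + q)%N.
Local Notation J := (Defs.eta R p q).
Local Notation o := (o_pq R p q).
Local Notation lie := (lie_algebra G).
Variables (phi : operator G -> 'M[R]_N) (psi : 'M[R]_N -> operator G).
Hypothesis L : lie_iso_o phi psi.
Variables (c : chart R d G) (x : 'I_d -> G -> R^o).
Hypothesis U : unit_chart c x.
Hypothesis G_connected : connected [set: G].

Local Notation X_ j := (xfield c 'e_j : operator G).
Let lX_ j : lie (X_ j) := xfield_alg U 'e_j.

Lemma basis_ops : exists g : 'I_d -> R -> G, forall j, one_parameter_subgroup (X_ j) (g j).
Proof.
have [g hg] := choice (fun j : 'I_d => one_parameter_exists U (lX_ j)).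
by exists g.
Qed.

(** If Ad a is trivial, conjugation by [a] fixes every one-parameter subgroup, so the centralizer of
    [a] is a subgroup containing a neighborhood of 1. *)
Lemma ker_Ad_center a : (forall Y, lie Y -> AdOp a Y = Y) -> lie_center G a.
Proof.
move=> ha; have [g hg] := basis_ops.
pose S := [set b : G | (a * b = b * a)%g].
have := @connected_subgroup R d G S G_connected; apply.
- have nT : nbhs (0 : 'rV[R]_d) setT by exact: filterT.
  have h := exp_nbhs U hg nT.
  apply: filterS h => _ [t _ <-]; rewrite /S /prod_exp /=.
  elim: (index_enum _) => [|j s IH]; first by rewrite big_nil mulg1 mul1g.
  have E : (a * g j (t 0 j) = g j (t 0 j) * a)%g.
    have h1 := AdOp_ops a (lX_ j) (hg j); rewrite ha// in h1.
    have h2 : (a * g j (t 0 j) * a^-1 = g j (t 0 j))%g := ops_unique (t 0 j) U (lX_ j) h1 (hg j).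
    by rewrite -{2}h2 mulgVK.
  by rewrite big_cons -mulgA -IH mulgA E !mulgA.
- by rewrite /S => b b' /= E E'; rewrite mulgA E -mulgA E' mulgA.
- rewrite /S => b /= E; apply: (mulgI b); rewrite mulgA mulVKg.
  by rewrite -E mulgK.
Qed.

(** The elements of [G] with an implementing matrix form a subgroup, and products of one-parameter
    subgroups near 1 belong to it. *)
Lemma implements_exists a : exists A, implements phi A a.
Proof.
have [g hg] := basis_ops.
pose S := [set b : G | exists A, implements phi A b].
have := @connected_subgroup R d G S G_connected; apply.
- have H j : exists e : R, 0 < e /\ forall t : R, `|t| < e -> exists A, implements phi A (g j t).
    have [e [P [e0 _ _ hP]]] := implements_ops L U (lX_ j) (hg j).
    by exists e; split => // t te; exists (P t); exact: hP.
  have [e he] := choice H.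
  have nN : nbhs (0 : 'rV[R]_d) [set t : 'rV[R]_d | forall j, `|t 0 j| < e j].
    have Hj j : \forall t \near (0 : 'rV[R]_d), `|(t : 'rV[R]_d) 0 j| < e j.
      apply: open_nbhs_nbhs; split; first exact: open_coord_lt.
      by rewrite /= mxE normr0; have [] := he j.
    exact: (filter_forall (nbhs_filter _) Hj).
  apply: filterS (exp_nbhs U hg nN) => _ [t te <-]; rewrite /S /prod_exp /=.
  elim: (index_enum _) => [|j s [A hA]]; first by rewrite big_nil; exists 1%:M; exact: implements1.
  rewrite big_cons; have [B hB] := (he j).2 _ (te j).
  by exists (B *m A); exact: implementsM.
- by move=> b b' [A hA] [B hB]; exists (A *m B); exact: implementsM.
- by move=> b [A hA]; exists (oinv A); exact: implementsV.
Qed.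

Lemma implements_center A a b : implements phi A a -> implements phi A b ->
  lie_center G (a * b^-1)%g.
Proof.
move=> hA hB; apply: ker_Ad_center => Y lY.
have [oA h1] := implementsM hA (implementsV hB).
apply: (li_inj L (AdOp_alg _ lY) lY); rewrite h1// (orth_mul hA.1) cj1.
by [].
Qed.

End AdjointGroup.

Lemma smooth_on_mxvec (R : realType) (V : normedModType R) m n (S : set V) (F : V -> 'M[R]_(m, n)) :
  open S -> smooth_on S F -> smooth_on S (fun z => mxvec (F z)).
Proof.
move=> oS /(smooth_on_mxP _ oS) sF; apply/(smooth_on_mxP _ oS) => i j; rewrite (ord1 i).
case/mxvec_indexP: j => j1 j2.
by apply: (smooth_on_eq oS _ (sF j1 j2)) => z _; rewrite mxvecE.
Qed.

Lemma is_derive_mxvec (R : realType) (V : normedModType R) m n (F : V -> 'M[R]_(m, n)) x v dF :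
  is_derive x v F dF -> is_derive x v (fun z => mxvec (F z)) (mxvec dF).
Proof.
move=> /(is_derive_mxP _ _ _ _) h; apply/is_derive_mxP => i j; rewrite (ord1 i).
case/mxvec_indexP: j => j1 j2; rewrite mxvecE.
suff -> : (fun y => mxvec (F y) 0 (mxvec_index j1 j2) : R^o) = (fun y => F y j1 j2 : R^o) by [].
by apply/funext => y; rewrite mxvecE.
Qed.

Lemma compact_seq_union (T : topologicalType) (I : eqType) (s : seq I) (f : I -> set T) :
  (forall i, i \in s -> compact (f i)) -> compact [set p | exists2 i, i \in s & f i p].
Proof.
elim: s => [|i s IH] h.
  have -> : [set p | exists2 i, i \in [::] & f i p] = set0 :> set T.
    by apply/seteqP; split=> p // [].
  exact: compact0.
have -> : [set p | exists2 j, j \in i :: s & f j p] = f i `|` [set p | exists2 j, j \in s & f j p].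
  apply/seteqP; split=> p.
    by move=> [j]; rewrite inE => /orP[/eqP -> ?|js fj]; [left|right; exists j].
  by move=> [fi|[j js fj]]; [exists i; rewrite ?mem_head|exists j => //; rewrite inE js orbT].
apply: compactU; first by apply: h; rewrite mem_head.
by apply: IH => j js; apply: h; rewrite inE js orbT.
Qed.

(** * Properness of the adjoint representation *)

Section Properness.
Context {R : realType} {d : nat} (G : lieGroupType R d) {p q : nat}.
Notation N := (p + q)%N.
Local Notation J := (Defs.eta R p q).
Local Notation o := (o_pq R p q).
Local Notation lie := (lie_algebra G).
Variables (phi : operator G -> 'M[R]_N) (psi : 'M[R]_N -> operator G).
Hypothesis L : lie_iso_o phi psi.
Variables (c : chart R d G) (x : 'I_d -> G -> R^o).
Hypothesis U : unit_chart c x.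
Hypothesis G_connected : connected [set: G].

Local Notation X_ j := (xfield c 'e_j : operator G).
Let lX_ j : lie (X_ j) := xfield_alg U 'e_j.

Definition mxprod (P : 'I_d -> R -> 'M[R]_N) (t : 'rV[R]_d) : 'M[R]_N :=
  \big[mulmx/1%:M]_(j < d) P j (t 0 j).

Lemma mxprod_axis (P : 'I_d -> R -> 'M[R]_N) (h : R) j : (forall i, P i 0 = 1%:M) ->
  mxprod P (h *: 'e_j) = P j h.
Proof.
move=> P0.
have H (s : seq 'I_d) : uniq s ->
    \big[mulmx/1%:M]_(i <- s) P i ((h *: 'e_j : 'rV[R]_d) 0 i) = if j \in s then P j h else 1%:M.
  elim: s => [|i s IH] /=; first by rewrite big_nil.
  move=> /andP[si us]; rewrite big_cons IH// inE !mxE eqxx.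
  have [E|ij] := eqVneq i j; first by rewrite E in si *; rewrite mulr1 (negPf si) mulmx1.
  by rewrite mulr0 P0 mul1mx.
by rewrite /mxprod H ?index_enum_uniq// mem_index_enum.
Qed.

Lemma smooth_mx_flow (Z : 'M[R]_N) (P : R -> 'M[R]_N) e r (S : set 'rV[R]_r) (u : 'rV[R]_r -> R^o) :
  (forall t : R, `|t| < e -> is_derive t (1 : R) P (Z *m P t)) -> open S -> smooth_on S u ->
  (forall z, S z -> `|u z| < e) -> smooth_on S (fun z => P (u z)).
Proof.
move=> dP oS su ue; apply/(smooth_on_mxP _ oS) => i j.
pose h k t := iter k (mulmx Z) (P t) i j : R.
apply: (@smooth_on_tower _ _ S [set t | `|t| < e] u h oS ue su) => k t te.
have H : is_derive t (1 : R) (fun t => iter k (mulmx Z) (P t)) (iter k.+1 (mulmx Z) (P t)).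
  elim: k => [|k IH]; first exact: dP.
  exact: (is_derive_mulmxl Z IH).
exact: ((is_derive_mxP _ _ _ _).1 H i j).
Qed.

Lemma section_near_one : exists (B : set G) (dl : R), [/\ compact B, 0 < dl &
  forall A a, implements phi A a -> `|mxvec (A - 1%:M)| < dl ->
  exists b z, [/\ B b, lie_center G z & a = (z * b)%g]].
Proof.
have [g hg] := basis_ops U.
have H j : exists eP : R * (R -> 'M[R]_N), [/\ 0 < eP.1, eP.2 0 = 1%:M,
    (forall t : R, `|t| < eP.1 -> is_derive t (1 : R) eP.2 (phi (X_ j) *m eP.2 t)) &
    forall t : R, `|t| < eP.1 -> implements phi (eP.2 t) (g j t)].
  by have [e [P hP]] := implements_ops L U (lX_ j) (hg j); exists (e, P).
have [eP heP] := choice H.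
pose e j := (eP j).1; pose P j := (eP j).2.
have e0 j : 0 < e j by have [] := heP j.
have P0 j : P j 0 = 1%:M by have [] := heP j.
have dP j : forall t : R, `|t| < e j -> is_derive t (1 : R) (P j) (phi (X_ j) *m P j t) by have [] := heP j.
have iP j : forall t : R, `|t| < e j -> implements phi (P j t) (g j t) by have [] := heP j.
clearbody e P; clear eP heP H.
pose D := [set t : 'rV[R]_d | forall j, `|t 0 j| < e j].
have oD : open D.
  apply: open_nbhsP => t Dt.
  have Hj j : \forall s \near t, `|(s : 'rV[R]_d) 0 j| < e j.
    by apply: open_nbhs_nbhs; split; [exact: open_coord_lt|exact: Dt].
  exact: (filter_forall (nbhs_filter _) Hj).
have D0 : D 0 by move=> j; rewrite mxE normr0.
pose Q := mxprod P.
have sQ : smooth_on D Q.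
  rewrite /Q /mxprod; elim: (index_enum _) => [|j s IH].
    by apply: (smooth_on_eq oD _ (@smooth_on_cstmx R _ N N D 1%:M)) => z _; rewrite big_nil.
  have Dj (z : 'rV[R]_d) : D z -> `|z 0 j| < e j by exact.
  have h := smooth_on_mulmx oD (smooth_mx_flow (dP j) oD (@smooth_on_coord R d D j) Dj) IH.
  by apply: (smooth_on_eq oD _ h) => z _; rewrite big_cons.
have iQ t : D t -> implements phi (Q t) (prod_exp g t).
  move=> Dt; rewrite /Q /mxprod /prod_exp; elim: (index_enum _) => [|j s IH].
    by rewrite !big_nil; exact: implements1.
  by rewrite !big_cons; apply: implementsM IH; exact: iP.
have Q0 : Q 0 = 1%:M.
  by rewrite /Q /mxprod; elim: (index_enum _) => [|j s IH]; rewrite ?big_nil ?big_cons// mxE P0 mul1mx.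
(* The coordinates in R^d of the skew part. Being linear, it is given by a matrix [C], which makes
   its composite with [Q] smooth. *)
pose Lf (A : 'M[R]_N) : 'rV[R]_d := xi x (psi (skew_part A)).
have Lf_lin : linear Lf.
  move=> s A B; rewrite /Lf skew_part_lin (li_psi_lin L _ (skew_part_o A) (skew_part_o B)).
  exact: xi_lin.
pose LL : {linear 'M[R]_N -> 'rV[R]_d} := HB.pack Lf (GRing.isLinear.Build _ _ _ _ _ Lf_lin).
pose C := lin1_mx (LL \o vec_mx).
have LC A : Lf A = mxvec A *m C by rewrite mul_rV_lin1 /= mxvecK.
pose F t := mxvec (Q t) *m C.
have sF : smooth_on D F.
  exact: (smooth_on_mulmx oD (smooth_on_mxvec oD sQ) (@smooth_on_cstmx R _ _ _ D C)).
have jF : jacobian F 0 = 1%:M.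
  apply/matrixP => i j; rewrite (jacobianE oD sF)//.
  have hP := dP i 0; rewrite normr0 P0 mulmx1 in hP.
  have hQ : is_derive (0 : 'rV[R]_d) 'e_i Q (phi (X_ i)).
    by apply: is_derive_line (hP (e0 i)) => h; rewrite !addr0 /Q mxprod_axis.
  have [_ ->] := is_derive_mulmxr C (is_derive_mxvec hQ).
  rewrite -LC /Lf (skew_part_id (li_o L (lX_ i))) (li_psiK L (lX_ i)) (xi_xfield U) !mxE.
  by rewrite eqxx /= eq_sym.
have [r r0 hinj] := @skew_part_inj R p q.
have nN : nbhs (0 : 'rV[R]_d) (D `&` ([set t | `|0 - t| <= 1] `&` [set t | `|mxvec (Q t - 1%:M)| < r])).
  apply: filterI; first exact: open_nbhs_nbhs.
  apply: filterI.
    apply/nbhs_ballP; exists 1 => //= t; rewrite -ball_normE /ball_ /= => /ltW; exact.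
  have h : {for 0, continuous (fun t => mxvec (Q t))} := smooth_on_cont (smooth_on_mxvec oD sQ) D0.
  have nb : nbhs (mxvec (Q 0)) [set z : 'rV[R]_(N * N) | `|z - mxvec (1%:M : 'M[R]_N)| < r].
    apply/nbhs_ballP; exists r => // z; rewrite -ball_normE /ball_ /= Q0 distrC.
    by [].
  have h2 : \forall t \near (0 : 'rV[R]_d), `|mxvec (Q t) - mxvec (1%:M : 'M[R]_N)| < r := h _ nb.
  by apply: filterS h2 => t; rewrite /= -linearB.
have uF : jacobian F 0 \in unitmx by rewrite jF unitmx1.
have [W [V [K [[oW oV] [W0 WN] WV VW _]]]] := inverse_function oD D0 sF uF nN.
have V0 : V (mxvec 1%:M *m C) by have [] := WV _ W0; rewrite /F Q0.
have sC : smooth_on setT (fun z : 'rV[R]_(N * N) => z *m C).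
  apply: (smooth_on_mulmx openT); last exact: smooth_on_cstmx.
  apply/(smooth_on_mxP _ openT) => i j; rewrite (ord1 i); exact: smooth_on_coord.
have cC := smooth_on_cont sC (I : setT (mxvec (1%:M : 'M[R]_N))).
have nV : nbhs (mxvec 1%:M *m C) V by exact: open_nbhs_nbhs.
have [dl dl0 hdl] := norm_nbhs (cC _ nV).
exists (prod_exp g @` [set t | `|0 - t| <= 1]), (Num.min dl r); split.
- apply: continuous_compact; last exact: compact_closed_ball.
  apply: continuous_subspaceT => t.
  exact: (tsmooth_cont (I : setT t) (prod_exp_smooth lX_ hg)).
- by rewrite lt_min dl0.
move=> A a hA; rewrite lt_min => /andP[A1 A2].
have VA : V (Lf A) by rewrite LC; apply: hdl; rewrite -linearB.
have [WK FK] := VW _ VA; set t := K (Lf A) in WK FK.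
have [Dt [_ [/= t1 tr]]] := WN _ WK.
(* By the choice of [t], the matrices [Q t] and [A] have the same skew part; both lie within [r] of
   1, where it determines them. *)
have QA : Q t = A.
  apply: hinj => //; [by have [] := iQ _ Dt|by have [] := hA|].
  move: FK; rewrite /F -LC /Lf => E.
  have oQ := skew_part_o (Q t); have oA := skew_part_o A.
  rewrite -(li_phiK L oQ) -(li_phiK L oA); congr phi.
  exact: (xi_inj U (li_alg L oQ) (li_alg L oA) E).
have hQ := iQ _ Dt; rewrite QA in hQ.
exists (prod_exp g t), (a * (prod_exp g t)^-1)%g; split.
- by exists t.
- exact: (implements_center L U G_connected hA hQ).
- by rewrite mulgVK.
Qed.

(** The implementing matrices of [H] are covered by finitely many small balls with centres
    implementing elements [a_ z] of [H]. In one ball, the product of the inverse of [a_ z] with [a]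
    has a matrix near 1, so it is in the compact set [B] up to a central element. The centre being
    finite, [H] is closed in a finite union of compact sets. *)
Lemma bounded_compact (H : set G) (C : R) : finite_set (lie_center G) -> closed H ->
  (forall a A, H a -> implements phi A a -> `|mxvec A| <= C) -> compact H.
Proof.
move=> fC cH HC.
have [B [dl [cB dl0 hB]]] := section_near_one.
have [A hA] := choice (implements_exists L U G_connected).
pose S := [set mxvec (A a) | a in H].
have cS : compact (closure S).
  apply: bounded_closed_compact; last exact: closed_closure.
  have cC : closed [set z : 'rV[R]_(N * N) | `|z| <= C].
    have -> : [set z : 'rV[R]_(N * N) | `|z| <= C] = (fun z : 'rV[R]_(N * N) => `|z|) @^-1` [set u | u <= C] by [].
    apply: closed_comp => [z _|]; [exact: norm_continuous|exact: closed_le].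
  exists C; split; first exact: num_real.
  move=> M CM z /= hz; apply: le_trans (ltW CM).
  suff : closure S `<=` [set z : 'rV[R]_(N * N) | `|z| <= C] by apply.
  rewrite [X in _ `<=` X]((closure_id _).1 cC); apply: closure_subset => _ [a Ha <-].
  exact: HC (hA a).
pose C1 := Num.max C 0; have C10 : 0 <= C1 by rewrite le_max lexx orbT.
(* Multiplying a matrix smaller than [rho] by one of size at most [C1] gives a matrix smaller than
   [dl]. *)
pose rho := dl / (N%:R * C1 + 1).
have den : 0 < N%:R * C1 + 1 by rewrite ltr_wpDl// mulr_ge0.
have rho0 : 0 < rho by rewrite divr_gt0.
have [D' D'S cov] : finite_subset_cover S (fun z : 'rV[R]_(N * N) => ball z rho) (closure S).
  move: cS; rewrite compact_cover; apply => [z _|z /= hz]; first exact: ball_open.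
  have [w [Sw bw]] := hz _ (nbhsx_ballx z rho rho0).
  by exists w => //; exact: ball_sym.
pose a_ (z : 'rV[R]_(N * N)) := xget 1%g [set a | H a /\ mxvec (A a) = z].
have a_P z : S z -> H (a_ z) /\ mxvec (A (a_ z)) = z.
  by move=> [a Ha E]; rewrite /a_; case: xgetP => [b -> //|/(_ a)]; case.
have [sc hsc] := (finite_seqP _).1 fC.
pose f (zw : 'rV[R]_(N * N) * G) := (fun b : G => a_ zw.1 * (zw.2 * b))%g @` B.
have cf zw : compact (f zw).
  apply: continuous_compact => //; apply: continuous_subspaceT => b.
  have [cm _] := @smooth_mul R d G.
  have cl (u : G) : continuous (fun b : G => u * b)%g.
    move=> v; apply: (@continuous_comp _ _ _ (fun b : G => (u, b)) (fun pq : G * G => pq.1 * pq.2)%g) (cm (u, v)).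
    by apply: cvg_pair => //=; exact: cvg_cst.
  exact: (continuous_comp (cl zw.2 b) (cl (a_ zw.1) (zw.2 * b)%g)).
have [sD hsD] := (finite_seqP _).1 (finite_fset D').
pose s := [seq (z, w) | z <- sD, w <- sc].
apply: (subclosed_compact cH (compact_seq_union (s := s) (fun zw _ => cf zw))) => a Ha.
have /cov[z zD bz] : closure S (mxvec (A a)) by apply: subset_closure; exists a.
have Sz : S z by have := D'S z zD; rewrite inE.
have [Hz Ez] := a_P z Sz.
have hq := implementsM (implementsV (hA (a_ z))) (hA a).
have nz : `|mxvec (A (a_ z))| <= C1.
  by rewrite le_max (HC _ _ Hz (hA _)).
have close : `|mxvec (oinv (A (a_ z)) *m A a - 1%:M)| < dl.
  rewrite -(orth_mulV (hA (a_ z)).1) -mulmxBr; apply: (le_lt_trans (mxvec_norm_mul _ _)).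
  have h1 : `|mxvec (A a - A (a_ z))| < rho.
    by rewrite linearB /= Ez distrC; move: bz; rewrite -ball_normE.
  have h2 := le_trans (mxvec_norm_oinv (A (a_ z))) nz.
  apply: (@le_lt_trans _ _ (N%:R * (C1 * rho))).
    by rewrite ler_wpM2l// ler_pM// ltW.
  rewrite /rho mulrA mulrA ltr_pdivrMr// mulrC ltr_pM2l//.
  by rewrite ltrDl.
have [b [w [Bb cw E]]] := hB _ _ hq close.
exists (z, w).
  apply/allpairsP; exists (z, w); split => //=.
    by have := zD; rewrite hsD.
  by move: cw; rewrite hsc.
by exists b => //=; rewrite -E mulVKg.
Qed.

End Properness.

(** * Degenerate orbits *)

Section LorentzForm.
Context {R : realType} {m : nat}.
Notation N := (1 + m)%N.

Lemma lorentz_form_sym (g P : 'M[R]_N) : P \in unitmx -> P *m g *m P^T = Defs.eta R 1 m ->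
  g \in unitmx /\ g^T = g.
Proof.
move=> uP E; have E2 : g = invmx P *m Defs.eta R 1 m *m (invmx P)^T.
  by rewrite -E trmx_inv !mulmxA mulVmx// mul1mx -mulmxA mulmxV ?unitmx_tr// mulmx1.
have ue : Defs.eta R 1 m \in unitmx by have [] := mulmx1_unit (@eta_eta R 1 m).
split; last by rewrite E2 !trmx_mul trmxK eta_tr mulmxA.
by rewrite E2 !unitmx_mul unitmx_tr unitmx_inv uP ue.
Qed.

Lemma gram_sub_scale n (U W : 'rV[R]_n) (s : R) :
  (W - s *: U) *m (W - s *: U)^T =
  W *m W^T - s *: (W *m U^T) - s *: (U *m W^T) + (s * s) *: (U *m U^T).
Proof.
have -> : (W - s *: U)^T = W^T - s *: U^T by apply/matrixP => i j; rewrite !mxE.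
by rewrite mulmxBl !mulmxBr -!scalemxAr -!scalemxAl scalerA opprB !addrA addrAC.
Qed.

(* Write [w = s u + z] with [z] in the spacelike factor: [q(w) = |z|^2]. *)
Lemma lorentz_orth_null (g P : 'M[R]_N) (u w : 'rV[R]_N) : P \in unitmx ->
  P *m g *m P^T = Defs.eta R 1 m -> u != 0 -> u *m g *m u^T = 0 -> u *m g *m w^T = 0 ->
  exists s (y : 'rV[R]_m), w *m g *m w^T = y *m y^T /\ (y = 0 -> w = s *: u).
Proof.
move=> uP E; have E2 : g = invmx P *m Defs.eta R 1 m *m (invmx P)^T.
  by rewrite -E trmx_inv !mulmxA mulVmx// mul1mx -mulmxA mulmxV ?unitmx_tr// mulmx1.
have gE (a b : 'rV[R]_N) : a *m g *m b^T = (a *m invmx P) *m Defs.eta R 1 m *m (b *m invmx P)^T.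
  by rewrite E2 trmx_mul !mulmxA.
have eE (a b : 'rV[R]_N) : a *m Defs.eta R 1 m *m b^T =
    rsubmx a *m (rsubmx b)^T - lsubmx a *m (lsubmx b)^T.
  have := @eta_block R 1 m 1 1 (lsubmx a)^T (rsubmx a)^T (lsubmx b)^T (rsubmx b)^T.
  by rewrite -!tr_row_mx !hsubmxK !trmxK.
rewrite !gE; set u' := u *m invmx P; set w' := w *m invmx P => u0.
have u'0 : u' != 0.
  by apply: contra u0 => /eqP h; rewrite -[u]mulmx1 -(mulVmx uP) mulmxA -/u' h mul0mx.
rewrite !eE; set U := rsubmx u'; set W := rsubmx w'; set a := lsubmx u'; set b := lsubmx w'.
move=> /eqP; rewrite subr_eq0 => /eqP hU /eqP; rewrite subr_eq0 => /eqP hW.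
have uE : u' = row_mx a U by rewrite hsubmxK.
have wE : w' = row_mx b W by rewrite hsubmxK.
have aE : a = (a 0 0)%:M by exact: mx11_scalar.
have bE' : b = (b 0 0)%:M by exact: mx11_scalar.
clearbody U W a b.
have a0 : a 0 0 != 0.
  apply: contra u'0 => /eqP h; rewrite uE aE h raddf0.
  have : U *m U^T = 0 by rewrite hU aE h raddf0 mul0mx.
  by rewrite -{1}[U]trmxK => /gram_eq0 /(congr1 trmx); rewrite trmxK trmx0 => ->; rewrite row_mx0.
pose s := b 0 0 / a 0 0; exists s, (W - s *: U).
have WU : W *m U^T = (b 0 0 * a 0 0)%:M.
  have := congr1 trmx hW; rewrite !trmx_mul !trmxK => ->.
  by rewrite {1}bE' {1}aE tr_scalar_mx -scalar_mxM.
split.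
  rewrite gram_sub_scale hU hW WU.
  apply/matrixP => i j; rewrite (ord1 i) (ord1 j) !mxE !big_ord1 !mxE !mulr1n /s.
  by move: (W *m W^T) (a 0 0) (b 0 0) a0 => Q a1 b1 h; field.
move=> /eqP; rewrite subr_eq0 => /eqP hWs.
have : w' = s *: u'.
  rewrite uE wE scale_row_mx -hWs; congr (row_mx _ _).
  by rewrite aE [LHS]bE' scale_scalar_mx /s divfK.
by move=> h; rewrite -[w]mulmx1 -(mulVmx uP) mulmxA -/w' h -scalemxAl /u' -mulmxA mulVmx// mulmx1.
Qed.

End LorentzForm.

Lemma smooth_map_tsmooth (R : realType) m n (M : manifoldType R m) (N : manifoldType R n) (F : M -> N) :
  (forall c, atlas M c -> tsmooth (cimg c) (F \o cinv c)) -> smooth_map F.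
Proof.
move=> H; split.
  move=> p _; have [c ac dp] := chart_at p.
  have cF := tsmooth_cont (cimg_cfun dp) (H c ac).
  have E : \forall q \near p, F q = ((F \o cinv c) \o cfun c) q.
    have hd : \forall q \near p, cdom c q by apply: open_nbhs_nbhs; split => //; exact: cdom_open.
    by apply: filterS hd => q dq /=; rewrite cinvK.
  have cp : {for p, continuous ((F \o cinv c) \o cfun c)}.
    by apply: continuous_comp; [exact: cfun_cont|exact: cF].
  move=> W; rewrite -{1}(cinvK ac dp) => nW; have h := cp W nW.
  have h2 : \forall q \near p, W (((F \o cinv c) \o cfun c) q) := h.
  have h3 : \forall q \near p, W (F q) by apply: filterS2 E h2 => q ->.
  exact: h3.
move=> c c' ac ac'; rewrite setTI cimgI//.
by have := tsmooth_chart (cimg_open ac) (H c ac) ac'.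
Qed.

(** * The differential of the orbit map *)

Section Orbit.
Context {R : realType} {d m : nat} (G : lieGroupType R d) (M : manifoldType R (1 + m)).
Local Notation lie := (lie_algebra G).
Variables (g : form_field M) (act : G -> M -> M) (x0 : M).
Hypothesis g_lorentz : lorentz_metric g.
Hypothesis act_isometric : isometric_action g act.

Definition orb a := act a x0.

Lemma orb_mul a b : act a (orb b) = orb (a * b)%g.
Proof. by have [_ h _ _] := act_isometric; rewrite /orb h. Qed.

Lemma orb1 : orb 1%g = x0.
Proof. by have [h _ _ _] := act_isometric; exact: h. Qed.

Lemma orb_smooth : smooth_map orb.
Proof.
have [_ _ s2 _] := act_isometric; apply: smooth_map_tsmooth => c ac.
exact: (tsmooth_map2 (cimg_open ac) s2 (chart_tsmooth ac) (tsmooth_cst x0)).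
Qed.

Lemma act_smooth a : smooth_map (act a).
Proof.
have [_ _ s2 _] := act_isometric; apply: smooth_map_tsmooth => c ac.
exact: (tsmooth_map2 (cimg_open ac) s2 (tsmooth_cst a) (chart_tsmooth ac)).
Qed.

Lemma stabilizer_closed : closed (stabilizer act x0).
Proof.
have -> : stabilizer act x0 = orb @^-1` [set x0] by [].
apply: closed_comp => [a _|]; first exact: (orb_smooth.1 a I).
by apply: accessible_closed_set1; apply: hausdorff_accessible; exact: manifold_hausdorff.
Qed.

Variables (c : chart R d G) (x : 'I_d -> G -> R^o).
Hypothesis U : unit_chart c x.
Variables (cM : chart R (1 + m) M) (y : 'I_(1 + m) -> M -> R^o).
Hypotheses (acM : atlas M cM) (dcM : cdom cM x0) (sy : forall j, smooth_fun (y j)).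
Hypothesis hy : \forall q \near x0, cdom cM q /\ forall j, y j q = cfun cM q 0 j.

(** The differential at 1 of the orbit map, applied to [X] and read in the chart [cM]; like [x] on
    the group, the [y j] are global smooth functions extending the coordinates. *)
Definition beta (X : operator G) : 'rV[R]_(1 + m) := \row_j X (y j \o orb) 1%g.

Lemma beta_lin (s : R) X Y : beta (s *: X + Y) = s *: beta X + beta Y.
Proof. by apply/rowP => j; rewrite !mxE. Qed.

Lemma sy_orb j : smooth_fun (y j \o orb).
Proof. exact: (smooth_fun_comp orb_smooth (sy j)). Qed.

Definition velocity n (N : manifoldType R n) (A : R -> N) (c' : chart R n N) : 'rV[R]_n :=
  'D_('e_0) (cfun c' \o (A \o @coord0 R)) (0 : 'rV[R]_1).

Lemma ops_tsmooth1 X gam : lie X -> one_parameter_subgroup X gam -> tsmooth setT (gam \o @coord0 R).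
Proof. by move=> lX hg; exact: (ops_tsmooth lX hg openT (@smooth_on_coord R 1 setT 0)). Qed.

Lemma coord00 : coord0 (0 : 'rV[R]_1) = 0.
Proof. by rewrite /coord0 mxE. Qed.

Lemma velocity_comp n k (N : manifoldType R n) (K : manifoldType R k) (F : N -> K) (A : R -> N) c1 c2 :
  tsmooth setT (A \o @coord0 R) -> smooth_map F -> atlas N c1 -> atlas K c2 ->
  cdom c1 (A 0) -> cdom c2 (F (A 0)) ->
  velocity (F \o A) c2 = velocity A c1 *m local_jacobian F c1 c2 (A 0).
Proof.
move=> sA sF a1 a2 d1 d2; rewrite /velocity.
have := derive_chart_map 'e_0 openT (I : setT (0 : 'rV[R]_1)) openT sF sA I a1 a2.
rewrite /= coord00; exact.
Qed.

Lemma velocity_unit X gam : lie X -> one_parameter_subgroup X gam -> velocity gam c = xi x X.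
Proof.
move=> lX hg; apply/rowP => j; rewrite mxE.
have s1 := ops_tsmooth1 lX hg.
have dgam : cdom c ((gam \o @coord0 R) 0) by rewrite /= coord00 (ops0 hg); exact: uc_dom U.
have E : \forall z \near (0 : 'rV[R]_1), x j (gam (coord0 z)) = (cfun c \o (gam \o @coord0 R)) z 0 j.
  have h3 := uc_near U; rewrite -{1}(ops0 hg) -coord00 in h3.
  have h4 : \forall z \near (0 : 'rV[R]_1), cdom c (gam (coord0 z)) /\
    forall j, x j (gam (coord0 z)) = cfun c (gam (coord0 z)) 0 j := tsmooth_cont I s1 h3.
  by apply: filterS h4 => z [_ ->].
have oT := tsmooth_open openT s1 (cdom_open (uc_atlas U)).
have sT := tsmooth_chart openT s1 (uc_atlas U).
have dfd : derivable (cfun c \o (gam \o @coord0 R)) 0 'e_0.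
  exact: diff_derivable (smooth_on_differentiable oT (conj I dgam) sT).
have [_ <-] := (is_derive_mxP _ _ _ _).1 (DeriveDef dfd erefl) 0 j.
rewrite -(near_eq_derive _ E).
have h1 := hg.2 _ (uc_smooth U j) 0; rewrite (ops0 hg) in h1.
have E2 (h : R) : x j (gam (coord0 (h *: 'e_0 + (0 : 'rV[R]_1)))) = x j (gam (h + 0)).
  by rewrite !addr0 /coord0 !mxE mulr1.
by have [_ ->] := @is_derive_line R _ _ (fun z => x j (gam (coord0 z))) (fun s => x j (gam s)) 0 'e_0 0 _ E2 h1.
Qed.

Lemma velocity_orb X gam : lie X -> one_parameter_subgroup X gam -> velocity (orb \o gam) cM = beta X.
Proof.
move=> lX hg; apply/rowP => j; rewrite mxE.
have s1 : tsmooth setT ((orb \o gam) \o @coord0 R).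
  exact: (tsmooth_map openT openT orb_smooth (ops_tsmooth1 lX hg) (fun _ _ => I)).
have og0 : ((orb \o gam) \o @coord0 R) 0 = x0 by rewrite /= coord00 (ops0 hg) orb1.
have dgam : cdom cM (((orb \o gam) \o @coord0 R) 0) by rewrite og0.
have E : \forall z \near (0 : 'rV[R]_1), y j (orb (gam (coord0 z))) = (cfun cM \o ((orb \o gam) \o @coord0 R)) z 0 j.
  have h3 := hy; rewrite -{1}og0 in h3.
  have h4 : \forall z \near (0 : 'rV[R]_1), cdom cM (orb (gam (coord0 z))) /\
    forall j, y j (orb (gam (coord0 z))) = cfun cM (orb (gam (coord0 z))) 0 j := tsmooth_cont I s1 h3.
  by apply: filterS h4 => z [_ ->].
have oT := tsmooth_open openT s1 (cdom_open acM).
have sT := tsmooth_chart openT s1 acM.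
have dfd : derivable (cfun cM \o ((orb \o gam) \o @coord0 R)) 0 'e_0.
  exact: diff_derivable (smooth_on_differentiable oT (conj I dgam) sT).
have [_ <-] := (is_derive_mxP _ _ _ _).1 (DeriveDef dfd erefl) 0 j.
rewrite -(near_eq_derive _ E).
have h1 := hg.2 _ (sy_orb j) 0; rewrite (ops0 hg) in h1.
have E2 (h : R) : y j (orb (gam (coord0 (h *: 'e_0 + (0 : 'rV[R]_1))))) = (y j \o orb) (gam (h + 0)).
  by rewrite !addr0 /coord0 !mxE mulr1.
by have [_ ->] := @is_derive_line R _ _ (fun z => y j (orb (gam (coord0 z)))) (fun s => (y j \o orb) (gam s)) 0 'e_0 0 _ E2 h1.
Qed.

Lemma velocity_act X gam a c2 : lie X -> one_parameter_subgroup X gam -> atlas M c2 -> cdom c2 (orb a) ->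
  velocity (fun t => orb (a * gam t)%g) c2 = beta X *m local_jacobian (act a) cM c2 x0.
Proof.
move=> lX hg a2 d2; have s1 : tsmooth setT ((orb \o gam) \o @coord0 R).
  exact: (tsmooth_map openT openT orb_smooth (ops_tsmooth1 lX hg) (fun _ _ => I)).
have og0 : (orb \o gam) 0 = x0 by rewrite /= (ops0 hg) orb1.
have := velocity_comp s1 (act_smooth a) acM a2; rewrite og0 (velocity_orb lX hg) => <- //.
have -> : (fun t => orb (a * gam t)%g) = act a \o (orb \o gam).
  by apply/funext => t; rewrite /= orb_mul.
by [].
Qed.

Definition gform (v w : 'rV[R]_(1 + m)) : R := (v *m g cM x0 *m w^T) 0 0.

Lemma gformE v w : v *m g cM x0 *m w^T = (gform v w)%:M.
Proof. exact: mx11_scalar. Qed.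

Lemma act_preserves a c2 : atlas M c2 -> cdom c2 (orb a) ->
  local_jacobian (act a) cM c2 x0 *m g c2 (orb a) *m (local_jacobian (act a) cM c2 x0)^T = g cM x0.
Proof. by move=> a2 d2; have [_ _ _ h] := act_isometric; exact: (h a cM c2 x0 acM a2 dcM d2). Qed.

Lemma gform_sym v w : gform v w = gform w v.
Proof.
have [P uP hP] := g_lorentz.2 cM x0 acM dcM; have [_ E] := lorentz_form_sym uP hP.
have e : (v *m g cM x0 *m w^T)^T = w *m g cM x0 *m v^T by rewrite !trmx_mul trmxK E mulmxA.
by rewrite /gform -e [in RHS]mxE.
Qed.

(** Since the inverse of [a] fixes [x0], the orbit maps take the same value on a exp(tX) a^-1 and on
    a exp(tX). *)
Lemma beta_Ad a X : stabilizer act x0 a -> lie X ->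
  beta (AdOp a X) = beta X *m local_jacobian (act a) cM cM x0.
Proof.
move=> Ha lX; have [gam hg] := one_parameter_exists U lX.
have da : cdom cM (orb a) by rewrite /orb Ha.
rewrite -(velocity_act lX hg acM da) -(velocity_orb (AdOp_alg a lX) (AdOp_ops a lX hg)).
have Hai : act (a^-1)%g x0 = x0 by have := orb_mul (a^-1)%g a; rewrite mulVg orb1 {1}/orb Ha.
suff -> : orb \o (fun t => a * gam t * a^-1)%g = (fun t => orb (a * gam t)%g) by [].
by apply/funext => t /=; rewrite -orb_mul [X in act _ X]/orb Hai.
Qed.

Lemma gform_Ad a X Y : stabilizer act x0 a -> lie X -> lie Y ->
  gform (beta (AdOp a X)) (beta (AdOp a Y)) = gform (beta X) (beta Y).
Proof.
move=> Ha lX lY; rewrite /gform (beta_Ad Ha lX) (beta_Ad Ha lY) trmx_mul.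
have da : cdom cM (orb a) by rewrite /orb Ha.
have := act_preserves acM da; rewrite {1}/orb Ha => E.
by rewrite -[in RHS]E !mulmxA.
Qed.

(** The velocity of the orbit curve at time s is the image of the velocity at 0 under [act (gam s)],
    so it vanishes for all s and the curve is constant. *)
Lemma beta_stab X gam t : lie X -> one_parameter_subgroup X gam -> beta X = 0 -> stabilizer act x0 (gam t).
Proof.
move=> lX hg b0; apply: smooth_separates => f sf.
have D0 s : is_derive s (1 : R) (fun s => f (orb (gam s)) : R^o) 0.
  have sfo : smooth_fun (fun a => f (orb a)) := smooth_fun_comp orb_smooth sf.
  have h1 := hg.2 _ sfo s.
  suff <- : X (fun a => f (orb a)) (gam s) = 0 by [].
  rewrite -{1}[gam s]mulg1 -(lie_alg_mull (gam s) _ 1%g lX).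
  have sfs : smooth_fun (fun p => f (act (gam s) p)) := smooth_fun_comp (act_smooth (gam s)) sf.
  have h2 : is_derive 0 (1 : R) (fun t => f (act (gam s) (orb (gam t))) : R^o)
      (X (fun a => f (orb (gam s * a))%g) 1%g).
    have := hg.2 _ (smooth_fun_comp orb_smooth sfs) 0; rewrite (ops0 hg).
    congr (is_derive _ _ _ (X _ _)); apply/funext => a /=.
    by rewrite orb_mul.
  have s1 : tsmooth setT ((orb \o gam) \o @coord0 R).
    exact: (tsmooth_map openT openT orb_smooth (ops_tsmooth1 lX hg) (fun _ _ => I)).
  have og0 : ((orb \o gam) \o @coord0 R) 0 = x0 by rewrite /= coord00 (ops0 hg) orb1.
  have d0 : cdom cM (((orb \o gam) \o @coord0 R) 0) by rewrite og0.
  have h3 := is_derive_chart 'e_0 openT (I : setT (0 : 'rV[R]_1)) s1 acM d0 sfs.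
  have E2 (h : R) : ((fun p => f (act (gam s) p)) \o ((orb \o gam) \o @coord0 R)) (h *: 'e_0 + (0 : 'rV[R]_1))
      = f (act (gam s) (orb (gam (h + 0)))).
    by rewrite /= !addr0 /coord0 !mxE mulr1.
  have [_ <-] := @is_derive_line R _ _ _ (fun t => f (act (gam s) (orb (gam t))) : R^o) 0 'e_0 0 _ E2 h2.
  have [_ ->] := h3.
  have e : 'D_('e_0) (cfun cM \o ((orb \o gam) \o @coord0 R)) (0 : 'rV[R]_1) = 0.
    by rewrite -[LHS]/(velocity (orb \o gam) cM) (velocity_orb lX hg) b0.
  rewrite e.
  rewrite deriveE ?linear0//.
  have Ix : cimg cM (cfun cM (((orb \o gam) \o @coord0 R) 0)) by exact: cimg_cfun.
  exact: (smooth_on_differentiableR (cimg_open acM) Ix (sfs cM acM)).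
have ht : `|t| < `|t| + 1 by rewrite ltrDl ltr01.
have h0 : `|0 : R| < `|t| + 1 by rewrite normr0 ltr_wpDl// ltr01.
by rewrite -[act _ _]/(orb (gam t)) (real_curve_const (fun u _ => D0 u) ht h0) (ops0 hg) orb1.
Qed.

Lemma stab_lie_algebra : subgroup_lie_algebra (stabilizer act x0) = [set X | lie X /\ beta X = 0].
Proof.
apply/seteqP; split=> X.
  move=> [lX [gam hg Hg]]; split => //; rewrite -(velocity_orb lX hg) /velocity.
  have -> : cfun cM \o ((orb \o gam) \o @coord0 R) = cst (cfun cM x0).
    by apply/funext => z /=; rewrite /orb Hg.
  by rewrite derive_cst.
move=> [lX b0]; split => //; have [gam hg] := one_parameter_exists U lX.
by exists gam => // t; exact: (beta_stab t lX hg b0).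
Qed.

Lemma beta_Ad_derive X Y gam : lie X -> lie Y -> one_parameter_subgroup X gam ->
  is_derive 0 (1 : R) (fun s => beta (AdOp (gam s) Y)) (beta (lie_bracket G X Y)).
Proof.
move=> lX lY hg; apply/is_derive_mxP => i j; rewrite (ord1 i) mxE.
have := AdOp_derive0 lX lY (one_parameter_exists U lY) hg (sy_orb j).
congr is_derive; apply/funext => s; by rewrite mxE.
Qed.

(** The derivative at 0 of [beta (AdOp (gam s) Y)], which vanishes identically because [gam] stays
    in the stabilizer. *)
Lemma beta_bracket X Y : lie X -> lie Y -> beta X = 0 -> beta Y = 0 -> beta (lie_bracket G X Y) = 0.
Proof.
move=> lX lY bX bY; have [gam hg] := one_parameter_exists U lX.
have [_ <-] := beta_Ad_derive lX lY hg.
have -> : (fun s => beta (AdOp (gam s) Y)) = cst 0.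
  by apply/funext => s; rewrite (beta_Ad (beta_stab s lX hg bX) lY) bY mul0mx.
by rewrite derive_cst.
Qed.

(** The derivative at 0 of the invariance [gform_Ad] along a one-parameter subgroup of the
    stabilizer. *)
Lemma gform_bracket X Y Z : lie X -> lie Y -> lie Z -> beta X = 0 ->
  gform (beta (lie_bracket G X Y)) (beta Z) + gform (beta Y) (beta (lie_bracket G X Z)) = 0.
Proof.
move=> lX lY lZ bX; have [gam hg] := one_parameter_exists U lX.
have hY := beta_Ad_derive lX lY hg; have hZ := beta_Ad_derive lX lZ hg.
have := is_derive_mulmx (is_derive_mulmxr (g cM x0) hY) (is_derive_trmx hZ).
rewrite (ops0 hg) !AdOp1.
have -> : (fun s => beta (AdOp (gam s) Y) *m g cM x0 *m (beta (AdOp (gam s) Z))^T) =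
    cst (beta Y *m g cM x0 *m (beta Z)^T).
  by apply/funext => s; rewrite /= !gformE (gform_Ad (beta_stab s lX hg bX) lY lZ).
by move=> [_]; rewrite derive_cst => /esym/matrixP/(_ 0 0); rewrite !mxE /gform => <-; rewrite !mxE.
Qed.

End Orbit.

Section OrbitSubmanifold.
Context {R : realType} {d m k : nat} (G : lieGroupType R d) (M : manifoldType R (1 + m)) (O : manifoldType R k).
Local Notation lie := (lie_algebra G).
Variables (g : form_field M) (act : G -> M -> M) (x0 : M) (i : O -> M) (pi : G -> O).
Hypothesis g_lorentz : lorentz_metric g.
Hypothesis act_isometric : isometric_action g act.
Hypothesis i_imm : immersion i.
Hypothesis pi_sub : submersion pi.
Hypothesis i_pi : forall a, i (pi a) = act a x0.
Hypothesis i_deg : degenerate_submanifold i g.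
Variables (c : chart R d G) (x : 'I_d -> G -> R^o).
Hypothesis U : unit_chart c x.
Variables (cM : chart R (1 + m) M) (y : 'I_(1 + m) -> M -> R^o).
Hypotheses (acM : atlas M cM) (dcM : cdom cM x0) (sy : forall j, smooth_fun (y j)).
Hypothesis hy : \forall q \near x0, cdom cM q /\ forall j, y j q = cfun cM q 0 j.
Local Notation beta := (beta act x0 y).
Local Notation gform := (gform g x0 cM).

Lemma i_pi1 : i (pi 1%g) = x0.
Proof. by rewrite i_pi; have [h _ _ _] := act_isometric; exact: h. Qed.

Lemma pi_ops_tsmooth X gam : lie X -> one_parameter_subgroup X gam -> tsmooth setT ((pi \o gam) \o @coord0 R).
Proof.
move=> lX hg; exact: (tsmooth_map openT openT pi_sub.1 (ops_tsmooth1 lX hg) (fun _ _ => I)).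
Qed.

(** The chain rule for the orbit map, the composite of [pi] and [i]. *)
Lemma beta_factor cO X : atlas O cO -> cdom cO (pi 1%g) -> lie X ->
  beta X = xi x X *m local_jacobian pi c cO 1%g *m local_jacobian i cO cM (pi 1%g).
Proof.
move=> aO dO lX; have [gam hg] := one_parameter_exists U lX.
rewrite -(velocity_orb act_isometric acM dcM sy hy lX hg).
have -> : orb act x0 \o gam = i \o (pi \o gam) by apply/funext => t /=; rewrite i_pi.
have d1 : cdom cO ((pi \o gam) 0) by rewrite /= (ops0 hg).
have d2 : cdom cM (i ((pi \o gam) 0)) by rewrite /= (ops0 hg) i_pi1.
rewrite (velocity_comp (pi_ops_tsmooth lX hg) i_imm.1 aO acM d1 d2).
have d3 : cdom c (gam 0) by rewrite (ops0 hg); exact: uc_dom U.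
rewrite (velocity_comp (ops_tsmooth1 lX hg) pi_sub.1 (uc_atlas U) aO d3 d1) (velocity_unit U lX hg).
by rewrite /= (ops0 hg).
Qed.

Lemma beta_surj cO w : atlas O cO -> cdom cO (pi 1%g) ->
  (w <= local_jacobian i cO cM (pi 1%g))%MS -> exists2 X, lie X & beta X = w.
Proof.
move=> aO dO /submxP[v ->].
have full := pi_sub.2 c cO 1%g (uc_atlas U) aO (uc_dom U) dO.
have /submxP[z ->] := submx_full v full.
have lX := xfield_alg U z; exists (xfield c z) => //.
by rewrite (beta_factor aO dO lX) (xi_xfield U).
Qed.

(** Degeneracy gives a null tangent vector orthogonal to the tangent space of the orbit. On its
    orthogonal in a Lorentz space the form is semidefinite with kernel the line it spans, by
    [lorentz_orth_null]. *)
Lemma lightlike_direction : exists2 X0, lie X0 &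
  [/\ beta X0 != 0, (forall X, lie X -> gform (beta X0) (beta X) = 0),
      (forall X, lie X -> 0 <= gform (beta X) (beta X)) &
      forall X, lie X -> gform (beta X) (beta X) = 0 -> exists s : R, beta X = s *: beta X0].
Proof.
have [cO aO dO] := chart_at (pi 1%g).
have dM : cdom cM (i (pi 1%g)) by rewrite i_pi1.
have [u [u0 uJ uorth]] := i_deg aO acM dO dM; rewrite i_pi1 in uorth.
have [X0 lX0 EX0] := beta_surj aO dO uJ.
have inJ X : lie X -> (beta X <= local_jacobian i cO cM (pi 1%g))%MS.
  by move=> lX; rewrite (beta_factor aO dO lX) submxMl.
have [P uP hP] := g_lorentz.2 cM x0 acM dcM.
have key X (lX : lie X) := lorentz_orth_null uP hP u0 (uorth u uJ) (uorth (beta X) (inJ X lX)).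
have sq (v : 'rV[R]_m) : (v *m v^T) 0 0 = \sum_j v 0 j ^+ 2.
  by rewrite mxE; apply: eq_bigr => j _; rewrite mxE expr2.
exists X0 => //; rewrite EX0; split => //.
- by move=> X lX; rewrite /gform (uorth _ (inJ X lX)) mxE.
- move=> X lX; have [s [v [E _]]] := key X lX.
  by rewrite /gform E sq; apply: sumr_ge0 => j _; exact: sqr_ge0.
- move=> X lX; have [s [v [E h]]] := key X lX.
  rewrite /gform E sq => /eqP; rewrite psumr_eq0; last by move=> j _; exact: sqr_ge0.
  move=> /allP v0; exists s; apply: h; apply/rowP => j; rewrite mxE.
  by apply/eqP; rewrite -sqrf_eq0; apply: v0; exact: mem_index_enum.
Qed.

Context {p q : nat}.
Notation N := (p.+1 + q.+1)%N.
Local Notation o := (o_pq R p.+1 q.+1).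
Variables (phi : operator G -> 'M[R]_N) (psi : 'M[R]_N -> operator G).
Hypothesis L : lie_iso_o phi psi.
Hypothesis G_connected : connected [set: G].
Hypothesis G_center : finite_set (lie_center G).
Hypothesis stab_noncompact : ~ compact (stabilizer act x0).

Let h : set 'M[R]_N := [set A | o A /\ beta (psi A) = 0].
(** Composed with [skew_part] because [lightlike_pair] asks for linearity and symmetry on all
    matrices. *)
Let b (A B : 'M[R]_N) : R := gform (beta (psi (skew_part A))) (beta (psi (skew_part B))).

Let b_o A B : o A -> o B -> b A B = gform (beta (psi A)) (beta (psi B)).
Proof. by move=> oA oB; rewrite /b !skew_part_id. Qed.

Lemma beta_psi_lin (s : R) A B : o A -> o B -> beta (psi (s *: A + B)) = s *: beta (psi A) + beta (psi B).
Proof. by move=> oA oB; rewrite (li_psi_lin L s oA oB) beta_lin. Qed.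

Lemma beta_psi0 : beta (psi 0) = 0.
Proof.
rewrite (li_psi0 L); apply/rowP => j; by rewrite !mxE.
Qed.

Lemma gform_lin (s : R) u v w : gform (s *: u + v) w = s * gform u w + gform v w.
Proof. by rewrite /gform !mulmxDl -!scalemxAl !mxE. Qed.

Lemma psi_bracket A B : o A -> o B -> psi (mx_bracket R N A B) = lie_bracket G (psi A) (psi B).
Proof.
move=> oA oB; have lA := li_alg L oA; have lB := li_alg L oB.
apply: (li_inj L); [exact: (li_alg L (o_opq_bracket oA oB))|exact: lie_bracket_alg|].
by rewrite (li_phiK L (o_opq_bracket oA oB)) (li_br L lA lB) (li_phiK L oA) (li_phiK L oB).
Qed.

Lemma orbit_lightlike_pair : exists X0, lightlike_pair h b X0.
Proof.
have [X0 lX0 [n0 orth pos rad]] := lightlike_direction.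
have oX0 := li_o L lX0; exists (phi X0); split.
- split; first by split; [exact: (o0 : o (0 : 'M[R]_N))|exact: beta_psi0].
  move=> s A B [oA bA] [oB bB]; split; first exact: o_opq_linear.
  by rewrite (beta_psi_lin s oA oB) bA bB scaler0 addr0.
- by move=> A [].
- move=> A B [oA bA] [oB bB]; split; first exact: o_opq_bracket.
  rewrite (psi_bracket oA oB).
  exact: (beta_bracket act_isometric U acM dcM sy hy (li_alg L oA) (li_alg L oB) bA bB).
- move=> s A B C; rewrite /b skew_part_lin (beta_psi_lin _ (skew_part_o A) (skew_part_o B)).
  exact: gform_lin.
- move=> A B; exact: (gform_sym g_lorentz acM dcM).
- move=> A oA; rewrite (b_o oA oA); exact: (pos _ (li_alg L oA)).
- move=> A B C [oA bA] oB oC; have lA := li_alg L oA; have lB := li_alg L oB; have lC := li_alg L oC.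
  rewrite (b_o (o_opq_bracket oA oB) oC) (b_o oB (o_opq_bracket oA oC)) (psi_bracket oA oB) (psi_bracket oA oC).
  exact: (gform_bracket act_isometric U acM dcM sy hy lA lB lC bA).
- by move=> A [oA bA]; rewrite (b_o oA oA) bA /gform !mul0mx mxE.
- move=> A oA; rewrite (b_o oA oA) => /(rad _ (li_alg L oA))[s bs]; exists s.
  have oB : o (A - s *: phi X0).
    by rewrite addrC -scaleNr; exact: o_opq_linear.
  split => //; rewrite addrC -scaleNr (beta_psi_lin _ oX0 oA) (li_psiK L lX0) bs scaleNr.
  by rewrite addNr.
- split => //; first by rewrite (b_o oX0 oX0) (li_psiK L lX0); exact: orth.
  by move=> [_]; rewrite (li_psiK L lX0) => /eqP; rewrite (negPf n0).
Qed.

Lemma orbit_normal_form : (p <= 1)%N -> (2 <= q)%N -> exists S : 'M[R]_N, [/\ orth S, p = 0%N,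
  (forall A, o A -> beta (psi (cj S A)) = 0 <-> A *m @vnull R p q = 0),
  (forall A, o A -> gform (beta (psi (cj S (wedge (@vnull R p q) (@vdual R p q))))) (beta (psi (cj S A))) = 0) &
  exists2 kappa : R, 0 < kappa & forall i j,
    gform (beta (psi (cj S (wedge (@vdual R p q) (sevec i))))) (beta (psi (cj S (wedge (@vdual R p q) (sevec j)))))
    = kappa *+ (i == j)].
Proof.
move=> p1 q2; have [X0 H] := orbit_lightlike_pair.
pose P : set 'M[R]_N := [set A | exists2 a, stabilizer act x0 a & implements phi A a].
have Po A : P A -> orth A by move=> [a _ []].
have Pb A X : P A -> o X -> b (cj A X) (cj A X) = b X X.
  move=> [a Ha [oA hA]] oX; have lX := li_alg L oX; have oc := cj_o oA oX.
  rewrite (b_o oc oc) (b_o oX oX).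
  have -> : psi (cj A X) = AdOp a (psi X).
    rewrite -{1}(li_phiK L oX) -(hA _ lX); exact: (li_psiK L (AdOp_alg a lX)).
  exact: (gform_Ad act_isometric U acM dcM sy hy Ha lX lX).
(* A bound on the implementing matrices would make the closed stabilizer compact. *)
have Pu C : exists2 A, P A & C < `|mxvec A|.
  apply: contrapT => nC; apply: stab_noncompact.
  apply: (bounded_compact L U G_connected (C := C) G_center (stabilizer_closed act_isometric)).
  move=> a A Ha hA; rewrite leNgt; apply/negP => CA; apply: nC; exists A => //.
  by exists a.
have [S [oS p0 hS bS [kappa k0 kS]]] := isotropy_normal_form p1 q2 H Po Pb Pu.
have oc A : o A -> o (cj S A) := cj_o oS.
exists S; split => //.
- move=> A oA; rewrite -(hS A oA) /h /=; split => [E|[]//].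
  by split => //; exact: oc.
- by move=> A oA; rewrite -(b_o (oc _ (wedge_o _ _)) (oc _ oA)) bS.
- by exists kappa => // i' j'; rewrite -(b_o (oc _ (wedge_o _ _)) (oc _ (wedge_o _ _))) kS.
Qed.

End OrbitSubmanifold.

Local Opaque vnull vdual.

Lemma lie_isomorphic_trans (R : realType) (V W T : lmodType R) (A : set V) bV (B : set W) bW (C : set T) bT :
  lie_isomorphic A bV B bW -> lie_isomorphic B bW C bT -> lie_isomorphic A bV C bT.
Proof.
move=> [f [bf lf hf]] [f' [bf' lf' hf']]; have fAB u : A u -> B (f u) by case: bf => h _ _; exact: h.
exists (f' \o f); split; first exact: (set_bij_comp bf bf').
  by move=> a u v Au Av /=; rewrite lf// lf'//; exact: fAB.
by move=> u v Au Av /=; rewrite hf// hf'//; exact: fAB.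
Qed.

(** * The stabilizer of a null vector as a semidirect product *)

Section NullStabilizer.
Context {R : realType} {q : nat}.
Notation N := (1 + q.+1)%N.
Local Notation o := (o_pq R 1 q.+1).
Local Notation br := (mx_bracket R N).
Local Notation vnull := (@vnull R 0 q).
Local Notation vdual := (@vdual R 0 q).
Local Notation sevec := (@sevec R 0 q).

Lemma sevec_bform_null i : bform (sevec i) vnull = 0.
Proof. by rewrite bformC bform_vnull_sevec. Qed.

Lemma sevec_bform_dual i : bform (sevec i) vdual = 0.
Proof. by rewrite bformC bform_vdual_sevec. Qed.

Lemma bform_suml p' q' (I : Type) (r : seq I) (F : I -> 'cV[R]_(p' + q')) y :
  bform (\sum_(i <- r) F i) y = \sum_(i <- r) bform (F i) y.
Proof.
by apply: (big_morph (fun z => bform z y)) => [u v|]; [exact: bformDl|exact: bform0l].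
Qed.

Lemma bform_sumr p' q' (I : Type) (r : seq I) (F : I -> 'cV[R]_(p' + q')) y :
  bform y (\sum_(i <- r) F i) = \sum_(i <- r) bform y (F i).
Proof. by rewrite bformC bform_suml; apply: eq_bigr => i _; rewrite bformC. Qed.

(** For [Z] killing [vnull], the action on the Euclidean space of vectors orthogonal to [vnull]
    modulo [vnull], in the basis of the [sevec i]. *)
Definition null_rot (Z : 'M[R]_N) : 'M[R]_q := \matrix_(i, j) bform (sevec i) (Z *m sevec j).
(** The translation part, read off the image of [vdual]; with [null_rot] it determines an element of
    o(1, q + 1) that kills [vnull]. *)
Definition null_trans (Z : 'M[R]_N) : 'cV[R]_q := \col_i bform (sevec i) (Z *m vdual).
Definition null_iso (Z : 'M[R]_N) := (null_rot Z, null_trans Z).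

Lemma null_sevec Z j : o Z -> Z *m vnull = 0 ->
  Z *m sevec j = - null_trans Z j 0 *: vnull + \sum_l null_rot Z l j *: sevec l.
Proof.
move=> oZ Zv; rewrite [LHS]cV_frame.
have -> : bform vnull (Z *m sevec j) = 0 by rewrite -[bform _ _]opprK -(o_form _ _ oZ) Zv bform0l oppr0.
have -> : bform vdual (Z *m sevec j) = - null_trans Z j 0.
  by rewrite mxE [in RHS]bformC (o_form _ _ oZ) opprK.
by rewrite scale0r addr0; congr (_ + _); apply: eq_bigr => l _; rewrite mxE.
Qed.

Lemma null_dual Z : o Z -> Z *m vnull = 0 -> Z *m vdual = \sum_l null_trans Z l 0 *: sevec l.
Proof.
move=> oZ Zv; rewrite [LHS]cV_frame.
have -> : bform vnull (Z *m vdual) = 0 by rewrite -[bform _ _]opprK -(o_form _ _ oZ) Zv bform0l oppr0.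
rewrite (o_isotropic _ oZ) !scale0r !add0r.
by apply: eq_bigr => l _; rewrite mxE.
Qed.

Lemma null_rot_mul Z Z' i j : o Z' -> Z *m vnull = 0 -> Z' *m vnull = 0 ->
  bform (sevec i) (Z *m (Z' *m sevec j)) = (null_rot Z *m null_rot Z') i j.
Proof.
move=> oZ' Zv Zv'; rewrite (null_sevec j oZ' Zv') mulmxDr -scalemxAr Zv scaler0 add0r mulmx_sumr bform_sumr mxE.
by apply: eq_bigr => l _; rewrite -scalemxAr bformZr mulrC [null_rot Z i l]mxE.
Qed.

Lemma null_trans_mul Z Z' i : o Z' -> Z *m vnull = 0 -> Z' *m vnull = 0 ->
  bform (sevec i) (Z *m (Z' *m vdual)) = (null_rot Z *m null_trans Z') i 0.
Proof.
move=> oZ' Zv Zv'; rewrite (null_dual oZ' Zv') mulmx_sumr bform_sumr mxE.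
by apply: eq_bigr => l _; rewrite -scalemxAr bformZr mulrC [null_rot Z i l]mxE.
Qed.

Lemma null_inj Z : o Z -> Z *m vnull = 0 -> null_rot Z = 0 -> null_trans Z = 0 -> Z = 0.
Proof.
move=> oZ Zv rZ tZ; rewrite (o_frame_sum oZ) (null_dual oZ Zv) Zv.
rewrite big1 => [|l _]; last by rewrite tZ mxE scale0r.
rewrite big1 ?wedge0l ?addr0 ?scaler0// => j _.
rewrite (null_sevec j oZ Zv) tZ rZ mxE oppr0 scale0r add0r big1 ?wedge0l// => l _.
by rewrite mxE scale0r.
Qed.

(** The element with prescribed translation and rotation parts; the double sum meets each plane
    twice, whence the factor 1/2. *)
Definition null_inv (S : 'M[R]_q * 'cV[R]_q) : 'M[R]_N :=
  \sum_l S.2 l 0 *: wedge (sevec l) vnull +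
  2^-1 *: \sum_l \sum_k S.1 l k *: wedge (sevec l) (sevec k).

Lemma null_inv_mul S (z : 'cV[R]_N) : null_inv S *m z = \sum_l S.2 l 0 *: (wedge (sevec l) vnull *m z) +
  2^-1 *: \sum_l \sum_k S.1 l k *: (wedge (sevec l) (sevec k) *m z).
Proof.
rewrite mulmxDl -scalemxAl !mulmx_suml; congr (_ + _ *: _).
  by apply: eq_bigr => l _; rewrite scalemxAl.
by apply: eq_bigr => l _; rewrite mulmx_suml; apply: eq_bigr => k _; rewrite scalemxAl.
Qed.

Lemma o_subspace p' q' : subspace (o_pq R p' q').
Proof. by split; [exact: (o0 : o_pq R p' q' 0)|move=> a X Y; exact: o_opq_linear]. Qed.

Lemma null_inv_o S : o (null_inv S).
Proof.
have so : subspace o := o_subspace 1 q.+1.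
apply: (subspaceD so).
  by apply: (subspace_sum _ so) => l _; apply: (subspaceZ _ so); exact: wedge_o.
apply: (subspaceZ _ so); apply: (subspace_sum _ so) => l _; apply: (subspace_sum _ so) => k _.
by apply: (subspaceZ _ so); exact: wedge_o.
Qed.

Lemma null_inv_null S : null_inv S *m vnull = 0.
Proof.
have [h1 _ _] := @bform_vnull R 0 q.
rewrite null_inv_mul !big1 ?scaler0 ?addr0// => l _.
  rewrite big1// => k _.
  by rewrite wedge_mul !sevec_bform_null !scale0r subr0 scaler0.
by rewrite wedge_mul h1 sevec_bform_null !scale0r subr0 scaler0.
Qed.

Lemma null_inv_rot S : S.1^T = - S.1 -> null_rot (null_inv S) = S.1.
Proof.
move=> /matrixP sk; apply/matrixP => i j; rewrite mxE null_inv_mul bformDr bformZr !bform_sumr.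
rewrite big1 => [|l _]; last first.
  rewrite wedge_mul bformZr bformBr (bformZr _ (sevec l)) (bformZr _ vnull).
  by rewrite sevec_bform_null bform_vnull_sevec !(mulr0, mul0r, subr0).
have -> : \sum_l bform (sevec i) (\sum_k S.1 l k *: (wedge (sevec l) (sevec k) *m sevec j)) =
   \sum_l \sum_k S.1 l k * ((k == j)%:R * (i == l)%:R - (l == j)%:R * (i == k)%:R).
  apply: eq_bigr => l _; rewrite bform_sumr; apply: eq_bigr => k _.
  by rewrite wedge_mul !bE !bform_sevec.
have E1 : \sum_l \sum_k S.1 l k * ((k == j)%:R * (i == l)%:R) = S.1 i j.
  rewrite (bigD1 i)//= [X in _ + X]big1 => [|l li]; last first.
    by apply: big1 => k _; rewrite [i == l]eq_sym (negPf li) !mulr0.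
  rewrite addr0 (bigD1 j)//= big1 => [|k kj]; last by rewrite (negPf kj) mul0r mulr0.
  by rewrite !eqxx !mulr1 addr0.
have E2 : \sum_l \sum_k S.1 l k * ((l == j)%:R * (i == k)%:R) = S.1 j i.
  rewrite (bigD1 j)//= [X in _ + X]big1 => [|l lj]; last first.
    by apply: big1 => k _; rewrite (negPf lj) mul0r mulr0.
  rewrite addr0 (bigD1 i)//= big1 => [|k ki]; last by rewrite [i == k]eq_sym (negPf ki) !mulr0.
  by rewrite !eqxx !mulr1 addr0.
have := sk i j; rewrite !mxE => E3.
have -> : \sum_l \sum_k S.1 l k * ((k == j)%:R * (i == l)%:R - (l == j)%:R * (i == k)%:R) = S.1 i j - S.1 j i.
  rewrite -E1 -E2 -sumrB; apply: eq_bigr => l _; rewrite -sumrB; apply: eq_bigr => k _.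
  by rewrite mulrBr.
by rewrite E3; field.
Qed.

Lemma null_inv_trans S : null_trans (null_inv S) = S.2.
Proof.
have [_ _ h3] := @bform_vnull R 0 q.
apply/matrixP => i j; rewrite (ord1 j) mxE null_inv_mul bformDr bformZr.
rewrite [X in 2^-1 * bform _ X]big1 => [|l _]; last first.
  by apply: big1 => k _; rewrite wedge_mul !sevec_bform_dual !scale0r subr0 scaler0.
rewrite [X in _ + _ * X]bformC bform0l mulr0 addr0 bform_sumr (bigD1 i)//= big1 => [|l li].
  rewrite wedge_mul h3 scale1r bformZr bformBr (bformZr _ vnull) sevec_bform_null bform_sevec eqxx.
  by rewrite !(mulr0, mulr1, subr0, addr0).
rewrite wedge_mul h3 scale1r bformZr bformBr (bformZr _ vnull) sevec_bform_null bform_sevec eq_sym (negPf li).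
by rewrite !(mulr0, subr0).
Qed.

Lemma null_stabilizer_semidirect :
  lie_isomorphic [set Z | o Z /\ Z *m vnull = 0] br (o_semidirect R q) (o_semidirect_bracket R q).
Proof.
exists null_iso; split.
- split.
  + move=> Z [oZ Zv]; rewrite /o_semidirect /=; apply/matrixP => i j; rewrite !mxE.
    by rewrite bformC (o_form _ _ oZ).
  + move=> Z Z' /set_mem[oZ Zv] /set_mem[oZ' Zv'] [/matrixP r /matrixP t].
    have oB : o (Z - Z') := subspaceB (o_subspace 1 q.+1) oZ oZ'.
    apply/eqP; rewrite -subr_eq0; apply/eqP; apply: null_inj => //.
    * by rewrite mulmxBl Zv Zv' subrr.
    * by apply/matrixP => i j; have := r i j; rewrite !mxE mulmxBl bformBr => ->; rewrite subrr.
    * by apply/matrixP => i j; have := t i j; rewrite !mxE mulmxBl bformBr => ->; rewrite subrr.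
  + move=> [A v] sk; exists (null_inv (A, v)); first by split; [exact: null_inv_o|exact: null_inv_null].
    by rewrite /null_iso null_inv_rot// null_inv_trans.
- move=> a Z Z' _ _; congr pair; apply/matrixP => i j; rewrite !mxE mulmxDl bformDr -scalemxAl bformZr//.
- move=> Z Z' [oZ Zv] [oZ' Zv']; congr pair; apply/matrixP => i j; rewrite /mx_bracket [LHS]mxE mulmxBl bformBr -!mulmxA.
    by rewrite !null_rot_mul//= [in RHS]mxE [X in _ = _ + X]mxE.
  by rewrite (ord1 j) !null_trans_mul//= [in RHS]mxE [X in _ = _ + X]mxE.
Qed.

End NullStabilizer.

(** * Horospherical coordinates *)

Section Horospherical.
Context {R : realType} {d q : nat} (G : lieGroupType R d).
Local Notation lie := (lie_algebra G).
Variables (c : chart R d G) (x : 'I_d -> G -> R^o).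
Hypothesis U : unit_chart c x.
Variables (A : operator G) (Y : 'I_q -> operator G).
Hypotheses (lA : lie A) (lY : forall i, lie (Y i)).
Hypothesis bYY : forall i j, lie_bracket G (Y i) (Y j) = 0.
Hypothesis bAY : forall i, lie_bracket G A (Y i) = - Y i.
Variables (gA : R -> G) (gY : 'I_q -> R -> G).
Hypotheses (hA : one_parameter_subgroup A gA) (hY : forall i, one_parameter_subgroup (Y i) (gY i)).

Lemma gY_commute i j s t : (gY i s * gY j t = gY j t * gY i s)%g.
Proof.
have e : AdOp (gY i s) (Y j) = Y j.
  have bz : lie_bracket G (Y i) (Y j) = 0 *: Y j by rewrite bYY scale0r.
  by rewrite (AdOp_eigen s (lY i) (lY j) (one_parameter_exists U (lY j)) (hY i) bz) mul0r expR0 scale1r.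
have h := AdOp_ops (gY i s) (lY j) (hY j); rewrite e in h.
by rewrite -[in RHS](ops_unique t U (lY j) h (hY j)) mulgVK.
Qed.

Lemma prod_commute (I : Type) (r : seq I) (a b : I -> G) :
  (forall i j, b i * a j = a j * b i)%g ->
  (\prod_(i <- r) (a i * b i) = (\prod_(i <- r) a i) * \prod_(i <- r) b i)%g.
Proof.
move=> ab; elim: r => [|i r IH]; first by rewrite !big_nil mulg1.
have e : (b i * \prod_(j <- r) a j = (\prod_(j <- r) a j) * b i)%g.
  elim: r {IH} => [|j r IH]; first by rewrite !big_nil mulg1 mul1g.
  by rewrite !big_cons mulgA ab -mulgA IH mulgA.
by rewrite !big_cons IH -!mulgA; congr (_ * _)%g; rewrite !mulgA e.
Qed.

Lemma prod_exp_add (y z : 'rV[R]_q) : prod_exp gY (z + y) = (prod_exp gY y * prod_exp gY z)%g.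
Proof.
rewrite /prod_exp -prod_commute; last by move=> i j; exact: gY_commute.
by apply: eq_bigr => j _; rewrite mxE addrC; have [-> _] := hY j.
Qed.

Definition horo (t : 'rV[R]_(1 + q)) : G := (prod_exp gY (rsubmx t) * gA (lsubmx t 0 0))%g.

Definition horo_dir (t : 'rV[R]_(1 + q)) (j : 'I_(1 + q)) : operator G :=
  match fintype.split j with inl _ => A | inr i => expR (lsubmx t 0 0) *: Y i end.

Lemma horo0 : horo 0 = 1%g.
Proof. by rewrite /horo !raddf0 mxE (prod_exp0 hY) (ops0 hA) mulg1. Qed.

Lemma horo_smooth : tsmooth setT horo.
Proof.
have oT : open [set: 'rV[R]_(1 + q)] by exact: openT.
have oT' : open [set: 'rV[R]_q] by exact: openT.
apply: (tsmooth_mul oT).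
  exact: (tsmooth_comp oT oT' (fun _ _ => I) (smooth_on_rsub oT) (prod_exp_smooth lY hY)).
have E : (fun t : 'rV[R]_(1 + q) => lsubmx t 0 0) = (fun t => t 0 (lshift q 0)).
  by apply/funext => t; rewrite mxE.
have := ops_tsmooth lA hA oT (@smooth_on_coord R _ setT (lshift q 0)).
have -> : (fun t : 'rV[R]_(1 + q) => gA (lsubmx t 0 0)) = (fun z => gA (z 0 (lshift q 0))).
  by apply/funext => t; rewrite mxE.
by [].
Qed.

Lemma horo_dir_alg t j : lie (horo_dir t j).
Proof.
rewrite /horo_dir; case: fintype.split => [_|i]; first exact: lA.
have := lie_alg_lin (expR (lsubmx t 0 0) - 1) (lY i) (lY i).
by rewrite scalerBl scale1r subrK.
Qed.

(** Moving exp(h Y_i) to the right past [gA s] conjugates it by [gA (- s)], which multiplies Y_i by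
    exp s because [A, Y_i] = - Y_i. So every coordinate line is a left translate of a one-parameter
    subgroup. *)
Lemma horo_line t j : exists2 gam, one_parameter_subgroup (horo_dir t j) gam &
  forall h : R, horo (h *: 'e_j + t) = (horo t * gam h)%g.
Proof.
rewrite /horo_dir /horo; case: (split_ordP j) => i ->.
  rewrite (ord1 i); exists gA => // h.
  have -> : rsubmx (h *: 'e_(lshift q 0) + t) = rsubmx t.
    by apply/rowP => k; rewrite !mxE eq_rlshift mulr0 add0r.
  have -> : lsubmx (h *: 'e_(lshift q 0) + t) 0 0 = lsubmx t 0 0 + h.
    by rewrite !mxE !eqxx mulr1 addrC.
  by have [-> _] := hA; rewrite mulgA.
set s := lsubmx t 0 0.
exists (fun h => (gA (- s) * gY i h * (gA (- s))^-1)%g).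
  have bz : lie_bracket G A (Y i) = -1 *: Y i by rewrite bAY scaleN1r.
  have := AdOp_ops (gA (- s)) (lY i) (hY i).
  by rewrite (AdOp_eigen (- s) lA (lY i) (one_parameter_exists U (lY i)) hA bz) mulN1r opprK.
move=> h.
have -> : rsubmx (h *: 'e_(rshift 1 i) + t) = h *: 'e_i + rsubmx t.
  by apply/rowP => k; rewrite !mxE (inj_eq (@rshift_inj _ _)).
have -> : lsubmx (h *: 'e_(rshift 1 i) + t) 0 0 = s.
  by rewrite !mxE eq_lrshift mulr0 add0r /s mxE.
rewrite prod_exp_add (prod_exp_axis hY) (opsN s hA) invgK !mulgA mulgK.
by [].
Qed.

End Horospherical.

Section Tangent.
Context {R : realType}.

Definition tangent r n (M : manifoldType R n) (F : 'rV[R]_r -> M) (c : chart R n M) (t : 'rV[R]_r) : 'M[R]_(r, n) :=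
  \matrix_(j < r) 'D_('e_j) (cfun c \o F) t.

Lemma tangent_comp r m n (M : manifoldType R m) (N : manifoldType R n) (U : set M) (f : M -> N)
    (S : set 'rV[R]_r) (F : 'rV[R]_r -> M) c c' t :
  open S -> S t -> open U -> smooth_map_on U f -> tsmooth S F -> U (F t) ->
  atlas M c -> atlas N c' -> cdom c (F t) -> cdom c' (f (F t)) ->
  tangent (f \o F) c' t = tangent F c t *m local_jacobian f c c' (F t).
Proof.
move=> oS St oU sf sF Ut ac ac' dt dt'; apply/row_matrixP => j.
rewrite row_mul !rowK; exact: (derive_chart_map 'e_j oS St oU sf sF Ut ac ac' dt dt').
Qed.

Lemma tangent_jacobian n (M : manifoldType R n) (F : 'rV[R]_n -> M) (S : set 'rV[R]_n) c t :
  open S -> S t -> tsmooth S F -> atlas M c -> cdom c (F t) ->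
  tangent F c t = jacobian (cfun c \o F) t.
Proof.
move=> oS St sF ac dt; apply/matrixP => i j.
have oT := tsmooth_open oS sF (cdom_open ac).
have sT := tsmooth_chart oS sF ac.
have Tt : (S `&` F @^-1` cdom c) t by [].
by rewrite (jacobianE oT sT)// mxE.
Qed.

Lemma tangent_near r n (M : manifoldType R n) (F F' : 'rV[R]_r -> M) c t :
  (\forall z \near t, F z = F' z) -> tangent F c t = tangent F' c t.
Proof.
move=> E; apply/row_matrixP => j; rewrite !rowK; apply: near_eq_derive.
by apply: filterS E => z /= ->.
Qed.

End Tangent.

Lemma gram_entry (R : realType) r n (B : 'M[R]_(r, n)) (g : 'M[R]_n) j l :
  (B *m g *m B^T) j l = (row j B *m g *m (row l B)^T) 0 0.
Proof.
rewrite -row_mul mxE [RHS]mxE; apply: eq_bigr => b _.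
by rewrite [row _ _ _ _]mxE [_^T b l]mxE [_^T b 0]mxE [row _ _ _ _]mxE.
Qed.

Section NullFrameMatrix.
Context {R : realType} {q : nat}.
Notation N := (1 + q.+1)%N.
Local Notation o := (o_pq R 1 q.+1).
Local Notation br := (mx_bracket R N).
Local Notation vnull := (@vnull R 0 q).
Local Notation vdual := (@vdual R 0 q).
Local Notation sevec := (@sevec R 0 q).

Lemma boost_horo i : br (wedge vnull vdual) (wedge vdual (sevec i)) = - wedge vdual (sevec i).
Proof.
have [h1 h2 h3] := @bform_vnull R 0 q.
rewrite bracket_wedge; last exact: wedge_o.
rewrite !wedge_mul h2 h3 bform_vnull_sevec bform_vdual_sevec !scale0r scale1r sub0r subrr wedge0r addr0.
exact: wedgeNl.
Qed.

Lemma horo_horo i j : br (wedge vdual (sevec i)) (wedge vdual (sevec j)) = 0.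
Proof.
have [h1 h2 h3] := @bform_vnull R 0 q.
rewrite bracket_wedge; last exact: wedge_o.
rewrite !wedge_mul h2 sevec_bform_dual bform_vdual_sevec !scale0r !subr0 wedge0l wedgeZr wedgexx.
by rewrite scaler0 addr0.
Qed.

(** Coordinates on a complement of the stabilizer of [vnull] in o(1, q + 1), spanned by the boost
    and the horospherical translations. *)
Definition frame_mx (u : 'rV[R]_(1 + q)) : 'M[R]_N :=
  u 0 (lshift q 0) *: wedge vnull vdual + \sum_i u 0 (rshift 1 i) *: wedge vdual (sevec i).

Lemma frame_mx_o u : o (frame_mx u).
Proof.
have so := o_subspace 1 q.+1 : subspace o.
apply: (subspaceD so); first by apply: (subspaceZ _ so); exact: wedge_o.
by apply: (subspace_sum _ so) => i _; apply: (subspaceZ _ so); exact: wedge_o.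
Qed.

Lemma frame_mx_null u : frame_mx u *m vnull =
  u 0 (lshift q 0) *: vnull - \sum_i u 0 (rshift 1 i) *: sevec i.
Proof.
have [h1 h2 h3] := @bform_vnull R 0 q.
rewrite mulmxDl -scalemxAl wedge_mul [bform vdual vnull]bformC h3 h1 scale1r scale0r subr0.
congr (_ + _); rewrite mulmx_suml -sumrN; apply: eq_bigr => i _.
rewrite -scalemxAl wedge_mul sevec_bform_null [bform vdual vnull]bformC h3 scale0r scale1r sub0r.
by rewrite scalerN.
Qed.

Lemma frame_mx_inj u : frame_mx u *m vnull = 0 -> u = 0.
Proof.
have [h1 h2 h3] := @bform_vnull R 0 q.
rewrite frame_mx_null => E; apply/rowP => j; rewrite mxE; case: (split_ordP j) => i ->.
  have := congr1 (bform vdual) E; rewrite [RHS]bformC bform0l bformBr (bformZr _ vnull) [bform vdual vnull]bformC h3 mulr1.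
  rewrite bform_sumr big1 ?subr0 ?(ord1 i)// => k _.
  by rewrite (bformZr _ (sevec k)) bform_vdual_sevec mulr0.
have := congr1 (bform (sevec i)) E; rewrite [RHS]bformC bform0l bformBr (bformZr _ vnull) sevec_bform_null mulr0.
rewrite bform_sumr (bigD1 i)//= big1 => [|k ki].
  by rewrite (bformZr _ (sevec i)) bform_sevec eqxx mulr1 addr0 sub0r => /eqP; rewrite oppr_eq0 => /eqP.
by rewrite (bformZr _ (sevec k)) bform_sevec eq_sym (negPf ki) mulr0.
Qed.

Lemma frame_mx_span Z : o Z -> exists u, (Z - frame_mx u) *m vnull = 0.
Proof.
move=> oZ.
exists (row_mx (\row__ bform vdual (Z *m vnull)) (\row_i - bform (sevec i) (Z *m vnull))).
rewrite mulmxBl frame_mx_null row_mxEl mxE {1}[Z *m vnull]cV_frame (o_isotropic _ oZ) scale0r addr0.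
rewrite opprB addrCA; rewrite addrC -[LHS]addrA addrC -addrA.
have -> : \sum_i (row_mx (\row__ bform vdual (Z *m vnull)) (\row_i - bform (sevec i) (Z *m vnull))) 0 (rshift 1 i) *: sevec i
   = - \sum_i bform (sevec i) (Z *m vnull) *: sevec i.
  by rewrite -sumrN; apply: eq_bigr => i _; rewrite row_mxEr mxE scaleNr.
move: (\sum_i _) (_ *: vnull) => a b; by apply/matrixP => i j; rewrite !mxE; ring.
Qed.

End NullFrameMatrix.

(** The Gram matrix of the form e^(2 s) |dy|^2 in the coordinates (s, y). *)
Definition cone_gram (R : realType) q (t : 'rV[R]_(1 + q)) : 'M[R]_(1 + q) :=
  block_mx 0 0 0 ((expR (lsubmx t 0 0) ^+ 2)%:M).

(** * The metric of the orbit in horospherical coordinates *)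

Section OrbitMetric.
Context {R : realType} {d m k q : nat} (G : lieGroupType R d) (M : manifoldType R (1 + m)) (O : manifoldType R k).
Notation N := (1 + q.+1)%N.
Local Notation lie := (lie_algebra G).
Local Notation o := (o_pq R 1 q.+1).
Variables (g : form_field M) (act : G -> M -> M) (x0 : M) (i : O -> M) (pi : G -> O).
Hypothesis g_lorentz : lorentz_metric g.
Hypothesis act_isometric : isometric_action g act.
Hypothesis i_imm : immersion i.
Hypothesis pi_sub : submersion pi.
Hypothesis i_pi : forall a, i (pi a) = act a x0.
Variables (c : chart R d G) (x : 'I_d -> G -> R^o).
Hypothesis U : unit_chart c x.
Variables (cM : chart R (1 + m) M) (y : 'I_(1 + m) -> M -> R^o).
Hypotheses (acM : atlas M cM) (dcM : cdom cM x0) (sy : forall j, smooth_fun (y j)).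
Hypothesis hy : \forall q \near x0, cdom cM q /\ forall j, y j q = cfun cM q 0 j.
Local Notation beta := (beta act x0 y).
Local Notation gform := (gform g x0 cM).
Local Notation orb := (orb act x0).
Variables (phi : operator G -> 'M[R]_N) (psi : 'M[R]_N -> operator G).
Hypothesis L : lie_iso_o phi psi.
Variables (S : 'M[R]_N) (kappa : R).
Hypothesis oS : orth S.
Local Notation vnull := (@vnull R 0 q).
Local Notation vdual := (@vdual R 0 q).
Local Notation sevec := (@sevec R 0 q).
Hypothesis hS : forall Z, o Z -> beta (psi (cj S Z)) = 0 <-> Z *m vnull = 0.
Hypothesis bS : forall Z, o Z -> gform (beta (psi (cj S (wedge vnull vdual)))) (beta (psi (cj S Z))) = 0.
Hypothesis kS : forall i j, gform (beta (psi (cj S (wedge vdual (sevec i))))) (beta (psi (cj S (wedge vdual (sevec j)))))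
    = kappa *+ (i == j).

Let A : operator G := psi (cj S (wedge vnull vdual)).
Let Y (i : 'I_q) : operator G := psi (cj S (wedge vdual (sevec i))).

Lemma horo_boost_alg : lie A.
Proof. exact: (li_alg L (cj_o oS (wedge_o _ _))). Qed.

Lemma horo_trans_alg j : lie (Y j).
Proof. exact: (li_alg L (cj_o oS (wedge_o _ _))). Qed.

Lemma horo_trans_bracket j l : lie_bracket G (Y j) (Y l) = 0.
Proof.
rewrite -(psi_bracket L (cj_o oS (wedge_o _ _)) (cj_o oS (wedge_o _ _))).
by rewrite -(cj_bracket _ _ oS) horo_horo cj0 (li_psi0 L).
Qed.

Lemma horo_boost_bracket j : lie_bracket G A (Y j) = - Y j.
Proof.
rewrite -(psi_bracket L (cj_o oS (wedge_o _ _)) (cj_o oS (wedge_o _ _))).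
rewrite -(cj_bracket _ _ oS) boost_horo.
have e : cj S (- wedge vdual (sevec j)) = -1 *: cj S (wedge vdual (sevec j)) + 0.
  by rewrite -{1}(cj0 S) -cj_linear scaleN1r addr0.
rewrite e (li_psi_lin L _ (cj_o oS (wedge_o _ _)) (o0 : o 0)) (li_psi0 L) addr0 scaleN1r.
by [].
Qed.

Lemma beta_conj_lin (s : R) Z Z' : o Z -> o Z' ->
  beta (psi (cj S (s *: Z + Z'))) = s *: beta (psi (cj S Z)) + beta (psi (cj S Z')).
Proof.
by move=> oZ oZ'; rewrite cj_linear (beta_psi_lin act x0 y L _ (cj_o oS oZ) (cj_o oS oZ')).
Qed.

Lemma beta_conj0 : beta (psi (cj S 0)) = 0.
Proof. rewrite cj0; exact: (beta_psi0 act x0 y L). Qed.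

Definition frame_beta : 'M[R]_(1 + q, 1 + m) :=
  \matrix_(j < 1 + q) beta (match fintype.split j with inl _ => A | inr l => Y l end).

Lemma frame_beta_mul u : u *m frame_beta = beta (psi (cj S (frame_mx u))).
Proof.
have H (I : Type) (r : seq I) (s : I -> R) (F : I -> 'M[R]_N) : (forall j, o (F j)) ->
    o (\sum_(j <- r) s j *: F j) /\
    beta (psi (cj S (\sum_(j <- r) s j *: F j))) = \sum_(j <- r) s j *: beta (psi (cj S (F j))).
  move=> oF; elim: r => [|j r [IH1 IH2]]; first by rewrite !big_nil beta_conj0; split; [exact: (o0 : o 0)|].
  rewrite !big_cons -IH2; split; [exact: o_opq_linear|exact: beta_conj_lin].
have [h1 h2] := H _ (index_enum _) (fun j => u 0 (rshift 1 j)) (fun j => wedge vdual (sevec j)) (fun j => wedge_o _ _).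
rewrite /frame_mx (beta_conj_lin _ (wedge_o _ _) h1) h2 mulmx_sum_row big_split_ord big_ord1 /=; congr (_ + _).
  by rewrite rowK; case: split_ordP => [l|l /eqP]; rewrite ?eq_lrshift.
apply: eq_bigr => j _; rewrite rowK; case: split_ordP => [l /eqP|l /rshift_inj ->//].
by rewrite eq_rlshift.
Qed.

Lemma frame_beta_free : row_free frame_beta.
Proof.
apply/row_freeP; have : kermx frame_beta = 0.
  apply/row_matrixP => j; rewrite row0; apply: frame_mx_inj; apply/(hS (frame_mx_o _)).
  by rewrite -frame_beta_mul -row_mul mulmx_ker row0.
by move=> /eqP; rewrite kermx_eq0 => /row_freeP.
Qed.

Lemma frame_beta_span X : lie X -> (beta X <= frame_beta)%MS.
Proof.
move=> lX; pose Z := cj (oinv S) (phi X).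
have oZ : o Z := cj_o (orth_oinv oS) (li_o L lX).
have EX : X = psi (cj S Z) by rewrite /Z cjVK// (li_psiK L lX).
have [u hu] := frame_mx_span oZ; apply/submxP; exists u; rewrite frame_beta_mul EX.
have oB : o (Z - frame_mx u) := subspaceB (o_subspace 1 q.+1) oZ (frame_mx_o u).
have := (hS oB).2 hu; have -> : Z - frame_mx u = -1 *: frame_mx u + Z by rewrite scaleN1r addrC.
by rewrite (beta_conj_lin _ (frame_mx_o u) oZ) scaleN1r => /eqP; rewrite addrC subr_eq0 => /eqP.
Qed.

(** The tangent space of the orbit at [x0] is the row space of the Jacobian of [i] and also that of
    [frame_beta]; both matrices have independent rows. *)
Lemma orbit_dim : k = (1 + q)%N.
Proof.
have [cO aO dO] := chart_at (pi 1%g).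
set Ji := local_jacobian i cO cM (pi 1%g).
have fJ : row_free Ji.
  by apply: i_imm.2 => //; rewrite (i_pi1 act_isometric i_pi).
have E : (Ji :=: frame_beta)%MS.
  apply/eqmxP/andP; split; last first.
    apply/row_subP => j; rewrite rowK.
    have lF : lie (match fintype.split j with inl _ => A | inr l => Y l end).
      by case: fintype.split => [_|l]; [exact: horo_boost_alg|exact: horo_trans_alg].
    rewrite (beta_factor act_isometric i_imm pi_sub i_pi U acM dcM sy hy aO dO lF).
    exact: submxMl.
  apply/row_subP => j.
  have [X lX <-] := beta_surj act_isometric i_imm pi_sub i_pi U acM dcM sy hy aO dO (row_sub j Ji).
  exact: frame_beta_span.
by rewrite -(eqP fJ) E (eqP frame_beta_free).
Qed.

(** The passage from the frame [A], [Y i] to the directions [horo_dir] at [t]. *)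
Definition cone_scale (t : 'rV[R]_(1 + q)) : 'M[R]_(1 + q) :=
  block_mx 1%:M 0 0 ((expR (lsubmx t 0 0))%:M).

Lemma cone_scale_unit t : cone_scale t \in unitmx.
Proof.
rewrite unitmxE det_ublock det1 mul1r det_scalar unitfE; apply: expf_neq0.
by rewrite gt_eqF// expR_gt0.
Qed.

Lemma frame_beta_gram : frame_beta *m g cM x0 *m frame_beta^T = block_mx 0 0 0 (kappa%:M).
Proof.
apply/matrixP => j l.
rewrite gram_entry -/(gform _ _).
have sym := gform_sym g_lorentz acM dcM.
rewrite !rowK; case: (split_ordP j) => j' ->; case: (split_ordP l) => l' ->.
- by rewrite block_mxEul mxE; exact: (bS (wedge_o _ _)).
- by rewrite block_mxEur mxE; exact: (bS (wedge_o _ _)).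
- by rewrite block_mxEdl mxE sym; exact: (bS (wedge_o _ _)).
- by rewrite block_mxEdr mxE; exact: kS.
Qed.

Variables (gA : R -> G) (gY : 'I_q -> R -> G).
Hypotheses (hA : one_parameter_subgroup A gA) (hY : forall i, one_parameter_subgroup (Y i) (gY i)).
Local Notation horo := (horo gA gY).

Lemma orb_horo_tangent a t c2 : atlas M c2 -> cdom c2 (orb (a * horo t)%g) ->
  tangent (fun t => orb (a * horo t)%g) c2 t =
  cone_scale t *m frame_beta *m local_jacobian (act (a * horo t)%g) cM c2 x0.
Proof.
move=> a2 d2; apply/row_matrixP => j; rewrite row_mul rowK.
have [gam hgam E] := horo_line U horo_boost_alg horo_trans_alg horo_trans_bracket horo_boost_bracket hA hY t j.
have lZ := horo_dir_alg horo_boost_alg horo_trans_alg t j.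
have -> : row j (cone_scale t *m frame_beta) = beta (horo_dir A Y t j).
  rewrite /horo_dir /cone_scale -{1}[frame_beta]vsubmxK mul_block_col mul1mx !mul0mx addr0 add0r mul_scalar_mx.
  case: (split_ordP j) => l ->.
    rewrite rowKu row_usubmx rowK; case: (split_ordP (lshift q l)) => // l' /eqP.
    by rewrite eq_lrshift.
  rewrite rowKd linearZ /= row_dsubmx rowK; case: (split_ordP (rshift 1 l)) => [l' /eqP|l' /rshift_inj ->].
    by rewrite eq_rlshift.
  by apply/rowP => b; rewrite !mxE.
rewrite -(velocity_act act_isometric acM dcM sy hy lZ hgam a2 d2) /velocity.
apply: derive_along => h /=; rewrite addr0 /coord0 E !mxE mulr1 mulgA.
by [].
Qed.

(** The isometry [act (a * horo t)] carries the computation back to [x0], where [frame_beta_gram]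
    applies; its Jacobian is invertible because the metric is nondegenerate. *)
Lemma orb_horo_gram a t c2 : atlas M c2 -> cdom c2 (orb (a * horo t)%g) ->
  let T := tangent (fun t => orb (a * horo t)%g) c2 t in
  T *m g c2 (orb (a * horo t)%g) *m T^T = kappa *: cone_gram t /\ row_free T.
Proof.
move=> a2 d2 T; rewrite /T (orb_horo_tangent a2 d2); set J := local_jacobian _ _ _ _.
have EJ := act_preserves act_isometric acM dcM a2 d2; rewrite -/J in EJ.
have [P uP hP] := g_lorentz.2 cM x0 acM dcM; have [ug _] := lorentz_form_sym uP hP.
have uJ : J \in unitmx by move: ug; rewrite -EJ !unitmx_mul => /andP[/andP[]].
split; last first.
  rewrite /row_free mxrankMfree; last by rewrite row_free_unit.
  by rewrite (eqmxMfull _ _) ?row_full_unit ?cone_scale_unit//; exact: frame_beta_free.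
rewrite !trmx_mul -!mulmxA (mulmxA J) (mulmxA _ J^T) EJ.
have e := frame_beta_gram; rewrite -!mulmxA in e.
rewrite (mulmxA (g cM x0)) (mulmxA frame_beta) e.
rewrite /cone_scale /cone_gram tr_block_mx !mulmx_block !trmx0 !mul0mx !mulmx0 !addr0 !add0r.
rewrite tr_scalar_mx -!scalar_mxM scale_block_mx !scaler0 scale_scalar_mx.
rewrite !mulmx0; congr (block_mx _ _ _ _%:M).
by move: (expR _) => u; ring.
Qed.

End OrbitMetric.

(** * The light cone *)

Section SmoothAux.
Context {R : realType}.

Lemma smooth_on_ln n (S : set 'rV[R]_n) (u : 'rV[R]_n -> R^o) : open S -> (forall z, S z -> 0 < u z) ->
  smooth_on S u -> smooth_on S (fun z => ln (u z) : R^o).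
Proof.
move=> oS u0 su.
(* The tower of derivatives of ln. *)
pose h (k : nat) (t : R) : R := if k is j.+1 then (-1) ^+ j * (j`!)%:R * (t^-1) ^+ j.+1 else ln t.
apply: (@smooth_on_tower _ _ S [set t | 0 < t] u h oS u0 su) => k t /= t0.
case: k => [|k]; first by rewrite /h expr0 fact0 mulr1 mul1r expr1; exact: is_derive1_ln.
have nz : t != 0 by rewrite gt_eqF.
have hi : is_derive t (1 : R) (fun s : R => s^-1 : R^o) (- t ^- 2).
  have d1 : derivable (id : R^o -> R^o) t 1 by exact: derivable_id.
  apply: DeriveDef; first exact: (@derivableV R R^o id t 1 nz d1).
  by rewrite (@deriveV R R^o id t 1 nz d1) derive_id /= -[_ *: _]/(_ * _) mulr1.
have hX := is_deriveX k.+1 hi.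
have hZ := is_deriveZ ((-1) ^+ k * (k`!)%:R) hX.
have E : (((-1) ^+ k * (k`!)%:R) *: ((fun s : R => s^-1 : R^o) ^+ k.+1) : R^o -> R^o) = h k.+1.
  apply/funext => s; rewrite /h -[LHS]/((_ * _) * (((fun s : R => s^-1 : R^o) ^+ k.+1) s)); congr (_ * _).
  by elim: k.+1 {hX hZ} => [//|j IH]; rewrite !exprS -IH.
have hZ2 : is_derive t (1 : R) (h k.+1 : R -> R^o)
    (((-1) ^+ k * (k`!)%:R) *: ((k.+1%:R * t^-1 ^+ k.+1.-1) *: - t ^- 2)) by rewrite -E; exact: hZ.
apply: is_derive_eq hZ2 _.
rewrite /h /= factS natrM -exprVn !exprS /GRing.scale /=.
ring.
Qed.

Lemma smooth_on_const_mx n r (S : set 'rV[R]_n) (u : 'rV[R]_n -> R^o) : open S -> smooth_on S u ->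
  smooth_on S (fun z => const_mx (u z) : 'rV[R]_r).
Proof.
move=> oS su; apply/(smooth_on_mxP _ oS) => i j; apply: (smooth_on_eq oS _ su) => z _.
by rewrite mxE.
Qed.

Lemma smooth_on_scale_mx n r (S : set 'rV[R]_n) (u : 'rV[R]_n -> R^o) (F : 'rV[R]_n -> 'rV[R]_r) : open S ->
  smooth_on S u -> smooth_on S F -> smooth_on S (fun z => u z *: F z).
Proof.
move=> oS su /(smooth_on_mxP _ oS) sF; apply/(smooth_on_mxP _ oS) => i j.
by apply: (smooth_on_eq oS _ (smooth_onM oS su (sF i j))) => z _; rewrite mxE.
Qed.

Lemma tsmooth_smooth_map r n (N : manifoldType R n) (W : set 'rV[R]_r) (F : 'rV[R]_r -> N) :
  open W -> tsmooth W F -> smooth_map_on W F.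
Proof.
move=> oW sF; split=> [p Wp|c c' ac ac']; first exact: tsmooth_cont Wp sF.
have -> : c = id_chart by exact: ac.
rewrite /= image_id setIT; exact: (tsmooth_chart oW sF ac').
Qed.

Lemma smooth_map_comp_row m r n (M : manifoldType R m) (V : set M) (K : M -> 'rV[R]_r) (u : 'rV[R]_r -> 'rV[R]_n) :
  open V -> smooth_map_on V K -> smooth_on setT u -> smooth_map_on V (u \o K).
Proof.
move=> oV sK su; have oT : open [set: 'rV[R]_r] by exact: openT.
split=> [p Vp|c c' ac ac'].
  by apply: continuous_comp; [exact: (sK.1 p Vp)|exact: (smooth_on_cont su (I : setT (K p)))].
have -> : c' = id_chart by exact: ac'.
have aid : atlas 'rV[R]_r (@id_chart R r) by [].
have oD := smooth_map_on_dom oV sK ac aid.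
have := sK.2 c id_chart ac aid; move: oD; rewrite /= => oD sD.
exact: (smooth_on_comp_mx oD oT (fun _ _ => I) sD su).
Qed.

End SmoothAux.

Section ConeMap.
Context {R : realType} {q : nat}.
Implicit Types (t : 'rV[R]_(1 + q)) (v : 'rV[R]_(1 + (1 + q))).
Local Notation J := (Defs.eta R 1 (1 + q)).

Definition cone_vec (a b : R) (y : 'rV[R]_q) : 'rV[R]_(1 + (1 + q)) :=
  row_mx (const_mx a : 'rV[R]_1) (row_mx (const_mx b : 'rV[R]_1) y : 'rV[R]_(1 + q)).

Lemma cone_vec_add (a b a' b' : R) y y' : cone_vec a b y + cone_vec a' b' y' = cone_vec (a + a') (b + b') (y + y').
Proof.
by rewrite /cone_vec !add_row_mx; congr (row_mx _ (row_mx _ _)); apply/rowP => j; rewrite !mxE.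
Qed.

Lemma cone_vec_scale (s a b : R) y : s *: cone_vec a b y = cone_vec (s * a) (s * b) (s *: y).
Proof.
by rewrite /cone_vec !scale_row_mx; congr (row_mx _ (row_mx _ _)); apply/rowP => j; rewrite !mxE.
Qed.

Lemma cone_vec_form a b y a' b' y' : (cone_vec a b y *m J *m (cone_vec a' b' y')^T) 0 0 = b * b' + (y *m y'^T) 0 0 - a * a'.
Proof.
have e := @eta_block R 1 (1 + q) 1 1 (const_mx a : 'rV[R]_1) (row_mx (const_mx b) y)^T
  (const_mx a' : 'rV[R]_1) (row_mx (const_mx b') y')^T.

have tE s b0 y0 : cone_vec s b0 y0 = (col_mx (const_mx s : 'rV[R]_1) (row_mx (const_mx b0) y0)^T)^T.
  by rewrite tr_col_mx trmxK trmx_const.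
rewrite !tE trmxK e trmxK tr_row_mx mul_row_col !trmx_const !mxE !big_ord1 !mxE.
by [].
Qed.

Definition sqnorm (y : 'rV[R]_q) : R := (y *m y^T) 0 0.

Lemma sqnormZ s y : sqnorm (s *: y) = s * (s * sqnorm y).
Proof.
rewrite /sqnorm; have -> : (s *: y)^T = s *: y^T by apply/matrixP => j l; rewrite !mxE.
by rewrite -scalemxAl -scalemxAr [LHS]mxE [X in _ * X]mxE.
Qed.

Definition cone t : 'rV[R]_(1 + (1 + q)) :=
  let s := expR (lsubmx t 0 0) in let Q := sqnorm (rsubmx t) in
  cone_vec (s * ((1 + Q) / 2)) (s * ((1 - Q) / 2)) (s *: rsubmx t).

(** A linear function equal to exp s on the image of [cone]; where it is positive, [cone_coord]
    inverts [cone] on null vectors. *)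
Definition cone_height v : R := lsubmx v 0 0 + lsubmx (rsubmx v : 'rV[R]_(1 + q)) 0 0.

Definition cone_coord v : 'rV[R]_(1 + q) :=
  row_mx (const_mx (ln (cone_height v))) ((cone_height v)^-1 *: rsubmx (rsubmx v : 'rV[R]_(1 + q))).

Lemma cone_height_vec a b y : cone_height (cone_vec a b y) = a + b.
Proof. by rewrite /cone_height /cone_vec row_mxKl row_mxKr row_mxKl !mxE. Qed.

Lemma cone_heightE t : cone_height (cone t) = expR (lsubmx t 0 0).
Proof. by rewrite cone_height_vec; field. Qed.

Lemma cone_coordK t : cone_coord (cone t) = t.
Proof.
rewrite /cone_coord cone_heightE expRK /cone /cone_vec !row_mxKr scalerA mulVf ?scale1r; last by rewrite gt_eqF ?expR_gt0.
by rewrite -[RHS]hsubmxK; congr row_mx; apply/rowP => j; rewrite (ord1 j) mxE.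
Qed.

Lemma cone_vec_eta v : v = cone_vec (lsubmx v 0 0) (lsubmx (rsubmx v : 'rV[R]_(1 + q)) 0 0) (rsubmx (rsubmx v : 'rV[R]_(1 + q))).
Proof.
rewrite /cone_vec; have e (a : 'rV[R]_1) : const_mx (a 0 0) = a.
  by apply/rowP => j; rewrite (ord1 j) mxE.
by rewrite !e !hsubmxK.
Qed.

Lemma cone_null t : cone t *m J *m (cone t)^T = 0.
Proof.
rewrite [LHS]mx11_scalar cone_vec_form -/(sqnorm _) sqnormZ.
set s := expR _; set Q := sqnorm _.
have -> : s * ((1 - Q) / 2) * (s * ((1 - Q) / 2)) + s * (s * Q) - s * ((1 + Q) / 2) * (s * ((1 + Q) / 2)) = 0.
  by field.
by rewrite raddf0.
Qed.

Lemma cone_vecK a b y : 0 < a + b -> b * b + sqnorm y - a * a = 0 -> cone (cone_coord (cone_vec a b y)) = cone_vec a b y.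
Proof.
move=> h0 E; rewrite /cone_coord cone_height_vec /cone /cone_vec !row_mxKl !row_mxKr mxE lnK ?posrE//.
rewrite sqnormZ scalerA divff ?scale1r ?gt_eqF//.
have -> : sqnorm y = (a + b) * (a - b) by move: E; move: (sqnorm y) => Q; lra.
congr (row_mx _ (row_mx _ _)); congr const_mx; field; by rewrite gt_eqF.
Qed.

Lemma coneK v : 0 < cone_height v -> v *m J *m v^T = 0 -> cone (cone_coord v) = v.
Proof.
rewrite [v]cone_vec_eta; move: (lsubmx v 0 0) (lsubmx (rsubmx v) 0 0) (rsubmx (rsubmx v)) => a b y.
by rewrite cone_height_vec => h0 /matrixP/(_ 0 0); rewrite cone_vec_form [X in _ = X]mxE; exact: cone_vecK.
Qed.

Lemma cone_neq0 t : cone t != 0.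
Proof.
apply/eqP => E; have := cone_heightE t; rewrite E /cone_height !raddf0 !mxE addr0 => /esym/eqP.
by rewrite gt_eqF ?expR_gt0.
Qed.

Lemma smooth_on_sqnorm : smooth_on setT (fun t => sqnorm (rsubmx t) : R^o).
Proof.
have oT : open [set: 'rV[R]_(1 + q)] by exact: openT.
have s1 (j : 'I_q) := smooth_onM oT (@smooth_on_coord R _ setT (rshift 1 j)) (@smooth_on_coord R _ setT (rshift 1 j)).
have := @smooth_on_sum R _ _ (index_enum 'I_q) xpredT setT _ oT (fun j _ => s1 j).
apply: (smooth_on_eq oT) => z _; rewrite /sqnorm mxE; apply: eq_bigr => j _.
by rewrite !mxE.
Qed.

Lemma cone_smooth : smooth_on setT cone.
Proof.
have oT : open [set: 'rV[R]_(1 + q)] by exact: openT.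
have se : smooth_on setT (fun t : 'rV[R]_(1 + q) => expR (lsubmx t 0 0) : R^o).
  apply: (smooth_on_eq oT _ (smooth_on_exp oT (@smooth_on_coord R _ setT (lshift q 0)))) => z _.
  by rewrite mxE.
have sQ := smooth_on_sqnorm.
have sh : smooth_on setT (fun _ : 'rV[R]_(1 + q) => 2^-1 : R^o) by exact: smooth_on_cst.
have s1 : smooth_on setT (fun _ : 'rV[R]_(1 + q) => 1 : R^o) by exact: smooth_on_cst.
have sa := smooth_onM oT se (smooth_onM oT (smooth_onD oT s1 sQ) sh).
have sb := smooth_onM oT se (smooth_onM oT (smooth_onB oT s1 sQ) sh).
have sc := smooth_on_scale_mx oT se (smooth_on_rsub (m1 := 1) (m2 := q) oT).
have sa' := @smooth_on_const_mx R _ 1 _ _ oT sa; have sb' := @smooth_on_const_mx R _ 1 _ _ oT sb.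
exact: (smooth_on_row_mx oT sa' (smooth_on_row_mx oT sb' sc)).
Qed.

Lemma smooth_on_height S : open S -> smooth_on S (cone_height : _ -> R^o).
Proof.
move=> oS; have := smooth_onD oS (@smooth_on_coord R _ S (lshift (1 + q) 0)) (@smooth_on_coord R _ S (rshift 1 (lshift q 0 : 'I_(1 + q)))).
apply: (smooth_on_eq oS) => z _; by rewrite /cone_height !mxE.
Qed.

Lemma height_open : open [set v | 0 < cone_height v].
Proof.
have oT : open [set: 'rV[R]_(1 + (1 + q))] by exact: openT.
apply: open_nbhsP => v v0.
have ch := smooth_on_cont (smooth_on_height oT) (I : setT v).
have nv : nbhs (cone_height v : R^o) [set r : R^o | 0 < r].
  by apply: open_nbhs_nbhs; split => //; exact: open_gt.
have h3 : \forall z \near v, 0 < cone_height z := ch _ nv.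
exact: h3.
Qed.

Lemma cone_coord_smooth : smooth_on [set v | 0 < cone_height v] cone_coord.
Proof.
have oW := height_open; have sw := smooth_on_height oW.
have sl := @smooth_on_const_mx R _ 1 _ _ oW (smooth_on_ln oW (fun _ h => h) sw).
have si : smooth_on [set v | 0 < cone_height v] (fun v => (cone_height v)^-1 : R^o).
  by apply: (smooth_onV oW _ sw) => v /= v0; rewrite gt_eqF.
suff sr : smooth_on [set v | 0 < cone_height v] (fun v => rsubmx (rsubmx v : 'rV[R]_(1 + q))).
  exact: (smooth_on_row_mx oW sl (smooth_on_scale_mx oW si sr)).
apply/(smooth_on_mxP _ oW) => i j.
have := @smooth_on_coord R _ [set v | 0 < cone_height v] (rshift 1 (rshift 1 j : 'I_(1 + q))).
by apply: (smooth_on_eq oW) => z _; rewrite (ord1 i) !mxE.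
Qed.

Lemma cone_line_height (h : R) t : cone (h *: 'e_(lshift q 0) + t) = expR h *: cone t.
Proof.
rewrite /cone.
have -> : rsubmx (h *: 'e_(lshift q 0) + t) = rsubmx t.
  by apply/rowP => j; rewrite !mxE eq_rlshift mulr0 add0r.
have -> : lsubmx (h *: 'e_(lshift q 0) + t) 0 0 = h + lsubmx t 0 0.
  by rewrite !mxE !eqxx mulr1.
by rewrite expRD cone_vec_scale !scalerA !mulrA.
Qed.

Lemma form_e j (z : 'rV[R]_q) : (z *m ('e_j : 'rV[R]_q)^T) 0 0 = z 0 j.
Proof.
rewrite mxE (bigD1 j)//= big1 ?addr0 => [|l lj]; first by rewrite !mxE !eqxx mulr1.
by rewrite !mxE (negPf lj) andbF mulr0.
Qed.

Lemma e_form j (z : 'rV[R]_q) : (('e_j : 'rV[R]_q) *m z^T) 0 0 = z 0 j.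
Proof. by rewrite -[_ *m _]trmxK trmx_mul trmxK mxE form_e. Qed.

Lemma sqnorm_line (h : R) j y : sqnorm (h *: 'e_j + y) = sqnorm y + 2 * h * y 0 j + h ^+ 2.
Proof.
rewrite /sqnorm; set e : 'rV[R]_q := 'e_j.
have -> : (h *: e + y)^T = h *: e^T + y^T by apply/matrixP => a b; rewrite !mxE.
rewrite mulmxDl !mulmxDr -!scalemxAl -!scalemxAr [LHS]mxE [X in X + _]mxE [X in _ + X]mxE.
have Z (s : R) (B : 'M[R]_(1, 1)) : (s *: B) 0 0 = s * B 0 0 by rewrite mxE.
rewrite !Z !e_form form_e mxE !eqxx /=; ring.
Qed.

(** [cone] is a polynomial of degree two in each coordinate y_j, so the partial derivative is the
    coefficient of the linear term. *)
Lemma cone_line_trans (h : R) j t : let s := expR (lsubmx t 0 0) in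
  cone (h *: 'e_(rshift 1 j) + t) =
  cone t + h *: cone_vec (s * rsubmx t 0 j) (- (s * rsubmx t 0 j)) (s *: 'e_j) + h ^+ 2 *: cone_vec (s / 2) (- (s / 2)) 0.
Proof.
rewrite /cone.
have -> : rsubmx (h *: 'e_(rshift 1 j) + t) = h *: 'e_j + rsubmx t.
  by apply/rowP => k; rewrite !mxE (inj_eq (@rshift_inj _ _)).
have -> : lsubmx (h *: 'e_(rshift 1 j) + t) 0 0 = lsubmx t 0 0.
  by rewrite !mxE eq_lrshift mulr0 add0r.
rewrite sqnorm_line; move: (expR _) (rsubmx t) => s y; move: (sqnorm y) => Q /=.
rewrite !cone_vec_scale !cone_vec_add scaler0 addr0; congr cone_vec; [by field|by field|].
by rewrite scalerDr !scalerA mulrC addrC.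
Qed.

Lemma is_derive_quadratic n (a w w2 : 'rV[R]_n) :
  is_derive (0 : R) (1 : R) (fun h : R => a + h *: w + h ^+ 2 *: w2) w.
Proof.
apply/is_derive_mxP => i j.
have h1 := is_derive_id (0 : R^o) (1 : R^o).
have h2 := is_deriveD (is_deriveD (is_derive_cst (a i j : R^o) (0 : R^o) (1 : R^o)) (is_deriveZ (w i j) h1))
  (is_deriveZ (w2 i j) (is_deriveX 2 h1)).
have E : (fun h : R => (a + h *: w + h ^+ 2 *: w2) i j : R^o) =
    cst (a i j : R^o) + (w i j \*: (id : R^o -> R^o)) + (w2 i j \*: ((id : R^o -> R^o) ^+ 2)).
  apply/funext => h; rewrite !mxE -[RHS]/(a i j + w i j * h + w2 i j * (h * h)); ring.
rewrite E; apply: is_derive_eq h2 _.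
rewrite /GRing.scale /= expr1; ring.
Qed.

Lemma cone_tangent_height t : row (lshift q 0) (tangent cone id_chart t) = cone t.
Proof.
rewrite rowK; have hd : is_derive (0 : R) (1 : R) (fun h : R => expR h *: cone t) (cone t).
  apply/is_derive_mxP => i j; have := is_deriveZ (cone t i j) (is_derive_expR (0 : R)).
  rewrite expR0 -[X in is_derive _ _ _ X]/(_ * _) mulr1.
  have -> : (fun h : R => (expR h *: cone t) i j : R^o) = (cone t i j \*: (expR : R -> R^o)).
    by apply/funext => h; rewrite !mxE mulrC.
  by [].
have E (h : R) : (cfun id_chart \o cone) (h *: 'e_(lshift q 0) + t) = expR (h + 0) *: cone t.
  by rewrite addr0 /= cone_line_height.
by have [_ ->] := @is_derive_line R _ _ (cfun id_chart \o cone) _ t _ 0 _ E hd.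
Qed.

Lemma cone_tangent_trans t j : row (rshift 1 j) (tangent cone id_chart t) =
  let s := expR (lsubmx t 0 0) in cone_vec (s * rsubmx t 0 j) (- (s * rsubmx t 0 j)) (s *: 'e_j).
Proof.
rewrite rowK /=; set s := expR _; set w := cone_vec _ _ _.
have hd := is_derive_quadratic (cone t) w (cone_vec (s / 2) (- (s / 2)) 0).
have E (h : R) : (cfun id_chart \o cone) (h *: 'e_(rshift 1 j) + t) =
    cone t + (h + 0) *: w + (h + 0) ^+ 2 *: cone_vec (s / 2) (- (s / 2)) 0.
  by rewrite addr0 /= cone_line_trans.
by have [_ ->] := @is_derive_line R _ _ (cfun id_chart \o cone) _ t _ 0 _ E hd.
Qed.

Lemma cone_tangent_gram t :
  tangent cone id_chart t *m J *m (tangent cone id_chart t)^T = cone_gram t.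
Proof.

have Z (s s' : R) (y z : 'rV[R]_q) : ((s *: y) *m (s' *: z)^T) 0 0 = s * s' * (y *m z^T) 0 0.
  have -> : (s' *: z)^T = s' *: z^T by apply/matrixP => a b; rewrite !mxE.
  by rewrite -scalemxAl -scalemxAr scalerA [LHS]mxE.
apply/matrixP => a b; rewrite gram_entry /cone_gram.
case: (split_ordP a) => j ->; case: (split_ordP b) => l ->; rewrite ?(ord1 j) ?(ord1 l).
- by rewrite block_mxEul !cone_tangent_height cone_null.
- rewrite block_mxEur cone_tangent_height cone_tangent_trans /= [RHS]mxE /cone cone_vec_form Z form_e.
  by move: (expR _) (rsubmx t 0 l) (sqnorm _) => s u Q; field.
- rewrite block_mxEdl cone_tangent_height cone_tangent_trans /= [RHS]mxE /cone cone_vec_form Z e_form.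
  by move: (expR _) (rsubmx t 0 j) (sqnorm _) => s u Q; field.
- rewrite block_mxEdr !cone_tangent_trans /= cone_vec_form Z e_form [RHS]mxE !mxE eqxx /= eq_sym.
  move: (expR _) => s; case: eqP => [->|_]; rewrite ?mulr1n ?mulr0n; ring.
Qed.

End ConeMap.

(** * The local homothety with the light cone *)

Section OrbitCone.
Context {R : realType} {d m q : nat} (G : lieGroupType R d) (M : manifoldType R (1 + m)) (O : manifoldType R (1 + q)).
Notation N := (1 + q.+1)%N.
Local Notation lie := (lie_algebra G).
Local Notation o := (o_pq R 1 q.+1).
Variables (g : form_field M) (act : G -> M -> M) (x0 : M) (i : O -> M) (pi : G -> O).
Hypothesis g_lorentz : lorentz_metric g.
Hypothesis act_isometric : isometric_action g act.
Hypothesis i_imm : immersion i.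
Hypothesis i_inj : injective i.
Hypothesis i_range : range i = range (act ^~ x0).
Hypothesis pi_sub : submersion pi.
Hypothesis i_pi : forall a, i (pi a) = act a x0.
Variables (c : chart R d G) (x : 'I_d -> G -> R^o).
Hypothesis U : unit_chart c x.
Variables (cM : chart R (1 + m) M) (y : 'I_(1 + m) -> M -> R^o).
Hypotheses (acM : atlas M cM) (dcM : cdom cM x0) (sy : forall j, smooth_fun (y j)).
Hypothesis hy : \forall q \near x0, cdom cM q /\ forall j, y j q = cfun cM q 0 j.
Local Notation beta := (beta act x0 y).
Local Notation gform := (gform g x0 cM).
Local Notation orb := (orb act x0).
Variables (phi : operator G -> 'M[R]_N) (psi : 'M[R]_N -> operator G).
Hypothesis L : lie_iso_o phi psi.
Variables (S : 'M[R]_N) (kappa : R).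
Hypothesis oS : orth S.
Local Notation vnull := (@vnull R 0 q).
Local Notation vdual := (@vdual R 0 q).
Local Notation sevec := (@sevec R 0 q).
Hypothesis hS : forall Z, o Z -> beta (psi (cj S Z)) = 0 <-> Z *m vnull = 0.
Hypothesis bS : forall Z, o Z -> gform (beta (psi (cj S (wedge vnull vdual)))) (beta (psi (cj S Z))) = 0.
Hypothesis kS : forall i j, gform (beta (psi (cj S (wedge vdual (sevec i))))) (beta (psi (cj S (wedge vdual (sevec j)))))
    = kappa *+ (i == j).
Hypothesis kappa_gt0 : 0 < kappa.

(** Around a point p = [pi a] the map [F] gives horospherical coordinates on the orbit, and the
    homothety is [cone] composed with a local inverse of [F]. Expressed through [F], the two metrics
    are [cone_gram] and [kappa] times it. *)
Lemma orbit_light_cone : locally_homothetic_to_light_cone (1 + q) i g.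
Proof.
have lA := horo_boost_alg L oS; have lY := horo_trans_alg L oS.
have [gA hA] := one_parameter_exists U lA.
have [gY hY] := choice (fun j => one_parameter_exists U (lY j)).
have oT : open [set: 'rV[R]_(1 + q)] by exact: openT.
have sh : tsmooth setT (horo gA gY) := horo_smooth lA lY hA hY.
move=> p; have [a Ea] : exists a, p = pi a.
  have : range i (i p) by exists p.
  by rewrite i_range => -[a _ Ea]; exists a; apply: i_inj; rewrite i_pi.
pose F t := pi (a * horo gA gY t)%g.
have sF : tsmooth setT F := tsmooth_map oT openT pi_sub.1 (tsmooth_mul oT (tsmooth_cst a) sh) (fun _ _ => I).
have iF : i \o F = fun t => orb (a * horo gA gY t)%g by apply/funext => t /=; rewrite i_pi.
have iFt t : i (F t) = orb (a * horo gA gY t)%g by rewrite -[LHS]/((i \o F) t) iF.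
have chain t c1 c2 : atlas O c1 -> atlas M c2 -> cdom c1 (F t) -> cdom c2 (i (F t)) ->
    tangent (i \o F) c2 t = tangent F c1 t *m local_jacobian i c1 c2 (F t).
  exact: (tangent_comp oT (I : setT t) openT i_imm.1 sF I).
have gram t c2 : atlas M c2 -> cdom c2 (i (F t)) ->
    tangent (i \o F) c2 t *m g c2 (i (F t)) *m (tangent (i \o F) c2 t)^T = kappa *: cone_gram t /\
    row_free (tangent (i \o F) c2 t).
  rewrite iF iFt => a2 d2.
  exact: (orb_horo_gram g_lorentz act_isometric U acM dcM sy hy L oS hS bS kS hA hY a2 d2).
have unitF t c1 : atlas O c1 -> cdom c1 (F t) -> tangent F c1 t \in unitmx.
  move=> a1 d1; have [c2 a2 d2] := chart_at (i (F t)).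
  have [_] := gram t c2 a2 d2; rewrite (chain t c1 c2 a1 a2 d1 d2) -row_free_unit => h.
  by apply: contraTT h; rewrite /row_free => h; rewrite neq_ltn; apply/orP; left;
    apply: leq_ltn_trans (mxrankM_maxl _ _) _; rewrite ltn_neqAle h rank_leq_row.
have F0 : F 0 = p by rewrite /F (horo0 hA hY) mulg1.
have [cO aO dO] := chart_at (F 0).
have uJ : jacobian (cfun cO \o F) 0 \in unitmx.
  by rewrite -(tangent_jacobian oT (I : setT (0 : 'rV[R]_(1 + q))) sF aO dO); exact: unitF.
have [U' [V [K [[oU oV] [U0 _] UV VU sK]]]] := manifold_ift oT I sF aO dO uJ filterT.
pose W := [set v : 'rV[R]_(1 + (1 + q)) | 0 < cone_height v] `&` cone_coord @^-1` U'.
have oH := @height_open R q.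
have oW : open W.
  apply: open_nbhsP => v [v0 Uv]; apply: filterI; first exact: open_nbhs_nbhs.
  by apply: (smooth_on_cont cone_coord_smooth v0); exact: open_nbhs_nbhs.
have sf : smooth_map_on V (cone \o K) := smooth_map_comp_row oV sK cone_smooth.
have sF' : tsmooth U' F by exact: tsmooth_sub sF.
exists V, W, (cone \o K); split => //; first by rewrite -F0; have [] := UV _ U0.
split.
- exact: sf.
- apply/seteqP; split=> v /=.
    move=> [q' Vq' <-]; have [UK _] := VU _ Vq'; split; first by split; [exact: cone_neq0|exact: cone_null].
    by split; [rewrite /= cone_heightE expR_gt0|rewrite /= cone_coordK].
  move=> [[_ vv] [v0 Uv]]; have [VF KF] := UV _ Uv.
  by exists (F (cone_coord v)) => //; rewrite KF coneK.
- exists (F \o cone_coord).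
    apply: (tsmooth_smooth_map oW).
    apply: (tsmooth_comp oW oU _ _ sF') => [v []//|].
    by apply: smooth_on_sub cone_coord_smooth => v [].
  by move=> q' Vq' /=; rewrite cone_coordK; have [] := VU _ Vq'.
(* The orbit carries [kappa] times the metric of the cone. *)
- exists kappa^-1; first by rewrite invr_gt0.
  move=> c1 c2 cL q' a1 a2 aL Vq' d1 d2 dL.
  have [Ut Ft] := VU _ Vq'; set t := K q' in Ut Ft.
  have d1t : cdom c1 (F t) by rewrite Ft.
  have d2t : cdom c2 (i (F t)) by rewrite Ft.
  have dLt : cdom cL ((cone \o K) (F t)) by rewrite Ft.
  have VFt : V (F t) by rewrite Ft.
  have idL : cL = id_chart by exact: aL.
  have E1 := tangent_comp oU Ut oV sf sF' VFt a1 aL d1t dLt.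
  have E2 : tangent ((cone \o K) \o F) cL t = tangent cone id_chart t.
    rewrite idL; apply: tangent_near.
    have nU : \forall z \near t, U' z by exact: open_nbhs_nbhs.
    by apply: filterS nU => z Uz /=; have [_ ->] := UV _ Uz.
  have G1 := cone_tangent_gram t; rewrite -E2 E1 in G1.
  have [G2 _] := gram t c2 a2 d2t; rewrite (chain t c1 c2 a1 a2 d1t d2t) in G2.
  have uB := unitF t c1 a1 d1t.
  rewrite Ft in G1 G2; rewrite /pullback /minkowski_metric.
  move: G1 G2 uB; move: (tangent F c1 t) => B.
  move: (local_jacobian (cone \o K) c1 cL q') (local_jacobian i c1 c2 q') => J1 J2 G1 G2 uB.
  (* The two pullbacks are compared after transport by the tangent matrix [B] of [F], which is
     invertible. *)
  have cancel (X : 'M[R]_(1 + q)) : X = invmx B *m (B *m X *m B^T) *m invmx B^T.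
    by rewrite -!mulmxA mulmxV ?unitmx_tr// mulmx1 mulmxA mulVmx// mul1mx.
  rewrite [LHS]cancel [X in _ *: X]cancel.
  have -> : B *m (J1 *m Defs.eta R 1 (1 + q) *m J1^T) *m B^T = cone_gram t.
    by rewrite -G1 trmx_mul !mulmxA.
  have -> : B *m (J2 *m g c2 (i q') *m J2^T) *m B^T = kappa *: cone_gram t.
    by rewrite -G2 trmx_mul !mulmxA.
  by rewrite -scalemxAr -scalemxAl scalerA mulVf ?scale1r// gt_eqF.
Qed.

End OrbitCone.

(** Both signatures are treated at once as p + 1 with p <= 1, so that the exclusion of O(2, n)
    becomes the conclusion p = 0; here n is q + 1. *)
Lemma degenerate_orbit_structure (R : realType) (p q d m k : nat) (p1 : (p <= 1)%N) (q2 : (2 <= q)%N)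
    (G : lieGroupType R d)
    (G_connected : connected [set: G])
    (G_center : finite_set (lie_center G))
    (G_local : locally_isomorphic_to_O G p.+1 q.+1)
    (M : manifoldType R (1 + m))
    (g : form_field M) (g_lorentz : lorentz_metric g)
    (act : G -> M -> M) (act_isometric : isometric_action g act)
    (x0 : M) (O : manifoldType R k) (i : O -> M)
    (O_orbit : orbit_submanifold act x0 i)
    (O_degenerate : degenerate_submanifold i g)
    (stab_noncompact : ~ compact (stabilizer act x0)) :
  [/\ p = 0%N,
      lie_isomorphic
        (subgroup_lie_algebra (stabilizer act x0)) (lie_bracket G)
        (o_semidirect R q) (o_semidirect_bracket R q) &
      locally_homothetic_to_light_cone q.+1 i g].
Proof.
have [phi [psi L]] := lie_iso_exists G_local.
have [i_imm i_inj i_range [pi pi_sub i_pi]] := O_orbit.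
have [c [x U]] := unit_chart_exists G.
have [cM acM dcM] := chart_at x0.
have [y [sy hy]] := chart_coords acM dcM.
have [S [oS p0 hS bS [kappa k0 kS]]] := orbit_normal_form g_lorentz act_isometric i_imm pi_sub i_pi O_degenerate
  U acM dcM sy hy L G_connected G_center stab_noncompact p1 q2.
subst p; split => //.
  apply: lie_isomorphic_trans null_stabilizer_semidirect.
  rewrite (stab_lie_algebra act_isometric U acM dcM sy hy).
  have oSV := orth_oinv oS.
  exists (fun X => cj (oinv S) (phi X)); split.
  - split.
    + move=> X [lX bX]; have oZ := cj_o oSV (li_o L lX); split=> //.
      by apply/(hS _ oZ); rewrite cjVK// (li_psiK L lX).
    + move=> X X' /set_mem[lX _] /set_mem[lX' _] E; apply: (li_inj L lX lX').
      by rewrite -[LHS](cjVK _ oS) E cjVK.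
    + move=> Z [oZ Zv]; have oc := cj_o oS oZ; exists (psi (cj S Z)); last by rewrite (li_phiK L oc) cjK.
      by split; [exact: (li_alg L oc)|apply/(hS _ oZ)].
  - by move=> s X X' [lX _] [lX' _]; rewrite (li_lin L s lX lX') cj_linear.
  - by move=> X X' [lX _] [lX' _]; rewrite (li_br L lX lX') cj_bracket.
(* The dimension of [O] is known only now; it is substituted so that horospherical coordinates
   become coordinates of [O]. *)
have Ek : k = (1 + q)%N := orbit_dim act_isometric i_imm pi_sub i_pi U acM dcM sy hy L oS hS.
subst k.
exact: (orbit_light_cone g_lorentz act_isometric i_imm i_inj i_range pi_sub i_pi U acM dcM sy hy L oS hS bS kS k0).
Qed.

Theorem theorem1p6 (R : realType) (n d m k : nat) (n_ge3 : (3 <= n)%N)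
    (G : lieGroupType R d)
    (G_connected : connected [set: G])
    (G_center : finite_set (lie_center G))
    (G_local : locally_isomorphic_to_O G 1 n \/ locally_isomorphic_to_O G 2 n)
    (M : manifoldType R (1 + m)) (M_connected : connected [set: M])
    (g : form_field M) (g_lorentz : lorentz_metric g)
    (act : G -> M -> M) (act_isometric : isometric_action g act)
    (x : M) (O : manifoldType R k) (i : O -> M)
    (O_orbit : orbit_submanifold act x i)
    (O_degenerate : degenerate_submanifold i g)
    (stab_noncompact : ~ compact (stabilizer act x)) :
  [/\ locally_isomorphic_to_O G 1 n,
      lie_isomorphic
        (subgroup_lie_algebra (stabilizer act x)) (lie_bracket G)
        (o_semidirect R n.-1) (o_semidirect_bracket R n.-1) &
      locally_homothetic_to_light_cone n i g].
Proof.
case: n n_ge3 G_local => // q q2 [G1|G2].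
  by have [_ h1 h2] := @degenerate_orbit_structure R 0 q d m k isT q2 G G_connected G_center G1 M g g_lorentz
    act act_isometric x O i O_orbit O_degenerate stab_noncompact.
(* The first conclusion reads 1 = 0. *)
by have [] := @degenerate_orbit_structure R 1 q d m k isT q2 G G_connected G_center G2 M g g_lorentz
    act act_isometric x O i O_orbit O_degenerate stab_noncompact.
Qed.
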